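(* Let $V$ be an $n$-dimensional $\mathbb Q$-vector space, $n$ even, with a non-degenerate symmetric bilinear form $\beta$, let $L$ be a maximal lattice with discriminant $D_L$, and assume $(-1)^{n/2}D_L$ is a square in $\mathbb Q$. Let $S$ be a finite set of primes containing all prime divisors of $D_L$, and set $\sigma_n=\frac2n\big(\frac{n(n-2)}8+1\big)$. Then there is $\sigma$ with $0<\sigma<\sigma_n$ such that the Euler product $\prod_{p\notin S}W^{(+1)}_{n/2}(p,p^{-ns/2})$ converges absolutely on $\mathrm{Re}(s)>\sigma$; the Dirichlet series $\zeta_{\beta,L}(s)=\sum_{\Lambda\text{ maximal},\,\Lambda\subset L}[L:\Lambda]^{-s}$ is meromorphic on $\mathrm{Re}(s)>\sigma$, its right-most pole there is $\sigma_n$, and this pole is double. Writing $\zeta_{\beta,L}(s)=A_{\beta,L}(s-\sigma_n)^{-2}(1+O(s-\sigma_n))$, the number $A_{\beta,L}$ is a positive real number.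
   Context: $Q(v)=\frac12\beta(v,v)$; $D_L=\det(\beta(v_i,v_j))$ for a $\mathbb Z$-basis of $L$. Lattices are finitely generated $\mathbb Z$-submodules of rank $n$. For a $\mathbb Z_p$-lattice $M\subset V\otimes\mathbb Q_p$, $\mu(M)$ is the $\mathbb Z_p$-ideal generated by $Q(v)$, $v\in M$; $\mu(L)\in\mathbb Q_{>0}$ is defined by $\mu(L)\mathbb Z_p=\mu(L\otimes\mathbb Z_p)$ for all $p$; $L$ is maximal if maximal for inclusion among lattices with the same norm. For $\ell\ge1$ and $K\subset[1,\ell-1]$ ($[a,b]=\{x\in\mathbb Z\mid a\le x\le b\}$): $\varphi_i(q)=\prod_{j=1}^i(q^j-1)$; for $I=\{i_1<\dots<i_r\}$, $i_0=0,i_{r+1}=\ell$, $\varphi_{(I)}=\varphi_\ell/\prod_\nu\varphi_{i_{\nu+1}-i_\nu}$; $w_{\ell,K}(q)=\sum_{I\subset K}(-1)^{\#(K\setminus I)}\varphi_{(I)}(q)$; $a^{(+1)}_\ell(K)=\sum_{i\in K}\big(\frac{\ell(\ell-1)}2-\frac{i(i-1)}2\big)$; and $W^{(+1)}_\ell(X,T)=\sum_{K\subset[1,\ell-1]}w_{\ell,K}(X^{-1})X^{a^{(+1)}_\ell(K)}T^{\#K}$. *)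

(* Defs.v *)
From HB Require Import structures.
From mathcomp Require Import all_boot all_order all_algebra finmap.
From mathcomp Require Import all_classical all_reals all_analysis.
From mathcomp Require Import complex.
From mathcomp.analysis.showcase Require summability.

Set Implicit Arguments.
Unset Strict Implicit.
Unset Printing Implicit Defensive.

Import Order.TTheory GRing.Theory Num.Theory.
Import numFieldNormedType.Exports.

Local Open Scope classical_set_scope.
Local Open Scope ring_scope.

Record primeNat := PrimeNat { prime_val :> nat; _ : prime prime_val }.

Lemma primeNatP (p : primeNat) : prime p.
Proof. by case: p. Qed.

(* [Zp p] is the inverse limit of the rings Z/p^k; the class in Z/p^k is
   given by its representative [zp_val x k] in [0, p^k[. *)
Record Zp (p : primeNat) := MkZp {
  zp_val :> nat -> int;
  _ : forall k, zp_val k = (zp_val k.+1 %% (p ^ k)%N)%Z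
}.

HB.instance Definition _ p := gen_eqMixin (Zp p).
HB.instance Definition _ p := gen_choiceMixin (Zp p).

Section ZpRing.
Variable p : primeNat.
Implicit Types (x y z : Zp p) (k : nat).

Lemma zp_step x k : x k = (x k.+1 %% (p ^ k)%N)%Z.
Proof. by case: x. Qed.

Lemma zp_small x k : (x k %% (p ^ k)%N)%Z = x k.
Proof. by rewrite zp_step modz_mod. Qed.

Lemma zp_ext x y : x =1 y -> x = y.
Proof.
case: x y => [f hf] [g hg] /= /funext fg; case: _ / fg hg => hg.
by congr MkZp; apply: Prop_irrelevance.
Qed.

Lemma modz_pS (m : int) k : ((m %% (p ^ k.+1)%N)%Z %% (p ^ k)%N)%Z = (m %% (p ^ k)%N)%Z.
Proof.
apply/eqP; rewrite eqz_mod_dvd.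
apply: (@dvdz_trans (p ^ k.+1)%N%:Z); first by rewrite dvdzE /= dvdn_exp2l.
by rewrite -eqz_mod_dvd modz_mod.
Qed.

Lemma zp_of_subproof (f : nat -> int) :
  (forall k, (f k.+1 = f k %[mod (p ^ k)%N])%Z) ->
  forall k, ((fun k => f k %% (p ^ k)%N)%Z k) =
            ((fun k => f k %% (p ^ k)%N)%Z k.+1 %% (p ^ k)%N)%Z.
Proof. by move=> hf k /=; rewrite modz_pS hf. Qed.

Definition zp_of f (hf : forall k, (f k.+1 = f k %[mod (p ^ k)%N])%Z) :=
  MkZp (zp_of_subproof hf).

Lemma zp_cst_subproof (m : int) k : ((fun=> m) k.+1 = (fun=> m) k %[mod (p ^ k)%N])%Z.
Proof. by []. Qed.

Lemma zp_mod x k : (x k.+1 = x k %[mod (p ^ k)%N])%Z.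
Proof. by rewrite -zp_step zp_small. Qed.

Lemma zp_add_subproof x y k :
  ((fun k => x k + y k) k.+1 = (fun k => x k + y k) k %[mod (p ^ k)%N])%Z.
Proof. by rewrite /= -modzDm !zp_mod modzDm. Qed.

Lemma zp_opp_subproof x k :
  ((fun k => - x k) k.+1 = (fun k => - x k) k %[mod (p ^ k)%N])%Z.
Proof. by rewrite /= -modzNm zp_mod modzNm. Qed.

Lemma zp_mul_subproof x y k :
  ((fun k => x k * y k) k.+1 = (fun k => x k * y k) k %[mod (p ^ k)%N])%Z.
Proof. by rewrite /= -modzMm !zp_mod modzMm. Qed.

Definition zp_zero := zp_of (zp_cst_subproof 0).
Definition zp_one := zp_of (zp_cst_subproof 1).
Definition zp_add x y := zp_of (zp_add_subproof x y).
Definition zp_opp x := zp_of (zp_opp_subproof x).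
Definition zp_mul x y := zp_of (zp_mul_subproof x y).

Lemma zp_addA : associative zp_add.
Proof. by move=> x y z; apply: zp_ext => k /=; rewrite modzDmr modzDml addrA. Qed.

Lemma zp_addC : commutative zp_add.
Proof. by move=> x y; apply: zp_ext => k /=; rewrite addrC. Qed.

Lemma zp_add0 : left_id zp_zero zp_add.
Proof. by move=> x; apply: zp_ext => k /=; rewrite modzDml add0r zp_small. Qed.

Lemma zp_addN : left_inverse zp_zero zp_opp zp_add.
Proof. by move=> x; apply: zp_ext => k /=; rewrite modzDml addNr. Qed.

HB.instance Definition _ :=
  GRing.isZmodule.Build (Zp p) zp_addA zp_addC zp_add0 zp_addN.

Lemma zp_mulA : associative zp_mul.
Proof. by move=> x y z; apply: zp_ext => k /=; rewrite modzMmr modzMml mulrA. Qed.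

Lemma zp_mulC : commutative zp_mul.
Proof. by move=> x y; apply: zp_ext => k /=; rewrite mulrC. Qed.

Lemma zp_mul1 : left_id zp_one zp_mul.
Proof. by move=> x; apply: zp_ext => k /=; rewrite modzMml mul1r zp_small. Qed.

Lemma zp_mulDl : left_distributive zp_mul zp_add.
Proof.
by move=> x y z; apply: zp_ext => k /=; rewrite modzMml modzDm mulrDl.
Qed.

Lemma zp_one_neq0 : zp_one != zp_zero.
Proof.
apply/eqP => /(congr1 (fun x : Zp p => x 1%N)) /=.
by rewrite expn1 mod0z modz_small // ltz_nat prime_gt1 ?primeNatP.
Qed.

HB.instance Definition _ := GRing.Zmodule_isComNzRing.Build (Zp p)
  zp_mulA zp_mulC zp_mul1 zp_mulDl zp_one_neq0.

Definition zp_unit : pred (Zp p) := fun x => `[< exists y, y * x = 1 >].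

Definition zp_inv x : Zp p :=
  if pselect (exists y, y * x = 1) is left h then projT1 (cid h) else x.

Lemma zp_mulVx : {in zp_unit, left_inverse 1 zp_inv *%R}.
Proof.
move=> x /asboolP ux; rewrite /zp_inv; case: pselect => // h.
by case: cid.
Qed.

Lemma zp_unitP x y : y * x = 1 -> zp_unit x.
Proof. by move=> yx; apply/asboolP; exists y. Qed.

Lemma zp_inv_out : {in [predC zp_unit], zp_inv =1 id}.
Proof. by move=> x /asboolPn ux; rewrite /zp_inv; case: pselect. Qed.

HB.instance Definition _ := GRing.ComNzRing_hasMulInverse.Build (Zp p)
  zp_mulVx zp_unitP zp_inv_out.

Lemma zp_modD x k j : (x (k + j)%N = x k %[mod (p ^ k)%N])%Z.
Proof.
elim: j => [|j IH]; first by rewrite addn0.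
rewrite -{}IH addnS; apply/eqP; rewrite eqz_mod_dvd.
apply: (@dvdz_trans (p ^ (k + j))%N%:Z).
  by rewrite dvdzE /= dvdn_exp2l // leq_addr.
by rewrite -eqz_mod_dvd zp_mod.
Qed.

Lemma zp_neq0P x : x != 0 -> exists k, forall j, ~~ ((p ^ k)%N %| x (k + j)%N)%Z.
Proof.
move=> x0; have [k xk] : exists k, x k != 0.
  apply: contrapT => /forallNP xk; case/eqP: x0; apply: zp_ext => k /=.
  by rewrite mod0z; have /negP := xk k; rewrite negbK => /eqP.
exists k => j; apply: contra xk => /dvdz_mod0P.
by rewrite zp_modD zp_small => ->.
Qed.

Lemma zp_idomain x y : x * y = 0 -> (x == 0) || (y == 0).
Proof.
move=> xy0; apply: contraPT xy0 => /norP[/zp_neq0P[k hk] /zp_neq0P[l hl]].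
move=> /(congr1 (fun x : Zp p => x (k + l)%N)) /=; rewrite mod0z.
move/dvdz_mod0P; rewrite dvdzE /= abszM.
have {hk} := hk l; have {hl} := hl k; rewrite addnC !dvdzE /=.
set a := `|x _|%N; set b := `|y _|%N; rewrite addnC => hb ha.
have a0 : (0 < a)%N by case: a ha => //; rewrite dvdn0.
have b0 : (0 < b)%N by case: b hb => //; rewrite dvdn0.
rewrite addnC pfactor_dvdn ?primeNatP ?muln_gt0 ?a0 // lognM //.
move: ha hb; rewrite !pfactor_dvdn ?primeNatP // -!ltnNge => ha hb.
by apply/negP; rewrite -ltnNge -addSn leq_add // ltnW.
Qed.

HB.instance Definition _ := GRing.ComUnitRing_isIntegral.Build (Zp p) zp_idomain.

End ZpRing.

Notation Qp p := {fraction Zp p}.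

Section Lattices.
Variable V : vectType rat.
Implicit Types (L M : set V) (beta : V -> V -> rat).

(* The rank of the Z-module generated by [g] is the dimension of the
   Q-space spanned by [g]. *)
Definition is_lattice L :=
  exists m (g : m.-tuple V),
    L = [set v | inIntSpan g v] /\ \dim <<g>>%VS = \dim {:V}.

Definition is_Zbasis m (e : m.-tuple V) L :=
  free e /\ L = [set v | inIntSpan e v].

(* [D] is D_L, which does not depend on the choice of the Z-basis. *)
Definition is_discriminant beta L (D : rat) :=
  exists m (e : m.-tuple V),
    is_Zbasis e L /\ D = \det (\matrix_(i < m, j < m) beta e`_i e`_j).

Definition cosets L M : set (set V) := [set [set x + y | y in M] | x in L].

Definition lattice_index L M : nat := #|` fset_set (cosets L M) |%fset.

Definition Zp_span (p : primeNat) (U : lmodType (Qp p)) (A : set U) : set U :=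
  [set x | exists m (c : 'I_m -> Zp p) (a : 'I_m -> U),
     (forall i, A (a i)) /\ x = \sum_(i < m) tofrac (c i) *: a i].

(* The space V (x) Q_p is 'rV[Qp p]_(\dim V), through the coordinates in a
   fixed Q-basis of V. *)
Definition to_Vp (p : primeNat) (v : V) : 'rV[Qp p]_(\dim {:V}) :=
  \row_i ratr (coord (vbasis {:V}) i v).

Definition quad_p beta (p : primeNat) (x : 'rV[Qp p]_(\dim {:V})) : Qp p :=
  (x *m (\matrix_(i, j) ratr (beta (vbasis {:V})`_i (vbasis {:V})`_j)) *m x^T)
    ord0 ord0 / 2.

Definition lattice_p (p : primeNat) L := Zp_span (to_Vp p @` L).

Definition norm_p beta (p : primeNat) (M : set 'rV[Qp p]_(\dim {:V})) :
    set (Qp p) :=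
  @Zp_span p (Qp p)^o (@quad_p beta p @` M).

(* The default value 0 is never taken when [beta] is non-degenerate, V is
   nonzero and [L] is a lattice. *)
Definition norm beta L : rat :=
  xget 0 [set m : rat | 0 < m /\
    forall p : primeNat,
      [set ratr m * tofrac z | z in [set: Zp p]] = norm_p beta (@lattice_p p L)].

Definition maximal_lattice beta L :=
  is_lattice L /\
  forall M, is_lattice M -> norm beta M = norm beta L -> L `<=` M -> M = L.

End Lattices.

Section WPolynomial.
Variable F : fieldType.
Variable l : nat.
Implicit Types (I K : {set 'I_l}) (q X T : F).

Definition phi i q : F := \prod_(1 <= j < i.+1) (q ^+ j - 1).

(* Subsets of [1, l-1] are the sets of elements of 'I_l not containing 0;
   [enum I] lists [I] in increasing order, so that the product runs over the
   differences i_(nu+1) - i_nu for 0 <= nu <= r. *)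
Definition phi_set I q : F :=
  phi l q /
  \prod_(d <- pairmap (fun a b => (b - a)%N) 0%N
                (rcons [seq val i | i <- enum I] l)) phi d q.

Definition w_coef K q : F :=
  \sum_(I : {set 'I_l} | I \subset K) (-1) ^+ #|K :\: I| * phi_set I q.

Definition a_exp K : nat :=
  \sum_(i in K) ((l * l.-1) %/ 2 - (i * i.-1) %/ 2)%N.

Definition W_plus X T : F :=
  \sum_(K : {set 'I_l} | K \subset [set i : 'I_l | (0 < i)%N])
     w_coef K X^-1 * X ^+ a_exp K * T ^+ #|K|.

End WPolynomial.

HB.instance Definition _ (R : rcfType) := PseudoPointedMetric.copy R[i] R[i]^o.
HB.instance Definition _ (R : rcfType) := GRing.ComAlgebra.copy R[i] R[i]^o.
HB.instance Definition _ (R : rcfType) := Vector.copy R[i] R[i]^o.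
HB.instance Definition _ (R : rcfType) := NormedModule.copy R[i] R[i]^o.

Section ComplexAnalysis.
Variable R : realType.
Implicit Types (F g : R[i] -> R[i]) (s z : R[i]).

(* k^z = exp (z log k), for k >= 1 *)
Definition natpow (k : nat) z : R[i] :=
  let r := expR (complex.Re z * ln k%:R) in
  let t := complex.Im z * ln k%:R in
  Complex (r * cos t) (r * sin t).

Definition abs_cvg_prod (u : nat -> R[i]) :=
  cvgn (series (fun k => `|u k - 1|)).

Definition holomorphic_at F z := \forall w \near z, derivable F w 1.

(* [F] has a pole of order [m] at [z]; the value [F z] is irrelevant. *)
Definition pole_of_order F z (m : nat) :=
  (0 < m)%N /\
  exists g, [/\ holomorphic_at g z, g z != 0 &
               \forall w \near z^', F w = g w / (w - z) ^+ m].

Definition is_pole F z := exists m, pole_of_order F z m.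

Definition meromorphic_on (U : set R[i]) F :=
  forall z, U z -> holomorphic_at F z \/ is_pole F z.

Definition euler_factor (n : nat) (S : seq nat) s (p : nat) : R[i] :=
  if prime p && (p \notin S)
  then W_plus n./2 p%:R (natpow p (- (n%:R * s / 2))) else 1.

Variable V : vectType rat.

Definition zeta_term (beta : V -> V -> rat) (L : set V) s (M : set V) : R[i] :=
  if `[< maximal_lattice beta M /\ M `<=` L >]
  then natpow (lattice_index L M) (- s) else 0.

(* Unordered summation over the net of finite sets of lattices, which over the
   complex numbers amounts to absolute convergence. *)
Definition zeta_sum (beta : V -> V -> rat) (L : set V) s z :=
  summability.partial_sum (zeta_term beta L s) @ summability.totally --> z.

End ComplexAnalysis.

Definition sigma_ (R : realType) (n : nat) : R :=
  2 / n%:R * (n%:R * (n%:R - 2) / 8 + 1).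

(* Main.v *)
(** In a Z-basis of L, and after division of the form by the norm of L, the
maximal sublattices of L become the sublattices of Z^n that are maximal among
those on which an even integral form G takes values in 2dZ, for some d.  By
the Chinese remainder theorem the number a(k) of such sublattices of index k is
multiplicative.  Write n = 2l and e = l(l-1)/2.  At a prime p not dividing
2 det G the form is split, because its signed determinant is a square;
splitting off hyperbolic planes one at a time gives a(p^k) = 0 unless l | k,
a(p^l) = (1 + 1)(1 + p)...(1 + p^(l-1)) and a(p^(lm)) <= (m+1)^l p^(em).  At the
other primes, a(p^k) is at most a polynomial in k times p^(ek/l).  Hence
sum a(k) k^(-s) = zeta(ls - e)^2 H(s), where the Dirichlet series H converges
absolutely for l Re s >= e + 3/4, and H((e+1)/l) is a convergent product of
positive numbers.  Since (w - 1) zeta(w) is given on Re w > 0 by an explicit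
series with value 1 at w = 1, the pole at sigma_n = (e+1)/l is double.  In the
Euler product of the W's all coefficients w_(l,K)(1/p) are bounded; only
K = {1} needs more, namely w_(l,{1})(1/p) = O(1/p). *)

From HB Require Import structures.
From mathcomp Require Import all_boot all_order all_algebra finmap.
From mathcomp Require Import perm fraction.
From mathcomp Require Import all_classical all_reals all_analysis.
From mathcomp Require Import complex.
From mathcomp.analysis.showcase Require summability.
From mathcomp Require Import zify ring lra.
Require Import Defs.

Set Implicit Arguments.
Unset Strict Implicit.
Unset Printing Implicit Defensive.

Import Order.TTheory GRing.Theory Num.Theory.
Import numFieldNormedType.Exports.

Local Open Scope classical_set_scope.
Local Open Scope ring_scope.

(** * Sublattices of Z^n *)

(** The local computations take place over Z, modulo powers of p: a sublattice is the row span of an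
    integral matrix, unimodular integral matrices replace changes of basis over Z_p, and what would
    be an exact splitting over Z_p becomes a splitting up to p^m times an even form, which does not
    affect divisibility of the form by p^m. The ring Z_p itself only enters through the definition
    of the norm.

    The obstacle is at the bad primes, where maximal lattices have no uniform shape. The local
    factor there converges already for l Re s > e, so a polynomial loss in k is harmless, and it
    suffices to bound all sublattices on which the form is divisible by p^m and whose index is
    within a bounded factor of the smallest possible one. At the good primes the exact exponent is
    needed, and maximality is used to pin it down.

    The main part of a(p^l) = 2 p^e (1 + O(1/p)) is cancelled by the factor (1 - p^(e-ls))^2. The
    constant 3/4 is a number th with 1/2 < th < 1: what is needed is convergence of the sum of the
    p^(-2 th). *)

Definition rspan m n (B : 'M[int]_(m, n)) : set 'rV[int]_n :=
  [set x | exists y : 'rV_m, x = y *m B].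

Lemma rspan_subP m1 m2 n (B : 'M[int]_(m1, n)) (C : 'M[int]_(m2, n)) :
  rspan B `<=` rspan C <-> exists X, B = X *m C.
Proof.
split=> [BC|[X ->] _ [y ->]]; last by exists (y *m X); rewrite mulmxA.
have /choice[f hf] : forall i, exists y : 'rV_m2, row i B = y *m C.
  by move=> i; apply: BC; exists (delta_mx 0 i); rewrite rowE.
exists (\matrix_i f i); apply/row_matrixP => i.
by rewrite row_mul rowK hf.
Qed.

Lemma rspan_mulU m n (X : 'M[int]_m) (B : 'M[int]_(m, n)) :
  X \in unitmx -> rspan (X *m B) = rspan B.
Proof.
move=> uX; apply/seteqP; split; apply/rspan_subP; first by exists X.
by exists (invmx X); rewrite mulmxA mulVmx // mul1mx.
Qed.

Lemma rspanD m n (B : 'M[int]_(m, n)) x y :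
  rspan B x -> rspan B y -> rspan B (x + y).
Proof. by move=> [u ->] [v ->]; exists (u + v); rewrite mulmxDl. Qed.

Lemma rspanZ m n (B : 'M[int]_(m, n)) a x : rspan B x -> rspan B (a *: x).
Proof. by move=> [u ->]; exists (a *: u); rewrite scalemxAl. Qed.

Lemma rspanN m n (B : 'M[int]_(m, n)) x : rspan B x -> rspan B (- x).
Proof. by move=> [u ->]; exists (- u); rewrite mulNmx. Qed.

Lemma rspanB m n (B : 'M[int]_(m, n)) x y :
  rspan B x -> rspan B y -> rspan B (x - y).
Proof. by move=> Bx By; apply: rspanD => //; apply: rspanN. Qed.

Lemma rspan0 m n (B : 'M[int]_(m, n)) : rspan B 0.
Proof. by exists 0; rewrite mul0mx. Qed.

Lemma rspan_row m n (B : 'M[int]_(m, n)) i : rspan B (row i B).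
Proof. by exists (delta_mx 0 i); rewrite rowE. Qed.

Lemma rspan1 n : rspan (1%:M : 'M[int]_n) = setT.
Proof. by apply/seteqP; split=> // x _; exists x; rewrite mulmx1. Qed.

Lemma rspan_coprime m n (B : 'M[int]_(m, n)) (a b : nat) x : coprime a b ->
  rspan B (a%:Z *: x) -> rspan B (b%:Z *: x) -> rspan B x.
Proof.
move=> ab ha hb; have [u [v uv]] := Bezoutz a%:Z b%:Z.
have -> : x = u *: (a%:Z *: x) + v *: (b%:Z *: x).
  rewrite !scalerA -scalerDl uv; suff -> : gcdz a b = 1 by rewrite scale1r.
  by apply/eqP; rewrite /gcdz /= eqz_nat.
by apply: rspanD; apply: rspanZ.
Qed.

Lemma rspan_col_mx m1 m2 n (B : 'M[int]_(m1, n)) (C : 'M[int]_(m2, n)) x :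
  rspan (col_mx B C) x <-> exists2 y, rspan B y & rspan C (x - y).
Proof.
split=> [[y ->]|[_ [u ->] [v hv]]].
  rewrite -[y]hsubmxK mul_row_col; exists (lsubmx y *m B).
    by exists (lsubmx y).
  by rewrite addrC addKr; exists (rsubmx y).
exists (row_mx u v); by rewrite mul_row_col -hv addrC subrK.
Qed.

Lemma unitmx_int_det n (X : 'M[int]_n) : X \in unitmx -> `|\det X|%N = 1%N.
Proof. by rewrite unitmxE unfold_in /= => /orP[]/eqP->. Qed.

Lemma rspan_det n (B C : 'M[int]_n) :
  rspan B = rspan C -> `|\det B|%N = `|\det C|%N.
Proof.
move=> e; have [X eB] : exists X, B = X *m C by apply/rspan_subP; rewrite e.
have [Y eC] : exists X, C = X *m B by apply/rspan_subP; rewrite e.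
apply/eqP; rewrite eqn_dvd {1}eC {3}eB !det_mulmx !abszM.
by rewrite !dvdn_mull.
Qed.

Lemma rspan_eqU n (B C : 'M[int]_n) : \det C != 0 ->
  rspan B = rspan C -> exists2 X, X \in unitmx & B = X *m C.
Proof.
move=> C0 e; have [X eB] : exists X, B = X *m C by apply/rspan_subP; rewrite e.
exists X => //; move: (rspan_det e); rewrite eB det_mulmx abszM unitmxE.
have : (0 < `|\det C|)%N by rewrite absz_gt0.
move: (\det X) `|\det C|%N => d c c0 /eqP; rewrite -{2}[c]mul1n eqn_pmul2r //.
by move/eqP=> d1; apply/unitrP; exists d; split; lia.
Qed.

(** In Smith form [C] is diagonal up to unimodular factors; truncating the diagonal, or padding it
    with zeros, makes it square without changing the span. *)
Lemma rspan_square m n (C : 'M[int]_(m, n)) :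
  exists B : 'M[int]_n, rspan B = rspan C.
Proof.
have [P uP [R uR [d _ ->]]] := int_Smith_normal_form C.
exists ((\matrix_(i < n, j < n) ((if (i < m)%N then d`_i else 0)
          *+ (i == j :> nat))) *m R).
rewrite -[in RHS]mulmxA (rspan_mulU _ uP).
apply/seteqP; split=> [_ [y ->]|_ [y ->]]; rewrite mulmxA.
  exists (\row_j (if insub (val j) is Some k then y 0 k else 0)); rewrite mulmxA.
  congr (_ *m R); apply/rowP => j; rewrite !mxE.
  rewrite (bigD1 j) //= big1 ?addr0 => [|i /negPf ij]; last first.
    by rewrite mxE (inj_eq val_inj) ij mulr0n mulr0.
  rewrite mxE eqxx mulr1n; case: ifP => [jm|jm].
    rewrite (bigD1 (Ordinal jm)) //= big1 ?addr0 => [|i /negPf ij]; last first.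
      rewrite !mxE; have -> : (i == j :> nat) = false by rewrite -ij.
      by rewrite mulr0n mulr0.
    by rewrite !mxE /= eqxx mulr1n; case: insubP => [k _ /= kj|]; 
      [congr (y 0 _ * _); apply: val_inj | rewrite ltn_ord].
  rewrite mulr0 big1 // => i _; rewrite !mxE.
  have -> : (i == j :> nat) = false by apply/negbTE; apply: contraFN jm => /eqP <-.
  by rewrite mulr0n mulr0.
exists (\row_j (if insub (val j) is Some k then y 0 k else 0)); rewrite mulmxA.
congr (_ *m R); apply/rowP => j; rewrite !mxE.
rewrite [RHS](bigD1 j) //= [X in _ + X]big1 ?addr0 => [|i /negPf ij]; last first.
  by rewrite !mxE (inj_eq val_inj) ij mulr0n mulr0.
rewrite !mxE eqxx mulr1n; case: insubP => [k jm /= kj|jm].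
  rewrite jm (bigD1 k) //= big1 ?addr0 => [|i /negPf ij]; last first.
    rewrite !mxE; have -> : (i == j :> nat) = false by rewrite -kj.
    by rewrite mulr0n mulr0.
  by rewrite !mxE kj eqxx mulr1n.
rewrite mul0r big1 // => i _; rewrite !mxE.
have -> : (i == j :> nat) = false by apply/negbTE; apply: contra jm => /eqP <-.
by rewrite mulr0n mulr0.
Qed.

Lemma smith_square n (B : 'M[int]_n) :
  exists (P R : 'M[int]_n) (d : 'rV[int]_n),
    [/\ P \in unitmx, R \in unitmx, B = P *m diag_mx d *m R &
        `|\det B|%N = (\prod_i `|d 0%R i|)%N].
Proof.
have [P uP [R uR [d _ eB]]] := int_Smith_normal_form B.
have e : \matrix_(i < n, j < n) (d`_i *+ (i == j :> nat)) = diag_mx (\row_i d`_i).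
  by apply/matrixP => i j; rewrite !mxE.
exists P, R, (\row_i d`_i); split=> //; first by rewrite eB e.
rewrite eB e !det_mulmx !abszM (unitmx_int_det uP) (unitmx_int_det uR) mul1n muln1 det_diag.
by rewrite (big_morph absz abszM (erefl _)).
Qed.

(** In the coordinates of the Smith form the lattice is the product of the ideals generated by the
    d_i, so the boxes of residues modulo the d_i represent Z^n modulo the lattice; their number is
    the product of the |d_i|. *)
Lemma rspan_reps n (B : 'M[int]_n) : \det B != 0 ->
  exists s : seq 'rV[int]_n, [/\ uniq s, size s = `|\det B|%N,
    forall x, exists2 r, r \in s & rspan B (x - r) &
    {in s &, forall r r', rspan B (r - r') -> r = r'}].
Proof.
rewrite -absz_gt0; have [P [R [d [uP uR eB ->]]]] := smith_square B.
move=> d0; have {}d0 i : d 0 i != 0.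
  by apply: contraTneq d0 => e; rewrite (bigD1 i) //= e.
have inB x : rspan B x <-> forall i, (d 0%R i %| (x *m invmx R)%R 0%R i)%Z.
  rewrite eB -mulmxA rspan_mulU //; split=> [[y ->] i|hx].
    by rewrite mulmxA mulmxK // mul_mx_diag mxE dvdz_mull.
  exists (\row_i ((x *m invmx R)%R 0%R i %/ d 0%R i)%Z); rewrite mulmxA.
  rewrite -[LHS](mulmxKV uR); congr (_ *m R); apply/rowP => i.
  by rewrite mul_mx_diag [RHS]mxE [X in _ = X * _]mxE divzK.
pose T := {dffun forall i : 'I_n, 'I_`|d 0%R i|%N}.
pose g (f : T) : 'rV[int]_n := (\row_i (f i : nat)%:Z) *m R.
have gi f f' : rspan B (g f - g f') -> f = f'.
  move=> /inB h; apply/ffunP => i; apply: val_inj => /=; move: (h i).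
  rewrite /g mulmxBl !mulmxK // !mxE.
  have := ltn_ord (f i); have := ltn_ord (f' i); move: (d0 i).
  move: (nat_of_ord (f i)) (nat_of_ord (f' i)) => a b.
  move: (d 0 i) => c c0 bc ac /dvdzP[q].
  have [->|q0] := eqVneq q 0; first lia.
  have : (`|c| <= `|(q * c)%R|)%N by rewrite abszM leq_pmull // absz_gt0.
  by move=> + e; rewrite -e; lia.
exists [seq g f | f : T]; split.
- rewrite map_inj_uniq ?enum_uniq // => f f' e.
  by apply: gi; rewrite e subrr; apply: rspan0.
- rewrite size_map -cardE card_dep_ffun foldrE big_image /=.
  by apply: eq_bigr => i _; rewrite card_ord.
- move=> x; have h i : (`|((x *m invmx R)%R 0%R i %% d 0%R i)%Z| < `|d 0%R i|)%N.
    have := modz_ge0 ((x *m invmx R) 0 i) (d0 i).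
    have := ltz_mod ((x *m invmx R) 0 i) (d0 i); lia.
  exists (g [ffun i => Ordinal (h i)]); first by apply: map_f; rewrite mem_enum.
  apply/inB => i; rewrite mulmxBl mulmxK // mxE [X in _ + X]mxE [X in _ - X]mxE ffunE /=.
  rewrite gez0_abs ?modz_ge0 //.
  by rewrite {1}(divz_eq ((x *m invmx R) 0 i) (d 0 i)) addrK dvdz_mull.
- by move=> _ _ /mapP[f _ ->] /mapP[f' _ ->] /gi ->.
Qed.

(** * Local counts *)

Section Covers.
Variables T U : eqType.
Implicit Types (A : set T) (N M : nat).

(** Finiteness and an upper bound for the cardinality in one statement. Such bounds add over unions
    and multiply over fibrations, and no cardinal of a set of lattices has to be formed. *)
Definition cov (T : eqType) (A : set T) N :=
  exists2 s : seq T, (size s <= N)%N & forall x, A x -> x \in s.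

Lemma cov_leq A N M : (N <= M)%N -> cov A N -> cov A M.
Proof. by move=> NM [s hs hA]; exists s => //; apply: leq_trans NM. Qed.

Lemma cov_sub A B N : B `<=` A -> cov A N -> cov B N.
Proof. by move=> BA [s hs hA]; exists s => // x /BA/hA. Qed.

Lemma cov_bind A N (F : T -> set U) M : cov A N -> (forall x, A x -> cov (F x) M) ->
  cov [set y | exists2 x, A x & F x y] (N * M).
Proof.
move=> [s hs hA] hF.
have /choice[f hf] : forall x, exists s' : seq U,
    (size s' <= M)%N /\ (A x -> forall y, F x y -> y \in s').
  move=> x; have [/hF[s' ? ?]|nA] := pselect (A x); first by exists s'.
  by exists [::].
exists (flatten [seq f x | x <- s]); last first.
  move=> y [x Ax Fxy]; apply/flattenP; exists (f x); first exact/map_f/hA.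
  exact: (hf x).2.
rewrite size_flatten /shape -map_comp sumnE big_map.
apply: leq_trans (leq_mul hs (leqnn M)).
rewrite -sum1_size big_distrl /=; apply: leq_sum => x _.
by rewrite mul1n; have [] := hf x.
Qed.

Lemma cov1 A x : (forall y, A y -> y = x) -> cov A 1.
Proof. by move=> h; exists [:: x] => // y /h ->; rewrite inE. Qed.

Lemma cov0 A N : (forall x, ~ A x) -> cov A N.
Proof. by move=> h; exists [::] => // x /h. Qed.

Lemma cov_image A N (f : T -> U) : cov A N -> cov (f @` A) N.
Proof.
move=> [s hs hA]; exists (map f s); first by rewrite size_map.
by move=> _ [x Ax <-]; apply/map_f/hA.
Qed.

Lemma cov_ltn K (F : nat -> set T) M : (forall i, (i < K)%N -> cov (F i) M) ->
  cov [set y | exists2 i, (i < K)%N & F i y] (K * M).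
Proof.
elim: K => [_|K IH h]; first by apply: cov0 => x [].
have [s hs hA] := IH (fun i iK => h i (ltnW iK)).
have [s' hs' hA'] := h K (ltnSn K); exists (s ++ s').
  by rewrite size_cat mulSn addnC leq_add.
move=> y [ i]; rewrite ltnS leq_eqVlt => /orP[/eqP->|iK] Fy; rewrite mem_cat.
  by rewrite hA' ?orbT.
by rewrite hA //; exists i.
Qed.

Lemma cov_setU A B N M : cov A N -> cov B M -> cov (A `|` B) (N + M).
Proof.
move=> [s hs hA] [s' hs' hB]; exists (s ++ s'); first by rewrite size_cat leq_add.
by move=> x [/hA|/hB] xs; rewrite mem_cat xs ?orbT.
Qed.

End Covers.

(** * Even integral forms and their values on sublattices *)

Section Forms.
Variable n : nat.
Implicit Types (G : 'M[int]_n) (x y z : 'rV[int]_n).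

Definition bil G x y : int := (x *m G *m y^T) 0 0.

Lemma bilDl G x y z : bil G (x + y) z = bil G x z + bil G y z.
Proof. by rewrite /bil !mulmxDl mxE. Qed.

Lemma bilDr G x y z : bil G z (x + y) = bil G z x + bil G z y.
Proof. by rewrite /bil linearD mulmxDr mxE. Qed.

Lemma bilZl G a x z : bil G (a *: x) z = a * bil G x z.
Proof. by rewrite /bil -!scalemxAl mxE. Qed.

Lemma bilZr G a x z : bil G z (a *: x) = a * bil G z x.
Proof. by rewrite /bil linearZ /= -scalemxAr mxE. Qed.

Lemma bil0l G z : bil G 0 z = 0.
Proof. by rewrite /bil !mul0mx mxE. Qed.

Lemma bil0r G z : bil G z 0 = 0.
Proof. by rewrite /bil trmx0 mulmx0 mxE. Qed.

Lemma bilD G H x y : bil (G + H) x y = bil G x y + bil H x y.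
Proof. by rewrite /bil mulmxDr mulmxDl mxE. Qed.

Lemma bilZ a G x y : bil (a *: G) x y = a * bil G x y.
Proof. by rewrite /bil -scalemxAr -scalemxAl mxE. Qed.

Lemma bilC G x y : G^T = G -> bil G x y = bil G y x.
Proof.
move=> sG; rewrite /bil -[in LHS](trmxK (x *m G *m y^T)) mxE.
by rewrite !trmx_mul sG trmxK mulmxA.
Qed.

Lemma bil_delta G i j : bil G (delta_mx 0 i) (delta_mx 0 j) = G i j.
Proof. by rewrite /bil -rowE trmx_delta -colE !mxE. Qed.

Definition evenf G := G^T = G /\ forall i, (2 %| G i i)%Z.

Lemma bil_sqrD G x y : G^T = G ->
  bil G (x + y) (x + y) = bil G x x + 2 * bil G x y + bil G y y.
Proof. by move=> sG; rewrite bilDl !bilDr (bilC y x sG); ring. Qed.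

Lemma evenf_bil G x : evenf G -> (2 %| bil G x x)%Z.
Proof.
move=> [sG dG]; rewrite (row_sum_delta x).
apply: (big_ind (fun x => (2 %| bil G x x)%Z)).
- by rewrite bil0l.
- move=> y z hy hz; rewrite bil_sqrD //.
  by apply: rpredD => //; apply: rpredD => //; apply: dvdz_mulr.
- by move=> i _; rewrite bilZl bilZr bil_delta !dvdz_mull.
Qed.

(** With Q(x) = [bil G x x] / 2 this says that Q takes its values in dZ on [S]. The factor 2 keeps
    the condition correct at the prime 2. *)
Definition iso G (d : int) (S : set 'rV[int]_n) :=
  forall x, S x -> (2 * d %| bil G x x)%Z.

(** Polarization; thanks to the factor 2 in [iso] nothing is lost on division by 2. *)
Lemma iso_bil m G d (B : 'M[int]_(m, n)) x y : G^T = G -> iso G d (rspan B) ->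
  rspan B x -> rspan B y -> (d %| bil G x y)%Z.
Proof.
move=> sG iB Bx By; have := iB _ (rspanD Bx By); rewrite bil_sqrD //.
have -> : bil G x x + 2 * bil G x y + bil G y y =
  2 * bil G x y + (bil G x x + bil G y y) by ring.
by rewrite rpredDr ?rpredD ?iB // dvdz_mul2l.
Qed.

(** Values of even forms are even, so an error term d E changes [bil] on the diagonal by multiples
    of 2d. The error term of [isotropic_reduce] is removed in this way. *)
Lemma iso_congr G H E d S : evenf E -> G = H + d *: E -> iso H d S -> iso G d S.
Proof.
move=> eE -> iH x Sx; rewrite bilD bilZ; apply: rpredD; first exact: iH.
by rewrite mulrC dvdz_mul // evenf_bil.
Qed.

End Forms.

Lemma bil_mulmx m n (G : 'M[int]_n) (B : 'M[int]_(m, n)) x y :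
  bil G (x *m B) (y *m B) = bil (B *m G *m B^T) x y.
Proof. by rewrite /bil trmx_mul !mulmxA. Qed.

Lemma evenf_mulmx m n (G : 'M[int]_n) (B : 'M[int]_(m, n)) :
  evenf G -> evenf (B *m G *m B^T).
Proof.
move=> eG; split; first by rewrite !trmx_mul trmxK eG.1 mulmxA.
by move=> i; rewrite -bil_delta -bil_mulmx evenf_bil.
Qed.

Lemma iso_gram n (G : 'M[int]_n) d (B : 'M[int]_n) : G^T = G -> d != 0 ->
  iso G d (rspan B) -> exists2 H, evenf H & B *m G *m B^T = d *: H.
Proof.
move=> sG d0 iB; exists (\matrix_(i, j) ((B *m G *m B^T) i j %/ d)%Z).
  split; first by apply/matrixP => i j; rewrite [LHS]mxE [LHS]mxE [RHS]mxE -bil_delta bilC ?bil_delta // !trmx_mul trmxK sG mulmxA.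
  move=> i; rewrite mxE -bil_delta -bil_mulmx -!rowE.
  have /dvdzP[q ->] := iB _ (rspan_row B i).
  by rewrite mulrA mulzK // dvdz_mull.
apply/matrixP => i j; rewrite [RHS]mxE [X in _ * X]mxE mulrC divzK //.
by rewrite -bil_delta -bil_mulmx (iso_bil sG iB) //; [exists (delta_mx 0 i)|exists (delta_mx 0 j)].
Qed.

(** Determinants of the Gram matrix d H. This bounds from below the index of a lattice on which the
    form is divisible by d. *)
Lemma iso_det n (G : 'M[int]_n) d (B : 'M[int]_n) : G^T = G -> d != 0 ->
  iso G d (rspan B) -> (d ^+ n %| (\det B) ^+ 2 * \det G)%Z.
Proof.
move=> sG d0 /(iso_gram sG d0)[H _ /(congr1 determinant)].
rewrite detZ !det_mulmx det_tr => e; apply/dvdzP; exists (\det H).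
by rewrite [RHS]mulrC -e; ring.
Qed.

Lemma iso_mulmx n (G : 'M[int]_n) d (U B : 'M[int]_n) :
  iso (U *m G *m U^T) d (rspan B) <-> iso G d (rspan (B *m U)).
Proof.
split=> h _ [y ->].
  by rewrite mulmxA bil_mulmx; apply: h; exists y.
by rewrite -bil_mulmx -mulmxA; apply: h; exists y.
Qed.

Lemma pfactor_dvdz p m (x : int) : prime p -> x != 0 ->
  (p%:Z ^+ m %| x)%Z = (m <= logn p `|x|)%N.
Proof. by move=> pp x0; rewrite dvdzE abszX /= pfactor_dvdn // absz_gt0. Qed.

(** Here [v] bounds the valuation of [g], so cancelling [g] costs at most v powers of p. At good
    primes v = 0; at bad primes v is the fixed loss c. *)
Lemma dvdz_pfactor_mul p v b m (g x : int) : prime p -> ~~ (p%:Z ^+ v.+1 %| g)%Z ->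
  (p%:Z ^+ m %| g * p%:Z ^+ b * x)%Z -> (p%:Z ^+ (m - b - v) %| x)%Z.
Proof.
move=> pp gv; have g0 : g != 0 by apply: contraNneq gv => ->; rewrite dvdz0.
have p0 : p%:Z != 0 by rewrite eqz_nat -lt0n prime_gt0.
have [->|x0] := eqVneq x 0; first by rewrite dvdz0.
move: gv; rewrite !pfactor_dvdz // ?mulf_neq0 ?expf_neq0 //.
rewrite !abszM abszX /= lognM ?muln_gt0 ?expn_gt0 ?absz_gt0 ?g0 ?prime_gt0 //.
by rewrite lognM ?expn_gt0 ?absz_gt0 ?g0 ?prime_gt0 // pfactorK //; lia.
Qed.

Lemma mx11D (A B : 'M[int]_1) : (A + B) 0 0 = A 0 0 + B 0 0.
Proof. by rewrite mxE. Qed.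

Lemma mx11N (A : 'M[int]_1) : (- A) 0 0 = - A 0 0.
Proof. by rewrite mxE. Qed.

Lemma mx11Z a (A : 'M[int]_1) : (a *: A) 0 0 = a * A 0 0.
Proof. by rewrite mxE. Qed.

(** * Bases adapted to an isotropic coordinate vector *)

Section Blocks.
Variable n : nat.
Implicit Types (u h : 'rV[int]_n) (f : 'cV[int]_n) (B G : 'M[int]_n).

Definition vec (x0 x1 : int) (x' : 'rV[int]_n) : 'rV[int]_(1 + (1 + n)) :=
  row_mx x0%:M (row_mx x1%:M x').

(** The rows are (b, t, u), (0, a, 0) and (0, f, B). For nonsingular [B], the lattice projects to b
    Z in the first coordinate, meets the line of the second coordinate vector in a Z, and its part
    with first coordinate 0, taken modulo that line, is the row lattice of [B]. *)
Definition blk (b t : int) u (a : int) f B : 'M[int]_(1 + (1 + n)) :=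
  block_mx b%:M (row_mx t%:M u) 0 (block_mx a%:M 0 f B).

(** The second coordinate vector e1 is isotropic and pairs only with the first coordinate vector e0,
    with value [g]. If g is not 0, the orthogonal of e1 is the hyperplane where the first coordinate
    vanishes, and [G] is the form on this hyperplane modulo e1. *)
Definition qblk (k g : int) h G : 'M[int]_(1 + (1 + n)) :=
  block_mx k%:M (row_mx g%:M h) (col_mx g%:M h^T) (block_mx 0 0 0 G).

Lemma vecP (x : 'rV[int]_(1 + (1 + n))) : exists x0 x1 x', x = vec x0 x1 x'.
Proof.
exists (lsubmx x 0 0), (lsubmx (rsubmx x) 0 0), (rsubmx (rsubmx x)).
by rewrite /vec -!mx11_scalar !hsubmxK.
Qed.

Lemma bil_qblk k g h G x0 x1 x' y0 y1 y' :
  bil (qblk k g h G) (vec x0 x1 x') (vec y0 y1 y') =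
  k * x0 * y0 + g * (x0 * y1 + x1 * y0) + x0 * (h *m y'^T) 0 0
  + y0 * (h *m x'^T) 0 0 + bil G x' y'.
Proof.
rewrite /bil /vec /qblk !tr_row_mx !tr_scalar_mx mul_row_block mul_row_col mul_row_block.
rewrite !mulmx0 !addr0 !add0r mul_mx_row mul_row_col add_row_mx mul_row_col addr0.
rewrite !mul_scalar_mx !mulmxDl -!scalemxAl !mul_mx_scalar.
have -> : x' *m h^T = h *m x'^T.
  by apply/matrixP => i j; rewrite !ord1 !mxE; apply: eq_bigr => l _; rewrite !mxE mulrC.
move: (h *m x'^T) (h *m y'^T) (x' *m G *m y'^T) => X Y Z.
rewrite !mxE /= !mulr1n; ring.
Qed.

Lemma rspan_blk b t u a f B x0 x1 x' :
  rspan (blk b t u a f B) (vec x0 x1 x') <->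
  exists i j y', [/\ x0 = i * b, x1 = i * t + j * a + (y' *m f) 0 0
                   & x' = i *: u + y' *m B].
Proof.
rewrite /vec /blk; split=> [[y]|[i [j [y [-> -> ->]]]]].
  rewrite -[y]hsubmxK -[rsubmx y]hsubmxK !mul_row_block !mulmx0 addr0.
  rewrite !mul_mx_row add_row_mx !mul_mx_scalar add0r.
  set i := lsubmx y; set j := lsubmx _; set y' := rsubmx (rsubmx y).
  move=> /eq_row_mx[e0 /eq_row_mx[e1 e2]]; exists (i 0 0), (j 0 0), y'.
  rewrite e2 [in i *m u](mx11_scalar i) mul_scalar_mx.
  move: e0 e1 => /matrixP/(_ 0 0) + /matrixP/(_ 0 0); rewrite !mxE /= !mulr1n.
  by move=> -> ->; split=> //; ring.
exists (vec i j y); rewrite /vec !mul_row_block !mulmx0 addr0.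
rewrite !mul_mx_row add_row_mx !mul_scalar_mx !add0r; congr row_mx.
  by rewrite scale_scalar_mx.
congr row_mx; rewrite -?mx11_scalar.
apply/matrixP => r c; rewrite !ord1 [LHS]mxE [RHS]mxE [X in _ = _ + X]mxE !mxE /= !mulr1n; ring.
Qed.

Lemma det_blk b t u a f B : \det (blk b t u a f B) = b * a * \det B.
Proof. by rewrite /blk det_ublock det_lblock !det_scalar1 mulrA. Qed.

Lemma rspan_ext2 (B C : 'M[int]_(1 + (1 + n))) :
  (forall x0 x1 x', rspan B (vec x0 x1 x') <-> rspan C (vec x0 x1 x')) ->
  rspan B = rspan C.
Proof.
move=> h; apply/seteqP; split=> x; have [x0 [x1 [x' ->]]] := vecP x; 
  by move/h.
Qed.

Lemma blk_oppb b t u a f B :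
  rspan (blk (- b) (- t) (- u) a f B) = rspan (blk b t u a f B).
Proof.
apply: rspan_ext2 => x0 x1 x'; rewrite !rspan_blk.
by split=> -[i [j [y [-> -> ->]]]]; exists (- i), j, y;
  rewrite ?scaleNr ?scalerN ?opprK; split=> //; ring.
Qed.

Lemma blk_oppa b t u a f B : rspan (blk b t u (- a) f B) = rspan (blk b t u a f B).
Proof.
apply: rspan_ext2 => x0 x1 x'; rewrite !rspan_blk.
by split=> -[i [j [y [-> -> ->]]]]; exists i, (- j), y; split=> //; ring.
Qed.

Lemma blk_mid b t u a f B X : X \in unitmx ->
  rspan (blk b t u a f (X *m B)) = rspan (blk b t u a (invmx X *m f) B).
Proof.
move=> uX; apply: rspan_ext2 => x0 x1 x'; rewrite !rspan_blk.
split=> -[i [j [y [-> -> ->]]]].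
  by exists i, j, (y *m X); rewrite !mulmxA mulmxK.
by exists i, j, (y *m invmx X); rewrite !mulmxA mulmxKV.
Qed.

Lemma blk_shiftu b t u a f B y :
  rspan (blk b t (u + y *m B) a f B) = rspan (blk b (t - (y *m f) 0 0) u a f B).
Proof.
apply: rspan_ext2 => x0 x1 x'; rewrite !rspan_blk.
split=> -[i [j [z [-> -> ->]]]].
  exists i, j, (z + i *: y); rewrite !mulmxDl -!scalemxAl scalerDr; split=> //.
    by rewrite mx11D mx11Z; ring.
  by rewrite -addrA [X in _ + X]addrC.
exists i, j, (z - i *: y); rewrite !mulmxBl -!scalemxAl scalerDr; split=> //.
  by rewrite mx11D mx11N mx11Z; ring.
by rewrite -addrA [X in _ = _ + X]addrC subrK.
Qed.

(** Together with [blk_mid] and [blk_shiftu]: [t] and [f] matter only modulo [a], and [u] only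
    modulo the row lattice of [B]. Counting lattices with given [b], [a] and middle lattice becomes
    counting residues. *)
Lemma blk_shiftt b t u a f B c z :
  rspan (blk b (t + c * a) u a (f + a *: z) B) = rspan (blk b t u a f B).
Proof.
apply: rspan_ext2 => x0 x1 x'; rewrite !rspan_blk.
split=> -[i [j [y [-> -> ->]]]].
  exists i, (j + i * c + (y *m z) 0 0), y; split=> //.
  by rewrite mulmxDr -scalemxAr mx11D mx11Z; ring.
exists i, (j - i * c - (y *m z) 0 0), y; split=> //.
by rewrite mulmxDr -scalemxAr mx11D mx11Z; ring.
Qed.

(** Row operations clear the first column below its top entry, and then the top row of the last n
    columns in the remaining block; both come from Smith forms. The signs of [b] and [a] are
    adjusted afterwards. *)
Lemma block_form (B : 'M[int]_(1 + (1 + n))) : \det B != 0 ->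
  exists (b t : int) u (a : int) f B', [/\ 0 < b, 0 < a, rspan B = rspan (blk b t u a f B') &
    `|\det B|%N = (`|b| * `|a| * `|\det B'|)%N].
Proof.
move=> B0.
suff [b [t [u [a [f [B' e]]]]]] : exists b t u a f B', rspan B = rspan (blk b t u a f B').
  wlog b0 : b t u e / 0 < b.
    move=> W; have [|b0|b0] := ltgtP b 0; last 2 first.
    - exact: W e b0.
    - by move: (rspan_det e); rewrite det_blk b0 !mul0r => /eqP; rewrite absz_eq0 (negPf B0).
    rewrite -oppr_gt0 => b0; apply: (W (- b) (- t) (- u) _ b0); rewrite blk_oppb; apply: e.
  wlog a0 : a e / 0 < a.
    move=> W; have [|a0|a0] := ltgtP a 0; last 2 first.
    - exact: W e a0.
    - by move: (rspan_det e); rewrite det_blk a0 mulr0 mul0r => /eqP; rewrite absz_eq0 (negPf B0).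
    rewrite -oppr_gt0 => a0; apply: (W (- a) _ a0); rewrite blk_oppa; apply: e.
  by exists b, t, u, a, f, B'; split=> //; rewrite (rspan_det e) det_blk !abszM.
have [P uP [R uR [d _ eB]]] := int_Smith_normal_form (lsubmx B).
pose B1 := invmx P *m B.
have eB1 : dlsubmx B1 = 0.
  have lB1 : lsubmx B1 = \matrix_(i, j) (d`_i *+ (i == j :> nat)) *m R.
    by rewrite -mulmx_lsub eB !mulmxA mulVmx // mul1mx.
  apply/matrixP => i j; have := congr1 (fun M : 'M[int]_(_, _) => M (rshift 1 i) j) lB1.
  rewrite !mxE => ->; rewrite big1 // => l _; rewrite !mxE !ord1 /=.
  by rewrite mulr0n mul0r.
set C := drsubmx B1.
have [P2 uP2 [R2 uR2 [d2 _ eC]]] := int_Smith_normal_form (rsubmx C).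
(* The last n columns of [C] have n + 1 rows, so the last row of their diagonal Smith factor is
   zero; the transposition moves it to the top. *)
pose Q2 := tperm_mx 0 ord_max *m invmx P2.
have uQ2 : Q2 \in unitmx by rewrite unitmx_mul unitmx_perm unitmx_inv.
pose C1 := Q2 *m C.
have eC1 : ursubmx (C1 : 'M[int]_(1 + n, 1 + n)) = 0.
  have rC1 : rsubmx C1 = xrow 0 ord_max (\matrix_(i, j) (d2`_i *+ (i == j :> nat))) *m R2.
    rewrite -mulmx_rsub eC /Q2 -!mulmxA [invmx P2 *m _]mulmxA mulVmx // mul1mx.
    by rewrite mulmxA -xrowE.
  apply/matrixP => i j; have := congr1 (fun M : 'M[int]_(_, _) => M (lshift n i) j) rC1.
  rewrite !mxE => ->; rewrite big1 // => l _; rewrite !mxE !ord1.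
  have -> : lshift n 0 = 0 :> 'I_(1 + n) by apply: val_inj.
  by rewrite tpermL /= gtn_eqF // mulr0n mul0r.
pose X := block_mx 1%:M 0 0 Q2 : 'M[int]_(1 + (1 + n)).
have uX : X \in unitmx by rewrite unitmxE det_ublock det1 mul1r -unitmxE.
exists (ulsubmx B1 0 0), (lsubmx (ursubmx B1) 0 0), (rsubmx (ursubmx B1)),
  (ulsubmx (C1 : 'M[int]_(1 + n, 1 + n)) 0 0), (dlsubmx (C1 : 'M[int]_(1 + n, 1 + n))), (drsubmx (C1 : 'M[int]_(1 + n, 1 + n))).
rewrite /blk -!mx11_scalar hsubmxK -eC1 submxK -eB1.
have -> : block_mx (ulsubmx B1) (ursubmx B1) (dlsubmx B1) C1 = X *m B1.
  rewrite -[B1 in RHS]submxK mulmx_block !mul1mx !mul0mx !add0r !addr0.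
  by rewrite eB1 mulmx0.
by rewrite rspan_mulU // rspan_mulU ?unitmx_inv.
Qed.

(** The permutation matrix that exchanges the first two coordinates, in blocks so that its products
    with block matrices are computed by rewriting. *)
Definition swp : 'M[int]_(1 + (1 + n)) :=
  let r := row_mx 1%:M 0 in let c := col_mx 1%:M 0 in
  block_mx 0 r c (1%:M - c *m r).

Lemma det_swp : \det swp = -1.
Proof.
rewrite /swp; set r := row_mx _ _; set c := col_mx _ _.
have rc : r *m c = 1%:M by rewrite mul_row_col mulmx1 mulmx0 addr0.
have -> : block_mx 0 r c (1%:M - c *m r) = block_mx 1%:M r 0 1%:M *m
    block_mx (- 1%:M) 0 c 1%:M *m block_mx 1%:M (- r) 0 1%:M.
  rewrite !mulmx_block !mul1mx !mulmx1 !mul0mx !mulmx0 !addr0 !add0r rc addNr.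
  by rewrite mul0mx add0r mulmxN addrC.
rewrite !det_mulmx !det_ublock det_lblock !det1.
by rewrite -[- 1%:M]scaleN1r detZ det1; ring.
Qed.

Lemma tr_swp : swp^T = swp.
Proof.
rewrite /swp tr_block_mx trmx0 tr_row_mx tr_col_mx !tr_scalar_mx !trmx0.
by congr block_mx; rewrite linearB /= trmx_mul tr_row_mx tr_col_mx !tr_scalar_mx !trmx0.
Qed.

Lemma mul_swp (x : 'M[int]_1) (R : 'M[int]_(1, 1 + n)) (y z : 'rV[int]_n) (w : 'M[int]_1)
    (f : 'cV[int]_n) (G : 'M[int]_n) (v : 'M[int]_1) :
  swp *m block_mx x R (col_mx v f) (block_mx w y (z^T) G) =
  block_mx v (row_mx w y) (col_mx x f) (col_mx R (row_mx z^T G)).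
Proof.
rewrite /swp; set r := row_mx _ _; set c := col_mx _ _.
rewrite mulmx_block !mul0mx !add0r mulmxBl mul1mx -[c *m r *m _]mulmxA.
rewrite mulmxBl mul1mx -[c *m r *m _]mulmxA.
have -> : r *m col_mx v f = v by rewrite mul_row_col mul1mx mul0mx addr0.
have -> : r *m block_mx w y z^T G = row_mx w y.
  by rewrite mul_row_block !mul1mx !mul0mx !addr0.
rewrite !mul_col_mx !mul1mx !mul0mx !opp_col_mx !add_col_mx.
rewrite subrr addr0 oppr0 addr0 add0r; congr block_mx.
by rewrite subrr !addr0 subr0 add0r.
Qed.

Lemma det_qblk k g h G : \det (qblk k g h G) = - g ^+ 2 * \det G.
Proof.
have -> : qblk k g h G = swp *m block_mx g%:M 0 (col_mx k%:M h^T) (block_mx g%:M h (0 : 'rV_n)^T G).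
  by rewrite mul_swp /qblk trmx0 -row_mx0 -block_mxEv.
rewrite det_mulmx det_swp det_lblock trmx0 det_ublock !det_scalar1; ring.
Qed.

End Blocks.

Lemma dvdz_prime_mul p m (c x : int) : prime p -> ~~ (p%:Z %| c)%Z ->
  (p%:Z ^+ m %| c * x)%Z -> (p%:Z ^+ m %| x)%Z.
Proof.
move=> pp pc h; have := @dvdz_pfactor_mul p 0 0 m c x pp.
by rewrite !subn0 expr1 expr0 mulr1; apply.
Qed.

(** Division by a unit of Z_p, carried out modulo p^m. *)
Lemma dvdz_prime_solve p m (w q : int) : prime p -> ~~ (p%:Z %| w)%Z ->
  exists z, (p%:Z ^+ m %| q + z * w)%Z.
Proof.
move=> pp pw; have [u [v e]] := Bezoutz (p%:Z ^+ m) w.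
have c1 : gcdz (p%:Z ^+ m) w = 1.
  apply/eqP; rewrite /gcdz eqz_nat abszX /= -/(coprime _ _).
  by apply: coprimeXl; rewrite prime_coprime.
exists (- q * v); rewrite c1 in e; apply/dvdzP; exists (q * u).
have -> : q + - q * v * w = q * (1 - v * w) by ring.
by rewrite -e; ring.
Qed.

(** * Lifting isotropic vectors and splitting off a plane *)

Definition pprim p n (e : 'rV[int]_n) := exists i, ~~ (p%:Z %| e 0%R i)%Z.

(** A Newton step. Some coordinate w of the gradient e G has valuation v <= c. Moving [e] by a
    multiple of p^(N-v) in that direction corrects Q(e) modulo p^(N+1), and the quadratic term has
    order at least 2(N-v) >= N + 1 because N > 2c. *)
Lemma hensel_step p n c N (G : 'M[int]_n) e : prime p -> evenf G ->
  ~~ (p%:Z ^+ c.+1 %| \det G)%Z -> (2 * c < N)%N -> pprim p e ->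
  (2 * p%:Z ^+ N %| bil G e e)%Z ->
  exists2 e', pprim p e' & (2 * p%:Z ^+ N.+1 %| bil G e' e')%Z.
Proof.
move=> pp eG dG cN [i0 pe] /dvdzP[q eq].
(* Otherwise p^(c+1) would divide e G adj(G) = det(G) e, hence det G, because [e] has a coordinate
   prime to p. *)
have [i hi] : exists i, ~~ (p%:Z ^+ c.+1 %| (e *m G) 0%R i)%Z.
  apply/existsP; apply: contraNT dG; rewrite negb_exists => /forallP h.
  apply: (dvdz_prime_mul pp pe).
  have -> : e 0 i0 * \det G = (e *m G *m \adj G) 0 i0.
    by rewrite -mulmxA mul_mx_adj mul_mx_scalar mxE mulrC.
  rewrite mxE; apply: rpred_sum => j _; apply: dvdz_mulr.
  by have := h j; rewrite negbK.
set w := (e *m G) 0 i in hi.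
have w0 : w != 0 by apply: contraNneq hi => ->; rewrite dvdz0.
set v := logn p `|w|.
have vc : (v <= c)%N by move: hi; rewrite pfactor_dvdz // -ltnNge ltnS.
have vN : (0 < N - v)%N by clear -vc cN; lia.
have vN2 : (N.+1 <= N - v + (N - v))%N by clear -vc cN; lia.
have /dvdzP[w' ew] : (p%:Z ^+ v %| w)%Z by rewrite pfactor_dvdz.
have pw' : ~~ (p%:Z %| w')%Z.
  apply: contraT; rewrite negbK => /dvdzP[w2 ew2].
  have : (p%:Z ^+ v.+1 %| w)%Z by rewrite ew ew2 exprS -mulrA dvdz_mull.
  by rewrite pfactor_dvdz // ltnn.
have [z hz] := dvdz_prime_solve 1 q pp pw'; rewrite expr1 in hz.
have ebil : bil G e (delta_mx 0 i) = w.
  by rewrite /bil trmx_delta -colE mxE.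
exists (e + (z * p%:Z ^+ (N - v)) *: delta_mx 0 i).
  exists i0; rewrite mxE rpredDr // mxE; apply/dvdz_mulr/dvdz_mull.
  by rewrite -(prednK vN) exprS dvdz_mulr.
rewrite bil_sqrD ?bilZr ?bilZl ?ebil ?bil_delta; last exact: eG.1.
have /dvdzP[s ->] := eG.2 i.
rewrite eq (_ : q * _ + _ + _ = 2 * p%:Z ^+ N * (q + z * w') +
   2 * (z ^+ 2 * s * (p%:Z ^+ (N - v) * p%:Z ^+ (N - v)))); last first.
  have -> : p%:Z ^+ N = p%:Z ^+ (N - v) * p%:Z ^+ v.
    by rewrite -exprD subnK // ltnW // -subn_gt0.
  by rewrite ew; move: (p%:Z ^+ (N - v)) (p%:Z ^+ v) => P1 P2; ring.
apply: rpredD; first by rewrite exprSr mulrA dvdz_mul.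
by rewrite dvdz_mul // dvdz_mull // -exprD dvdz_exp2l.
Qed.

Lemma hensel p n c N M (G : 'M[int]_n) e : prime p -> evenf G ->
  ~~ (p%:Z ^+ c.+1 %| \det G)%Z -> (2 * c < N)%N -> pprim p e ->
  (2 * p%:Z ^+ N %| bil G e e)%Z ->
  exists2 e', pprim p e' & (2 * p%:Z ^+ M %| bil G e' e')%Z.
Proof.
move=> pp eG dG cN pe he.
suff [e' pe' he'] : exists2 e', pprim p e' & (2 * p%:Z ^+ (N + M) %| bil G e' e')%Z.
  exists e' => //; apply: dvdz_trans he'.
  by rewrite dvdz_mul // dvdz_exp2l // leq_addl.
elim: M => [|M [e1 pe1 he1]]; first by exists e; rewrite ?addn0.
rewrite addnS; apply: (hensel_step pp eG dG _ pe1 he1).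
exact: leq_trans cN (leq_addr _ _).
Qed.

(** The vector [e] is c times a member r of a basis of Z^n, with c prime to p, so r is isotropic to
    the same precision. A second change of basis, from the Smith form of the row of products of r
    with the other basis vectors, makes r pair with only one of them, and [swp] puts r in the second
    place. The value of the form at r, divisible by 2 p^M, goes into the error term [E]. *)
Lemma isotropic_reduce p M n (G : 'M[int]_(1 + (1 + n))) e : prime p -> evenf G ->
  pprim p e -> (2 * p%:Z ^+ M %| bil G e e)%Z ->
  exists U k g h G' E, [/\ U \in unitmx, evenf G', evenf E, (2 %| k)%Z &
    U *m G *m U^T = qblk k g h G' + p%:Z ^+ M *: E].
Proof.
move=> pp eG [i0 pe] he.
have [L uL [R uR [d _ eqe]]] := int_Smith_normal_form e.
have {eqe} [c eqe] : exists c, e = c *: row 0 R.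
  exists (L 0 0 * d`_0); rewrite eqe [L in LHS]mx11_scalar mul_scalar_mx -scalemxAl -scalerA.
  congr (_ *: _); rewrite rowE scalemxAl; congr (_ *m R).
  by apply/rowP => j; rewrite !mxE !eqxx /= mulr_natr eq_sym.
have pc : ~~ (p%:Z %| c)%Z.
  by apply: contra pe => pc; rewrite eqe mxE dvdz_mulr.
have hr : (2 * p%:Z ^+ M %| bil G (row 0%R R) (row 0%R R))%Z.
  move: he; rewrite eqe bilZl bilZr; have /dvdzP[q ->] := evenf_bil (row 0 R) eG.
  rewrite [q * 2]mulrC !(mulrCA _ 2) !dvdz_mul2l //.
  by move=> h; apply: (dvdz_prime_mul pp pc); apply: (dvdz_prime_mul pp pc).
pose G1 := R *m G *m R^T.
have eG1 : evenf G1 by apply: evenf_mulmx.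
have [L2 uL2 [R2 uR2 [d2 _ eq2]]] := int_Smith_normal_form (ursubmx G1).
pose g := L2 0 0 * d2`_0.
have eqg : ursubmx G1 *m invmx R2 = row_mx g%:M 0.
  rewrite eq2 mulmxK // [L2 in LHS]mx11_scalar mul_scalar_mx; apply/rowP => j.
  rewrite !mxE; case: split_ordP => j' ->; rewrite !mxE ?ord1 /= ?eqxx ?mulr1n //.
  by rewrite mulr0n mulr0.
pose X : 'M[int]_(1 + (1 + n)) := block_mx 1%:M 0 0 (invmx R2)^T.
pose A := invmx R2.
have uX : X \in unitmx.
  by rewrite unitmxE det_lblock det1 mul1r -unitmxE unitmx_tr unitmx_inv.
pose G2 := X *m G1 *m X^T.
have eG2 : evenf G2 by apply: evenf_mulmx.
have [x ex] : exists x, ulsubmx G1 = (2 * p%:Z ^+ M * x)%:M.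
  have : ulsubmx G1 = (bil G (row 0 R) (row 0 R))%:M.
    rewrite [LHS]mx11_scalar; congr _%:M; rewrite !rowE bil_mulmx bil_delta.
    by rewrite [LHS]mxE [LHS]mxE; congr (G1 _ _); apply: val_inj.
  by have /dvdzP[x ->] := hr => ->; exists x; rewrite mulrC.
have sG1 : dlsubmx G1 = (ursubmx G1)^T by rewrite trmx_ursub eG1.1.
pose G3 : 'M[int]_(1 + n) := A^T *m drsubmx G1 *m A.
have eqG2 : G2 = block_mx (2 * p%:Z ^+ M * x)%:M (row_mx g%:M 0) (col_mx g%:M 0) G3.
  rewrite /G2 -[G1]submxK /X tr_block_mx tr_scalar_mx !trmx0 trmxK !mulmx_block.
  rewrite !mul1mx !mulmx1 !mul0mx !mulmx0 !addr0 !add0r eqg ex sG1.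
  by rewrite -trmx_mul -/A eqg tr_row_mx tr_scalar_mx trmx0.
have [[sG2 dG2]] := eG2.
pose k := ulsubmx (G3 : 'M[int]_(1 + n, 1 + n)) 0 0.
pose h := ursubmx (G3 : 'M[int]_(1 + n, 1 + n)).
pose G' := drsubmx (G3 : 'M[int]_(1 + n, 1 + n)).
have sG3 : G3^T = G3.
  by move: sG2; rewrite eqG2 tr_block_mx => /eq_block_mx[].
have eqG3 : G3 = block_mx k%:M h h^T G'.
  by rewrite -[LHS]submxK /k -mx11_scalar; congr block_mx; rewrite trmx_ursub sG3.
have dG3 i : (2 %| G3 i i)%Z.
  by have := dG2 (rshift 1 i); rewrite eqG2 block_mxEdr.
have sG' : G'^T = G' by rewrite /G' trmx_drsub sG3.
exists (swp n *m X *m R), k, g, h, G',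
  (block_mx 0 0 0 (block_mx (2 * x)%:M 0 0 0)); split.
- rewrite !unitmx_mul uX uR !andbT unitmxE det_swp.
  by rewrite unitrN unitr1.
- split=> // i; have := dG3 (rshift 1 i).
  by rewrite eqG3 block_mxEdr.
- split; first by rewrite tr_block_mx !trmx0 tr_block_mx !trmx0 tr_scalar_mx.
  move=> i; case: (split_ordP i) => i' ->; first by rewrite block_mxEul mxE dvdz0.
  rewrite block_mxEdr; case: (split_ordP i') => i2 ->.
    by rewrite block_mxEul mxE !ord1 eqxx mulr1n dvdz_mulr.
  by rewrite block_mxEdr mxE dvdz0.
- have := dG3 (lshift n 0); rewrite eqG3 block_mxEul mxE eqxx mulr1n //.
rewrite !trmx_mul tr_swp !mulmxA.
have -> : swp n *m X *m R *m G *m R^T *m X^T *m swp n = swp n *m G2 *m swp n.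
  by rewrite /G2 /G1 !mulmxA.
rewrite eqG2 eqG3 mul_swp -[LHS]trmxK [(_ *m swp n)^T]trmx_mul tr_swp.
rewrite tr_block_mx tr_col_mx !tr_row_mx trmx0 !tr_scalar_mx -block_mxEv.
rewrite tr_block_mx trmxK sG' trmx0 tr_scalar_mx.
have -> : block_mx g%:M h 0 G' = block_mx g%:M h (0 : 'rV[int]_n)^T G'.
  by rewrite trmx0.
rewrite mul_swp trmx0 -block_mxEv tr_block_mx tr_row_mx tr_col_mx tr_block_mx.
rewrite !trmx0 !tr_scalar_mx sG' trmxK /qblk scale_block_mx !scaler0 scale_block_mx.
rewrite !scaler0 add_block_mx !addr0 add_block_mx !addr0 !add0r.
by rewrite scale_scalar_mx mulrCA mulrA.
Qed.

Lemma det_congr n (A E : 'M[int]_n) d : (d %| \det (A + d *: E) - \det A)%Z.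
Proof.
rewrite /determinant -sumrB; apply: rpred_sum => s _; rewrite -mulrBr.
apply: dvdz_mull; apply: (big_ind2 (fun x y => (d %| x - y)%Z)).
- by rewrite subrr dvdz0.
- move=> x1 y1 x2 y2 h1 h2.
  have -> : x1 * x2 - y1 * y2 = x1 * (x2 - y2) + (x1 - y1) * y2 by ring.
  by rewrite rpredD //; [apply: dvdz_mull | apply: dvdz_mulr].
- by move=> i _; rewrite !mxE addrAC subrr add0r dvdz_mulr.
Qed.

Lemma Posz_exp a b : (a ^ b)%N%:Z = a%:Z ^+ b.
Proof. by elim: b => // b IH; rewrite expnS PoszM IH exprS. Qed.

(** * Lattices over a given middle lattice *)

Section StepCover.
Variables (p : nat) (n : nat) (k g : int) (h : 'rV[int]_n) (G : 'M[int]_n).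
Hypotheses (pp : prime p) (sG : G^T = G).
Let Q := qblk k g h G.
Local Notation P m := (p%:Z ^+ m).

Let p_neq0 : p%:Z != 0. Proof. by rewrite eqz_nat -lt0n prime_gt0. Qed.

Let sQ : Q^T = Q.
Proof.
rewrite /Q /qblk tr_block_mx tr_row_mx tr_col_mx !tr_scalar_mx trmxK.
by rewrite tr_block_mx !trmx0 sG.
Qed.

Lemma blk_row1 b t (u : 'rV[int]_n) a f B : rspan (blk b t u a f B) (vec b t u).
Proof. by apply/rspan_blk; exists 1, 0, 0; rewrite !mul0mx mxE scale1r !addr0; split=> //; ring. Qed.

Lemma blk_row2 b t (u : 'rV[int]_n) a f B : rspan (blk b t u a f B) (vec 0 a 0).
Proof. by apply/rspan_blk; exists 0, 1, 0; rewrite !mul0mx mxE scale0r !addr0; split=> //; ring. Qed.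

Lemma blk_row3 b t (u : 'rV[int]_n) a f B y :
  rspan (blk b t u a f B) (vec 0 ((y *m f) 0 0) (y *m B)).
Proof. by apply/rspan_blk; exists 0, 0, y; rewrite scale0r add0r; split=> //; ring. Qed.

Lemma iso_blk_cross d b t u a f B y : iso Q d (rspan (blk b t u a f B)) ->
  (d %| g * b * (y *m f) 0%R 0%R + (b * (h *m (y *m B)^T) 0%R 0%R + bil G u (y *m B)))%Z.
Proof.
move=> /(iso_bil sQ)/(_ (blk_row1 _ _ _ _ _ _) (blk_row3 _ _ _ _ _ _ y)).
by rewrite bil_qblk; congr (dvdz _ _); ring.
Qed.

Lemma iso_blk_diag d b t u a f B : iso Q d (rspan (blk b t u a f B)) ->
  (2 * d %| 2 * (g * b * t) + (k * b ^+ 2 + 2 * (b * (h *m u^T) 0%R 0%R) + bil G u u))%Z.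
Proof.
move=> /(_ _ (blk_row1 _ _ _ _ _ _)).
by rewrite bil_qblk; congr (dvdz _ _); ring.
Qed.

(** The conditions on [t] and [f] are linear with leading coefficient g p^b, so two solutions agree
    modulo p^(m-b-v). Since only residues modulo p^a matter, each of the n + 1 entries has at most
    p^(a-(m-b-v)) choices. *)
Lemma step_cov v m b a u B : ~~ (P v.+1 %| g)%Z ->
  cov [set S | exists t f, S = rspan (blk (P b) t u (P a) f B) /\ iso Q (P m) S]
      ((p ^ (a - (m - b - v))) ^ n.+1).
Proof.
move=> gv; set A := [set S | _].
have [[S0 [t0 [f0 [eS0 iS0]]]]|nA] := pselect (exists S, A S); last first.
  by apply: cov0 => S AS; apply: nA; exists S.
rewrite eS0 in iS0; set mu := (m - b - v)%N; set N := (p ^ (a - mu))%N.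
have N0 : (0 < N)%N by rewrite expn_gt0 prime_gt0.
(* If mu > a, the truncated exponent a - mu is 0 and N = 1, so p^mu N is a multiple of p^a and not
   equal to it; [c] is the quotient. *)
have hN : exists c : int, P mu * N%:Z = c * P a.
  have [le_mu|lt_mu] := leqP mu a.
    by exists 1; rewrite mul1r /N Posz_exp -exprD subnKC.
  exists (P (mu - a)); rewrite /N (eqP (ltnW lt_mu : a - mu == 0)%N) mulr1.
  by rewrite -exprD subnK // ltnW.
have [c hc] := hN.
pose F (w : {ffun 'I_n.+1 -> 'I_N}) := rspan (blk (P b)
   (t0 + P mu * (w ord0 : nat)%:Z) u (P a)
   (f0 + P mu *: \col_i (w (lift ord0 i) : nat)%:Z) B).
exists [seq F w | w : {ffun 'I_n.+1 -> 'I_N}].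
  by rewrite size_map -cardE card_ffun !card_ord.
move=> S [t [f [-> iS]]].
have ht : (P mu %| t - t0)%Z.
  have := rpredB (iso_blk_diag iS) (iso_blk_diag iS0).
  rewrite opprD addrACA subrr addr0 -mulrBr dvdz_mul2l // -mulrBr.
  exact: dvdz_pfactor_mul.
have hf i : (P mu %| f i 0%R - f0 i 0%R)%Z.
  have := rpredB (iso_blk_cross (delta_mx 0 i) iS) (iso_blk_cross (delta_mx 0 i) iS0).
  rewrite opprD addrACA subrr addr0 -mulrBr -!rowE !mxE.
  exact: dvdz_pfactor_mul.
have [z0 ez0] := dvdzP ht; have /choice[z ez] := fun i => dvdzP (hf i).
have hz (y : int) : (`|(y %% N)%Z| < N)%N.
  have := modz_ge0 y (_ : N%:Z != 0); have := ltz_mod y (_ : N%:Z != 0).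
  by rewrite eqz_nat -lt0n N0; clear; lia.
pose w : {ffun 'I_n.+1 -> 'I_N} := [ffun i =>
  if unlift ord0 i is Some j then Ordinal (hz (z j)) else Ordinal (hz z0)].
apply/mapP; exists w; first by rewrite mem_enum.
rewrite /F !ffunE unlift_none /=.
have habs y : (`|(y %% N)%Z|%N : int) = (y %% N)%Z.
  by rewrite gez0_abs // modz_ge0 // eqz_nat -lt0n.
rewrite habs.
have -> : t = t0 + P mu * (z0 %% N)%Z + ((z0 %/ N)%Z * c) * P a.
  rewrite -mulrA -hc -[t](subrK t0) ez0 {1}(divz_eq z0 N).
  move: (z0 %/ N)%Z (z0 %% N)%Z (P mu) => x1 x2 x3; ring.
rewrite -[f in LHS](_ : (f0 + P mu *: \col_i (w (lift ord0 i) : nat)%:Z) +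
   P a *: (c *: \col_i (z i %/ N)%Z) = f); first by rewrite blk_shiftt.
apply/colP => i; rewrite !mxE !ffunE liftK /= habs mulrA [P a * c]mulrC -hc.
rewrite -[f i 0](subrK (f0 i 0)) ez {3}(divz_eq (z i) N).
move: (z i %/ N)%Z (z i %% N)%Z (P mu) => x1 x2 x3; ring.
Qed.

(** The matrix [B'] is moved to the fixed [B] and [u] to its representative r, which only changes
    [t] and [f]; then [step_cov] applies for each r. *)
Lemma blk_cov v m b a B (s : seq 'rV[int]_n) : \det B != 0 -> ~~ (P v.+1 %| g)%Z ->
  cov [set S | exists t u f B', [/\ rspan B' = rspan B,
         exists2 r, r \in s & rspan B (u - r),
         S = rspan (blk (P b) t u (P a) f B') & iso Q (P m) S]]
      (size s * (p ^ (a - (m - b - v))) ^ n.+1).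
Proof.
move=> B0 gv.
have cs : cov [set r | r \in s] (size s) by exists s.
apply: cov_sub (cov_bind cs (fun r _ => step_cov m b a r B gv)).
move=> S [t [u [f [B' [eB [r rs [y ey]] eS iS]]]]]; exists r => //.
have [X uX eB'] := rspan_eqU B0 eB.
have eS' : S = rspan (blk (P b) (t - (y *m (invmx X *m f)) 0 0) r (P a) (invmx X *m f) B).
  by rewrite eS eB' blk_mid // -[u](subrK r) ey addrC blk_shiftu.
by exists (t - (y *m (invmx X *m f)) 0 0), (invmx X *m f).
Qed.

(** What maximality of norm d says about integral vectors: [x] lies in [S] as soon as adjoining it
    would keep Q in dZ. This weaker property is the one that passes to the middle block of [blk]. *)
Definition sat n (G : 'M[int]_n) d (S : set 'rV[int]_n) := iso G d S /\
  forall x, (2 * d %| bil G x x)%Z -> (forall z, S z -> (d %| bil G x z)%Z) -> S x.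

(** The product of the first two rows gives m <= a + b. The rest comes from vectors that saturation
    forces into the lattice: p^(b-1) e0 if b > m, then p^(m-b) e1, and p^a u placed in the last
    coordinates. *)
Lemma sat_qblk m b t u a f B : (2 %| k)%Z -> ~~ (p%:Z %| g)%Z -> \det B != 0 ->
  sat Q (P m) (rspan (blk (P b) t u (P a) f B)) ->
  [/\ (a + b)%N = m, sat G (P m) (rspan B) & rspan B (P a *: u)].
Proof.
move=> k2 pg B0 [iS satS].
have p1 : 1 < `|p%:Z| by rewrite ger0_norm // ltz_nat prime_gt1.
have B_inj (y : 'rV_n) : y *m B = 0 -> y = 0.
  move=> /(congr1 (mulmx^~ (\adj B))); rewrite mul0mx -mulmxA mul_mx_adj mul_mx_scalar.
  move/rowP=> hy; apply/rowP=> i; have := hy i; rewrite !mxE => /eqP.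
  by rewrite mulf_eq0 (negPf B0) => /eqP.
have in0 x1 x' : rspan (blk (P b) t u (P a) f B) (vec 0 x1 x') ->
    exists j y, x1 = j * P a + (y *m f) 0 0 /\ x' = y *m B.
  move/rspan_blk => [i [j [y [+ -> ->]]]].
  move/esym/eqP; rewrite mulf_eq0 (negPf (expf_neq0 _ p_neq0)) orbF => /eqP->.
  by exists j, y; rewrite mul0r scale0r !add0r.
have bilS x0 x1 x' : (2 * P m %| bil Q (vec x0 x1 x') (vec x0 x1 x'))%Z ->
    (forall i j y, (P m %| bil Q (vec x0 x1 x') (vec (i * P b)
       (i * t + j * P a + (y *m f) 0%R 0%R) (i *: u + y *m B)))%Z) ->
    rspan (blk (P b) t u (P a) f B) (vec x0 x1 x').
  move=> h1 h2; apply: satS => // z; have [z0 [z1 [z' ->]]] := vecP z.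
  by move/rspan_blk => [i [j [y [-> -> ->]]]].
have F1 : (m <= a + b)%N.
  have := iso_bil sQ iS (blk_row1 _ _ _ _ _ _) (blk_row2 _ _ _ _ _ _).
  rewrite bil_qblk bil0r trmx0 mulmx0 mxE !mulr0 !mul0r !addr0 add0r -exprD => H.
  by have := dvdz_prime_mul pp pg H; rewrite dvdz_Pexp2l // addnC.
have bm : (b <= m)%N.
  (* If b > m, then p^m still divides p^(b-1), so p^(b-1) e0 belongs to the lattice, although all
     first coordinates there are multiples of p^b. *)
  rewrite leqNgt; apply/negP => mb.
  have /rspan_blk[i [_ [_ [+ _ _]]]] : rspan (blk (P b) t u (P a) f B) (vec (P b.-1) 0 0).
    have h1 : (P m %| P b.-1)%Z by rewrite dvdz_exp2l // -ltnS prednK //; apply: leq_ltn_trans mb.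
    apply: bilS => [|i j y]; rewrite bil_qblk bil0l trmx0 mulmx0 [(0 : 'M[int]_1) 0 0]mxE.
      have -> : k * P b.-1 * P b.-1 + g * (P b.-1 * 0 + 0 * P b.-1) + P b.-1 * 0 + P b.-1 * 0 + 0 = k * (P b.-1 * P b.-1) by ring.
      by apply: dvdz_mul => //; apply: dvdz_mulr.
    apply: rpredD; last exact: dvdz0.
    apply: rpredD; last by rewrite mulr0 dvdz0.
    apply: rpredD; last by rewrite dvdz_mulr.
    apply: rpredD; first by rewrite dvdz_mulr // dvdz_mull.
    by rewrite mul0r addr0 dvdz_mull // dvdz_mulr.
  move=> e; have : (P b %| P b.-1)%Z by rewrite e dvdz_mull.
  rewrite dvdz_Pexp2l // leqNgt; have : (0 < b)%N by apply: leq_ltn_trans mb.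
  by move=> b0; rewrite prednK // leqnn.
have amb : (a <= m - b)%N.
  (* The vector e1 is isotropic and pairs with the lattice in multiples of p^b, so p^(m-b) e1
     belongs to the lattice; hence p^a divides p^(m-b). *)
  have /in0[j [y [e /esym/B_inj ey]]] : rspan (blk (P b) t u (P a) f B) (vec 0 (P (m - b)) 0).
    apply: bilS => [|i j y]; rewrite bil_qblk bil0l trmx0 mulmx0 [(0 : 'M[int]_1) 0 0]mxE.
      by rewrite !(mulr0, mul0r, addr0) dvdz0.
    by rewrite !(mulr0, mul0r, addr0, add0r) (mulrCA _ i) -exprD subnK // !dvdz_mull.
  move: e; rewrite ey mul0mx mxE addr0 => e; have : (P a %| P (m - b))%Z by rewrite e dvdz_mull.
  by rewrite dvdz_Pexp2l.
have abm : (a + b)%N = m by clear -F1 bm amb; lia.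
have Puu : (2 * P b %| bil G u u)%Z.
  have : (2 * P b %| 2 * (g * P b * t) + (k * P b ^+ 2 + 2 * (P b * (h *m u^T) 0%R 0%R) + bil G u u))%Z.
    by apply: dvdz_trans (iso_blk_diag iS); rewrite dvdz_mul // dvdz_exp2l.
  rewrite !rpredDl //.
  - by rewrite dvdz_mul // dvdz_mulr.
  - by rewrite dvdz_mul // expr2 dvdz_mulr.
  - by rewrite dvdz_mul // dvdz_mulr // dvdz_mull.
have PuB y : (P b %| bil G u (y *m B))%Z.
  have := dvdz_trans (dvdz_exp2l p%:Z bm) (iso_blk_cross y iS).
  set X := (y *m f) 0 0; set Y := (h *m _) 0 0; set Z := bil _ _ _ => H.
  have -> : Z = g * P b * X + (P b * Y + Z) - P b * (g * X + Y).
    by move: (P b) => x; ring.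
  by rewrite rpredB // dvdz_mulr.
have uB : rspan B (P a *: u).
  have /in0[j [y [_ ->]]] : rspan (blk (P b) t u (P a) f B) (vec 0 0 (P a *: u)); last by exists y.
  apply: bilS => [|i j y]; rewrite bil_qblk !bilZl ?bilZr !(mulr0, mul0r, addr0, add0r).
    by rewrite -abm exprD (mulrCA 2 (P a)); apply: dvdz_mul => //; apply: dvdz_mull.
  rewrite bilDr bilZr linearZ /= -scalemxAr mx11Z -abm exprD; apply: rpredD.
    by rewrite -mulrA dvdz_mull // mulrCA dvdz_mul // dvdz_mulr.
  rewrite dvdz_mul // rpredD // dvdz_mull //.
  by apply: dvdz_trans Puu; rewrite dvdz_mull.
split=> //; split=> [_ [y ->]|x' hx hxB].
  have := iS _ (blk_row3 _ _ _ _ _ _ y).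
  by rewrite bil_qblk !(mulr0, mul0r, addr0, add0r).
have /dvdzP[q eq] : (P b %| bil G x' u)%Z.
  by have := hxB _ uB; rewrite bilZr -abm exprD dvdz_mul2l // expf_neq0.
(* The value [tau] makes (0, tau, x') pair with the first row in a multiple of p^b p^a = p^m. *)
have [tau htau] := dvdz_prime_solve a ((h *m x'^T) 0 0 + q) pp pg.
have /in0[j [y [_ ->]]] : rspan (blk (P b) t u (P a) f B) (vec 0 tau x'); last by exists y.
apply: bilS => [|i j y]; rewrite bil_qblk !(mulr0, mul0r, addr0, add0r) //.
rewrite bilDr bilZr eq addrA rpredD //; last by apply: hxB; exists y.
rewrite (_ : _ + _ + _ = i * (P b * ((h *m x'^T) 0 0 + q + tau * g))).
  by rewrite -abm [(a + b)%N]addnC exprD dvdz_mull // dvdz_mul.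
by move: (P b) (h *m x'^T) => x1 x2; ring.
Qed.

End StepCover.

Lemma sat_mulmx n (G : 'M[int]_n) d U (B : 'M[int]_n) : U \in unitmx ->
  sat G d (rspan B) -> sat (U *m G *m U^T) d (rspan (B *m invmx U)).
Proof.
move=> uU [iB sB]; split; first by apply/iso_mulmx; rewrite mulmxKV.
move=> x hx hxz; have [y ey] : rspan B (x *m U).
  apply: sB; first by rewrite bil_mulmx.
  move=> _ [y ->]; rewrite -[y *m B](mulmxKV uU) bil_mulmx; apply: hxz.
  by exists y; rewrite mulmxA.
by exists y; rewrite mulmxA -ey mulmxK.
Qed.

Lemma evenfN n (E : 'M[int]_n) : evenf E -> evenf (- E).
Proof. by move=> [sE dE]; split=> [|i]; rewrite ?linearN /= ?sE // mxE rpredN. Qed.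

Lemma sat_congr n (H E : 'M[int]_n) d S : evenf E ->
  sat (H + d *: E) d S -> sat H d S.
Proof.
move=> eE [iS sS]; split.
  by apply: (iso_congr (evenfN eE) _ iS); rewrite scalerN addrK.
move=> x hx hxz; apply: sS => [|z Sz]; rewrite bilD bilZ; apply: rpredD; auto.
  by rewrite mulrC dvdz_mul // evenf_bil.
exact: dvdz_mulr.
Qed.

Lemma rspan_image n (U B : 'M[int]_n) : U \in unitmx ->
  (fun x => x *m U) @` rspan (B *m invmx U) = rspan B.
Proof.
move=> uU; apply/seteqP; split=> [_ [_ [y ->] <-]|_ [y ->]].
  by exists y; rewrite mulmxA mulmxKV.
by exists (y *m B *m invmx U); [exists y; rewrite mulmxA | rewrite mulmxKV].
Qed.

Lemma unit_det2 n (U : 'M[int]_n) : U \in unitmx -> \det U ^+ 2 = 1.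
Proof. by rewrite unitmxE unfold_in /= => /orP[]/eqP->; rewrite ?sqrrN expr1n. Qed.

Lemma det_mx2 (R : comPzRingType) (A : 'M[R]_2) :
  \det A = A 0 0 * A 1 1 - A 0 1 * A 1 0.
Proof.
rewrite (expand_det_row _ 0) !big_ord_recl big_ord0 /cofactor !det_mx11 !mxE /=.
have -> : lift ord0 (ord0 : 'I_1) = 1 :> 'I_2 by apply: val_inj.
have -> : lift 1 (0 : 'I_1) = 0 :> 'I_2 by apply: val_inj.
have -> : ord0 = 0 :> 'I_2 by apply: val_inj.
by rewrite expr0 expr1 mul1r addr0 mulN1r mulrN.
Qed.

(** * Isotropic vectors over finite fields of odd characteristic *)

Section FiniteField.
Variable F : finFieldType.
Hypothesis F2 : 2 != 0 :> F.

(** The fibres of squaring have at most 2 elements, and the fibre of 0 has only one. *)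
Lemma card_squares : (#|F| < 2 * #|[set x ^+ 2 | x : F]%SET|)%N.
Proof.
set Sq := [set x ^+ 2 | x : F]%SET.
have -> : #|F| = (\sum_(s in Sq) #|[set x : F | x ^+ 2 == s]%SET|)%N.
  rewrite -sum1_card (partition_big (fun x : F => x ^+ 2) (mem Sq)) /=; last first.
    by move=> x _; apply: finset.imset_f.
  by apply: eq_bigr => s _; rewrite -sum1_card; apply: eq_bigl => x; rewrite inE.
have S0 : 0 \in Sq by apply/imsetP; exists 0; rewrite ?expr0n.
rewrite (bigD1 0) //= (cardsD1 0 Sq) S0 mulnDr muln1 add2n ltnS -addn1 addnC.
have -> : #|[set x : F | x ^+ 2 == 0]%SET| = 1%N.
  by apply/eqP/cards1P; exists 0; apply/setP => x; rewrite !inE expf_eq0.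
rewrite addn1 ltnS mulnC -sum_nat_const.
rewrite [X in (_ <= X)%N](eq_bigl (fun s => (s \in Sq) && (s != 0))); last first.
  by move=> s; rewrite !inE andbC.
apply: leq_sum => s /andP[/imsetP[x _ ->] _].
apply: leq_trans (_ : #|[set x; - x]%SET| <= 2)%N; last by rewrite cards2; case: (_ != _).
apply: subset_leq_card; apply/fintype.subsetP => y; rewrite !inE -subr_eq0 subr_sqr mulf_eq0.
by rewrite subr_eq0 addr_eq0.
Qed.

(** The values a x^2 and the values c - b y^2 each fill more than half of [F], hence meet. *)
Lemma conic_solve (a b c : F) : a != 0 -> b != 0 ->
  exists x y, a * x ^+ 2 + b * y ^+ 2 = c.
Proof.
move=> a0 b0; set Sq := [set x ^+ 2 | x : F]%SET.
pose A := [set a * s | s in Sq]%SET; pose B := [set c - b * s | s in Sq]%SET.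
have cA : #|A| = #|Sq| by rewrite card_imset //; apply: mulfI.
have cB : #|B| = #|Sq| by rewrite card_imset // => s t /addrI/oppr_inj/(mulfI b0).
have : (A :&: B != finset.set0)%SET.
  apply/negP => /eqP AB; have := cardsUI A B; rewrite AB cards0 addn0 cA cB => h.
  have := card_squares; rewrite -/Sq mul2n -addnn -h ltnNge max_card //.
case/finset.set0Pn => z; rewrite inE => /andP[/imsetP[_ /imsetP[x _ ->] ->]].
by case/imsetP => _ /imsetP[y _ ->] e; exists x, y; rewrite e subrK.
Qed.

Lemma ker_nonzero n m (M : 'M[F]_(n, m)) : (m < n)%N ->
  exists2 v : 'rV_n, v != 0 & v *m M = 0.
Proof.
move=> mn; have : kermx M != 0.
  by rewrite -mxrank_eq0 mxrank_ker subn_eq0 -ltnNge (leq_ltn_trans (rank_leq_col _)).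
by case/rowV0Pn => v /sub_kermxP vM v0; exists v.
Qed.

Let q n (A : 'M[F]_n) (x y : 'rV[F]_n) := (x *m A *m y^T) 0 0.

(** Three pairwise orthogonal nonzero vectors exist by dimension. If they are anisotropic,
    [conic_solve] represents - q(v3) on the plane of the other two. *)
Lemma isotropic3 n (A : 'M[F]_n) : A^T = A -> (2 < n)%N ->
  exists2 x : 'rV_n, x != 0 & (x *m A *m x^T) 0 0 = 0.
Proof.
move=> sA n3; apply: contrapT => nex.
have an x : x != 0 -> q A x x != 0.
  by move=> x0; apply/eqP => qx; apply: nex; exists x.
have qC x y : q A x y = q A y x.
  by rewrite /q -[in LHS](trmxK (x *m A *m y^T)) mxE !trmx_mul sA trmxK mulmxA.
have qDl x y z : q A (x + y) z = q A x z + q A y z by rewrite /q !mulmxDl mxE.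
have qZl a x z : q A (a *: x) z = a * q A x z by rewrite /q -!scalemxAl mxE.
have [v1 v10 _] := ker_nonzero (0 : 'M[F]_(n, 0)) (ltnW (ltnW n3)).
have [v2 v20 v2h] := ker_nonzero (A *m v1^T) (ltnW n3).
have [v3 v30 v3h] := ker_nonzero (A *m row_mx v1^T v2^T) n3.
have q21 : q A v2 v1 = 0 by rewrite /q -mulmxA v2h mxE.
have [q31 q32] : q A v3 v1 = 0 /\ q A v3 v2 = 0.
  move: v3h; rewrite mul_mx_row mul_mx_row -row_mx0 => /eq_row_mx[].
  by rewrite !mulmxA => /matrixP/(_ 0 0) + /matrixP/(_ 0 0); rewrite /q => -> ->; rewrite !mxE.
have [x [y exy]] := conic_solve (- q A v3 v3) (an _ v10) (an _ v20).
set w := x *: v1 + y *: v2 + v3.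
have qw z : q A w z = x * q A v1 z + y * q A v2 z + q A v3 z.
  by rewrite /w !qDl !qZl.
apply: nex; exists w.
  apply: contraTneq (an _ v30) => w0; rewrite negbK.
  have := qw v3; rewrite w0 {1}/q !mul0mx mxE (qC v1) (qC v2) q31 q32 !mulr0 !add0r.
  by move=> <-.
rewrite -/(q A w w) qw !(qC _ w) !qw (qC v1) q21 (qC v1 v3) (qC v2 v3) q31 q32.
rewrite !(mulr0, addr0, add0r).
move/eqP: exy; rewrite -subr_eq0 opprK => /eqP <-; ring.
Qed.

(** A root of the binary form: if the entry A00 is not 0, it vanishes at (s - A01, A00). *)
Lemma isotropic2 (A : 'M[F]_2) s : A^T = A -> - \det A = s ^+ 2 ->
  exists2 x : 'rV_2, x != 0 & (x *m A *m x^T) 0 0 = 0.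
Proof.
move=> sA; rewrite det_mx2 => es.
have A10 : A 1 0 = A 0 1 by rewrite -[in LHS]sA mxE.
have qE (x : 'rV_2) : (x *m A *m x^T) 0 0 = A 0 0 * x 0 0 ^+ 2 + 2 * A 0 1 * x 0 0 * x 0 1 + A 1 1 * x 0 1 ^+ 2.
  rewrite !mxE !big_ord_recl big_ord0 !mxE !big_ord_recl !big_ord0.
  have -> : lift ord0 (ord0 : 'I_1) = 1 :> 'I_2 by apply: val_inj.
  have -> : ord0 = 0 :> 'I_2 by apply: val_inj.
  by rewrite A10; ring.
have [a0|a0] := eqVneq (A 0 0) 0.
  exists (\row_j if j == 0 then 1 else 0); last by rewrite qE a0 !mxE /=; ring.
  by apply/eqP => /matrixP/(_ 0 0)/eqP; rewrite !mxE /= oner_eq0.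
exists (\row_j if j == 0 then s - A 0 1 else A 0 0).
  by apply/eqP => /matrixP/(_ 0 1); rewrite !mxE /=; apply/eqP.
rewrite qE !mxE /=; move: es; rewrite A10 => es.
have -> : A 0 0 * (s - A 0 1) ^+ 2 + 2 * A 0 1 * (s - A 0 1) * A 0 0 + A 1 1 * A 0 0 ^+ 2 =
  A 0 0 * (s ^+ 2 - A 0 1 * A 0 1 + A 0 0 * A 1 1) by ring.
by rewrite -es; ring.
Qed.

End FiniteField.

(** For odd p such a form is, over Z_p, a sum of l hyperbolic planes. *)
Definition split_form p l (G : 'M[int]_(l.*2)) := [/\ evenf G,
  ~~ (p%:Z %| \det G)%Z & exists s, (p%:Z %| (-1) ^+ l * \det G - s ^+ 2)%Z].

(** In rank 2 the square signed determinant provides the isotropic line modulo p; from rank 4 on,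
    every form has one by [isotropic3]. *)
Lemma split_isotropic p l (G : 'M[int]_(l.+1.*2)) : prime p -> odd p ->
  split_form p G -> exists2 e, pprim p e & (2 * p%:Z %| bil G e e)%Z.
Proof.
move=> pp op [eG dG [s hs]].
have pF (z : int) : (p%:Z %| z)%Z = (z%:~R == 0 :> 'F_p).
  by rewrite (dvdz_pcharf (pchar_Fp pp)).
pose A : 'M['F_p]_(l.+1.*2) := map_mx intr G.
have sA : A^T = A.
  by apply/matrixP => i j; rewrite !mxE -[in LHS]eG.1 mxE.
have F2 : 2 != 0 :> 'F_p.
  rewrite -[2]/(2%:Z%:~R) -pF dvdzE /= dvdn_prime2 //.
  by apply: contraTneq op => ->.
have [x x0 qx] : exists2 x : 'rV_(l.+1.*2), x != 0 & (x *m A *m x^T) 0 0 = 0.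
  case: l G eG dG s hs @A sA => [|l] G eG dG s hs A sA.
    apply: (isotropic2 (s := s%:~R) sA).
    move: hs; rewrite pF rmorphB rmorphM rmorphXn /= subr_eq0 expr1 mulN1r => /eqP.
    by rewrite /A det_map_mx rmorphXn.
  exact: isotropic3.
pose e : 'rV[int]_(l.+1.*2) := map_mx (fun y : 'F_p => (y : nat)%:Z) x.
have ex : map_mx intr e = x.
  by apply/rowP => i; rewrite !mxE -pmulrn natr_Zp.
exists e.
  have [i xi] : exists i, x 0 i != 0.
    apply/existsP; apply: contraNT x0; rewrite negb_exists => /forallP h.
    by apply/eqP/rowP => i; rewrite mxE; apply/eqP; have := h i; rewrite negbK.
  by exists i; rewrite pF; have /rowP/(_ i) := ex; rewrite mxE => ->.
have /dvdzP[y ey] := evenf_bil e eG; rewrite ey [2 * _]mulrC dvdz_mul2r //.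
have : (p%:Z ^+ 1 %| 2 * y)%Z.
  rewrite mulrC -ey expr1 pF -qx -ex; apply/eqP.
  have -> : (map_mx intr e : 'rV['F_p]_(l.+1.*2))^T = map_mx intr e^T.
    by apply/matrixP => i j; rewrite !mxE.
  by rewrite -!map_mxM [RHS]mxE.
move/(dvdz_prime_mul pp); rewrite expr1; apply.
by rewrite dvdzE /= dvdn_prime2 //; apply: contraTneq op => ->.
Qed.

(** Modulo p, det G is - g^2 det G'. So the complement is again unimodular at p with square signed
    determinant, and the reduction can be iterated. *)
Lemma split_reduce p m l (G : 'M[int]_(l.+1.*2)) : prime p -> odd p ->
  split_form p G ->
  exists (U : 'M[int]_(1 + (1 + l.*2))) k g h (G' : 'M[int]_(l.*2)) E,
   [/\ U \in unitmx, ~~ (p%:Z %| g)%Z /\ (2 %| k)%Z, split_form p G', evenf E &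
    U *m G *m U^T = qblk k g h G' + p%:Z ^+ m *: E].
Proof.
move=> pp op sG; have [e0 pe0 he0] := split_isotropic pp op sG.
have [eG dG [s hs]] := sG.
(* Precision m + 1 instead of m allows the determinants to be compared modulo p even when m = 0. *)
have [e pe he] : exists2 e, pprim p e & (2 * p%:Z ^+ m.+1 %| bil G e e)%Z.
  by apply: (@hensel p _ 0 1 m.+1 G e0 pp eG).
have [U [k [g [h [G' [E [uU eG' eE k2 eqG]]]]]]] :=
  @isotropic_reduce p m.+1 (l.*2) G e pp eG pe he.
have hdet : (p%:Z %| \det G + g ^+ 2 * \det G')%Z.
  have := det_congr (qblk k g h G') E (p%:Z ^+ m.+1).
  rewrite -eqG !det_mulmx det_tr det_qblk mulrAC -expr2 unit_det2 // mul1r.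
  rewrite mulNr opprK => H; apply: dvdz_trans H.
  by rewrite exprS dvdz_mulr.
have pg : ~~ (p%:Z %| g)%Z.
  apply: contra dG => pg; move: hdet; rewrite rpredDr // dvdz_mulr // expr2 dvdz_mulr //.
exists U, k, g, h, G', (p%:Z *: E); split=> //; last first.
- by rewrite scalerA -exprSr.
- split=> [|i]; first by rewrite linearZ /= eE.1.
  by rewrite mxE dvdz_mull // eE.2.
split=> //.
  apply: contra dG => pG'; move: hdet; rewrite rpredDr // dvdz_mull //.
(* Here [z] inverts [g] modulo p, so s z is a square root modulo p of the new signed determinant. *)
have [z hz] := dvdz_prime_solve 1 (- 1) pp pg; rewrite expr1 in hz.
exists (s * z).
have -> : (-1) ^+ l * \det G' - (s * z) ^+ 2 =
   z ^+ 2 * ((-1) ^+ l.+1 * \det G - s ^+ 2) + (-1) ^+ l * (z ^+ 2 * (\det G + g ^+ 2 * \det G'))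
   - (-1) ^+ l * \det G' * (z * g + 1) * (-1 + z * g) by rewrite (exprS _ l); move: ((-1) ^+ l) => x; ring.
by rewrite rpredB // ?rpredD ?dvdz_mull.
Qed.

Lemma prime_pow_mul3 p k x y z : prime p -> (x * y * z)%N = (p ^ k)%N ->
  exists b a c, [/\ x = (p ^ b)%N, y = (p ^ a)%N, z = (p ^ c)%N & k = (b + a + c)%N].
Proof.
move=> pp e.
have h t : (t %| p ^ k)%N -> exists b, t = (p ^ b)%N.
  by case/(dvdn_pfactor _ _ pp) => b _ ->; exists b.
have [b eb] : exists b, x = (p ^ b)%N by apply: h; rewrite -e -mulnA dvdn_mulr.
have [a ea] : exists b, y = (p ^ b)%N by apply: h; rewrite -e mulnAC dvdn_mull.
have [c ec] : exists b, z = (p ^ b)%N by apply: h; rewrite -e dvdn_mull.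
exists b, a, c; split=> //; apply/eqP; move/eqP: e.
by rewrite eb ea ec -!expnD eqn_exp2l ?prime_gt1 // eq_sym.
Qed.

Lemma blk_form_p p n (B : 'M[int]_(1 + (1 + n))) k : prime p ->
  `|\det B|%N = (p ^ k)%N ->
  exists b t u a f B' c, [/\ rspan B = rspan (blk (p%:Z ^+ b) t u (p%:Z ^+ a) f B'),
    `|\det B'|%N = (p ^ c)%N, \det B' != 0 & k = (b + a + c)%N].
Proof.
move=> pp eB; have B0 : \det B != 0 by rewrite -absz_gt0 eB expn_gt0 prime_gt0.
have [b [t [u [a [f [B' [b0 a0 -> e]]]]]]] := block_form B0.
move: (e); rewrite eB => /esym/(prime_pow_mul3 pp)[b1 [a1 [c [eb ea ec ->]]]].
exists b1, t, u, a1, f, B', c; split=> //.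
  by rewrite -!Posz_exp -eb -ea !gtz0_abs.
by rewrite -absz_gt0 ec expn_gt0 prime_gt0.
Qed.

(** * Upper bound at the good primes *)

Section GoodStep.
Variables (p m n l N : nat) (k g : int) (h : 'rV[int]_n) (G' : 'M[int]_n).
Variables (G U E : 'M[int]_(1 + (1 + n))).
Hypotheses (pp : prime p) (pg : ~~ (p%:Z %| g)%Z) (k2 : (2 %| k)%Z) (eG' : evenf G').
Hypotheses (uU : U \in unitmx) (eE : evenf E).
Hypothesis eqG : U *m G *m U^T = qblk k g h G' + p%:Z ^+ m *: E.

Let sat_reduce (B : 'M[int]_(1 + (1 + n))) : sat G (p%:Z ^+ m) (rspan B) ->
  sat (qblk k g h G') (p%:Z ^+ m) (rspan (B *m invmx U)).
Proof. by move=> /(sat_mulmx uU); rewrite eqG; apply: sat_congr. Qed.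

Let det_reduce (B : 'M[int]_(1 + (1 + n))) : `|\det (B *m invmx U)|%N = `|\det B|%N.
Proof.
by rewrite det_mulmx abszM (@unitmx_int_det _ (invmx U)) ?unitmx_inv // muln1.
Qed.

Lemma good_step_det : (forall (B : 'M[int]_n) k, `|\det B|%N = (p ^ k)%N ->
    sat G' (p%:Z ^+ m) (rspan B) -> k = (l * m)%N) ->
  forall (B : 'M[int]_(1 + (1 + n))) k, `|\det B|%N = (p ^ k)%N ->
    sat G (p%:Z ^+ m) (rspan B) -> k = (l.+1 * m)%N.
Proof.
move=> IH B j eB /sat_reduce sB; rewrite -det_reduce in eB.
have [b [t [u [a [f [B' [c [eqB eB' B'0 ->]]]]]]]] := blk_form_p pp eB.
rewrite eqB in sB; have [abm sB' _] := sat_qblk pp eG'.1 k2 pg B'0 sB.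
by rewrite (IH _ _ eB' sB') mulSn [(b + a)%N]addnC abm.
Qed.

(** Over a fixed middle lattice, of index p^(l m), one has a + b = m; then [t] and [f] are
    determined, since v = 0 and m - b = a. For a = 0 the vector u lies in the middle lattice, which
    leaves one lattice. Each a from 1 to m gives at most one lattice per residue of u, that is p^(l
    m). *)
Lemma good_step_cov : (forall (B : 'M[int]_n) k, `|\det B|%N = (p ^ k)%N ->
    sat G' (p%:Z ^+ m) (rspan B) -> k = (l * m)%N) ->
  cov [set S | exists (B : 'M[int]_n) k, [/\ S = rspan B, `|\det B|%N = (p ^ k)%N &
         sat G' (p%:Z ^+ m) S]] N ->
  cov [set S | exists (B : 'M[int]_(1 + (1 + n))) k, [/\ S = rspan B,
         `|\det B|%N = (p ^ k)%N & sat G (p%:Z ^+ m) S]] (N * (1 + m * p ^ (l * m))).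
Proof.
move=> IHd IHc; pose Q := qblk k g h G'.
have pg1 : ~~ (p%:Z ^+ 1 %| g)%Z by rewrite expr1.
pose F (S' : set 'rV[int]_n) : set (set 'rV[int]_(1 + (1 + n))) := [set S | exists b a t u f B',
  [/\ (a + b)%N = m, rspan B' = S', S' (p%:Z ^+ a *: u),
      S = rspan (blk (p%:Z ^+ b) t u (p%:Z ^+ a) f B') & iso Q (p%:Z ^+ m) S]].
have covF S' : (exists (B : 'M[int]_n) k, [/\ S' = rspan B, `|\det B|%N = (p ^ k)%N &
         sat G' (p%:Z ^+ m) S']) -> cov (F S') (1 + m * p ^ (l * m)).
  move=> [B0 [c [eS' dB0 sS']]]; rewrite eS' in sS'.
  have cE := IHd _ _ dB0 sS'.
  have B00 : \det B0 != 0 by rewrite -absz_gt0 dB0 expn_gt0 prime_gt0.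
  have [s [_ ss hs _]] := rspan_reps B00.
  have c0 := blk_cov k h pp eG'.1 m m 0 [:: 0] B00 pg1.
  have c1 i := blk_cov k h pp eG'.1 m (m - i.+1) i.+1 s B00 pg1.
  rewrite !sub0n expn0 exp1n muln1 in c0.
  have c1' : cov [set S | exists2 i, (i < m)%N & exists t u f B',
      [/\ rspan B' = rspan B0, exists2 r, r \in s & rspan B0 (u - r),
          S = rspan (blk (p%:Z ^+ (m - i.+1)) t u (p%:Z ^+ i.+1) f B') &
          iso Q (p%:Z ^+ m) S]] (m * p ^ (l * m)).
    apply: cov_ltn => i im; apply: cov_leq (c1 i).
    by rewrite subKn // subn0 subnn expn0 exp1n muln1 ss dB0 cE.
  apply: cov_sub (cov_setU c0 c1') => S [b [[|a] [t [u [f [B' [abm eB' uS' eS iS]]]]]]].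
    left; exists t, u, f, B'; rewrite eB' eS'; split=> //.
      exists 0; first by rewrite inE.
      by move: uS'; rewrite eS' expr0 scale1r subr0.
    by rewrite eS -abm add0n.
  right; exists a; first by rewrite -abm addSn ltnS leq_addr.
  exists t, u, f, B'; rewrite eB' eS'; split=> //.
  by rewrite eS -abm addKn.
apply: cov_sub (cov_image (fun S : set _ => (fun x => x *m U) @` S) (cov_bind IHc covF)).
move=> S [B [c [eS dB sS]]]; rewrite eS in sS.
have {}sS := sat_reduce sS; rewrite -det_reduce in dB.
exists (rspan (B *m invmx U)); last by rewrite rspan_image.
have [b [t [u [a [f [B' [c' [eqB eB' B'0 _]]]]]]]] := blk_form_p pp dB.
have := sS; rewrite eqB => sS2.
have [abm sB' uB'] := sat_qblk pp eG'.1 k2 pg B'0 sS2.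
exists (rspan B'); first by exists B', c'.
by exists b, a, t, u, f, B'; split=> //; apply: sS2.1.
Qed.

End GoodStep.

Lemma good_upper p m l (G : 'M[int]_(l.*2)) : prime p -> odd p -> split_form p G ->
  (forall (B : 'M[int]_(l.*2)) k, `|\det B|%N = (p ^ k)%N ->
     sat G (p%:Z ^+ m) (rspan B) -> k = (l * m)%N) /\
  cov [set S | exists (B : 'M[int]_(l.*2)) k, [/\ S = rspan B, `|\det B|%N = (p ^ k)%N &
         sat G (p%:Z ^+ m) S]] (\prod_(i < l) (1 + m * p ^ (i * m))).
Proof.
move=> pp op; elim: l G => [|l IH] G sG.
  split=> [B k|]; last first.
    rewrite big_ord0; apply: (cov1 (x := rspan (0 : 'M[int]_(0.*2)))) => S [B [k [-> _ _]]].
    by congr rspan; apply/matrixP => -[].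
  rewrite det_mx00 mul0n => e _; apply/eqP.
  by rewrite -(eqn_exp2l _ _ (prime_gt1 pp)) expn0 -e.
have [U [k [g [h [G' [E [uU [pg k2] sG' eE eqG]]]]]]] := split_reduce m pp op sG.
have [IHd IHc] := IH _ sG'; have [eG' _ _] := sG'.
split; first exact: (good_step_det pp pg k2 eG' uU eE eqG IHd).
by rewrite big_ord_recr /=; apply: (good_step_cov pp pg k2 eG' uU eE eqG IHd IHc).
Qed.

(** * Lower bound at the good primes *)

Section LowerStep.
Variables (p n l : nat) (k g : int) (h : 'rV[int]_n) (G' : 'M[int]_n).
Hypotheses (pp : prime p) (pg : ~~ (p%:Z %| g)%Z) (k2 : (2 %| k)%Z) (eG' : evenf G').
Let Q := qblk k g h G'.

Lemma lower_branch0 B : iso G' p%:Z (rspan B) ->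
  iso Q p%:Z (rspan (blk p%:Z 0 0 1 0 B)).
Proof.
move=> iB x; have [x0 [x1 [x' ->]]] := vecP x.
move/rspan_blk => [i [j [y [-> -> ->]]]]; rewrite scaler0 add0r bil_qblk.
set H := (h *m _) 0 0; have [k' ->] := dvdzP k2; set Z := i * 0 + _ + _.
have -> : k' * 2 * (i * p%:Z) * (i * p%:Z) + g * (i * p%:Z * Z + Z * (i * p%:Z)) +
  i * p%:Z * H + i * p%:Z * H = (2 * p%:Z) * (k' * i * i * p%:Z + g * i * Z + i * H).
  by ring.
by apply: rpredD; [apply: dvdz_mulr | apply: iB; exists y].
Qed.

(** Every residue [r] occurs: [t] makes Q of the first row divisible by p, and the entries of [f]
    make that row pair with the lower rows in multiples of p. Both congruences are solvable since p
    does not divide [g]. *)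
Lemma lower_branch1 B r : iso G' p%:Z (rspan B) ->
  exists t f, iso Q p%:Z (rspan (blk 1 t r p%:Z f B)).
Proof.
move=> iB; have [k' ek] := dvdzP k2; have [q eq] := dvdzP (evenf_bil r eG').
have [t ht] := dvdz_prime_solve 1 (k' + (h *m r^T) 0 0 + q) pp pg.
have /choice[f hf] : forall i, exists z, (p%:Z ^+ 1 %|
    ((h *m (row i B)^T) 0%R 0%R + bil G' r (row i B)) + z * g)%Z.
  by move=> i; apply: dvdz_prime_solve.
rewrite expr1 in ht hf.
exists t, (\col_i f i) => x; have [x0 [x1 [x' ->]]] := vecP x.
move/rspan_blk => [i [j [y [-> -> ->]]]]; rewrite bil_qblk.
have hy : (p%:Z %| (h *m (y *m B)^T) 0%R 0%R + bil G' r (y *m B) + (y *m \col_i f i) 0%R 0%R * g)%Z.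
  have -> : (h *m (y *m B)^T) 0 0 + bil G' r (y *m B) + (y *m \col_i f i) 0 0 * g =
    \sum_i y 0 i * ((h *m (row i B)^T) 0 0 + bil G' r (row i B) + f i * g).
    have hlin (w : 'rV[int]_n) : (w *m (y *m B)^T) 0 0 = \sum_i y 0 i * (w *m (row i B)^T) 0 0.
      rewrite trmx_mul mulmxA mxE; apply: eq_bigr => c _; rewrite !mxE mulrC; congr (_ * _).
      by apply: eq_bigr => d _; rewrite !mxE.
    rewrite /bil !hlin [X in _ + X * g]mxE mulr_suml -!big_split /=.
    by apply: eq_bigr => c _; rewrite !mxE; ring.
  by apply: rpred_sum => c _; rewrite dvdz_mull.
rewrite linearD linearZ /= mulmxDr -scalemxAr mx11D mx11Z bilDl !bilDr !bilZl !bilZr.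
rewrite (bilC (y *m B) r eG'.1) eq ek.
set H1 := (h *m r^T) 0 0 in ht *; set H2 := (h *m (y *m B)^T) 0 0 in hy *.
set Y := (y *m _) 0 0 in hy *; set R := bil G' r _ in hy *.
have -> : k' * 2 * (i * 1) * (i * 1) + g * (i * 1 * (i * t + j * p%:Z + Y) +
  (i * t + j * p%:Z + Y) * (i * 1)) + i * 1 * (i * H1 + H2) + i * 1 * (i * H1 + H2) +
  (i * (i * (q * 2)) + i * R + (i * R + bil G' (y *m B) (y *m B))) =
  2 * (i * i * (k' + H1 + q + t * g) + i * (H2 + R + Y * g) + p%:Z * (g * i * j)) +
  bil G' (y *m B) (y *m B) by ring.
rewrite rpredD //; last by apply: iB; exists y.
rewrite dvdz_mul2l //; apply: rpredD; last exact: dvdz_mulr.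
by apply: rpredD; apply: dvdz_mull.
Qed.

(** The 1 + p^l lattices over each middle lattice are distinct. The middle lattice is recovered from
    the vectors with first coordinate 0, the branch from whether the first coordinate 1 occurs, and
    the residue r from the vectors with first coordinate 1. *)
Lemma lower_step (s' : seq (set 'rV[int]_n)) : uniq s' ->
  (forall S, S \in s' -> exists B : 'M[int]_n, [/\ S = rspan B,
      `|\det B|%N = (p ^ l)%N & iso G' p%:Z S]) ->
  exists s : seq (set 'rV[int]_(1 + (1 + n))), [/\ uniq s,
    size s = (size s' * (1 + p ^ l))%N &
    forall S, S \in s -> exists B : 'M[int]_(1 + (1 + n)), [/\ S = rspan B,
      `|\det B|%N = (p ^ l.+1)%N & iso Q p%:Z S]].
Proof.
move=> us' hs'.
have p0 : p%:Z != 0 by rewrite eqz_nat -lt0n prime_gt0.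
have /choice[Bf hB] : forall S, exists B : 'M[int]_n, S \in s' -> [/\ S = rspan B,
    `|\det B|%N = (p ^ l)%N & iso G' p%:Z (rspan B)].
  move=> S; have [/hs'[B [-> ? ?]]|nS] := boolP (S \in s'); first by exists B.
  by exists 0.
have Bf0 S : S \in s' -> \det (Bf S) != 0.
  by move=> /hB[_ e _]; rewrite -absz_gt0 e expn_gt0 prime_gt0.
have /choice[rp hrp] : forall S, exists s : seq 'rV[int]_n, S \in s' ->
   [/\ uniq s, size s = (p ^ l)%N &
    {in s &, forall r r', rspan (Bf S) (r - r') -> r = r'}].
  move=> S; have [Ss|nS] := boolP (S \in s'); last by exists [::].
  have [s [us ss _ hs]] := rspan_reps (Bf0 _ Ss); exists s => _; split=> //.
  by rewrite ss; have [] := hB _ Ss.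
have /choice[tf htf] : forall Sr : set 'rV[int]_n * 'rV[int]_n, exists tf : int * 'cV[int]_n,
   Sr.1 \in s' -> iso Q p%:Z (rspan (blk 1 tf.1 Sr.2 p%:Z tf.2 (Bf Sr.1))).
  move=> [S r] /=; have [Ss|nS] := boolP (S \in s'); last by exists (0, 0).
  by have [_ _ /(lower_branch1 r)[t [f iS]]] := hB _ Ss; exists (t, f).
pose S0 (S : set 'rV[int]_n) := rspan (blk p%:Z 0 0 1 0 (Bf S)).
pose S1 (S : set 'rV[int]_n) r := rspan (blk 1 (tf (S, r)).1 r p%:Z (tf (S, r)).2 (Bf S)).
have rec b t u a f S : b != 0 -> S \in s' ->
    S = [set x' | exists x1, rspan (blk b t u a f (Bf S)) (vec 0 x1 x')].
  move=> b0 Ss; have [eS _ _] := hB _ Ss.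
  rewrite {1}eS; apply/seteqP; split=> [_ [y ->]|x' [x1 /rspan_blk[i [j [y [+ _ ->]]]]]].
    by exists ((y *m f) 0 0); apply: blk_row3.
  by move/esym/eqP; rewrite mulf_eq0 (negPf b0) orbF => /eqP->; exists y; rewrite scale0r add0r.
have S0in S : ~ exists x1 x', S0 S (vec 1 x1 x').
  move=> [x1 [x' /rspan_blk[i [_ [_ [e _ _]]]]]].
  have : (p%:Z %| 1%R)%Z by rewrite e dvdz_mull.
  by rewrite dvdzE /= dvdn1 => /eqP p1; move: pp; rewrite p1.
have S1in S r : exists x1 x', S1 S r (vec 1 x1 x').
  by exists (tf (S, r)).1, r; apply: blk_row1.
exists ([seq S0 M | M <- s'] ++ [seq S1 M r | M <- s', r <- rp M]); split.
- rewrite cat_uniq; apply/and3P; split.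
  + rewrite map_inj_in_uniq // => S S' Ss S's e.
    rewrite (rec p%:Z 0 0 1 0 S p0 Ss) (rec p%:Z 0 0 1 0 S' p0 S's).
    by apply/funext => x'; move: e; rewrite /S0 => ->.
  + apply/hasPn => _ /allpairsPdep[S [r [_ _ ->]]]; apply/negP => /mapP[S' _ e].
    by apply: (S0in S'); rewrite -e; apply: S1in.
  + apply: allpairs_uniq_dep => //; first by move=> S /hrp[].
    move=> [S r] [S' r'] /allpairsPdep[Sa [ra [h1 h2 e1]]].
    move=> /allpairsPdep[Sb [rb [h3 h4 e2]]] /= e.
    have eS1 : S = Sa := congr1 (@projT1 _ _) e1.
    have er1 : r = ra := congr1 (fun x : {_ : set 'rV[int]_n & 'rV[int]_n} => projT2 x) e1.
    have eS2 : S' = Sb := congr1 (@projT1 _ _) e2.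
    have er2 : r' = rb := congr1 (fun x : {_ : set 'rV[int]_n & 'rV[int]_n} => projT2 x) e2.
    rewrite -eS1 in h1 h2; rewrite -er1 in h2; rewrite -eS2 in h3 h4; rewrite -er2 in h4.
    have eS : S = S'.
      rewrite (rec 1 (tf (S, r)).1 r p%:Z (tf (S, r)).2 S (oner_neq0 _) h1).
      rewrite [RHS](rec 1 (tf (S', r')).1 r' p%:Z (tf (S', r')).2 S' (oner_neq0 _) h3).
      by apply/funext => x'; move: e; rewrite /S1 => ->.
    rewrite -eS in e h4 *; congr existT.
    have : S1 S r' (vec 1 (tf (S, r)).1 r) by rewrite -e; apply: blk_row1.
    move/rspan_blk => [i [j [y [+ _ er]]]]; rewrite mulr1 => i1.
    have [_ _ hinj] := hrp _ h1; apply: hinj => //.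
    by exists y; rewrite er -i1 scale1r addrC addKr.
- rewrite size_cat size_map size_allpairs_dep mulnDr muln1; congr addn.
  rewrite sumnE big_map big_seq (eq_bigr (fun=> (p ^ l)%N)); last by move=> S /hrp[].
  by rewrite -big_seq big_const_seq iter_addn_0 count_predT mulnC.
move=> S; rewrite mem_cat => /orP[/mapP[S' Ss ->]|/allpairsPdep[S' [r [Ss rr ->]]]].
  exists (blk p%:Z 0 0 1 0 (Bf S')); have [_ e iS] := hB _ Ss; split=> //.
    by rewrite det_blk mulr1 abszM e expnS.
  exact: lower_branch0.
exists (blk 1 (tf (S', r)).1 r p%:Z (tf (S', r)).2 (Bf S')).
have [_ e iS] := hB _ Ss; split=> //; first by rewrite det_blk mul1r abszM e expnS.
exact: (htf (S', r)).
Qed.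

End LowerStep.

(** Norm p is enough: a(p^l) is the coefficient whose exact value enters the asymptotics. *)
Lemma good_lower p l (G : 'M[int]_(l.*2)) : prime p -> odd p -> split_form p G ->
  exists s : seq (set 'rV[int]_(l.*2)), [/\ uniq s,
    size s = (\prod_(i < l) (1 + p ^ i))%N &
    forall S, S \in s -> exists B : 'M[int]_(l.*2), [/\ S = rspan B,
      `|\det B|%N = (p ^ l)%N & iso G p%:Z S]].
Proof.
move=> pp op; elim: l G => [|l IH] G sG.
  exists [:: rspan (0 : 'M[int]_(0.*2))]; split; rewrite ?big_ord0 // => S.
  rewrite inE => /eqP->; exists 0; split; rewrite ?det_mx00 //.
  by move=> x _; rewrite (_ : x = 0) ?bil0l ?dvdz0 //; apply/rowP => -[].
have [U [k [g [h [G' [E [uU [pg k2] sG' eE eqG]]]]]]] := split_reduce 1 pp op sG.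
have [s' [us' ss' hs']] := IH _ sG'; have [eG' _ _] := sG'.
have [s [us ss hs]] := lower_step h pp pg k2 eG' us' hs'.
exists [seq (fun x : 'rV[int]_(l.+1.*2) => x *m U) @` M | M : set _ <- s].
have cancelU S : (fun x => x *m invmx U) @` ((fun x => x *m U) @` S) = S.
  apply/seteqP; split=> [_ [_ [x Sx <-] <-]|x Sx]; first by rewrite mulmxK.
  by exists (x *m U); [exists x | rewrite mulmxK].
split.
- by rewrite map_inj_uniq // => S S' /(congr1 (fun T => (fun x => x *m invmx U) @` T)); rewrite !cancelU.
- by rewrite size_map ss ss' big_ord_recr.
move=> _ /mapP[S /hs[B [eS dB iS]] ->]; exists (B *m U); split.
- rewrite eS; apply/seteqP; split=> [_ [_ [y ->] <-]|_ [y ->]].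
    by exists y; rewrite mulmxA.
  by exists (y *m B); [exists y | rewrite mulmxA].
- by rewrite det_mulmx abszM dB unitmx_int_det // muln1.
move=> _ [x Sx <-]; rewrite bil_mulmx eqG bilD bilZ expr1.
by apply: rpredD; [apply: iS | rewrite mulrC dvdz_mul // evenf_bil].
Qed.

(** * Upper bound at an arbitrary prime *)

Lemma rspan_detZ n (B : 'M[int]_n) x : rspan B ((\det B) *: x).
Proof.
exists (x *m \adj B).
by rewrite -mulmxA mul_adj_mx mul_mx_scalar.
Qed.

Lemma rspan_absdetZ n (B : 'M[int]_n) x : rspan B (`|\det B|%N%:Z *: x).
Proof.
rewrite abszE; case: (ger0P (\det B)) => _; first exact: rspan_detZ.
by rewrite scaleNr; apply/rspanN/rspan_detZ.
Qed.

(** A lattice of index d contains d Z^n, so it is determined by a basis matrix modulo d. *)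
Lemma cov_det n d : (0 < d)%N -> exists C,
  cov [set S | exists B : 'M[int]_n, S = rspan B /\ `|\det B|%N = d] C.
Proof.
move=> d0; pose F (M : 'M['I_d]_n) : set 'rV[int]_n :=
  rspan (col_mx (map_mx (fun i : 'I_d => (i : nat)%:Z) M) (d%:Z)%:M).
exists #|{: 'M['I_d]_n}|; exists [seq F M | M : 'M['I_d]_n].
  by rewrite size_map -cardE.
move=> _ [B [-> eB]].
have hd (y : int) : (`|(y %% d)%Z| < d)%N.
  have := modz_ge0 y (_ : d%:Z != 0); have := ltz_mod y (_ : d%:Z != 0).
  by rewrite eqz_nat -lt0n d0; clear; lia.
pose M : 'M['I_d]_n := \matrix_(i, j) Ordinal (hd (B i j)).
apply/mapP; exists M; first by rewrite mem_enum.
have eM : map_mx (fun i : 'I_d => (i : nat)%:Z) M =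
    B - d%:Z *: \matrix_(i, j) (B i j %/ d)%Z.
  apply/matrixP => i j; rewrite !mxE /= gez0_abs ?modz_ge0 ?eqz_nat -?lt0n //.
  by rewrite {2}(divz_eq (B i j) d) mulrC addrC addKr.
rewrite /F eM; apply/seteqP; split=> [_ [y ->]|x].
  apply/rspan_col_mx; exists (y *m (B - d%:Z *: \matrix_(i, j) (B i j %/ d)%Z)).
    by exists y.
  rewrite mulmxBr opprB addrC subrK -scalemxAr.
  by exists (y *m \matrix_(i, j) (B i j %/ d)%Z); rewrite mul_mx_scalar.
move/rspan_col_mx => [_ [y ->] [z ez]]; rewrite -[x](subrK (y *m (B - d%:Z *: \matrix_(i, j) (B i j %/ d)%Z))) ez.
apply: rspanD; first by rewrite mul_mx_scalar -eB; apply: rspan_absdetZ.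
rewrite mulmxBr -scalemxAr; apply: rspanB; first by exists y.
by rewrite -{1}eB; apply: rspan_absdetZ.
Qed.

Lemma cov_det_lt p n K : prime p -> exists C,
  cov [set S | exists (B : 'M[int]_n) k, [/\ S = rspan B, `|\det B|%N = (p ^ k)%N &
    (k < K)%N]] C.
Proof.
move=> pp; elim: K => [|K [C hC]].
  by exists 0%N; apply: cov0 => S [B [k []]].
have [C' hC'] : exists C, cov [set S | exists B : 'M[int]_n, S = rspan B /\ `|\det B|%N = (p ^ K)%N] C.
  by apply: cov_det; rewrite expn_gt0 prime_gt0.
exists (C + C')%N; apply: cov_sub (cov_setU hC hC') => S [B [k [-> eB]]].
rewrite ltnS leq_eqVlt => /orP[/eqP ek|kK]; first by right; exists B; rewrite -ek.
by left; exists B, k.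
Qed.

(** Q has valuation at most 2c on vectors primitive at p. If p^m divides Q(x) and m - 2j > 2c, then
    x / p^j is therefore not primitive and can be divided by p once more. *)
Lemma anisotropic_dvd p n c m (G : 'M[int]_n) x : prime p -> evenf G ->
  ~ (exists2 e, pprim p e & (2 * p%:Z ^+ (2 * c).+1 %| bil G e e)%Z) ->
  (2 * p%:Z ^+ m %| bil G x x)%Z ->
  exists x0, x = p%:Z ^+ (uphalf (m - 2 * c)) *: x0.
Proof.
move=> pp eG an hx.
have p0 : p%:Z != 0 by rewrite eqz_nat -lt0n prime_gt0.
suff H j : (j <= uphalf (m - 2 * c))%N -> exists x0, x = p%:Z ^+ j *: x0 by exact: H.
elim: j => [_|j IH jt]; first by exists x; rewrite scale1r.
have [x0 ex] := IH (ltnW jt).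
have [pr|npr] := pselect (pprim p x0).
  exfalso; apply: an; exists x0 => //.
  move: hx; rewrite ex bilZl bilZr; have [q ->] := dvdzP (evenf_bil x0 eG).
  rewrite [q * 2]mulrC !(mulrCA _ 2) !dvdz_mul2l // mulrA -exprD.
  have -> : m = (j + j + (m - (j + j)))%N by move: jt; rewrite uphalf_half; clear; lia.
  rewrite (exprD _ (j + j) (m - (j + j))) dvdz_mul2l ?expf_neq0 //; apply: dvdz_trans.
  by rewrite dvdz_exp2l //; move: jt; rewrite uphalf_half; clear; lia.
have hd i : (p%:Z %| x0 0%R i)%Z.
  by apply: contrapT => /negP ni; apply: npr; exists i.
exists (\row_i (x0 0%R i %/ p)%Z); rewrite ex exprSr -scalerA; congr (_ *: _).
by apply/rowP => i; rewrite mxE [X in _ * X]mxE mulrC divzK.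
Qed.

Lemma tr_qblk n k g h (G : 'M[int]_n) : G^T = G -> (qblk k g h G)^T = qblk k g h G.
Proof.
move=> sG; rewrite /qblk tr_block_mx tr_row_mx tr_col_mx !tr_scalar_mx trmxK.
by rewrite tr_block_mx !trmx0 sG.
Qed.

Section BadStep.
Variables (p n l c c' m N : nat) (k g : int) (h : 'rV[int]_n) (G' : 'M[int]_n).
Hypotheses (pp : prime p) (gc : ~~ (p%:Z ^+ c.+1 %| g)%Z) (eG' : evenf G').
Hypotheses (dG' : ~~ (p%:Z ^+ c.+1 %| \det G')%Z) (nl : n = l.*2).
Let Q := qblk k g h G'.
Local Notation P m := (p%:Z ^+ m).

(** Here [c] bounds the valuations of [g] and det G', and [c'] is the excess allowed in the index.
    By [iso_det] the middle lattice has index at least p^(l m - c), and m <= a + b + c; so a + b and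
    the middle index are fixed up to bounded errors, and at most p^(c'+2c) choices remain for each
    entry of [t] and [f]. *)
Lemma bad_step :
  cov [set S | exists (B : 'M[int]_n) k, [/\ S = rspan B, `|\det B|%N = (p ^ k)%N,
         (k <= l * m + (c' + c))%N & iso G' (P m) S]] N ->
  cov [set S | exists (B : 'M[int]_(1 + (1 + n))) k, [/\ S = rspan B,
         `|\det B|%N = (p ^ k)%N, (k <= l.+1 * m + c')%N & iso Q (P m) S]]
      ((m + (c' + c)).+1 * ((m + (c' + c)).+1 *
         (N * (p ^ (l * m + (c' + c)) * (p ^ (c' + c + c)) ^ n.+1)))).
Proof.
move=> IH; set K := (m + (c' + c)).+1.
have p0 : p%:Z != 0 by rewrite eqz_nat -lt0n prime_gt0.
have p1 : 1 < `|p%:Z| by rewrite ger0_norm // ltz_nat prime_gt1.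
have dG'0 : \det G' != 0 by apply: contraNneq dG' => ->; rewrite dvdz0.
pose A' : set (set 'rV[int]_n) := [set S | exists (B : 'M[int]_n) k, [/\ S = rspan B,
  `|\det B|%N = (p ^ k)%N, (k <= l * m + (c' + c))%N & iso G' (P m) S]].
pose F a b (S' : set 'rV[int]_n) : set (set 'rV[int]_(1 + (1 + n))) := [set S |
  exists t u f B', [/\ rspan B' = S', (a + b <= m + (c' + c))%N,
    S = rspan (blk (P b) t u (P a) f B') & iso Q (P m) S]].
have covF a b S' : A' S' -> cov (F a b S')
    (p ^ (l * m + (c' + c)) * (p ^ (c' + c + c)) ^ n.+1).
  move=> [B0 [j [eS' dB0 jl iS']]].
  have B00 : \det B0 != 0 by rewrite -absz_gt0 dB0 expn_gt0 prime_gt0.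
  have [s [_ ss hs _]] := rspan_reps B00.
  have [ab|ab] := leqP (a + b) (m + (c' + c)); last first.
    by apply: cov0 => S [t [u [f [B' [_ ab' _ _]]]]]; move: ab; rewrite ltnNge ab'.
  apply: cov_leq (_ : cov _ (size s * (p ^ (a - (m - b - c))) ^ n.+1)) => [|].
    rewrite ss dB0 leq_mul ?leq_pexp2l ?prime_gt0 // leq_exp2r //.
    rewrite leq_pexp2l ?prime_gt0 //; move: ab; clear; lia.
  apply: cov_sub (blk_cov k h pp eG'.1 m b a s B00 gc) => S [t [u [f [B' [eB' _ eS iS]]]]].
  exists t, u, f, B'; rewrite eB' eS'; split=> //.
apply: cov_sub (cov_ltn (K := K) (F := fun a => [set S | exists2 b, (b < K)%N &
    [set S | exists2 S', A' S' & F a b S' S] S])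
    (fun a _ => cov_ltn (fun b _ => cov_bind IH (covF a b)))).
move=> _ [B [j [-> dB jl iS]]].
have [b [t [u [a [f [B' [d [eqB eB' B'0 ej]]]]]]]] := blk_form_p pp dB.
rewrite eqB in iS *.
have iB' : iso G' (P m) (rspan B').
  move=> _ [y ->]; have := iS _ (blk_row3 _ _ _ _ _ _ y).
  by rewrite bil_qblk !(mulr0, mul0r, addr0, add0r).
have ld : (l * m <= d + c)%N.
  have := iso_det eG'.1 (expf_neq0 m p0) iB'.
  rewrite -exprM pfactor_dvdz ?mulf_neq0 ?expf_neq0 //.
  rewrite abszM lognM ?absz_gt0 ?expf_neq0 // abszX eB' -expnM pfactorK //.
  move: dG'; rewrite pfactor_dvdz // -ltnNge ltnS; move: (logn p _) => v.
  by rewrite nl -mul2n; clear; nia.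
have mab : (m <= a + b + c)%N.
  have := iso_bil (tr_qblk k g h eG'.1) iS (blk_row1 _ _ _ _ _ _) (blk_row2 _ _ _ _ _ _).
  rewrite bil_qblk bil0r trmx0 mulmx0 mxE !mulr0 !mul0r !addr0 add0r mulrA => H.
  have := dvdz_pfactor_mul pp gc H; rewrite dvdz_Pexp2l //; clear; lia.
exists a; first by move: jl; rewrite ej /K mulSn; move: ld; clear; lia.
exists b; first by move: jl; rewrite ej /K mulSn; move: ld; clear; lia.
exists (rspan B').
  by exists B', d; split=> //; move: jl mab; rewrite ej mulSn; clear; lia.
exists t, u, f, B'; split=> //; move: jl ld; rewrite ej mulSn; clear; lia.
Qed.

End BadStep.

(** Induction on l, for all c' at once since each step enlarges c'. If no vector primitive at p has
    Q divisible by p^(2c+1), the lattices in question are p^t times the members of a finite list;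
    otherwise Hensel lifting splits off a plane. The constant depends neither on m nor on the
    form. *)
Lemma bad_bound p l : prime p -> forall c c', exists C, forall m (G : 'M[int]_(l.*2)),
  evenf G -> ~~ (p%:Z ^+ c.+1 %| \det G)%Z ->
  cov [set S | exists (B : 'M[int]_(l.*2)) k, [/\ S = rspan B, `|\det B|%N = (p ^ k)%N,
         (k <= l * m + c')%N & iso G (p%:Z ^+ m) S]]
      (C * (m.+1 ^ (2 * l) * p ^ (m * 'C(l, 2)))).
Proof.
move=> pp; elim: l => [|l IH] c c'.
  exists 1%N => m G _ _; rewrite muln0 expn0 bin_small // muln0 expn0.
  apply: (cov1 (x := rspan (0 : 'M[int]_(0.*2)))) => S [B [k [-> _ _ _]]].
  by congr rspan; apply/matrixP => -[].
have [C' hC'] := IH c (c' + c)%N.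
(* In the anisotropic case the lattices are divided by p^t with 2t >= m - 2c, in rank 2(l+1). Of an
   index exponent at most (l+1) m + c' there remains at most c' + 2(l+1)c. *)
have [Ca hCa] := @cov_det_lt p (l.+1.*2) (c' + 2 * l.+1 * c).+1 pp.
pose Ci := ((c' + c).+1 ^ 2 * C' * (p ^ (c' + c) * (p ^ (c' + c + c)) ^ (l.*2).+1))%N.
exists (Ca + Ci)%N => m G eG dG.
have p0 : (0 < p)%N by rewrite prime_gt0.
have [[e0 pe0 he0]|an] := pselect (exists2 e, pprim p e &
   (2 * p%:Z ^+ (2 * c).+1 %| bil G e e)%Z); last first.
  set t := uphalf (m - 2 * c).
  apply: cov_leq (cov_sub _ (cov_image (fun S : set _ => (fun x => p%:Z ^+ t *: x) @` S) hCa)).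
    by rewrite mulnDl -[X in (X <= _)%N]muln1 (leq_trans _ (leq_addr _ _)) // leq_mul // muln_gt0 !expn_gt0 p0.
  move=> S [B [k [eS dB kl iS]]].
  have /choice[b hb] : forall i, exists x0, row i B = p%:Z ^+ t *: x0.
    move=> i; apply: (anisotropic_dvd pp eG an); apply: iS.
    by rewrite eS; apply: rspan_row.
  pose B0 := \matrix_i b i.
  have eB : B = p%:Z ^+ t *: B0.
    by apply/row_matrixP => i; rewrite hb linearZ /= rowK.
  exists (rspan B0); last first.
    rewrite eS eB; apply/seteqP; split=> [_ [_ [y ->] <-]|_ [y ->]].
      by exists y; rewrite scalemxAr.
    by exists (y *m B0); [exists y | rewrite scalemxAr].
  move: dB; rewrite eB detZ abszM -exprM abszX /= => /esym e.
  have /(dvdn_pfactor _ _ pp)[k0 _ ek0] : (`|\det B0| %| p ^ k)%N by rewrite e dvdn_mull.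
  exists B0, k0; split=> //; move: e; rewrite ek0 -expnD => /eqP.
  rewrite eqn_exp2l ?prime_gt1 // => /eqP e; move: kl; rewrite e /t uphalf_half.
  by rewrite -!mul2n; clear; nia.
(* Precision m is what the lattices require; precision c + 1 keeps the valuations of [g] and det G'
   at most c. *)
set M := maxn m c.+1.
have [e pe he] := hensel M pp eG dG (ltnSn _) pe0 he0.
have [U [k [g [h [G' [E [uU eG' eE k2 eqG]]]]]]] := @isotropic_reduce p M (l.*2) G e pp eG pe he.
have hdet : (p%:Z ^+ c.+1 %| \det G + g ^+ 2 * \det G')%Z.
  have := det_congr (qblk k g h G') E (p%:Z ^+ M).
  rewrite -eqG !det_mulmx det_tr det_qblk mulrAC -expr2 unit_det2 // mul1r.
  rewrite mulNr opprK => H; apply: dvdz_trans H.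
  by rewrite dvdz_exp2l // leq_maxr.
have gc : ~~ (p%:Z ^+ c.+1 %| g)%Z.
  by apply: contra dG => pg; move: hdet; rewrite rpredDr // dvdz_mulr // expr2 dvdz_mulr.
have dG' : ~~ (p%:Z ^+ c.+1 %| \det G')%Z.
  by apply: contra dG => pG'; move: hdet; rewrite rpredDr // dvdz_mull.
have H := bad_step k h pp gc eG' dG' (erefl _) (hC' m G' eG' dG').
apply: cov_leq (cov_sub _ (cov_image (fun S : set _ => (fun x => x *m U) @` S) H)); last first.
  move=> S [B [j [eS dB jl iS]]]; exists (rspan (B *m invmx U)); last first.
    by rewrite eS; apply: rspan_image.
  exists (B *m invmx U), j; split=> //.
    by rewrite det_mulmx abszM (@unitmx_int_det _ (invmx U)) ?unitmx_inv // muln1.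
  apply: (@iso_congr _ _ (U *m G *m U^T) (- (p%:Z ^+ (M - m) *: E))).
  - apply: evenfN; split=> [|i]; first by rewrite linearZ /= eE.1.
    by rewrite mxE dvdz_mull // eE.2.
  - by rewrite eqG scalerN scalerA -exprD subnKC ?leq_maxl // addrK.
  by apply/iso_mulmx; rewrite mulmxKV // -eS.
rewrite mulnDl; apply: leq_trans (leq_addl _ _).
have hK : ((m + (c' + c)).+1 <= (c' + c).+1 * m.+1)%N by clear; nia.
apply: leq_trans (leq_mul hK (leq_mul hK (leqnn _))) _.
have -> : (p ^ (l * m + (c' + c)) = p ^ (m * l) * p ^ (c' + c))%N by rewrite expnD (mulnC l m).
have -> : (p ^ (m * 'C(l.+1, 2)) = p ^ (m * 'C(l, 2)) * p ^ (m * l))%N.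
  by rewrite binS bin1 mulnDr expnD.
have -> : (m.+1 ^ (2 * l.+1) = m.+1 * m.+1 * m.+1 ^ (2 * l))%N by rewrite mulnS expnD mulnn.
rewrite /Ci -mulnn; apply: eq_leq; clear.
move: (m.+1 ^ _)%N (p ^ (m * 'C(l, 2)))%N (p ^ (m * l))%N (p ^ (c' + c))%N (_ ^ l.*2.+1)%N.
by move: (c' + c).+1 m.+1 => *; ring.
Qed.

(** * Multiplicativity *)

Lemma absz1_unit (x : int) : `|x|%N = 1%N -> x \is a GRing.unit.
Proof. by case: x => [[|[|x]]|[|x]]. Qed.

Definition idx n (k : nat) (S : set 'rV[int]_n) :=
  exists B : 'M[int]_n, S = rspan B /\ `|\det B|%N = k.

Lemma idx_scale n k (S : set 'rV[int]_n) x : idx k S -> S (k%:Z *: x).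
Proof. by move=> [B [-> <-]]; apply: rspan_absdetZ. Qed.

Lemma idx_uniq n k k' (S : set 'rV[int]_n) : idx k S -> idx k' S -> k = k'.
Proof. by move=> [B [eB <-]] [C [eC <-]]; apply: rspan_det; rewrite -eB. Qed.

Lemma idx_sub_eq n k (S T : set 'rV[int]_n) : (0 < k)%N ->
  idx k S -> idx k T -> S `<=` T -> S = T.
Proof.
move=> k0 [B [-> dB]] [C [-> dC]] /rspan_subP[X eB].
rewrite eB rspan_mulU // unitmxE.
move/eqP: dB; rewrite eB det_mulmx abszM dC -{2}[k]mul1n eqn_pmul2r // => /eqP d1.
exact: absz1_unit.
Qed.

Lemma idx_coprime n k (S : set 'rV[int]_n) (a b : nat) x : idx k S -> coprime a b ->
  S (a%:Z *: x) -> S (b%:Z *: x) -> S x.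
Proof. by move=> [B [-> _]]; apply: rspan_coprime. Qed.

(** By Bezout the intersection is k' S + k S'. Its determinant is a multiple of k k' and divides
    both k k' k'^n and k k' k^n. *)
Lemma idx_meet n k k' (S S' : set 'rV[int]_n.+1) : coprime k k' ->
  idx k S -> idx k' S' -> idx (k * k') (S `&` S').
Proof.
move=> kk' iS iS'; have [B [eB dB]] := iS; have [B' [eB' dB']] := iS'.
have [C eC] := rspan_square (col_mx (k'%:Z *: B) (k%:Z *: B')).
have eSS : S `&` S' = rspan C.
  rewrite eC; apply/seteqP; split=> [x [Sx S'x]|x /rspan_col_mx[_ [y ->] [z ez]]].
    have [u [v uv]] := Bezoutz k%:Z k'%:Z.
    have {}uv : u * k%:Z + v * k'%:Z = 1.
      by rewrite uv; apply/eqP; rewrite /gcdz /= eqz_nat.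
    move: Sx S'x; rewrite eB eB' => -[y ey] [z ez].
    apply/rspan_col_mx; exists ((v *: y) *m (k'%:Z *: B)); first by exists (v *: y).
    exists (u *: z); rewrite -!scalemxAl -!scalemxAr -ey -ez !scalerA.
    by rewrite -[X in X - _]scale1r -scalerBl -uv addrK.
  rewrite -[x](subrK (y *m (k'%:Z *: B))) ez -!scalemxAr; split; rewrite ?eB ?eB'.
    apply: rspanD; last by apply: rspanZ; exists y.
    by rewrite -eB; apply: idx_scale.
  apply: rspanD; first by apply: rspanZ; exists z.
  by rewrite -eB'; apply: idx_scale.
exists C; split=> //; apply/eqP; rewrite eqn_dvd; apply/andP; split; last first.
  rewrite Gauss_dvd //; apply/andP; split.
    have [X ->] : exists X, C = X *m B by apply/rspan_subP; rewrite -eSS -eB; apply: subIsetl.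
    by rewrite det_mulmx abszM dB dvdn_mull.
  have [X ->] : exists X, C = X *m B' by apply/rspan_subP; rewrite -eSS -eB'; apply: subIsetr.
  by rewrite det_mulmx abszM dB' dvdn_mull.
have h1 : (`|\det C| %| k * k' * k' ^ n)%N.
  have [X /(congr1 determinant)] : exists X, k'%:Z *: B = X *m C.
    apply/rspan_subP; rewrite eC => _ [y ->]; apply/rspan_col_mx.
    by exists (y *m (k'%:Z *: B)); [exists y | exists 0; rewrite subrr mul0mx].
  rewrite detZ det_mulmx => /(congr1 absz); rewrite !abszM abszX dB /= => e.
  by rewrite -mulnA -expnS mulnC e dvdn_mull.
have h2 : (`|\det C| %| k * k' * k ^ n)%N.
  have [X /(congr1 determinant)] : exists X, k%:Z *: B' = X *m C.
    apply/rspan_subP; rewrite eC => _ [y ->]; apply/rspan_col_mx.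
    by exists 0; [apply: rspan0 | exists y; rewrite subr0].
  rewrite detZ det_mulmx => /(congr1 absz); rewrite !abszM abszX dB' /= => e.
  by rewrite mulnAC -expnS e dvdn_mull.
have : (`|\det C| %| gcdn (k * k' * k' ^ n) (k * k' * k ^ n))%N by rewrite dvdn_gcd h1.
rewrite -muln_gcdr (_ : gcdn _ _ = 1%N) ?muln1 //.
by apply/eqP; rewrite -/(coprime _ _) coprimeXl // coprimeXr // coprime_sym.
Qed.

(** The lattice S + k Z^n. For [S] of index k k' with k and k' coprime it isolates the part of [S]
    at the primes of k. *)
Definition addk n (S : set 'rV[int]_n) (k : nat) : set 'rV[int]_n :=
  [set x | exists2 y, S y & exists z, x = y + k%:Z *: z].

Lemma addk_sub n (S : set 'rV[int]_n) k : S `<=` addk S k.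
Proof. by move=> x Sx; exists x => //; exists 0; rewrite scaler0 addr0. Qed.

Lemma addk_scale n k k' (S : set 'rV[int]_n) x : idx (k * k') S ->
  addk S k x -> S (k'%:Z *: x).
Proof.
move=> iS [y Sy [z ->]]; have [B [eB _]] := iS.
rewrite scalerDr scalerA -PoszM mulnC eB; apply: rspanD.
  by apply: rspanZ; rewrite -eB.
by rewrite -eB; apply: idx_scale.
Qed.

Lemma addk_idx_dvd n k k' (S : set 'rV[int]_n) : (0 < k)%N -> (0 < k')%N ->
  coprime k k' -> idx (k * k') S -> exists2 k1, (k1 %| k)%N & idx k1 (addk S k).
Proof.
move=> k0 k'0 kk' [B [-> dB]].
have [C eC] := rspan_square (col_mx B (k%:Z)%:M).
have eS : addk (rspan B) k = rspan C.
  rewrite eC; apply/seteqP; split=> [_ [y By [z ->]]|x /rspan_col_mx[y By [z ez]]].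
    by apply/rspan_col_mx; exists y => //; exists z; rewrite addrC addKr mul_mx_scalar.
  by exists y => //; exists z; rewrite -mul_mx_scalar -ez addrC subrK.
exists `|\det C|%N; last by exists C.
have h1 : (`|\det C| %| k * k')%N.
  have [X eB] : exists X, B = X *m C.
    by apply/rspan_subP; rewrite -eS; apply: addk_sub.
  by rewrite -dB eB det_mulmx abszM dvdn_mull.
have h2 : (`|\det C| %| k ^ n)%N.
  have [X /(congr1 determinant)] : exists X, (k%:Z)%:M = X *m C.
    apply/rspan_subP; rewrite eC => _ [y ->]; apply/rspan_col_mx.
    by exists 0; [apply: rspan0 | exists y; rewrite subr0].
  rewrite det_scalar det_mulmx => /(congr1 absz); rewrite abszM abszX /= => ->.
  by rewrite dvdn_mull.
move: h1; rewrite Gauss_dvdl //; apply: coprime_dvdl h2 _.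
exact: coprimeXl.
Qed.

Lemma addk_meet n k k' (S : set 'rV[int]_n) : coprime k k' -> idx (k * k') S ->
  addk S k `&` addk S k' = S.
Proof.
move=> kk' iS; apply/seteqP; split=> [x [S1 S2]|x Sx]; last by split; apply: addk_sub.
apply: (idx_coprime iS kk'); last exact: addk_scale S1.
by apply: addk_scale S2; rewrite mulnC.
Qed.

(** The two overlattices have indices dividing k and k', and their intersection [S] has index k k';
    so equality holds in both. *)
Lemma addk_idx n k k' (S : set 'rV[int]_n.+1) : (0 < k)%N -> (0 < k')%N ->
  coprime k k' -> idx (k * k') S -> idx k (addk S k) /\ idx k' (addk S k').
Proof.
move=> k0 k'0 kk' iS; have k'k : coprime k' k by rewrite coprime_sym.
have iS' : idx (k' * k) S by rewrite mulnC.
have [k1 k1k i1] := addk_idx_dvd k0 k'0 kk' iS.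
have [k2 k2k i2] := addk_idx_dvd k'0 k0 k'k iS'.
have cop : coprime k1 k2 by apply: coprime_dvdl k1k _; apply: coprime_dvdr k2k _.
have := idx_meet cop i1 i2; rewrite addk_meet // => /idx_uniq/(_ iS) e.
have l1 := dvdn_leq k0 k1k; have l2 := dvdn_leq k'0 k2k.
have [e1 e2] : k1 = k /\ k2 = k' by move: e l1 l2 k0 k'0; clear; nia.
by rewrite e1 in i1; rewrite e2 in i2.
Qed.

Lemma dvdz_coprime (a b : nat) (x : int) : coprime a b ->
  (a%:Z %| x)%Z -> (b%:Z %| x)%Z -> ((a * b)%N%:Z %| x)%Z.
Proof. by move=> ab ha hb; rewrite PoszM Gauss_dvdz ?ha. Qed.

Lemma dvdz_gauss (a b : nat) (x : int) : coprime a b -> (a%:Z %| b%:Z * x)%Z -> (a%:Z %| x)%Z.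
Proof. by move=> ab; rewrite Gauss_dvdzr. Qed.

Lemma dvdz_nat (a b : nat) (x : int) : (a %| b)%N -> (b%:Z %| x)%Z -> (a%:Z %| x)%Z.
Proof. by move=> ab; apply: dvdz_trans; rewrite dvdzE. Qed.

Lemma cardfs_prod (T U : choiceType) (A : {fset T}) (B : {fset U}) :
  #|` A `*` B|%fset = (#|` A| * #|` B|)%fset.
Proof.
have -> : (A `*` B = [fset z in [seq (x, y) | x <- enum_fset A, y <- enum_fset B]])%fset.
  apply/fsetP => -[x y]; rewrite in_fsetM in_fset /=; apply/andP/allpairsP.
    by move=> [xA yB]; exists (x, y).
  by move=> [[x' y'] [/= xA yB [-> ->]]].
rewrite card_fseq undup_id ?size_allpairs //.
by apply: allpairs_uniq; rewrite ?fset_uniq // => -[? ?] [? ?].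
Qed.

(** * Maximal sublattices of Z^n and their number *)

Section MaximalLattices.
Variables (n : nat) (G : 'M[int]_n.+1).
Hypothesis eG : evenf G.
Implicit Types (S : set 'rV[int]_n.+1) (k d r : nat).

(* S is maximal of norm d, tested on the vectors y / r of Q^n. *)
Definition maxl d S := iso G d%:Z S /\ forall r y, (0 < r)%N ->
  (2 * (d * r ^ 2)%N%:Z %| bil G y y)%Z -> (forall z, S z -> ((d * r)%N%:Z %| bil G y z)%Z) ->
  exists2 z, S z & y = r%:Z *: z.

Hypotheses (maxT : maxl 1 setT) (norm1 : forall d, iso G d%:Z setT -> d = 1%N).

Lemma dvd2_bil d y : (2 * d%:Z %| bil G y y)%Z = (d%:Z %| (bil G y y %/ 2)%Z)%Z.
Proof.
have [q ->] := dvdzP (evenf_bil y eG).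
by rewrite mulzK // [2 * _]mulrC dvdz_mul2r.
Qed.

(** [S] contains k Z^n, where Q takes the values k^2 Q(x). Hence d / gcd(d, k^2) divides all values
    of Q on Z^n, and it is 1 by [norm1]. *)
Lemma iso_idx_dvd d k S : (0 < k)%N -> idx k S -> iso G d%:Z S -> (d %| k ^ 2)%N.
Proof.
move=> k0 iS isoS; set g := gcdn d (k ^ 2).
have g0 : (0 < g)%N by rewrite gcdn_gt0 expn_gt0 k0 orbT.
have ed : d = (d %/ g * g)%N by rewrite divnK // dvdn_gcdl.
have ek : (k ^ 2 = k ^ 2 %/ g * g)%N by rewrite divnK // dvdn_gcdr.
suff d1 : (d %/ g)%N = 1%N by rewrite ed d1 mul1n dvdn_gcdr.
apply: norm1 => x _; have := isoS _ (idx_scale x iS).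
have cop : coprime (d %/ g) (k ^ 2 %/ g).
  have : gcdn (d %/ g * g) (k ^ 2 %/ g * g) = g by rewrite -ed -ek.
  have aux (b c : nat) : (0 < c)%N -> (b * c)%N = c -> b == 1%N by clear; nia.
  by rewrite -muln_gcdl => /(aux _ _ g0).
rewrite dvd2_bil bilZl bilZr mulrA -PoszM mulnn dvd2_bil.
have [q ->] := dvdzP (evenf_bil x eG); rewrite mulrA !mulzK //.
rewrite {1}ed ek !PoszM [_ * q]mulrAC dvdz_mul2r ?eqz_nat -?lt0n //.
exact: dvdz_gauss.
Qed.

Lemma coprime_split k k' r : (0 < r)%N -> (0 < k)%N -> (0 < k')%N -> coprime k k' -> exists r1 r2,
  [/\ r = (r1 * r2)%N, coprime r1 r2, coprime r1 k' & coprime r2 k].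
Proof.
move=> r0 k0 k'0 kk'; exists (r`_(\pi(k)))%N, (r`_(\pi(k)^'))%N; split.
- by rewrite partnC.
- exact: coprime_partC.
- by apply: (@pnat_coprime \pi(k)); rewrite ?part_pnat // -coprime_pi'.
- by rewrite coprime_sym (@pnat_coprime \pi(k)) ?part_pnat ?pnat_pi.
Qed.

Lemma maxl_scale d S N r y : (0 < N)%N -> (exists2 z, S z & N%:Z *: y = (N * r)%N%:Z *: z) ->
  exists2 z, S z & y = r%:Z *: z.
Proof.
move=> N0 [z Sz e]; exists z => //; apply/rowP => i; move/rowP/(_ i): e.
rewrite !mxE PoszM -mulrA => /mulfI; apply.
by rewrite eqz_nat -lt0n.
Qed.

Lemma scale_coprime_split (r1 r2 : nat) (y z1 z2 : 'rV[int]_n.+1) : (0 < r1)%N ->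
  coprime r1 r2 -> y = r1%:Z *: z1 -> y = r2%:Z *: z2 ->
  exists w, z1 = r2%:Z *: w /\ y = (r1 * r2)%N%:Z *: w.
Proof.
move=> r10 co ey ey2.
have h i : (r2%:Z %| z1 0%R i)%Z.
  apply: (@dvdz_gauss _ r1); first by rewrite coprime_sym.
  have -> : r1%:Z * z1 0 i = r2%:Z * z2 0 i.
    by have := congr1 (fun M : 'rV_n.+1 => M 0 i) ey2; rewrite ey !mxE.
  by rewrite dvdz_mulr.
have ez1 : z1 = r2%:Z *: \row_i (z1 0%R i %/ r2)%Z.
  by apply/rowP => i; rewrite mxE [X in _ * X]mxE mulrC divzK.
exists (\row_i (z1 0%R i %/ r2)%Z); split=> //.
by rewrite ey {1}ez1 scalerA -PoszM.
Qed.

(** The denominator is split as r1 r2 with r1 prime to k' and r2 prime to k; y / r1 is tested on [S]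
    and y / r2 on [S']. A test vector of [S] is moved into the intersection by multiplication with
    k', which is prime to d r1. *)
Lemma maxl_meet k k' d d' S S' : (0 < k)%N -> (0 < k')%N -> coprime k k' ->
  idx k S -> idx k' S' -> maxl d S -> maxl d' S' -> maxl (d * d') (S `&` S').
Proof.
move=> k0 k'0 kk' iS iS' [isoS maxS] [isoS' maxS'].
have dk := iso_idx_dvd k0 iS isoS; have dk' := iso_idx_dvd k'0 iS' isoS'.
have dd' : coprime d d'.
  by apply: coprime_dvdl dk _; apply: coprime_dvdr dk' _; rewrite coprimeXl // coprimeXr.
split.
  move=> x [/isoS + /isoS']; rewrite !dvd2_bil; exact: dvdz_coprime.
move=> r y r0 hy hyz.
have [r1 [r2 [er r12 r1k' r2k]]] := coprime_split r0 k0 k'0 kk'.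
have [r10 r20] : (0 < r1 /\ 0 < r2)%N by move: r0; rewrite er muln_gt0 => /andP[].
have [z1 Sz1 ey1] : exists2 z, S z & y = r1%:Z *: z.
  apply: maxS => // [|z Sz].
    move: hy; rewrite !dvd2_bil; apply: dvdz_nat.
    by apply/dvdnP; exists (d' * r2 ^ 2)%N; rewrite er; ring.
  apply: (@dvdz_gauss _ k').
    by rewrite coprimeMl r1k' andbT; apply: coprime_dvdl dk _; rewrite coprimeXl.
  rewrite -bilZr; apply: dvdz_nat (hyz _ _).
    by apply/dvdnP; exists (d' * r2)%N; rewrite er; ring.
  split; last exact: idx_scale.
  by have [B [eB _]] := iS; rewrite eB; apply: rspanZ; rewrite -eB.
have [z2 Sz2 ey2] : exists2 z, S' z & y = r2%:Z *: z.
  apply: maxS' => // [|z Sz].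
    move: hy; rewrite !dvd2_bil; apply: dvdz_nat.
    by apply/dvdnP; exists (d * r1 ^ 2)%N; rewrite er; ring.
  apply: (@dvdz_gauss _ k).
    rewrite coprimeMl r2k andbT; apply: coprime_dvdl dk' _; rewrite coprimeXl //.
    by rewrite coprime_sym.
  rewrite -bilZr; apply: dvdz_nat (hyz _ _).
    by apply/dvdnP; exists (d * r1)%N; rewrite er; ring.
  split; first exact: idx_scale.
  by have [B [eB _]] := iS'; rewrite eB; apply: rspanZ; rewrite -eB.
have [w [ew ey]] := scale_coprime_split r10 r12 ey1 ey2.
exists w; last by rewrite er.
split.
  apply: (idx_coprime iS r2k); first by rewrite -ew.
  exact: idx_scale.
apply: (idx_coprime iS' r1k'); last exact: idx_scale.
suff -> : r1%:Z *: w = z2 by [].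
apply/rowP => i; have := congr1 (fun M : 'rV_n.+1 => M 0 i) ey2.
rewrite ey !mxE PoszM -mulrA mulrCA => /mulfI-> //.
by rewrite eqz_nat -lt0n.
Qed.

(** On the overlattice Q is divisible by the part d1 of d at the primes of k. For maximality the
    denominator is split again: y / r1 lies in [S] by maximality of [S], and y / r2 in Z^n by
    maximality of Z^n. *)
Lemma maxl_addk k k' d S : (0 < k)%N -> (0 < k')%N -> coprime k k' ->
  idx (k * k') S -> maxl d S -> maxl (gcdn d (k ^ 2)) (addk S k).
Proof.
move=> k0 k'0 kk' iS [isoS maxS].
have kk'0 : (0 < k * k')%N by rewrite muln_gt0 k0.
have [iS1 _] := addk_idx k0 k'0 kk' iS.
have [B1 [eB1 _]] := iS1; have [B [eB _]] := iS.
have dk := iso_idx_dvd kk'0 iS isoS.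
set d1 := gcdn d (k ^ 2); set d2 := gcdn d (k' ^ 2).
have d1k' : coprime d1 k'.
  by apply: coprime_dvdl (dvdn_gcdr _ _) _; rewrite coprimeXl.
have d2k : coprime d2 k.
  by apply: coprime_dvdl (dvdn_gcdr _ _) _; rewrite coprimeXl // coprime_sym.
have d12 : coprime d1 d2.
  by apply: coprime_dvdr (dvdn_gcdr _ _) _; rewrite coprimeXr.
have ed : d = (d1 * d2)%N.
  apply/eqP; rewrite eqn_dvd Gauss_dvd // !dvdn_gcdl !andbT.
  have : (d %| gcdn (d * k' ^ 2) (k ^ 2 * k' ^ 2))%N by rewrite dvdn_gcd dvdn_mulr //= -expnMn.
  rewrite -muln_gcdl -/d1 => h.
  have : (d %| gcdn (d1 * d) (d1 * k' ^ 2))%N by rewrite dvdn_gcd h dvdn_mull.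
  by rewrite -muln_gcdr.
split.
  move=> x S1x; rewrite dvd2_bil; apply: (@dvdz_gauss _ (k' ^ 2)); first by rewrite coprimeXr.
  have := isoS _ (addk_scale iS S1x); rewrite dvd2_bil bilZl bilZr mulrA -PoszM mulnn.
  have [q ->] := dvdzP (evenf_bil x eG); rewrite mulrA !mulzK //.
  by apply: dvdz_nat; apply: dvdn_gcdl.
(* This is the case where y lies in [S]; the general case follows by scaling both y and r with k
   k'. *)
have main r y : (0 < r)%N -> S y -> (2 * (d1 * r ^ 2)%N%:Z %| bil G y y)%Z ->
    (forall z, addk S k z -> ((d1 * r)%N%:Z %| bil G y z)%Z) ->
    exists2 z, addk S k z & y = r%:Z *: z.
  move=> r0 Sy hy hyz.
  have [r1 [r2 [er r12 r1k' r2k]]] := coprime_split r0 k0 k'0 kk'.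
  have [r10 r20] : (0 < r1 /\ 0 < r2)%N by move: r0; rewrite er muln_gt0 => /andP[].
  have r1d2 : coprime r1 d2 by apply: coprime_dvdr (dvdn_gcdr _ _) _; rewrite coprimeXr.
  have [z1 Sz1 ey1] : exists2 z, S z & y = r1%:Z *: z.
    apply: maxS => // [|z Sz].
      rewrite dvd2_bil ed mulnAC; apply: dvdz_coprime.
      - by rewrite coprimeMl d12 coprimeXl.
      - move: hy; rewrite dvd2_bil; apply: dvdz_nat.
        by apply/dvdnP; exists (r2 ^ 2)%N; rewrite er; ring.
      - by have := isoS _ Sy; rewrite dvd2_bil; apply: dvdz_nat; apply: dvdn_gcdl.
    rewrite ed mulnAC; apply: dvdz_coprime; first by rewrite coprimeMl d12.
      apply: dvdz_nat (hyz z (addk_sub k Sz)).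
      by apply/dvdnP; exists r2; rewrite er; ring.
    apply: (@dvdz_nat _ d); first exact: dvdn_gcdl.
    by rewrite eB in isoS Sy Sz; apply: (iso_bil eG.1 isoS).
  have [z2 _ ey2] : exists2 z, [set: 'rV[int]_n.+1] z & y = r2%:Z *: z.
    apply: maxT.2 => // [|z _].
      move: hy; rewrite !dvd2_bil; apply: dvdz_nat.
      by apply/dvdnP; exists (d1 * r1 ^ 2)%N; rewrite er; ring.
    rewrite mul1n; apply: (@dvdz_gauss _ k) => //; rewrite -bilZr.
    apply: dvdz_nat (hyz _ (idx_scale z iS1)).
    by apply/dvdnP; exists (d1 * r1)%N; rewrite er; ring.
  have [w [ew ey]] := scale_coprime_split r10 r12 ey1 ey2.
  exists w; last by rewrite er.
  apply: (idx_coprime iS1 r2k); last exact: idx_scale.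
  by apply: addk_sub; rewrite -ew.
move=> r y r0 hy hyz; apply: (@maxl_scale d _ (k * k')) => //.
apply: main; first by rewrite muln_gt0 kk'0.
- exact: idx_scale.
- rewrite dvd2_bil bilZl bilZr; move: hy; have [q ->] := dvdzP (evenf_bil y eG).
  rewrite [2 * _]mulrC dvdz_mul2r // !mulrA mulzK // -PoszM => h.
  rewrite expnMn [X in (X%:Z %| _)%Z](_ : _ = (k * k' * (k * k') * (d1 * r ^ 2))%N); last by ring.
  by rewrite (PoszM (k * k' * (k * k'))) dvdz_mul.
- move=> z Sz; rewrite bilZl (mulnCA d1) (PoszM (k * k')) dvdz_mul //.
  exact: hyz.
Qed.

Definition maxL S := exists2 d, (0 < d)%N & maxl d S.

Definition Amax k : set (set 'rV[int]_n.+1) := [set S | idx k S /\ maxL S].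

Lemma Amax_finite k : (0 < k)%N -> finite_set (Amax k).
Proof.
move=> k0; have [C [s _ hs]] := @cov_det n.+1 k k0.
apply: (sub_finite_set (B := [set` s])); last exact: finite_seq.
by move=> S [[B [eS dB]] _]; apply: hs; exists B.
Qed.

Definition acount k := #|` fset_set (Amax k)|%fset.

(** Intersection is a bijection from pairs of maximal lattices of indices k and k' to those of index
    k k'; the inverse sends S to S + k Z^n and S + k' Z^n. *)
Lemma acount_mul k k' : (0 < k)%N -> (0 < k')%N -> coprime k k' ->
  acount (k * k') = (acount k * acount k')%N.
Proof.
move=> k0 k'0 kk'; have kk'0 : (0 < k * k')%N by rewrite muln_gt0 k0.
have k'k : coprime k' k by rewrite coprime_sym.
have f1 := Amax_finite k0; have f2 := Amax_finite k'0; have f := Amax_finite kk'0.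
pose F (P : set 'rV[int]_n.+1 * set 'rV[int]_n.+1) := P.1 `&` P.2.
have key S S' : Amax k S -> Amax k' S' ->
    [/\ Amax (k * k') (S `&` S'), addk (S `&` S') k = S & addk (S `&` S') k' = S'].
  move=> [iS [d d0 mS]] [iS' [d' d'0 mS']].
  have iSS := idx_meet kk' iS iS'.
  have [iA iA'] := addk_idx k0 k'0 kk' iSS.
  split.
  - split=> //; exists (d * d')%N; first by rewrite muln_gt0 d0.
    exact: (maxl_meet k0 k'0 kk').
  - apply: (idx_sub_eq k0 iA iS) => _ [y [Sy _] [z ->]].
    have [B [eB _]] := iS; rewrite eB; apply: rspanD; first by rewrite -eB.
    by rewrite -eB; apply: idx_scale.
  - apply: (idx_sub_eq k'0 iA' iS') => _ [y [_ Sy] [z ->]].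
    have [B [eB _]] := iS'; rewrite eB; apply: rspanD; first by rewrite -eB.
    by rewrite -eB; apply: idx_scale.
have eA : fset_set (Amax (k * k')) =
    [fset F P | P in (fset_set (Amax k) `*` fset_set (Amax k'))%fset]%fset.
  apply/fsetP => S; rewrite in_fset_set //; apply/idP/imfsetP => /=.
    move/set_mem => -[iS [d d0 mS]].
    have [i1 i2] := addk_idx k0 k'0 kk' iS.
    exists (addk S k, addk S k'); last by rewrite /F /= addk_meet.
    rewrite in_fsetM /= !in_fset_set //; apply/andP; split; apply/mem_set; split=> //.
      exists (gcdn d (k ^ 2)); first by rewrite gcdn_gt0 d0.
      exact: (maxl_addk k0 k'0 kk').
    exists (gcdn d (k' ^ 2)); first by rewrite gcdn_gt0 d0.
    by apply: (maxl_addk k'0 k0 k'k) => //; rewrite mulnC.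
  move=> [[S1 S2]]; rewrite in_fsetM /= !in_fset_set // => /andP[].
  by move=> /set_mem a1 /set_mem a2 ->; apply/mem_set; have [] := key _ _ a1 a2.
rewrite /acount eA card_in_imfset /= ?cardfs_prod //.
move=> [S1 S2] [T1 T2]; rewrite !in_fsetM /= !in_fset_set // => /andP[].
move=> /set_mem s1 /set_mem s2 /andP[/set_mem t1 /set_mem t2] e.
have [_ e1 e2] := key _ _ s1 s2; have [_ e1' e2'] := key _ _ t1 t2.
by move: e; rewrite /F /= => e; congr (_, _); [rewrite -[LHS]e1 -[RHS]e1' e | rewrite -[LHS]e2 -[RHS]e2' e].
Qed.

Lemma acount1 : acount 1 = 1%N.
Proof.
rewrite /acount (_ : Amax 1 = [set setT]) ?fset_set1 ?cardfs1 //.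
apply/seteqP; split=> [S [[B [-> dB]] _]|S ->]; last first.
  by split; [exists 1%:M; rewrite rspan1 det1 | exists 1%N].
rewrite -(rspan1 n.+1) -[B]mulmx1 rspan_mulU // unitmxE; exact: absz1_unit.
Qed.

Lemma acount_cov k N : (0 < k)%N -> cov (Amax k) N -> (acount k <= N)%N.
Proof.
move=> k0 [s ss hs]; apply: leq_trans ss.
apply: (@leq_trans #|` [fset S in s]%fset|); last first.
  by rewrite card_fseq size_undup.
apply: fsubset_leq_card; apply/fsubsetP => S.
by rewrite (in_fset_set (Amax_finite k0)) => /set_mem/hs; rewrite in_fset.
Qed.

Lemma acount_uniq k (s : seq (set 'rV[int]_n.+1)) : (0 < k)%N -> uniq s ->
  (forall S, S \in s -> Amax k S) -> (size s <= acount k)%N.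
Proof.
move=> k0 us hs; rewrite -(undup_id us) -card_fseq.
apply: fsubset_leq_card; apply/fsubsetP => S; rewrite in_fset => /hs h.
by rewrite (in_fset_set (Amax_finite k0)); apply/mem_set.
Qed.

(** By comparison of determinants the Gram matrix is p^m H with det H prime to p. The p-part r1 of a
    denominator is cancelled by inverting [H], the rest r2 by maximality of Z^n. *)
Lemma unimod_max p m l S : prime p -> n.+1 = l.*2 -> ~~ (p%:Z %| \det G)%Z ->
  idx (p ^ (l * m)) S -> iso G (p%:Z ^+ m) S -> maxl (p ^ m) S.
Proof.
move=> pp nl pG iS isoS; have [B [eB dB]] := iS.
have p0 : p%:Z != 0 by rewrite eqz_nat -lt0n prime_gt0.
set k := (p ^ (l * m))%N in iS dB.
have k0 : (0 < k)%N by rewrite expn_gt0 prime_gt0.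
have isoB : iso G (p%:Z ^+ m) (rspan B) by rewrite -eB.
split; first by rewrite Posz_exp.
have [H eH gramH] := iso_gram eG.1 (expf_neq0 m p0) isoB.
have pH : ~~ (p%:Z %| \det H)%Z.
  move/(congr1 determinant): gramH; rewrite detZ !det_mulmx det_tr => /(congr1 absz).
  rewrite !abszM dB abszX abszX /= mulnAC -expnM.
  have -> : (k * k = p ^ (m * n.+1))%N.
    by rewrite /k nl -expnD -mul2n; congr expn; clear; nia.
  move=> /eqP; rewrite eqn_pmul2l ?expn_gt0 ?prime_gt0 // => /eqP e.
  by rewrite dvdzE -e -dvdzE.
have H0 : (0 < `|\det H|)%N.
  by rewrite absz_gt0; apply: contraNneq pH => ->; rewrite dvdz0.
have cH : coprime p `|\det H| by rewrite prime_coprime // -[X in (X %| _)%N]/`|p%:Z|%N -dvdzE.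
have main r y : (0 < r)%N -> S y -> (2 * (p ^ m * r ^ 2)%N%:Z %| bil G y y)%Z ->
    (forall z, S z -> ((p ^ m * r)%N%:Z %| bil G y z)%Z) -> exists2 z, S z & y = r%:Z *: z.
  move=> r0 Sy hy hyz.
  have [r1 [r2 [er r12 r1H r2p]]] := coprime_split r0 (prime_gt0 pp) H0 cH.
  have [r10 r20] : (0 < r1 /\ 0 < r2)%N by move: r0; rewrite er muln_gt0 => /andP[].
  have r2k : coprime r2 k by rewrite coprimeXr.
  have [z2 _ ey2] : exists2 z, [set: 'rV[int]_n.+1] z & y = r2%:Z *: z.
    apply: maxT.2 => // [|z _].
      move: hy; rewrite !dvd2_bil; apply: dvdz_nat.
      by apply/dvdnP; exists (p ^ m * r1 ^ 2)%N; rewrite er; ring.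
    rewrite mul1n; apply: (@dvdz_gauss _ k) => //; rewrite -bilZr.
    apply: dvdz_nat (hyz _ (idx_scale z iS)).
    by apply/dvdnP; exists (p ^ m * r1)%N; rewrite er; ring.
  have [z1 Sz1 ey1] : exists2 z, S z & y = r1%:Z *: z.
    have [z ez] : rspan B y by rewrite -eB.
    have hz j : (r1%:Z %| z 0%R j)%Z.
      apply: (dvdz_gauss r1H).
      have : (r1%:Z %| \det H * z 0%R j)%Z.
        have -> : \det H * z 0 j = (z *m H *m \adj H) 0 j.
          by rewrite -mulmxA mul_mx_adj mul_mx_scalar mxE.
        rewrite mxE; apply: rpred_sum => i _; apply: dvdz_mulr.
        have : ((p ^ m * r)%N%:Z %| bil G y (delta_mx 0%R i *m B))%Z.
          by apply: hyz; rewrite eB; exists (delta_mx 0 i).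
        rewrite ez bil_mulmx gramH bilZ PoszM Posz_exp dvdz_mul2l ?expf_neq0 //.
        have -> : bil H z (delta_mx 0 i) = (z *m H) 0 i by rewrite /bil trmx_delta -colE mxE.
        by apply: dvdz_nat; rewrite er dvdn_mulr.
      by rewrite !dvdzE !abszM.
    exists ((\row_j (z 0%R j %/ r1)%Z) *m B); first by rewrite eB; eexists.
    rewrite ez scalemxAl; congr (_ *m B); apply/rowP => j.
    by rewrite mxE [X in _ * X]mxE mulrC divzK.
  have [w [ew ey]] := scale_coprime_split r10 r12 ey1 ey2.
  exists w; last by rewrite er.
  by apply: (idx_coprime iS r2k); [rewrite -ew | apply: idx_scale].
move=> r y r0 hy hyz; apply: (@maxl_scale 1%N _ k) => //.
apply: main; first by rewrite muln_gt0 k0.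
- exact: idx_scale.
- rewrite dvd2_bil bilZl bilZr; move: hy; have [q ->] := dvdzP (evenf_bil y eG).
  rewrite [2 * _]mulrC dvdz_mul2r // !mulrA mulzK // -PoszM => h.
  rewrite expnMn [X in (X%:Z %| _)%Z](_ : _ = (k * k * (p ^ m * r ^ 2))%N); last by ring.
  by rewrite (PoszM (k * k)) dvdz_mul.
- move=> z Sz; rewrite bilZl (mulnCA (p ^ m)%N) (PoszM k) dvdz_mul //.
  exact: hyz.
Qed.

(** If p^3 divided an elementary divisor of [H], some basis vector z of the lattice could be
    replaced by z / p: its value Q and its products with the lattice would still be divisible by
    p^m. So each of the n + 1 elementary divisors has valuation at most 2. *)
Lemma max_gram_bound p m B H : prime p -> \det B != 0 -> \det H != 0 ->
  B *m G *m B^T = (p ^ m)%N%:Z *: H -> evenf H -> maxl (p ^ m) (rspan B) ->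
  (logn p `|\det H| <= 2 * n.+1)%N.
Proof.
move=> pp B0 H0 gramH eH [_ maxB].
have p0 : (0 < p)%N by rewrite prime_gt0.
have [P [R [d [uP uR eqH ->]]]] := smith_square H.
have d0 i : d 0 i != 0.
  apply: contraNneq H0 => di; rewrite eqH !det_mulmx det_diag (bigD1 i) //= di.
  by rewrite mul0r mulr0 mul0r.
have hd i : (logn p `|d 0%R i| <= 2)%N.
  rewrite leqNgt; apply/negP => hi.
  have p3 : (p%:Z ^+ 3 %| d 0%R i)%Z by rewrite pfactor_dvdz.
  pose z := row i (invmx P).
  have zH : z *m H = d 0 i *: row i R.
    rewrite /z eqH -row_mul -mulmxA mulKmx // row_mul; apply/rowP => j.
    rewrite !mxE (bigD1 i) //= big1 ?addr0 => [|c /negPf ci]; last first.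
      by rewrite !mxE eq_sym ci mulr0n mul0r.
    by rewrite !mxE eqxx mulr1n.
  have bH w : bil H z w = d 0 i * (row i R *m w^T) 0 0.
    by rewrite /bil zH -scalemxAl mxE.
  have [_ [w ->] ev] : exists2 v, rspan B v & z *m B = p%:Z *: v.
    apply: maxB => // [|_ [w ->]]; rewrite bil_mulmx gramH bilZ.
      rewrite PoszM mulrCA dvdz_mul //.
      have h2 := evenf_bil z eH; have h3 : (p%:Z ^+ 3 %| bil H z z)%Z by rewrite bH dvdz_mulr.
      (* For p = 2 the required divisor 2 p^2 is p^3 itself; for odd p the factor 2 comes from the
         evenness of [H]. *)
      have [p2|p2] := eqVneq p 2; first by move: h3; rewrite p2.
      have c2 : coprime 2 (p ^ 2) by rewrite coprimeXr // prime_coprime // dvdn_prime2 // eq_sym.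
      rewrite Gauss_dvdz ?h2 ?andbT //=.
      by apply: dvdz_trans h3; rewrite Posz_exp dvdz_exp2l.
    rewrite PoszM dvdz_mul // bH; apply: dvdz_mulr; apply: dvdz_trans p3.
    by rewrite -[X in (X %| _)%Z]expr1 dvdz_exp2l.
  have : (p%:Z %| \det (invmx P))%Z.
    rewrite (expand_det_row _ i); apply: rpred_sum => j _; apply: dvdz_mulr.
    have -> : invmx P i j = p%:Z * w 0 j.
      have : \det B * z 0 j = \det B * (p%:Z * w 0 j).
        have -> : \det B * z 0 j = (z *m B *m \adj B) 0 j.
          by rewrite -mulmxA mul_mx_adj mul_mx_scalar [RHS]mxE.
        rewrite ev -scalemxAl -mulmxA mul_mx_adj mul_mx_scalar mxE [X in _ * X]mxE; ring.
      by move/(mulfI B0); rewrite mxE.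
    exact: dvdz_mulr.
  by rewrite dvdzE unitmx_int_det ?unitmx_inv //= dvdn1 => /eqP p1; move: pp; rewrite p1.
have [_] : (0 < \prod_i `|d 0%R i|)%N /\ (logn p (\prod_i `|d 0%R i|) <= \sum_(i < n.+1) 2)%N.
  apply: (big_ind2 (fun x s => (0 < x)%N /\ (logn p x <= s)%N)).
  - by rewrite logn1.
  - by move=> x1 s1 x2 s2 [x10 h1] [x20 h2]; rewrite muln_gt0 x10 lognM // leq_add.
  - by move=> i _; rewrite absz_gt0.
by rewrite sum_nat_const card_ord mulnC.
Qed.

End MaximalLattices.

Section Counts.
Variables (l : nat) (G : 'M[int]_(l.+1.*2)).
Let n := (l.*2).+1.
Hypotheses (eG : evenf G) (G0 : \det G != 0).
Hypotheses (maxT : maxl (n := n) G 1 setT).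
Hypotheses (norm1 : forall d : nat, iso G d%:Z setT -> d = 1%N).
Local Notation a := (acount (n := n) G).

(** The norm divides the square of the index by [iso_idx_dvd], so it is a power of p; saturation is
    maximality with denominator 1. *)
Lemma Amax_prime_pow p k (S : set 'rV[int]_n.+1) : prime p -> Amax (n := n) G (p ^ k) S ->
  exists m (B : 'M[int]_n.+1), [/\ S = rspan B, `|\det B|%N = (p ^ k)%N,
    iso G (p%:Z ^+ m) S, sat G (p%:Z ^+ m) S & maxl (n := n) G (p ^ m) S].
Proof.
move=> pp [iS [d d0 mS]]; have [B [eB dB]] := iS.
have pk0 : (0 < p ^ k)%N by rewrite expn_gt0 prime_gt0.
have /(dvdn_pfactor _ _ pp)[m _ ed] : (d %| p ^ (k * 2))%N.
  by rewrite expnM; apply: (iso_idx_dvd eG norm1 pk0 iS mS.1).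
rewrite {}ed in mS.
exists m, B; have [isoS maxS] := mS; rewrite Posz_exp in isoS; split=> //.
split=> // x hx hxz; have [z Sz ->] : exists2 z, S z & x = 1%:Z *: z; last by rewrite scale1r.
by apply: maxS => //; rewrite ?exp1n ?muln1 ?Posz_exp.
Qed.

(** For m = 1 the upper bound of [good_upper] is attained by the lattices of [good_lower], which are
    maximal by [unimod_max]. *)
Lemma acount_good p : prime p -> odd p -> ~~ (p%:Z %| \det G)%Z ->
  (exists s, (-1) ^+ l.+1 * \det G = s ^+ 2) ->
  [/\ forall k, (0 < a (p ^ k))%N -> (l.+1 %| k)%N,
      forall m, (a (p ^ (l.+1 * m)) <= \prod_(i < l.+1) (1 + m * p ^ (i * m)))%N &
      a (p ^ l.+1) = (\prod_(i < l.+1) (1 + p ^ i))%N].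
Proof.
move=> pp op pG [s es].
have sG : split_form p G by split=> //; exists s; rewrite es subrr dvdz0.
have pk0 k : (0 < p ^ k)%N by rewrite expn_gt0 prime_gt0.
have upper m : (a (p ^ (l.+1 * m)) <= \prod_(i < l.+1) (1 + m * p ^ (i * m)))%N.
  apply: acount_cov => //; apply: cov_sub (good_upper m pp op sG).2 => S AS.
  have [m' [B [eS dB _ satS _]]] := Amax_prime_pow pp AS.
  exists B, (l.+1 * m)%N; split=> //.
  have := (good_upper m' pp op sG).1 B _ dB; rewrite -eS => /(_ satS)/eqP.
  by rewrite eqn_mul2l /= => /eqP ->.
split=> //.
- move=> k; rewrite cardfs_gt0 => /fset0Pn[S].
  rewrite (in_fset_set (Amax_finite G (pk0 k))) => /set_mem AS.
  have [m [B [eS dB _ satS _]]] := Amax_prime_pow pp AS.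
  by rewrite eS in satS; rewrite ((good_upper m pp op sG).1 B _ dB satS) dvdn_mulr.
apply/eqP; rewrite eqn_leq; apply/andP; split.
  have := upper 1%N; rewrite muln1; congr (_ <= _)%N.
  by apply: eq_bigr => i _; rewrite mul1n muln1.
have [t [ut <- ht]] := good_lower pp op sG.
apply: acount_uniq => // S /ht[B [eS dB iS]].
split; first by exists B.
exists (p ^ 1)%N; first exact: pk0.
apply: (unimod_max (l := l.+1) eG maxT pp) => //.
by exists B; rewrite muln1.
Qed.

(** Determinants give 2k + c = 2(l+1) m + v, where c is the valuation of det G and v <= 4(l+1) that
    of the Gram determinant divided by its power of p^m. So m is at most (k + c) / (l+1) and k at
    most (l+1) m + 2(l+1), and [bad_bound] applies to each such m. *)
Lemma acount_bad p : prime p -> exists C c, forall k,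
  (a (p ^ k) <= C * (k + c).+1 ^ (2 * l.+1).+1 * p ^ ((k + c) %/ l.+1 * 'C(l.+1, 2)))%N.
Proof.
move=> pp; set c := logn p `|\det G|.
have pG : ~~ (p%:Z ^+ c.+1 %| \det G)%Z by rewrite pfactor_dvdz // ltnn.
have [C hC] := bad_bound l.+1 pp c (l.+1.*2); exists C, c => k.
have pk0 : (0 < p ^ k)%N by rewrite expn_gt0 prime_gt0.
have p0 : p%:Z != 0 by rewrite eqz_nat -lt0n prime_gt0.
set M := ((k + c) %/ l.+1)%N.
have step i : (i < M.+1)%N -> cov [set S | exists (B : 'M[int]_(l.+1.*2)) k,
   [/\ S = rspan B, `|\det B|%N = (p ^ k)%N, (k <= l.+1 * i + l.+1.*2)%N & iso G (p%:Z ^+ i) S]]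
   (C * (M.+1 ^ (2 * l.+1) * p ^ (M * 'C(l.+1, 2)))).
  rewrite ltnS => iM; apply: cov_leq (hC i G eG pG).
  rewrite leq_mul // leq_mul ?leq_exp2r // leq_pexp2l ?prime_gt0 //.
  by rewrite leq_mul2r iM orbT.
apply: leq_trans (acount_cov pk0 (cov_sub _ (cov_ltn step))) _.
  move=> S AS; have [m [B [eS dB iS _ mS]]] := Amax_prime_pow pp AS.
  have B0 : \det B != 0 by rewrite -absz_gt0 dB.
  have iB := iS; rewrite eS in iB; have [H eH gramH] := iso_gram eG.1 (expf_neq0 m p0) iB.
  have := congr1 determinant gramH; rewrite detZ !det_mulmx det_tr -exprM => eD.
  have H0 : \det H != 0.
    apply/eqP => h0; move/eqP: eD; rewrite h0 mulr0 !mulf_eq0 (negPf B0) (negPf G0) //.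
  have lD : (k + c + k = m * n.+1 + logn p `|\det H|)%N.
    move: (congr1 (logn p \o absz) eD); rewrite /= !abszM dB abszX /=.
    by rewrite !lognM ?muln_gt0 ?absz_gt0 ?B0 ?G0 ?pk0 ?expn_gt0 ?prime_gt0 // !pfactorK.
  have hb : (logn p `|\det H| <= 2 * n.+1)%N.
    by rewrite eS in mS; apply: (max_gram_bound (m := m) pp B0 H0 _ eH mS); rewrite Posz_exp.
  have n2 : n.+1 = (2 * l.+1)%N by rewrite mul2n.
  exists m.
    by rewrite ltnS /M leq_divRL //; move: lD; rewrite n2; clear; nia.
  exists B, k; split=> //; move: lD hb; move: (logn p _) => v; rewrite n2 -mul2n; clear; nia.
rewrite -mulnA mulnCA leq_mul // mulnA -expnS leq_mul // leq_exp2r //.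
by rewrite ltnS /M leq_div.
Qed.

End Counts.

(** * Norms of lattices *)

Section Rational.
Variable F : fieldType.
Hypothesis charF : forall d : int, d != 0 -> d%:~R != 0 :> F.

Lemma ratr_frac (q : rat) (n d : int) : d != 0 -> q = n%:~R / d%:~R ->
  ratr q = n%:~R / d%:~R :> F.
Proof.
move=> d0 qE; have dR : d%:~R != 0 :> rat by rewrite intr_eq0.
have E : numq q * d = n * denq q.
  apply: (@intr_inj rat); rewrite !rmorphM /= numqE {1}qE.
  by rewrite mulrAC divfK.
rewrite /ratr; apply/eqP; rewrite eqr_div ?charF // -!rmorphM /= E //.
Qed.

Lemma ratr_char0B : {morph (@ratr F) : x y / x - y}.
Proof.
move=> x y; rewrite [LHS](@ratr_frac _ (numq x * denq y - numq y * denq x) (denq x * denq y)).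
- rewrite /ratr !rmorphB /= !rmorphM /=.
  by field; rewrite !charF ?denq_neq0.
- by rewrite mulf_neq0.
- rewrite !rmorphB /= !rmorphM /= !numqE.
  by field; rewrite !intr_eq0 !denq_neq0.
Qed.

Lemma ratr_char0M : {morph (@ratr F) : x y / x * y}.
Proof.
move=> x y; rewrite [LHS](@ratr_frac _ (numq x * numq y) (denq x * denq y)).
- by rewrite /ratr !rmorphM /=; field; rewrite !charF ?denq_neq0.
- by rewrite mulf_neq0.
- rewrite !rmorphM /= !numqE.
  by field; rewrite !intr_eq0 !denq_neq0.
Qed.

End Rational.

Section Padic.
Variable p : primeNat.

Lemma zp_nat (n k : nat) : (n%:R : Zp p) k = (n%:Z %% (p ^ k)%N)%Z.
Proof.
elim: n => [|n IH]; first by [].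
rewrite -natr1 /= IH modzDm; congr modz; lia.
Qed.

Lemma zp_int (a : int) k : (a%:~R : Zp p) k = (a %% (p ^ k)%N)%Z.
Proof.
case: a => n; first exact: zp_nat.
rewrite NegzE rmorphN /= -[n.+1%:~R]/(n.+1%:R) zp_nat modzNm.
by [].
Qed.

Lemma tofrac_int (a : int) : tofrac (a%:~R : Zp p) = a%:~R.
Proof. by rewrite rmorph_int. Qed.

(** A nonzero d is not 0 modulo p^|d|, since |d| < p^|d|. *)
Lemma Qp_char0 (d : int) : d != 0 -> d%:~R != 0 :> Qp p.
Proof.
move=> d0; rewrite -tofrac_int tofrac_eq0; apply: contra d0 => /eqP E.
have : (d%:~R : Zp p) `|d|%N = 0 by rewrite E /= mod0z.
rewrite zp_int => /dvdz_mod0P; rewrite dvdzE /= => h.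
apply: contraTT h => d0; rewrite gtnNdvd ?absz_gt0 //.
by apply: ltn_expl; apply: prime_gt1; apply: primeNatP.
Qed.

(** This is [ratr] with a fixed target, so that the structure of a ring morphism can be attached to
    it. *)
Definition rp (q : rat) : Qp p := ratr q.

Lemma rp_zmod : zmod_morphism rp.
Proof. exact: ratr_char0B Qp_char0. Qed.

Lemma rp_monoid : monoid_morphism rp.
Proof. by split; [exact: (ratr_int _ 1) | exact: ratr_char0M Qp_char0]. Qed.

HB.instance Definition _ := GRing.isZmodMorphism.Build rat (Qp p) rp rp_zmod.
HB.instance Definition _ := GRing.isMonoidMorphism.Build rat (Qp p) rp rp_monoid.

Variable U : lmodType (Qp p).
Implicit Types (A : set U) (x y : U).

Lemma zspan_in A x : A x -> Zp_span A x.
Proof.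
move=> Ax; exists 1%N, (fun=> 1), (fun=> x); split=> //.
by rewrite big_ord1 rmorph1 scale1r.
Qed.

Lemma zspan0 A : Zp_span A 0.
Proof. by exists 0%N, (fun=> 0), (fun=> 0); split; [case | rewrite big_ord0]. Qed.

Lemma zspanD A x y : Zp_span A x -> Zp_span A y -> Zp_span A (x + y).
Proof.
move=> [m [c [a [Aa ->]]]] [m' [c' [a' [Aa' ->]]]].
exists (m + m')%N, (fun i => match fintype.split i with inl j => c j | inr j => c' j end),
  (fun i => match fintype.split i with inl j => a j | inr j => a' j end); split.
  by move=> i; case: fintype.splitP.
rewrite big_split_ord /=; congr (_ + _); apply: eq_bigr => i _.
  by rewrite (unsplitK (inl i)).
by rewrite (unsplitK (inr i)).
Qed.

Lemma zspanZ A (z : Zp p) x : Zp_span A x -> Zp_span A (tofrac z *: x).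
Proof.
move=> [m [c [a [Aa ->]]]]; exists m, (fun i => z * c i), a; split=> //.
by rewrite scaler_sumr; apply: eq_bigr => i _; rewrite scalerA rmorphM.
Qed.

Lemma zspanB A x y : Zp_span A x -> Zp_span A y -> Zp_span A (x - y).
Proof.
move=> hx hy; apply: zspanD => //; have := zspanZ (-1) hy.
by rewrite rmorphN1 scaleN1r.
Qed.

Lemma zspan_ind A (P : set U) : P 0 -> (forall x y, P x -> P y -> P (x + y)) ->
  (forall z x, P x -> P (tofrac z *: x)) -> A `<=` P -> Zp_span A `<=` P.
Proof.
move=> P0 PD PZ AP _ [m [c [a [Aa ->]]]]; apply: (big_ind P) => // i _.
by apply: PZ; apply: AP.
Qed.

End Padic.

(** If p divided the denominator of a / b or of b / a, reducing modulo p the relation over Z_p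
    between numerator and denominator would contradict lowest terms. Hence the local conditions that
    define [norm] have at most one solution. *)
Lemma rat_units (a b : rat) : 0 < a -> 0 < b ->
  (forall p : primeNat, (exists z, rp p a = rp p b * tofrac z) /\ (exists z, rp p b = rp p a * tofrac z)) ->
  a = b.
Proof.
move=> a0 b0 H; set q := a / b.
have q0 : 0 < q by rewrite divr_gt0.
have b0' : b != 0 by rewrite gt_eqF.
have a0' : a != 0 by rewrite gt_eqF.
have K (x y : int) : x != 0 -> y != 0 -> coprime `|x| `|y| ->
  (forall p : primeNat, exists z : Zp p, x%:~R = y%:~R * tofrac z :> Qp p) -> `|y|%N = 1%N.
  move=> x0 y0 cxy hz; case: (ltngtP `|y|%N 1%N) => //.
    by rewrite ltnS leqn0 absz_eq0 (negPf y0).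
  move=> y1; pose p := PrimeNat (pdiv_prime y1); have [z] := hz p.
  rewrite -!tofrac_int -rmorphM => /eqP; rewrite tofrac_eq => /eqP /(congr1 (fun x : Zp p => x 1%N)).
  rewrite /= !zp_int expn1 => E.
  have py : (pdiv `|y| %| `|y|)%N := pdiv_dvd _.
  have : (x %% pdiv `|y|)%Z = 0.
    by rewrite E modzMml; apply/dvdz_mod0P; rewrite dvdz_mulr // dvdzE.
  move=> /dvdz_mod0P; rewrite dvdzE /= => px.
  have : (pdiv `|y| %| gcdn `|x| `|y|)%N by rewrite dvdn_gcd px py.
  by rewrite (eqP cxy) dvdn1 => /eqP p1; have := pdiv_prime y1; rewrite p1.
have nq : numq q != 0 by rewrite numq_eq0 gt_eqF.
have rq p : rp p q = (numq q)%:~R / (denq q)%:~R by [].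
have d1 : `|denq q|%N = 1%N.
  apply: (K (numq q)) => //; first by rewrite coprime_num_den.
  move=> p; have [[z az] _] := H p; exists z.
  have rb : rp p b != 0 by rewrite fmorph_eq0.
  have E : rp p q = tofrac z by rewrite /q rmorphM fmorphV /= az mulrAC divff // mul1r.
  by rewrite -E rq mulrC divfK // Qp_char0.
have n1 : `|numq q|%N = 1%N.
  apply: (K (denq q)) => //; first by rewrite coprime_sym coprime_num_den.
  move=> p; have [_ [z az]] := H p; exists z.
  have ra : rp p a != 0 by rewrite fmorph_eq0.
  have E : (rp p q)^-1 = tofrac z.
    by rewrite -fmorphV /q invf_div rmorphM fmorphV /= az mulrAC divff // mul1r.
  by rewrite -E rq invf_div mulrC divfK // Qp_char0.
have : q = 1.
  rewrite -(divq_num_den q); have -> : denq q = 1 by have := denq_gt0 q; lia.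
  have n0 : 0 < numq q by rewrite numq_gt0.
  by have -> : numq q = 1 by lia.
by move=> /divr1_eq.
Qed.

Lemma common_den (I : finType) (f : I -> rat) :
  exists2 N : nat, (0 < N)%N & forall i, f i * N%:R \is a Num.int.
Proof.
exists (\prod_i `|denq (f i)|)%N; first by rewrite prodn_gt0 // => i; rewrite absz_gt0.
move=> i; rewrite (bigD1 i) //= natrM mulrA rpredM ?natr_int //.
have -> : `|denq (f i)|%:R = (denq (f i))%:~R :> rat by rewrite -{2}[denq (f i)]absz_denq.
by rewrite -numqE intr_int.
Qed.

(** * The norm as a global generator *)

Section Norm.
Variables (V : vectType rat) (beta : V -> V -> rat).
Hypothesis bD : forall u v w, beta (u + v) w = beta u w + beta v w.
Hypothesis bZ : forall a u w, beta (a *: u) w = a * beta u w.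
Hypothesis bC : forall u v, beta u v = beta v u.
Hypothesis bnd : forall u, (forall v, beta u v = 0) -> u = 0.
Hypothesis V0 : exists v : V, v != 0.
Implicit Types (M : set V) (u v w : V).

Definition qf v : rat := beta v v / 2.

Lemma b0 w : beta 0 w = 0. Proof. by rewrite -(scale0r 0) bZ mul0r. Qed.
Lemma bDr u v w : beta w (u + v) = beta w u + beta w v.
Proof. by rewrite bC bD !(bC w). Qed.
Lemma bZr a u w : beta w (a *: u) = a * beta w u.
Proof. by rewrite bC bZ bC. Qed.

Lemma b_suml (I : Type) (r : seq I) (c : I -> rat) (f : I -> V) w :
  beta (\sum_(i <- r) c i *: f i) w = \sum_(i <- r) c i * beta (f i) w.
Proof.
by elim: r => [|i r IH]; rewrite ?big_nil ?b0 // !big_cons bD bZ IH.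
Qed.

Lemma b_sumr (I : Type) (r : seq I) (c : I -> rat) (f : I -> V) w :
  beta w (\sum_(i <- r) c i *: f i) = \sum_(i <- r) c i * beta w (f i).
Proof. by rewrite bC b_suml; apply: eq_bigr => i _; rewrite bC. Qed.

Lemma qfD u v : qf (u + v) = qf u + qf v + beta u v.
Proof. by rewrite /qf bD !bDr (bC v u); field. Qed.

Lemma qfZ a u : qf (a *: u) = a ^+ 2 * qf u.
Proof. by rewrite /qf bZ bZr; field. Qed.

Definition subgp M := M 0 /\ forall u v, M u -> M v -> M (u - v).

Lemma subgpN M u : subgp M -> M u -> M (- u).
Proof. by move=> [M0 MB] Mu; rewrite -(sub0r u); apply: MB. Qed.

Lemma subgpD M u v : subgp M -> M u -> M v -> M (u + v).
Proof. by move=> sM Mu Mv; rewrite -(opprK v); apply: sM.2 => //; apply: subgpN. Qed.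

Lemma subgp_mulz M u (k : int) : subgp M -> M u -> M (u *~ k).
Proof.
move=> sM Mu; have H n : M (u *+ n).
  by elim: n => [|n IH]; [rewrite mulr0n; exact: sM.1 | rewrite mulrS; apply: subgpD].
by case: k => n; [exact: H | rewrite NegzE mulrNz; apply: subgpN => //; exact: H].
Qed.

Lemma span_subgp m (g : m.-tuple V) : subgp [set v | inIntSpan g v].
Proof.
split=> [|u v [a ->] [b ->]].
  by exists [ffun=> 0]; rewrite big1 // => i _; rewrite ffunE mulr0z.
exists [ffun i => a i - b i]; rewrite -sumrB; apply: eq_bigr => i _.
by rewrite ffunE mulrzBr.
Qed.

Lemma span_gen m (g : m.-tuple V) (i : 'I_m) : inIntSpan g g`_i.
Proof.
exists [ffun j => (j == i)%:R]; rewrite (bigD1 i) //= ffunE eqxx mulr1z big1 ?addr0 // => j ji.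
by rewrite ffunE (negPf ji) mulr0z.
Qed.

Lemma lattice_subgp M : is_lattice M -> subgp M.
Proof. by move=> [m [g [-> _]]]; apply: span_subgp. Qed.

Lemma mulz_scale (u : V) (k : int) : u *~ k = k%:~R *: u.
Proof. by rewrite scaler_int. Qed.

Lemma lattice_full M : is_lattice M -> forall v, exists2 N : nat, (0 < N)%N & M (N%:R *: v).
Proof.
move=> lM v; have sM := lattice_subgp lM; have [m [g [ME dg]]] := lM.
have vg : v \in <<g>>%VS.
  have /eqP -> : <<g>>%VS == fullv by rewrite eqEdim subvf /= dg.
  exact: memvf.
have [N N0 HN] := common_den (fun i => coord g i v); exists N => //.
rewrite (coord_span vg) scaler_sumr; apply: (big_ind M) => [|x y|i _]; [exact: sM.1|exact: subgpD|].
rewrite scalerA mulrC; have /intrP[k ->] := HN i.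
rewrite -mulz_scale; apply: subgp_mulz => //.
rewrite ME; exact: span_gen.
Qed.

(* The last clause says that m is an integral combination of values of Q on M. *)
Definition isnorm M (m : rat) :=
  [/\ 0 < m, forall v, M v -> exists k : int, qf v = k%:~R * m &
   forall P : set rat, P 0 -> (forall x y, P x -> P y -> P (x - y)) ->
     (forall v, M v -> P (qf v)) -> P m].

Lemma isnorm_beta M m u v : subgp M -> isnorm M m -> M u -> M v -> exists k : int, beta u v = k%:~R * m.
Proof.
move=> sM [_ H _] Mu Mv; have [a aE] := H _ (subgpD sM Mu Mv).
have [b bE] := H _ Mu; have [c cE] := H _ Mv.
exists (a - b - c); rewrite (_ : beta u v = qf (u + v) - qf u - qf v); last by rewrite qfD; ring.
by rewrite aE bE cE !rmorphB /=; ring.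
Qed.

Definition formp (p : primeNat) (x y : 'rV[Qp p]_(\dim {:V})) : Qp p :=
  (x *m (\matrix_(i, j) ratr (beta (vbasis {:V})`_i (vbasis {:V})`_j)) *m y^T) ord0 ord0.

Lemma formp_to (p : primeNat) u v : formp (to_Vp p u) (to_Vp p v) = rp p (beta u v).
Proof.
set b := vbasis {:V}.
have -> : beta u v = \sum_(i < \dim {:V}) \sum_(j < \dim {:V}) coord b i u * beta b`_i b`_j * coord b j v.
  rewrite {1}(coord_vbasis (memvf u)) b_suml; apply: eq_bigr => i _.
  rewrite {1}(coord_vbasis (memvf v)) b_sumr mulr_sumr; apply: eq_bigr => j _.
  by rewrite [coord _ j v * _]mulrC mulrA.
rewrite /formp mxE rmorph_sum; under [RHS]eq_bigr do rewrite rmorph_sum.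
rewrite exchange_big /=; apply: eq_bigr => j _.
rewrite !mxE mulr_suml; apply: eq_bigr => i _.
by rewrite !mxE !rmorphM.
Qed.

Lemma formpDl (p : primeNat) x y z : @formp p (x + y) z = formp x z + formp y z.
Proof. by rewrite /formp !mulmxDl mxE. Qed.
Lemma formpZl (p : primeNat) c x z : @formp p (c *: x) z = c * formp x z.
Proof. by rewrite /formp -!scalemxAl mxE. Qed.
Lemma formpDr (p : primeNat) x y z : @formp p z (x + y) = formp z x + formp z y.
Proof. by rewrite /formp linearD mulmxDr mxE. Qed.
Lemma formpZr (p : primeNat) c x z : @formp p z (c *: x) = c * formp z x.
Proof. by rewrite /formp linearZ /= -scalemxAr mxE. Qed.

Lemma formpC (p : primeNat) x y : @formp p x y = formp y x.
Proof.
rewrite /formp; set A := \matrix_(_, _) _.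
have sA : A^T = A by apply/matrixP => i j; rewrite !mxE bC.
by rewrite -[in LHS](trmxK (x *m A *m y^T)) mxE !trmx_mul trmxK sA mulmxA.
Qed.

(** At each p, m lies in the local ideal because it is an integral combination of values of Q on
    [M]; conversely the values of Q at Z_p-combinations of vectors of [M] are multiples of m by
    polarization. Then [rat_units] identifies the value chosen by [norm]. *)
Lemma isnorm_norm M m : subgp M -> isnorm M m -> norm beta M = m.
Proof.
move=> sM nm; have [m0 mQ mgen] := nm.
have rm p : rp p m != 0 by rewrite fmorph_eq0 gt_eqF.
have key : forall p : primeNat,
   [set ratr m * tofrac z | z in [set: Zp p]] = norm_p beta (@lattice_p V p M).
  move=> p; rewrite -/(rp p m).
  have mult (x y : Qp p) : (exists z : Zp p, rp p m * tofrac z = x) -> (exists z : Zp p, rp p m * tofrac z = y) ->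
    exists z : Zp p, rp p m * tofrac z = x + y.
    by move=> [z <-] [z' <-]; exists (z + z'); rewrite rmorphD mulrDr.
  have multZ (c : Zp p) (x : Qp p) : (exists z : Zp p, rp p m * tofrac z = x) ->
    exists z : Zp p, rp p m * tofrac z = tofrac c * x.
    by move=> [z <-]; exists (c * z); rewrite rmorphM mulrCA.
  have mult0 : exists z : Zp p, rp p m * tofrac z = 0 by exists 0; rewrite rmorph0 mulr0.
  have multk (k : int) : exists z : Zp p, rp p m * tofrac z = rp p (k%:~R * m).
    by exists k%:~R; rewrite tofrac_int rmorphM rmorph_int mulrC.
  have B1 x v : @lattice_p V p M x -> M v -> exists z : Zp p, rp p m * tofrac z = formp x (to_Vp p v).
    move=> lx Mv; move: x lx; apply: zspan_ind => [|x y hx hy|z x hx|x [u Mu <-]].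
    - by exists 0; rewrite rmorph0 mulr0 /formp !mul0mx mxE.
    - by rewrite formpDl; apply: mult.
    - by rewrite formpZl; apply: multZ.
    - by rewrite formp_to; have [k ->] := isnorm_beta sM nm Mu Mv; apply: multk.
  have B2 x y : @lattice_p V p M x -> @lattice_p V p M y -> exists z : Zp p, rp p m * tofrac z = formp x y.
    move=> lx ly; move: y ly; apply: zspan_ind => [|y1 y2 h1 h2|z y hy|y [u Mu <-]].
    - by exists 0; rewrite rmorph0 mulr0 /formp trmx0 mulmx0 mxE.
    - by rewrite formpDr; apply: mult.
    - by rewrite formpZr; apply: multZ.
    - exact: B1.
  have quadE x : quad_p beta x = formp x x / 2 by [].
  have two : (2 : Qp p) != 0 by have := @Qp_char0 p 2; apply.
  have qfE v : quad_p beta (to_Vp p v) = rp p (qf v).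
    by rewrite quadE formp_to /qf rmorphM fmorphV rmorph_nat.
  apply/seteqP; split=> [_ [z _ <-]|].
    rewrite mulrC; apply: zspanZ.
    have := mgen [set q | norm_p beta (@lattice_p V p M) (rp p q)]; apply => [|x y hx hy|v Mv] /=.
    - rewrite rmorph0; exact: zspan0.
    - rewrite rmorphB; exact: zspanB.
    - rewrite -qfE; apply: zspan_in; exists (to_Vp p v) => //.
      by apply: zspan_in; exists v.
  have lat0 : @lattice_p V p M 0 by apply: zspan0.
  have QP x : @lattice_p V p M x -> exists z : Zp p, rp p m * tofrac z = quad_p beta x.
    (* Membership in the local lattice is carried along, because the additive step needs [B2] for
       the two summands. *)
    suff : @lattice_p V p M `<=` [set x | @lattice_p V p M x /\ exists z : Zp p, rp p m * tofrac z = quad_p beta x].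
      by move=> h /h[].
    clear x; apply: zspan_ind => [|x y [lx hx] [ly hy]|z x [lx hx]|x [u Mu <-]] /=.
    - by split=> //; exists 0; rewrite quadE rmorph0 mulr0 /formp !mul0mx mxE mul0r.
    - split; first exact: zspanD.
      rewrite (_ : quad_p beta (x + y) = quad_p beta x + quad_p beta y + (formp x y + formp y x) / 2).
        apply: (mult _ _ (mult _ _ hx hy)).
        rewrite (formpC y x).
        have -> : (formp x y + formp x y) / 2 = formp x y by field.
        exact: B2.
      by rewrite !quadE formpDl !formpDr; field.
    - split; first exact: zspanZ.
      rewrite quadE formpZl formpZr -!mulrA.
      exact: (multZ z _ (multZ z _ hx)).
    - split; first by apply: zspan_in; exists u.
      by rewrite qfE; have [k ->] := mQ u Mu; apply: multk.
  rewrite /norm_p; apply: (@zspan_ind p (Qp p)^o) => [|x y|z x|x [u lu <-]].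
  - by exists 0 => //; rewrite rmorph0 mulr0.
  - by move=> [z _ <-] [z' _ <-]; exists (z + z') => //; rewrite rmorphD mulrDr.
  - by move=> [z' _ <-]; exists (z * z') => //; rewrite rmorphM mulrCA.
  - by have [z <-] := QP u lu; exists z.
rewrite /norm; case: xgetP => [m' _ [m'0 H']|/(_ m)[]//].
apply: rat_units => // p; split.
  have : [set ratr m * tofrac z | z in [set: Zp p]] (rp p m').
    by rewrite key -H'; exists 1 => //; rewrite rmorph1 mulr1.
  by move=> [z _ <-]; exists z.
have : [set ratr m' * tofrac z | z in [set: Zp p]] (rp p m).
  by rewrite H' -key; exists 1 => //; rewrite rmorph1 mulr1.
by move=> [z _ <-]; exists z.
Qed.

(** The values of Q on [M] generate a subgroup of (1/(2N)) Z, which is cyclic; m is its least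
    positive element. The subgroup is not 0, since otherwise polarization would make beta vanish. *)
Lemma isnorm_exists M : is_lattice M -> exists m, isnorm M m.
Proof.
move=> lM; have sM := lattice_subgp lM; have [r [g [ME _]]] := lM.
have [N N0 HN] := common_den (fun ij : 'I_r * 'I_r => beta g`_ij.1 g`_ij.2).
have NR : (2 * N)%:R != 0 :> rat by rewrite pnatr_eq0; lia.
have Qi v : M v -> qf v * (2 * N)%:R \is a Num.int.
  rewrite ME => -[a ->]; rewrite /qf natrM mulrA divfK //.
  under eq_bigr do rewrite mulz_scale.
  rewrite b_suml mulr_suml rpred_sum // => i _.
  rewrite b_sumr mulr_sumr mulr_suml rpred_sum // => j _.
  rewrite mulrA -mulrA rpredM ?(HN (i, j)) // rpredM ?intr_int //.
(* The subgroup generated by the values of Q, as the intersection of all subgroups that contain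
   them. *)
pose Z (q : rat) := forall P : set rat, P 0 -> (forall x y, P x -> P y -> P (x - y)) ->
     (forall v, M v -> P (qf v)) -> P q.
have ZQ v : M v -> Z (qf v) by move=> Mv P _ _; apply.
have Z0 : Z 0 by move=> P.
have ZB x y : Z x -> Z y -> Z (x - y) by move=> hx hy P P0 PB PQ; exact: (PB _ _ (hx P P0 PB PQ) (hy P P0 PB PQ)).
have ZN x : Z x -> Z (- x) by move=> hx; rewrite -(sub0r x); apply: ZB.
have ZD x y : Z x -> Z y -> Z (x + y) by move=> hx hy; rewrite -(opprK y); apply: ZB => //; apply: ZN.
have ZMn x (k : nat) : Z x -> Z (x *+ k).
  by move=> hx; elim: k => [|k IH]; rewrite ?mulr0n // mulrS; apply: ZD.
have ZMz x (k : int) : Z x -> Z (x *~ k).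
  by move=> hx; case: k => n; [exact: (ZMn x n hx) | rewrite NegzE mulrNz; apply: ZN; exact: (ZMn x n.+1 hx)].
have Zi q : Z q -> q * (2 * N)%:R \is a Num.int.
  move=> hq; apply: (hq [set q | q * (2 * N)%:R \is a Num.int]) => //= [|x y hx hy].
    by rewrite mul0r.
  by rewrite mulrBl rpredB.
have [v Mv v0] : exists2 v, M v & qf v != 0.
  apply: contrapT => /forall2NP H.
  have Q0 v : M v -> qf v = 0 by move=> Mv; have [//|/negP] := H v; rewrite negbK => /eqP.
  have B0 u v : M u -> M v -> beta u v = 0.
    move=> Mu Mv; have := qfD u v; rewrite !Q0 //; last exact: subgpD.
    by rewrite !add0r => /esym.
  have [u u0] := V0; case/eqP: u0; apply: bnd => w.
  have [a a0 Ma] := lattice_full lM u; have [b b0' Mb] := lattice_full lM w.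
  have := B0 _ _ Ma Mb; rewrite bZ bZr => /eqP.
  by rewrite !mulf_eq0 !pnatr_eq0 !gtn_eqF //= => /eqP.
have [k0 [k0p Zk0]] : exists k : nat, (0 < k)%N /\ Z (k%:R / (2 * N)%:R).
  have /intrP[t tE] := Zi _ (ZQ v Mv).
  have t0 : t != 0 by apply: contraNneq v0 => t0; move: tE; rewrite t0 => /eqP; rewrite mulf_eq0 (negPf NR) orbF.
  exists `|t|%N; split; first by rewrite absz_gt0.
  have E : qf v = t%:~R / (2 * N)%:R by rewrite -tE mulfK.
  have [tp|tn] := leP 0 t.
    by have -> : `|t|%:R = t%:~R :> rat; [rewrite -{2}(gez0_abs tp) | rewrite -E; apply: ZQ].
  have -> : `|t|%:R = - t%:~R :> rat by rewrite -rmorphN /= -(ltz0_abs tn).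
  by rewrite mulNr -E; apply: ZN; exact: (ZQ v Mv).
have ex : exists k, `[< (0 < k)%N /\ Z (k%:R / (2 * N)%:R) >] by exists k0; apply/asboolP.
case: (ex_minnP ex) => k /asboolP[kp Zk] kmin {k0 k0p Zk0 ex}.
exists (k%:R / (2 * N)%:R); split; first by rewrite divr_gt0 ?ltr0n //; lia.
  move=> u Mu; have /intrP[t tE] := Zi _ (ZQ u Mu).
  exists (t %/ k)%Z.
  have tE2 : t%:~R = (t %/ k)%Z%:~R * k%:R + (t %% k)%Z%:~R :> rat.
    by rewrite {1}(divz_eq t k) rmorphD rmorphM.
  have Zr : Z ((t %% k)%Z%:~R / (2 * N)%:R).
    have -> : (t %% k)%Z%:~R / (2 * N)%:R = qf u - (k%:R / (2 * N)%:R) *~ (t %/ k)%Z.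
      rewrite -[qf u](mulfK NR) tE tE2 -[k%:R / _ *~ _]mulrzr.
      by move: ((2 * N)%:R : rat) NR => c c0; field.
    by apply: ZB; [apply: ZQ | apply: ZMz].
  have r0 : (0 <= (t %% k)%Z) by apply: modz_ge0; lia.
  have rk : (t %% k)%Z < k by apply: ltz_pmod; lia.
  have rE : (t %% k)%Z = 0.
    case E : (t %% k)%Z r0 rk Zr => [[|r']|r'] // _ rk Zr.
    have := kmin r'.+1; case: asboolP => [_ /(_ isT)|[]]; last by split.
    by move: rk; rewrite ltz_nat ltnNge => /negP.
  by rewrite -[LHS](mulfK NR) tE tE2 rE addr0 -mulrA.
by move=> P P0 PB PQ; apply: Zk.
Qed.

Lemma isnorm_sub L M m m' : M `<=` L -> isnorm L m -> isnorm M m' -> exists2 k : nat, (0 < k)%N & m' = k%:R * m.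
Proof.
move=> ML [m0 mQ _] [m'0 _ gen].
have [k kE] : exists k : int, m' = k%:~R * m.
  apply: (gen [set q | exists k : int, q = k%:~R * m]) => [|x y [a ->] [b ->]|v Mv] /=.
  - by exists 0; rewrite mul0r.
  - by exists (a - b); rewrite rmorphB mulrBl.
  - by apply: mQ; apply: ML.
have k0 : 0 < k by move: m'0; rewrite kE pmulr_lgt0 // ltr0z.
by exists `|k|%N; rewrite ?absz_gt0 ?gt_eqF // kE -{1}(gez0_abs (ltW k0)).
Qed.

End Norm.

(** * Coordinates with respect to a basis of L *)

Section Translation.
Variables (V : vectType rat) (beta : V -> V -> rat).
Hypothesis bD : forall u v w, beta (u + v) w = beta u w + beta v w.
Hypothesis bZ : forall a u w, beta (a *: u) w = a * beta u w.
Hypothesis bC : forall u v, beta u v = beta v u.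
Hypothesis bnd : forall u, (forall v, beta u v = 0) -> u = 0.
Hypothesis V0 : exists v : V, v != 0.
Variables (n : nat) (e : n.+1.-tuple V) (L : set V).
Hypothesis free_e : free e.
Hypothesis LE : L = [set v | inIntSpan e v].
Hypothesis Lmax : maximal_lattice beta L.
Implicit Types (x y z : 'rV[int]_n.+1) (S : set 'rV[int]_n.+1).

Definition emb x : V := \sum_(i < n.+1) (x 0%R i)%:~R *: e`_i.

Lemma embD x y : emb (x + y) = emb x + emb y.
Proof.
rewrite /emb -big_split; apply: eq_bigr => i _.
by rewrite mxE rmorphD scalerDl.
Qed.

Lemma embZ (k : int) x : emb (k *: x) = k%:~R *: emb x.
Proof.
by rewrite /emb scaler_sumr; apply: eq_bigr => i _; rewrite mxE rmorphM scalerA.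
Qed.

Lemma embB x y : emb (x - y) = emb x - emb y.
Proof. by rewrite embD -scaleN1r embZ rmorphN1 scaleN1r. Qed.

Lemma emb0 : emb 0 = 0.
Proof. by rewrite -(subrr 0) embB subrr. Qed.

Lemma emb_inj : injective emb.
Proof.
move=> x y /eqP; rewrite -subr_eq0 -embB => /eqP E.
have /freeP/(_ _ E) H := free_e.
apply/rowP => i; apply/eqP; rewrite -subr_eq0; apply/eqP.
by have := H i; rewrite !mxE => /eqP; rewrite intr_eq0 => /eqP.
Qed.

Lemma emb_mulmx m (y : 'rV[int]_m) (B : 'M[int]_(m, n.+1)) :
  emb (y *m B) = \sum_(i < m) emb (row i B) *~ y 0%R i.
Proof.
rewrite mulmx_sum_row; elim/big_rec2: _ => [|i u x _ <-]; first exact: emb0.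
by rewrite embD embZ mulz_scale.
Qed.

Lemma emb_L : L = emb @` setT.
Proof.
rewrite LE; apply/seteqP; split=> [v [a ->]|_ [x _ <-]].
  exists (\row_i a i) => //; rewrite /emb; apply: eq_bigr => i _.
  by rewrite mxE mulz_scale.
exists [ffun i => x 0%R i]; rewrite /emb; apply: eq_bigr => i _.
by rewrite ffunE mulz_scale.
Qed.

Lemma L_lat : is_lattice L. Proof. by case: Lmax. Qed.

Lemma emb_full (v : V) : exists2 r : nat, (0 < r)%N & exists y, r%:R *: v = emb y.
Proof.
have [r r0] := lattice_full L_lat v; rewrite emb_L => -[y _ yE].
by exists r => //; exists y.
Qed.

Lemma ex_mu : exists m, isnorm beta L m.
Proof. exact: isnorm_exists bD bZ bC bnd V0 _ L_lat. Qed.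

Definition mu : rat := projT1 (cid ex_mu).
Lemma muP : isnorm beta L mu. Proof. exact: (projT2 (cid ex_mu)). Qed.
Lemma mu_gt0 : 0 < mu. Proof. by have [] := muP. Qed.
Lemma mu_neq0 : mu != 0. Proof. by rewrite gt_eqF // mu_gt0. Qed.

(** The Gram matrix of the form divided by the norm of L. The quotients are integers by
    [isnorm_beta]; [numq] only turns them into elements of [int]. *)
Definition G : 'M[int]_n.+1 := \matrix_(i, j) numq (beta e`_i e`_j / mu).

Lemma L_e (i : 'I_n.+1) : L e`_i. Proof. by rewrite LE; apply: span_gen. Qed.

Lemma GE (i j : 'I_n.+1) : beta e`_i e`_j = (G i j)%:~R * mu.
Proof.
have [k kE] := isnorm_beta bD bC (lattice_subgp L_lat) muP (L_e i) (L_e j).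
by rewrite mxE kE mulfK ?mu_neq0 // numq_int.
Qed.

Lemma betaE x y : beta (emb x) (emb y) = (bil G x y)%:~R * mu.
Proof.
rewrite /emb (b_suml bD bZ) /bil mxE rmorph_sum /= mulr_suml.
under eq_bigr do rewrite (b_sumr bD bZ bC) mulr_sumr.
rewrite exchange_big /=; apply: eq_bigr => j _.
rewrite !mxE rmorphM rmorph_sum /= !mulr_suml; apply: eq_bigr => i _.
by rewrite GE rmorphM /=; ring.
Qed.

Lemma qfE x : qf beta (emb x) = (bil G x x)%:~R * mu / 2.
Proof. by rewrite /qf betaE. Qed.

Lemma G_even : evenf G.
Proof.
split=> [|i]; first by apply/matrixP => i j; rewrite !mxE bC.
have [_ /(_ _ (L_e i))[k kE] _] := muP.
apply/dvdzP; exists k; apply: (@intr_inj rat); apply: (mulIf mu_neq0).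
by rewrite -GE rmorphM /=; move: kE; rewrite /qf => /(congr1 (fun t => t * 2)); rewrite divfK // => ->; ring.
Qed.

Lemma bil_dvd x (d : int) (k : int) : qf beta (emb x) = k%:~R * (d%:~R * mu) -> (2 * d %| bil G x x)%Z.
Proof.
rewrite qfE => /(congr1 (fun t => t * 2)); rewrite divfK // => E.
apply/dvdzP; exists k; apply: (@intr_inj rat); apply: (mulIf mu_neq0); rewrite E !rmorphM /=.
by ring.
Qed.

Lemma dvd_qf x (d : int) : (2 * d %| bil G x x)%Z -> exists k : int, qf beta (emb x) = k%:~R * (d%:~R * mu).
Proof.
move=> /dvdzP[k kE]; exists k; rewrite qfE kE !rmorphM /=; by field.
Qed.

Lemma det_scale B (N : nat) : (0 < N)%N -> (forall x, rspan B (N%:Z *: x)) -> \det B != 0 :> int.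
Proof.
move=> N0 H; have /rspan_subP[X XE] : rspan (N%:Z%:M : 'M[int]_n.+1) `<=` rspan B.
  by move=> _ [y ->]; rewrite -scalemx1 -scalemxAr mulmx1.
apply: contra_eq_neq (congr1 determinant XE) => B0; rewrite det_mulmx B0 mulr0 det_scalar.
by rewrite expf_neq0 // lt0n_neq0.
Qed.

(** The generators of [M] have integral coordinates, and [rspan_square] reduces their number to n +
    1. As [M] contains a positive multiple of each basis vector, it contains K L for some K > 0, so
    the determinant is not 0. *)
Lemma sub_lattice M : is_lattice M -> M `<=` L ->
  exists2 B : 'M[int]_n.+1, \det B != 0 & M = emb @` (rspan B).
Proof.
move=> lM ML; have [r [g [ME _]]] := lM.
have /choice[c Hc] : forall i : 'I_r, exists x, g`_i = emb x.
  move=> i; have : L g`_i by apply: ML; rewrite ME; apply: span_gen.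
  by rewrite emb_L => -[x _ <-]; exists x.
have [B BE] := rspan_square (\matrix_i c i).
have MB : M = emb @` (rspan B).
  rewrite BE ME; apply/seteqP; split=> [v [a ->]|_ [_ [y ->] <-]].
    exists ((\row_i a i) *m \matrix_i c i); first by exists (\row_i a i).
    by rewrite emb_mulmx; apply: eq_bigr => i _; rewrite rowK -Hc mxE.
  exists [ffun i => y 0%R i]; rewrite emb_mulmx; apply: eq_bigr => i _.
  by rewrite rowK -Hc ffunE.
exists B => //.
have /choice[N HN] : forall i : 'I_n.+1, exists N : nat, (0 < N)%N /\ M (N%:R *: e`_i).
  by move=> i; have [N N0 MN] := lattice_full lM e`_i; exists N.
pose K := (\prod_i N i)%N.
have K0 : (0 < K)%N by rewrite prodn_gt0 // => i; have [] := HN i.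
apply: (@det_scale B K K0) => x.
have sM := lattice_subgp lM.
have : M (emb (K%:Z *: x)).
  rewrite embZ /emb scaler_sumr; apply: (big_ind M) => [|u v|i _]; [exact: sM.1|exact: subgpD|].
  rewrite scalerA mulrC -scalerA -mulz_scale; apply: subgp_mulz => //.
  rewrite /K (bigD1 i) //= -[(_ * _)%N%:~R]/((_ * _)%N%:R) natrM mulrC -scalerA.
  rewrite scaler_nat pmulrn; apply: subgp_mulz => //.
  by have [] := HN i.
by rewrite MB => -[y By] /emb_inj <-.
Qed.

Lemma emb_sub (B : 'M[int]_n.+1) : emb @` rspan B `<=` L.
Proof. by rewrite emb_L => _ [x _ <-]; exists x. Qed.

Lemma lattice_emb (B : 'M[int]_n.+1) : \det B != 0 -> is_lattice (emb @` rspan B).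
Proof.
move=> B0; exists n.+1, [tuple emb (row i B) | i < n.+1]; set g := [tuple _ | _ < _].
have gi (i : 'I_n.+1) : g`_i = emb (row i B) by rewrite -tnth_nth tnth_mktuple.
split.
  apply/seteqP; split=> [_ [_ [y ->] <-]|v [a ->]].
    exists [ffun i => y 0%R i]; rewrite emb_mulmx; apply: eq_bigr => i _.
    by rewrite gi ffunE.
  exists ((\row_i a i) *m B); first by exists (\row_i a i).
  by rewrite emb_mulmx; apply: eq_bigr => i _; rewrite gi mxE.
apply/eqP; rewrite eqn_leq dimvS ?subvf //=; apply: dimvS.
apply/subvP => v _.
have [k k0 [y yE]] := emb_full v.
have -> : v = (k%:R * (\det B)%:~R)^-1 *: emb (\det B *: y).
  rewrite embZ -yE !scalerA -mulrA [(\det B)%:~R * _]mulrC mulVf ?scale1r //.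
  by rewrite mulf_neq0 ?intr_eq0 ?pnatr_eq0 ?lt0n_neq0.
rewrite memvZ // -mul_mx_scalar -(mul_adj_mx B) mulmxA emb_mulmx.
apply: rpred_sum => i _; rewrite mulz_scale memvZ // -gi memv_span //.
by rewrite mem_nth // size_tuple.
Qed.

Lemma index_emb (B : 'M[int]_n.+1) : \det B != 0 -> lattice_index L (emb @` rspan B) = `|\det B|%N.
Proof.
move=> B0; have [s [us sz cs ds]] := rspan_reps B0.
pose co (x : V) : set V := [set x + y | y in emb @` rspan B].
have coE x y : co (emb x) = co (emb y) <-> rspan B (x - y).
  split=> [E|Bxy].
    have : co (emb y) (emb x).
      by rewrite -E; exists 0; rewrite ?addr0 //; exists 0; [apply: rspan0|apply: emb0].
    move=> [_ [z Bz <-]]; rewrite -embD => /emb_inj <-.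
    by rewrite addrAC subrr add0r.
  apply/seteqP; split=> _ [_ [z Bz <-] <-].
    exists (emb (x - y + z)); first by exists (x - y + z) => //; apply: rspanD.
    by rewrite -!embD; congr emb; rewrite addrA [y + _]addrC subrK.
  exists (emb (z - (x - y))); first by exists (z - (x - y)) => //; apply: rspanB.
  by rewrite -!embD; congr emb; rewrite opprB addrA [x + z]addrC -addrA [x + _]addrC subrK addrC.
pose F : {fset set V} := [fset c in [seq co (emb x) | x <- s]]%fset.
have -> : lattice_index L (emb @` rspan B) = #|` F |%fset.
  rewrite /lattice_index (_ : cosets _ _ = [set` F]) ?set_fsetK //.
  apply/seteqP; split=> [_ [v + <-]|c].
    rewrite emb_L => -[x _ <-]; have [r rs Br] := cs x.
    rewrite /= !inE; apply/mapP; exists r => //.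
    exact/coE.
  rewrite /= !inE => /mapP[x xs ->]; exists (emb x) => //.
  by rewrite emb_L; exists x.
rewrite card_fseq undup_id ?size_map //.
rewrite map_inj_in_uniq // => x y xs ys /coE; exact: ds.
Qed.

(** If y / r passes the test of [maxl], then adjoining it to [M] gives a lattice of the same norm,
    hence [M] itself. *)
Lemma max_maxl M d : is_lattice M -> isnorm beta M (d%:R * mu) -> (0 < d)%N -> M `<=` L ->
  maximal_lattice beta M -> forall B : 'M[int]_n.+1, M = emb @` rspan B -> maxl G d (rspan B).
Proof.
move=> lM nM d0 ML [_ Mm] B MB; have sM := lattice_subgp lM.
have [_ nQ ngen] := nM.
split=> [x Bx|r y r0 hyy hyz].
  have [|k kE] := nQ (emb x); first by rewrite MB; exists x.
  by apply: (bil_dvd (k := k)); rewrite kE.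
pose w := r%:R^-1 *: emb y.
have rR : r%:R != 0 :> rat by rewrite pnatr_eq0 lt0n_neq0.
have [m [g [ME dg]]] := lM.
pose g' : m.+1.-tuple V := [tuple of w :: g].
pose M' := [set v | inIntSpan g' v].
have M'E v : M' v <-> exists2 u, M u & exists k : int, v = u + w *~ k.
  split=> [[a ->]|[u + [k ->]]].
    rewrite big_ord_recl /= addrC; eexists; last by exists (a ord0).
    rewrite ME; exists [ffun i => a (lift ord0 i)]; apply: eq_bigr => i _.
    by rewrite ffunE.
  rewrite ME => -[a ->]; exists [ffun i => oapp a k (unlift ord0 i)].
  rewrite big_ord_recl /= ffunE unlift_none /= addrC; congr (_ + _).
  by apply: eq_bigr => i _; rewrite ffunE liftK.
have MM' : M `<=` M' by move=> v Mv; apply/M'E; exists v => //; exists 0; rewrite mulr0z addr0.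
have lM' : is_lattice M'.
  exists m.+1, g'; split=> //; apply/eqP; rewrite eqn_leq dimvS ?subvf //= -dg.
  by apply/dimvS/sub_span => v vg; rewrite inE vg orbT.
have Qw : exists k : int, qf beta w = k%:~R * (d%:R * mu).
  have [k kE] := dvd_qf hyy; exists k; rewrite /w (qfZ bZ bC) kE.
  rewrite -[(d * r ^ 2)%N%:~R]/((d * r ^ 2)%N%:R) natrM natrX; by field.
have Bw v : M v -> exists k : int, beta v w = k%:~R * (d%:R * mu).
  rewrite MB => -[z Bz <-]; have /dvdzP[k kE] := hyz z Bz.
  exists k; rewrite /w (bZr bZ bC) bC betaE kE rmorphM /=.
  rewrite -[(d * r)%N%:~R]/((d * r)%N%:R) natrM; by field.
have nM' : isnorm beta M' (d%:R * mu).
  split; first by case: nM.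
    move=> v /M'E[u Mu [k ->]].
    have [a aE] := nQ u Mu; have [b bE] := Qw; have [c cE] := Bw u Mu.
    exists (a + k ^+ 2 * b + k * c); rewrite mulz_scale (qfD bD bC) (qfZ bZ bC) (bZr bZ bC) aE bE cE.
    by rewrite !rmorphD !rmorphM /=; ring.
  by move=> P P0 PB PQ; apply: ngen => // v Mv; apply: PQ; apply: MM'.
have EM : M' = M.
  apply: Mm => //; rewrite (isnorm_norm bD bZ bC (lattice_subgp lM') nM').
  by rewrite (isnorm_norm bD bZ bC sM nM).
have : M w by rewrite -EM; apply/M'E; exists 0; [exact: sM.1 | exists 1; rewrite add0r mulr1z].
rewrite MB => -[z Bz zE]; exists z => //; apply: emb_inj; rewrite embZ zE /w.
by rewrite -[r%:Z%:~R]/(r%:R) scalerA divff ?scale1r.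
Qed.

Lemma maximal_sub M : maximal_lattice beta M -> M `<=` L ->
  exists2 B : 'M[int]_n.+1, \det B != 0 & M = emb @` (rspan B) /\ maxL G (rspan B).
Proof.
move=> Mm ML; have lM := Mm.1; have [B B0 MB] := sub_lattice lM ML.
have [m nm] := isnorm_exists bD bZ bC bnd V0 lM.
have [d d0 dE] := isnorm_sub ML muP nm.
exists B => //; split=> //; exists d => //; rewrite dE in nm.
exact: max_maxl MB.
Qed.

Lemma maxT : maxl G 1 setT.
Proof.
have h : isnorm beta L (1%:R * mu) by rewrite mul1r; apply: muP.
have := @max_maxl L 1 L_lat h isT (@subset_refl _ L) Lmax 1%:M.
by rewrite rspan1; apply; apply: emb_L.
Qed.

Lemma norm1 (d : nat) : iso G d%:Z setT -> d = 1%N.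
Proof.
move=> H; have [_ _ gen] := muP.
have [k] : exists k : int, mu = k%:~R * (d%:R * mu).
  have := gen [set q | exists k : int, q = k%:~R * (d%:R * mu)]; apply=> /=.
  - by exists 0; rewrite mul0r.
  - by move=> x y [a ->] [b ->]; exists (a - b); rewrite rmorphB mulrBl.
  - by move=> v; rewrite emb_L => -[x _ <-]; exact: (dvd_qf (H x I)).
rewrite mulrA -{1}[mu]mul1r => /(mulIf mu_neq0) E.
have {}E : 1 = k * d%:Z by apply: (@intr_inj rat); rewrite rmorphM /= -E.
have : (d%:Z %| 1)%Z by apply/dvdzP; exists k.
by rewrite dvdzE /= dvdn1 => /eqP.
Qed.

(** The norm of the lattice is a multiple of d mu. A vector v of a larger lattice with the same norm
    has a multiple y = r v in L, and y passes the test with denominator r because Q(v) and the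
    products of v with the lattice are multiples of that norm. *)
Lemma maxL_maximal (B : 'M[int]_n.+1) : \det B != 0 -> maxL G (rspan B) ->
  maximal_lattice beta (emb @` rspan B).
Proof.
have zn (m : nat) : m%:Z%:~R = m%:R :> rat by [].
move=> B0 [d d0 [isoB maxB]]; have lM := lattice_emb B0; set M := emb @` rspan B in lM *.
split=> // M' lM' nE MM'; apply/seteqP; split=> // v M'v.
have sM' := lattice_subgp lM'; have sM := lattice_subgp lM.
have [nu nuM] := isnorm_exists bD bZ bC bnd V0 lM.
have [nu' nuM'] := isnorm_exists bD bZ bC bnd V0 lM'.
move: nE; rewrite (isnorm_norm bD bZ bC sM nuM) (isnorm_norm bD bZ bC sM' nuM') => nE; subst nu'.
have [k kE] : exists k : int, nu = k%:~R * (d%:R * mu).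
  have [_ _ gen] := nuM.
  have := gen [set q | exists k : int, q = k%:~R * (d%:R * mu)]; apply=> /=.
  - by exists 0; rewrite mul0r.
  - by move=> x y [a ->] [b ->]; exists (a - b); rewrite rmorphB mulrBl.
  - by move=> u [x Bx <-]; exact: (dvd_qf (isoB x Bx)).
have [r r0 [y yE]] := emb_full v.
have rR : r%:R != 0 :> rat by rewrite pnatr_eq0 lt0n_neq0.
have [z Bz zE] : exists2 z, rspan B z & y = r%:Z *: z.
  apply: maxB => // [|z Bz].
    have [_ /(_ v M'v)[t tE] _] := nuM'.
    apply: (bil_dvd (k := k * t)); rewrite -yE (qfZ bZ bC) tE kE !rmorphM /=.
    by rewrite !zn; ring.
  have M'z : M' (emb z) by apply: MM'; exists z.
  have [t tE] := isnorm_beta bD bC sM' nuM' M'v M'z.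
  apply/dvdzP; exists (k * t); apply: (@intr_inj rat); apply: (mulIf mu_neq0).
  rewrite -betaE -yE bZ tE kE !rmorphM /= !zn; ring.
exists z => //; apply: (scalerI rR).
by rewrite yE zE embZ.
Qed.

Lemma G_det (D : rat) : D = \det (\matrix_(i < n.+1, j < n.+1) beta e`_i e`_j) ->
  D = mu ^+ n.+1 * (\det G)%:~R.
Proof.
move=> ->; rewrite -det_map_mx -detZ; congr determinant.
by apply/matrixP => i j; rewrite mxE GE [RHS]mxE [(map_mx _ _) i j]mxE mulrC.
Qed.

(** A kernel vector would be orthogonal to L, and every vector of V has a multiple in L. *)
Lemma G_det0 : \det G != 0.
Proof.
apply/negP => /eqP G0.
have : \det (map_mx intr G : 'M[rat]_n.+1) == 0 by rewrite det_map_mx G0.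
move=> /det0P[v v0 vG].
pose w : V := \sum_(i < n.+1) v 0%R i *: e`_i.
have we j : beta w e`_(nat_of_ord (j : 'I_n.+1)) = 0.
  have := congr1 (fun A : 'rV_n.+1 => A 0%R j * mu) vG; rewrite !mxE mul0r => <-.
  rewrite (b_suml bD bZ) mulr_suml; apply: eq_bigr => i _.
  by rewrite GE [(map_mx _ _) i j]mxE mulrA.
have w0 : w = 0.
  apply: bnd => u; have [r r0 [y yE]] := emb_full u.
  have rR : r%:R != 0 :> rat by rewrite pnatr_eq0 lt0n_neq0.
  apply: (mulfI rR); rewrite mulr0 -(bZr bZ bC) yE /emb (b_sumr bD bZ bC) big1 // => i _.
  by rewrite we mulr0.
have /freeP/(_ _ w0) H := free_e.
by case/eqP: v0; apply/rowP => i; rewrite H mxE.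
Qed.

End Translation.

(** * Complex series and derivability *)

Local Open Scope complex_scope.
Local Open Scope ring_scope.

Section Modulus.
Variable R : realType.
Implicit Types (z w : R[i]) (u v : nat -> R[i]).

(** The modulus as a real number, since the norm of [R[i]] takes its values in [R[i]]. *)
Definition nm z : R := Num.sqrt (complex.Re z ^+ 2 + complex.Im z ^+ 2).

Lemma nmE z : `|z| = (nm z)%:C.
Proof. exact: normc_def. Qed.

Lemma nm_ge0 z : 0 <= nm z.
Proof. exact: sqrtr_ge0. Qed.

Lemma nmM z w : nm (z * w) = nm z * nm w.
Proof.
apply: (@complexI R); rewrite -nmE normrM !nmE.
by rewrite -(rmorphM (real_complex R)).
Qed.

Lemma nmV z : nm z^-1 = (nm z)^-1.
Proof.
apply: (@complexI R); rewrite -nmE normfV !nmE.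
by rewrite -(fmorphV (real_complex R)).
Qed.

Lemma nmD z w : nm (z + w) <= nm z + nm w.
Proof.
rewrite -lecR -nmE (rmorphD (real_complex R)) /= -!nmE.
exact: ler_normD.
Qed.

Lemma nmN z : nm (- z) = nm z.
Proof. by rewrite /nm; case: z => a b /=; rewrite !sqrrN. Qed.

Lemma nmB z w : nm (z - w) = nm (w - z).
Proof. by rewrite -nmN opprB. Qed.

Lemma nm_subD z w : nm (z - w) <= nm z + nm w.
Proof. by apply: (le_trans (nmD _ _)); rewrite nmN. Qed.

Lemma nm_real (r : R) : nm r%:C = `|r|.
Proof. by rewrite /nm /= expr0n addr0 sqrtr_sqr. Qed.

Lemma nm0 : nm 0 = 0.
Proof. by rewrite -[0]/((0 : R)%:C) nm_real normr0. Qed.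

Lemma nm1 : nm 1 = 1.
Proof. by rewrite -[1]/((1 : R)%:C) nm_real normr1. Qed.

Lemma nm_eq0 z : nm z = 0 -> z = 0.
Proof. by move=> z0; apply/eqP; rewrite -normr_eq0 nmE z0. Qed.

Lemma nm_gt0 z : z != 0 -> 0 < nm z.
Proof.
by move=> z0; rewrite lt_def nm_ge0 andbT; apply: contra z0 => /eqP/nm_eq0->.
Qed.

Lemma nmX z n : nm (z ^+ n) = nm z ^+ n.
Proof. by elim: n => [|n IH]; rewrite ?expr0 ?nm1 // !exprS nmM IH. Qed.

Lemma Re_le_nm z : `|complex.Re z| <= nm z.
Proof. by rewrite -sqrtr_sqr ler_wsqrtr // lerDl sqr_ge0. Qed.

Lemma Im_le_nm z : `|complex.Im z| <= nm z.
Proof. by rewrite -sqrtr_sqr ler_wsqrtr // lerDr sqr_ge0. Qed.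

Lemma nm_le z : nm z <= `|complex.Re z| + `|complex.Im z|.
Proof.
rewrite -[leRHS]ger0_norm ?addr_ge0 // -sqrtr_sqr ler_wsqrtr // sqrrD !real_normK ?num_real //.
by rewrite addrAC lerDl mulrn_wge0 // mulr_ge0.
Qed.

Lemma nm_sum (I : Type) (r : seq I) (P : pred I) (F : I -> R[i]) :
  nm (\sum_(i <- r | P i) F i) <= \sum_(i <- r | P i) nm (F i).
Proof.
elim/big_rec2: _ => [|i y x _ IH]; first by rewrite nm0.
by apply: (le_trans (nmD _ _)); rewrite lerD2l.
Qed.

Lemma Re_sum (I : Type) (r : seq I) (P : pred I) (F : I -> R[i]) :
  complex.Re (\sum_(i <- r | P i) F i) = \sum_(i <- r | P i) complex.Re (F i).
Proof. by elim/big_rec2: _ => // i y x _ <-; case: (F i) x => [? ?] [? ?]. Qed.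

Lemma Im_sum (I : Type) (r : seq I) (P : pred I) (F : I -> R[i]) :
  complex.Im (\sum_(i <- r | P i) F i) = \sum_(i <- r | P i) complex.Im (F i).
Proof. by elim/big_rec2: _ => // i y x _ <-; case: (F i) x => [? ?] [? ?]. Qed.

Lemma ReD z w : complex.Re (z + w) = complex.Re z + complex.Re w.
Proof. by case: z w => [? ?] [? ?]. Qed.

Lemma ImD z w : complex.Im (z + w) = complex.Im z + complex.Im w.
Proof. by case: z w => [? ?] [? ?]. Qed.

Lemma ReN z : complex.Re (- z) = - complex.Re z.
Proof. by case: z. Qed.

Lemma ImN z : complex.Im (- z) = - complex.Im z.
Proof. by case: z. Qed.

Lemma ReM z w : complex.Re (z * w) = complex.Re z * complex.Re w - complex.Im z * complex.Im w.
Proof. by case: z w => [? ?] [? ?]. Qed.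

Lemma ImM z w : complex.Im (z * w) = complex.Re z * complex.Im w + complex.Im z * complex.Re w.
Proof. by case: z w => [? ?] [? ?]. Qed.

Lemma ReCM (r : R) z : complex.Re (r%:C * z) = r * complex.Re z.
Proof. by rewrite ReM /= mul0r subr0. Qed.

Lemma ImCM (r : R) z : complex.Im (r%:C * z) = r * complex.Im z.
Proof. by rewrite ImM /= mul0r addr0. Qed.

Lemma complexP z w : complex.Re z = complex.Re w -> complex.Im z = complex.Im w -> z = w.
Proof. by case: z w => [? ?] [? ?] /= -> ->. Qed.

(** Convergence of real and imaginary parts, so that the theorems on real sequences apply
    directly. *)
Definition ctends u z :=
  ((fun n => complex.Re (u n)) @ \oo --> complex.Re z) /\
  ((fun n => complex.Im (u n)) @ \oo --> complex.Im z).

Lemma eq_ctends u v z : u =1 v -> ctends u z -> ctends v z.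
Proof. by move=> /funext ->. Qed.

Lemma ctends_cst z : ctends (fun=> z) z.
Proof. by split; apply: cvg_cst. Qed.

Lemma ctendsD u v z w : ctends u z -> ctends v w -> ctends (fun n => u n + v n) (z + w).
Proof.
move=> [uR uI] [vR vI]; split.
  by rewrite ReD; under eq_fun do rewrite ReD; apply: cvgD.
by rewrite ImD; under eq_fun do rewrite ImD; apply: cvgD.
Qed.

Lemma ctendsN u z : ctends u z -> ctends (fun n => - u n) (- z).
Proof.
move=> [uR uI]; split.
  by rewrite ReN; under eq_fun do rewrite ReN; apply: cvgN.
by rewrite ImN; under eq_fun do rewrite ImN; apply: cvgN.
Qed.

Lemma ctendsB u v z w : ctends u z -> ctends v w -> ctends (fun n => u n - v n) (z - w).
Proof. by move=> uz vw; apply: ctendsD => //; apply: ctendsN. Qed.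

Lemma ctendsM u v z w : ctends u z -> ctends v w -> ctends (fun n => u n * v n) (z * w).
Proof.
move=> [uR uI] [vR vI]; split.
  rewrite ReM; under eq_fun do rewrite ReM.
  by apply: cvgB; apply: cvgM.
rewrite ImM; under eq_fun do rewrite ImM.
by apply: cvgD; apply: cvgM.
Qed.

Lemma ctendsZ c u z : ctends u z -> ctends (fun n => c * u n) (c * z).
Proof. exact/ctendsM/ctends_cst. Qed.

Lemma ctends_unique u z w : ctends u z -> ctends u w -> z = w.
Proof.
move=> [uR uI] [vR vI]; apply: complexP.
  exact: (cvg_unique _ uR vR).
exact: (cvg_unique _ uI vI).
Qed.

Lemma ctends_shift k u z : ctends (fun n => u (n + k)%N) z <-> ctends u z.
Proof.
split=> -[uR uI]; split.
- by move: uR; rewrite (cvg_shiftn k (fun n => complex.Re (u n))).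
- by move: uI; rewrite (cvg_shiftn k (fun n => complex.Im (u n))).
- by rewrite (cvg_shiftn k (fun n => complex.Re (u n))).
- by rewrite (cvg_shiftn k (fun n => complex.Im (u n))).
Qed.

Lemma ctends_le u z B : ctends u z -> (forall n, nm (u n) <= B) -> nm z <= B.
Proof.
move=> [uR uI] uB; have B0 : 0 <= B by apply: le_trans (uB 0%N); apply: nm_ge0.
rewrite -[leRHS]ger0_norm // -sqrtr_sqr ler_wsqrtr //.
have h : (fun n => complex.Re (u n) * complex.Re (u n) + complex.Im (u n) * complex.Im (u n)) @ \oo
   --> complex.Re z * complex.Re z + complex.Im z * complex.Im z by apply: cvgD; apply: cvgM.
rewrite !expr2 -(cvg_lim _ h) //; apply: limr_le; first by apply/cvg_ex; eexists; exact: h.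
apply: nearW => n; rewrite -!expr2.
have : nm (u n) ^+ 2 <= B ^+ 2 by rewrite ler_sqr ?nnegrE ?nm_ge0.
by rewrite sqr_sqrtr // addr_ge0 ?sqr_ge0.
Qed.

Lemma ctends_dist u z (r : nat -> R) : (forall n, nm (u n - z) <= r n) ->
  r @ \oo --> 0 -> ctends u z.
Proof.
move=> ur r0.
have H (f : nat -> R) (l : R) : (forall n, `|f n - l| <= r n) -> f @ \oo --> l.
  move=> fr; apply/cvgrPdist_le => e e0.
  move/cvgrPdist_le : r0 => /(_ e e0); apply: filterS => n.
  rewrite sub0r normrN => re; rewrite distrC; apply: (le_trans (fr n)).
  exact: le_trans (ler_norm _) re.
split; apply: H => n; apply: le_trans (ur n).
  by rewrite -ReN -ReD Re_le_nm.
by rewrite -ImN -ImD Im_le_nm.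
Qed.

Definition ssum (T : nmodType) (f : nat -> T) (n : nat) : T := \sum_(0 <= i < n) f i.

Lemma ssumS (T : nmodType) (f : nat -> T) n : ssum f n.+1 = ssum f n + f n.
Proof. exact: big_nat_recr. Qed.

Lemma ssum0 (T : nmodType) (f : nat -> T) : ssum f 0 = 0.
Proof. exact: big_geq. Qed.

Lemma ssum_le (f g : nat -> R) n : (forall i, f i <= g i) -> ssum f n <= ssum g n.
Proof. by move=> fg; apply: ler_sum => i _. Qed.

Lemma ssum_mono (f : nat -> R) m n : (forall i, 0 <= f i) -> (m <= n)%N -> ssum f m <= ssum f n.
Proof.
move=> f0 mn; rewrite /ssum (big_cat_nat _ mn) //= lerDl.
by apply: sumr_ge0.
Qed.

(** For nonnegative terms this is convergence; applied to moduli it expresses absolute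
    convergence. *)
Definition bdd (f : nat -> R) := exists B, forall n, ssum f n <= B.

Lemma bdd_cvg (f : nat -> R) : (forall i, 0 <= f i) -> bdd f -> cvgn (ssum f).
Proof.
move=> f0 [B fB]; apply: nondecreasing_is_cvgn.
  by move=> m n mn; apply: ssum_mono.
by exists B => _ [n _ <-].
Qed.

Lemma bdd_le (f g : nat -> R) : (forall i, f i <= g i) -> bdd g -> bdd f.
Proof. by move=> fg [B gB]; exists B => n; apply: le_trans (gB n); apply: ssum_le. Qed.

Lemma bddZ (c : R) (f : nat -> R) : 0 <= c -> bdd f -> bdd (fun i => c * f i).
Proof.
move=> c0 [A fA]; exists (c * A) => n; rewrite /ssum -mulr_sumr.
by rewrite ler_wpM2l //; apply: fA.
Qed.

Lemma bdd_tail (f : nat -> R) (e : R) : (forall i, 0 <= f i) -> bdd f -> 0 < e ->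
  exists N, forall m n, (N <= m)%N -> (m <= n)%N -> ssum f n - ssum f m <= e.
Proof.
move=> f0 fb e0; have cf := bdd_cvg f0 fb.
have /cvgrPdist_le /(_ e e0) [N _ hN] := cf.
exists N => m n Nm mn; have := hN m Nm => /=.
have := nondecreasing_cvgn_le (fun i j ij => ssum_mono f0 ij) cf n.
move=> h1; rewrite ler_norml => /andP[_ h2]; apply: le_trans h2.
by rewrite lerD2r.
Qed.

(** Meaningful when the moduli are summable, by [csumP]. *)
Definition csum u : R[i] :=
  Complex (limn (ssum (fun n => complex.Re (u n)))) (limn (ssum (fun n => complex.Im (u n)))).

Lemma csumP u : bdd (fun n => nm (u n)) -> ctends (ssum u) (csum u).
Proof.
move=> ub.
have H (f : nat -> R) : (forall n, `|f n| <= nm (u n)) -> cvgn (ssum f).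
  move=> fu; apply: (@normed_cvg R); apply: bdd_cvg => [i|]; first exact: normr_ge0.
  exact: bdd_le fu ub.
split.
  have -> : (fun n => complex.Re (ssum u n)) = ssum (fun n => complex.Re (u n)).
    by apply/funext => n; rewrite /ssum Re_sum.
  by apply: H => n; apply: Re_le_nm.
have -> : (fun n => complex.Im (ssum u n)) = ssum (fun n => complex.Im (u n)).
  by apply/funext => n; rewrite /ssum Im_sum.
by apply: H => n; apply: Im_le_nm.
Qed.

Lemma ctends_csum u z : ctends (ssum u) z -> bdd (fun n => nm (u n)) -> csum u = z.
Proof. by move=> uz ub; apply: ctends_unique (csumP ub) uz. Qed.

Lemma nearC (z : R[i]) (P : R[i] -> Prop) :
  (exists2 e : R, 0 < e & forall w, nm (w - z) < e -> P w) <-> (\forall w \near z, P w).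
Proof.
split=> [[e e0 eP]|].
  apply/nbhs_ballP; exists e%:C => /=; first by rewrite ltcR.
  move=> w; rewrite -ball_normE /ball_ /= => zw; apply: eP.
  by rewrite nmB -ltcR -nmE.
(* In the order of [R[i]] a positive radius is a positive real number. *)
move=> /nbhs_ballP[[a b] /=]; rewrite ltcE /= => /andP[/eqP b0 a0] eP.
exists a => // w wz; apply: eP; rewrite -ball_normE /ball_ /= nmE ltcE /= b0 eqxx /=.
by rewrite nmB.
Qed.

Lemma nearC' (z : R[i]) (P : R[i] -> Prop) :
  (exists2 e : R, 0 < e & forall w, w != z -> nm (w - z) < e -> P w) <->
  (\forall w \near z^', P w).
Proof.
split=> [[e e0 eP]|].
  apply/nearC; exists e => // w wz /= nz; exact: eP.
by move=> /nearC[e e0 eP]; exists e => // w wz ?; apply: eP.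
Qed.

(* Explicit second-order error terms: a series of functions is derivable as soon
   as the error constants of its terms are summable. *)
Definition qa (f : R[i] -> R[i]) w (D : R[i]) (A d : R) :=
  forall h, nm h <= d -> nm (f (w + h) - f w - h * D) <= A * nm h ^+ 2.

Lemma qa_derivable (f : R[i] -> R[i]) w D A d : 0 < d -> qa f w D A d -> derivable f w 1.
Proof.
move=> d0 q; apply/cvg_ex; exists D; apply/cvgrPdist_le => -[e b].
rewrite ltcE /= => /andP[/eqP b0 e0]; rewrite {}b0.
have A0 : 0 < `|A| + 1 by rewrite ltr_wpDl.
apply/nearC'; exists (Num.min d (e / (`|A| + 1))).
  by rewrite lt_min d0 divr_gt0.
move=> h h0; rewrite subr0 lt_min => /andP[hd he].
have nh := nm_gt0 h0.
rewrite nmE -[Complex e 0]/(e%:C) lecR.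
have -> : D - h^-1 *: (f (h *: 1 + w) - f w) = - (h^-1 * (f (w + h) - f w - h * D)).
  rewrite -[_ *: (_ - _)]/(h^-1 * _) -[h *: 1]/(h * 1) mulr1 [h + w]addrC.
  by rewrite [h^-1 * (_ - h * D)]mulrBr mulKf // opprB.
rewrite nmN nmM nmV ler_pdivrMl //.
apply: (le_trans (q h (ltW hd))); rewrite expr2 mulrA [leRHS]mulrC ler_wpM2r ?nm_ge0 //.
apply: (@le_trans _ _ ((`|A| + 1) * nm h)).
  by rewrite ler_wpM2r ?nm_ge0 // (le_trans (ler_norm _)) // lerDl.
by rewrite mulrC -ler_pdivlMr // ltW.
Qed.

(** The quadratic bound holds for all partial sums with the same constant, and it passes to the
    limit. *)
Lemma qa_series (u : nat -> R[i] -> R[i]) w (D : nat -> R[i]) (A : nat -> R) d :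
  (forall k, qa (u k) w (D k) (A k) d) -> bdd A -> bdd (fun k => nm (D k)) ->
  (forall h, nm h <= d -> bdd (fun k => nm (u k (w + h)))) -> 0 < d ->
  exists B, qa (fun s => csum (fun k => u k s)) w (csum D) B d.
Proof.
move=> q [B AB] bD bu d0; exists B => h hd.
have w0 : bdd (fun k => nm (u k w)).
  by have := bu 0; rewrite nm0 addr0; apply; apply: ltW.
have := ctendsB (ctendsB (csumP (bu h hd)) (csumP w0)) (ctendsZ h (csumP bD)).
move/ctends_le; apply=> n.
rewrite /ssum mulr_sumr -!sumrB; apply: (le_trans (nm_sum _ _ _)).
apply: (@le_trans _ _ (\sum_(0 <= i < n) A i * nm h ^+ 2)).
  by apply: ler_sum => i _; apply: q.
by rewrite -mulr_suml ler_wpM2r ?exprn_ge0 ?nm_ge0 //; apply: AB.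
Qed.

Lemma qa_mul (f g : R[i] -> R[i]) w Df Dg (Af Ag d : R) :
  0 <= d -> 0 <= Af -> 0 <= Ag ->
  qa f w Df Af d -> qa g w Dg Ag d ->
  qa (fun s => f s * g s) w (Df * g w + f w * Dg)
    (nm (f w) * Ag + nm (g w) * Af + (nm Df + Af * d) * (nm Dg + Ag * d)) d.
Proof.
move=> d0 Af0 Ag0 qf qg h hd; have {}qf := qf h hd; have {}qg := qg h hd.
move: qf qg; set ef := _ - _ - _; set eg := _ - _ - _ => qf qg.
have -> : f (w + h) * g (w + h) - f w * g w - h * (Df * g w + f w * Dg) =
  f w * eg + g w * ef + (h * Df + ef) * (h * Dg + eg).
  by rewrite /ef /eg; ring.
have nh := nm_ge0 h.
have H (D e : R[i]) A : 0 <= A -> nm e <= A * nm h ^+ 2 -> nm (h * D + e) <= nm h * (nm D + A * d).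
  move=> A0 ee; apply: (le_trans (nmD _ _)); rewrite nmM mulrDr lerD2l.
  apply: (le_trans ee); rewrite expr2 mulrCA.
  by rewrite ler_wpM2l // ler_wpM2l.
apply: (le_trans (nmD _ _)); rewrite [leRHS]mulrDl; apply: lerD.
  apply: (le_trans (nmD _ _)); rewrite !nmM [leRHS]mulrDl -!mulrA; apply: lerD.
    by rewrite ler_wpM2l ?nm_ge0.
  by rewrite ler_wpM2l ?nm_ge0.
rewrite nmM; apply: (@le_trans _ _ (nm h * (nm Df + Af * d) * (nm h * (nm Dg + Ag * d)))).
  by apply: ler_pM; rewrite ?nm_ge0 //; apply: H.
by rewrite mulrACA mulrC expr2.
Qed.

Lemma qa_affine (f : R[i] -> R[i]) (a b s : R[i]) D A d : 0 < d -> a != 0 ->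
  qa f (a * s + b) D A d ->
  qa (fun s => f (a * s + b)) s (a * D) (A * nm a ^+ 2) (d / nm a).
Proof.
move=> d0 a0 q h hd; have -> : a * (s + h) + b = a * s + b + a * h by ring.
rewrite mulrA [h * a]mulrC; apply: (le_trans (q _ _)).
  by rewrite nmM mulrC -ler_pdivlMr // nm_gt0.
by rewrite nmM exprMn mulrA.
Qed.

Lemma qa_weak (f : R[i] -> R[i]) w D (A A' d d' : R) :
  A <= A' -> d' <= d -> qa f w D A d -> qa f w D A' d'.
Proof.
move=> AA dd q h hd; apply: (le_trans (q h (le_trans hd dd))).
by rewrite ler_wpM2r ?exprn_ge0 ?nm_ge0.
Qed.

(** Stronger than derivability at [w], and stable under sums, products and affine substitutions;
    series are treated with [qa], where the constants are explicit. *)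
Definition QA (f : R[i] -> R[i]) w := exists D A d, [/\ 0 < d, 0 <= A & qa f w D A d].

Lemma qaQA (f : R[i] -> R[i]) w D A d : 0 < d -> qa f w D A d -> QA f w.
Proof.
move=> d0 q; exists D, `|A|, d; split => //.
exact: qa_weak (ler_norm _) (lexx _) q.
Qed.

Lemma QA_derivable f w : QA f w -> derivable f w 1.
Proof. by move=> [D [A [d [d0 A0 q]]]]; apply: qa_derivable d0 q. Qed.

Lemma QA_mul f g w : QA f w -> QA g w -> QA (fun s => f s * g s) w.
Proof.
move=> [D [A [d [d0 A0 q]]]] [D' [A' [d' [d'0 A'0 q']]]].
have m0 : 0 < Num.min d d' by rewrite lt_min d0.
apply: (@qaQA _ _ _ _ _ m0); apply: qa_mul (ltW m0) A0 A'0 _ _.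
  by apply: qa_weak q => //; rewrite ge_min lexx.
by apply: qa_weak q' => //; rewrite ge_min lexx orbT.
Qed.

Lemma QA_add f g w : QA f w -> QA g w -> QA (fun s => f s + g s) w.
Proof.
move=> [D [A [d [d0 A0 q]]]] [D' [A' [d' [d'0 A'0 q']]]].
have m0 : 0 < Num.min d d' by rewrite lt_min d0.
exists (D + D'), (A + A'), (Num.min d d'); split; rewrite ?addr_ge0 // => h.
rewrite le_min => /andP[hd hd'].
have -> : f (w + h) + g (w + h) - (f w + g w) - h * (D + D') =
  (f (w + h) - f w - h * D) + (g (w + h) - g w - h * D') by ring.
by apply: (le_trans (nmD _ _)); rewrite mulrDl lerD // ?q ?q'.
Qed.

Lemma QA_lin (a b : R[i]) w : QA (fun s => a * s + b) w.
Proof.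
exists a, 0, 1; split => // h _; rewrite mul0r.
by rewrite (_ : _ - _ = 0) ?nm0 //; ring.
Qed.

Lemma QA_affine f a b s : a != 0 -> QA f (a * s + b) -> QA (fun s => f (a * s + b)) s.
Proof.
move=> a0 [D [A [d [d0 A0 q]]]].
by apply: (qaQA _ (qa_affine d0 a0 q)); rewrite divr_gt0 ?nm_gt0.
Qed.

End Modulus.

(** * The exponential function and k^z *)

Section Elementary.
Variable R : realType.
Implicit Types (a b x y : R) (z w h : R[i]) (k : nat).

Lemma eq_lexx (x y : R) : x = y -> x <= y.
Proof. by move=> ->. Qed.

(** All follows from 1 + x <= exp x, taken at a and at - a. *)
Lemma expR_sub1 a : `|expR a - 1 - a| <= a ^+ 2 * expR `|a|.
Proof.
have h1 := expR_ge1Dx a; have h2 := expR_ge1Dx (- a).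
have e0 := expR_gt0 a.
have h3 : expR a - 1 <= a * expR a.
  have : (1 - a) * expR a <= expR (- a) * expR a by rewrite ler_pM2r.
  by rewrite expRN mulVf ?gt_eqF // mulrBl mul1r; lra.
rewrite ger0_norm; last by lra.
have [a0|a0] := leP 0 a.
  rewrite ger0_norm //; apply: (@le_trans _ _ (a * (expR a - 1))); first by lra.
  by rewrite expr2 -mulrA ler_wpM2l //; lra.
have e1 : 1 <= expR `|a| by apply: le_trans (expR_ge1Dx _); rewrite lerDl.
apply: (@le_trans _ _ (a ^+ 2)); last by rewrite ler_peMr ?sqr_ge0.
by nra.
Qed.

Lemma sin_MVT b : exists2 c, `|c| <= `|b| & sin b = cos c * b.
Proof.
have H x : 0 <= x -> exists2 c, `|c| <= x & sin x = cos c * x.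
  move=> x0; have [|c] := @MVT_segment R (@sin R) (@cos R) 0 x x0 (fun y _ => is_derive_sin y).
  - apply: continuous_subspaceT => y; exact: continuous_sin.
  rewrite in_itv /= => /andP[c0 cx]; rewrite sin0 !subr0 => E.
  by exists c => //; rewrite ger0_norm.
have [b0|b0] := leP 0 b; first by rewrite ger0_norm //; apply: H.
have [|c cb E] := H (- b); first by lra.
by exists c; [rewrite (ltr0_norm b0) | apply: oppr_inj; rewrite -sinN E mulrN].
Qed.

Lemma sin_le_norm b : `|sin b| <= `|b|.
Proof.
by have [c _ ->] := sin_MVT b; rewrite normrM ler_piMl // cos_max.
Qed.

Lemma cos_sub1E b : cos b - 1 = - (sin (b / 2) ^+ 2 *+ 2).
Proof.
have {1}-> : b = (b / 2) *+ 2 by rewrite -mulr_natr divfK.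
by rewrite cos_mulr2n cos2sin2; ring.
Qed.

Lemma cos_sub1 b : `|cos b - 1| <= b ^+ 2.
Proof.
rewrite cos_sub1E normrN ger0_norm ?mulrn_wge0 ?sqr_ge0 //.
have : sin (b / 2) ^+ 2 <= (b / 2) ^+ 2.
  by rewrite -[leLHS]real_normK ?num_real // -[leRHS]real_normK ?num_real // ler_sqr ?nnegrE // sin_le_norm.
have := sqr_ge0 b; rewrite -mulr_natr expr_div_n; lra.
Qed.

Lemma cos_sub1' b : `|cos b - 1| <= `|b|.
Proof.
rewrite cos_sub1E normrN ger0_norm ?mulrn_wge0 ?sqr_ge0 //.
have h1 := sin_le_norm (b / 2); have h2 := sin_max (b / 2).
have : sin (b / 2) ^+ 2 <= `|sin (b / 2)|.
  by rewrite -[leLHS]real_normK ?num_real // expr2 ler_piMl.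
move: h1; rewrite normrM (@ger0_norm _ 2^-1) // -mulr_natr; lra.
Qed.

Lemma sin_subid b : `|sin b - b| <= b ^+ 2.
Proof.
have [c cb ->] := sin_MVT b; rewrite -{2}[b]mul1r -mulrBl normrM.
rewrite -[leRHS]real_normK ?num_real // expr2 ler_wpM2r //.
exact: le_trans (cos_sub1' c) cb.
Qed.

Definition cexp z : R[i] :=
  Complex (expR (complex.Re z) * cos (complex.Im z)) (expR (complex.Re z) * sin (complex.Im z)).

Lemma cexpD z w : cexp (z + w) = cexp z * cexp w.
Proof.
apply: complexP; rewrite ?ReM ?ImM /= ReD ImD expRD ?cosD ?sinD; ring.
Qed.

Lemma cexp0 : cexp 0 = 1.
Proof. by apply: complexP; rewrite /= expR0 ?cos0 ?sin0 ?mulr1 ?mulr0. Qed.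

Lemma nm_cexp z : nm (cexp z) = expR (complex.Re z).
Proof.
by rewrite /nm /= !exprMn -mulrDr cos2Dsin2 mulr1 sqrtr_sqr ger0_norm ?expR_ge0.
Qed.

Definition cexp2 z := cexp z - 1 - z.

(** The real part exp a cos b - 1 - a and the imaginary part exp a sin b - b are each split into an
    error of the real exponential and an error of cos or sin. *)
Lemma nm_cexp2 z : nm (cexp2 z) <= 4 * nm z ^+ 2 * expR (nm z).
Proof.
case: z => a b; set N := nm (Complex a b).
have N2 : N ^+ 2 = a ^+ 2 + b ^+ 2 by rewrite sqr_sqrtr ?addr_ge0 ?sqr_ge0.
have ea : expR `|a| <= expR N by rewrite ler_expR; apply: (@Re_le_nm R (Complex a b)).
apply: (@le_trans _ _ (4 * N ^+ 2 * expR `|a|)); last first.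
  by rewrite ler_wpM2l // mulr_ge0 // sqr_ge0.
have e1 : expR a <= expR `|a| by rewrite ler_expR ler_norm.
have e0 := expR_gt0 a.
have e1' : 1 <= expR `|a| by apply: le_trans (expR_ge1Dx _); rewrite lerDl.
have h1 : `|complex.Re (cexp2 (Complex a b))| <= (a ^+ 2 + b ^+ 2) * expR `|a|.
  rewrite /cexp2 !ReD !ReN /= (_ : _ - _ = (expR a - 1 - a) + expR a * (cos b - 1)); last by ring.
  apply: (le_trans (ler_normD _ _)); rewrite mulrDl; apply: lerD; first exact: expR_sub1.
  rewrite normrM (gtr0_norm e0) mulrC; apply: ler_pM; rewrite ?(ltW e0) //.
  exact: cos_sub1.
have h3 : `|complex.Im (cexp2 (Complex a b))| <= (b ^+ 2 *+ 2 + `|a| * `|b|) * expR `|a|.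
  rewrite /cexp2 !ImD !ImN /= (_ : _ - _ = expR a * (sin b - b) + (expR a - 1) * b); last by ring.
  apply: (le_trans (ler_normD _ _)); rewrite [leRHS]mulrDl; apply: lerD.
    rewrite normrM (gtr0_norm e0) mulrC; apply: ler_pM; rewrite ?(ltW e0) //.
    by apply: le_trans (sin_subid b) _; rewrite mulr2n lerDl sqr_ge0.
  rewrite normrM mulrAC ler_wpM2r //.
  have q1 := expR_ge1Dx a; have q2 := expR_ge1Dx (- a).
  have q3 : expR a - 1 <= a * expR a.
    have : (1 - a) * expR a <= expR (- a) * expR a by rewrite ler_pM2r.
    by rewrite expRN mulVf ?gt_eqF // mulrBl mul1r; lra.
  have [a0|a0] := leP 0 a.
    by rewrite ger0_norm; [rewrite ger0_norm in e1 e1' *|]; lra.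
  have q4 : `|a| <= `|a| * expR `|a| by rewrite ler_peMr.
  apply: le_trans q4; have l1 : expR a < 1 by rewrite expR_lt1.
  by rewrite (ltr0_norm a0) ltr0_norm; lra.
apply: (le_trans (nm_le _)); apply: (le_trans (lerD h1 h3)).
rewrite -mulrDl ler_wpM2r ?expR_ge0 // N2.
have := sqr_ge0 (`|a| - `|b|); rewrite sqrrB !real_normK ?num_real //.
have := sqr_ge0 a; have := sqr_ge0 b; lra.
Qed.

Definition kp k x : R := expR (x * ln k%:R).

Lemma kp_ge0 k x : 0 <= kp k x. Proof. exact: expR_ge0. Qed.
Lemma kpD k x y : kp k (x + y) = kp k x * kp k y.
Proof. by rewrite /kp mulrDl expRD. Qed.
Lemma kp0 k : kp k 0 = 1. Proof. by rewrite /kp mul0r expR0. Qed.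
Lemma kp1 x : kp 1 x = 1. Proof. by rewrite /kp ln1 mulr0 expR0. Qed.
Lemma kpN k x : kp k (- x) = (kp k x)^-1. Proof. by rewrite /kp mulNr expRN. Qed.

Lemma natpos k : (0 < k)%N -> (k%:R : R) \in Num.pos.
Proof. by move=> k0; rewrite posrE ltr0n. Qed.

Lemma ln_nat_ge0 k : 0 <= ln (k%:R : R).
Proof. by case: k => [|k]; [rewrite ln0 | rewrite ln_ge0 // ler1n]. Qed.

Lemma kpM m k x : (0 < m)%N -> (0 < k)%N -> kp (m * k) x = kp m x * kp k x.
Proof. by move=> m0 k0; rewrite /kp natrM lnM ?natpos // mulrDr expRD. Qed.

Lemma kpX p j x : (0 < p)%N -> kp (p ^ j) x = kp p x ^+ j.
Proof.
move=> p0; elim: j => [|j IH]; first by rewrite expn0 kp1.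
by rewrite expnS kpM ?expn_gt0 ?p0 // IH exprS.
Qed.

Lemma kpMn k x n : kp k (x * n%:R) = kp k x ^+ n.
Proof. by rewrite /kp mulrAC expRM_natr. Qed.

Lemma kp_nat k n : (0 < k)%N -> kp k n%:R = k%:R ^+ n.
Proof. by move=> k0; rewrite /kp expRM_natl lnK ?natpos. Qed.

Lemma kp_id k : (0 < k)%N -> kp k 1 = k%:R.
Proof. by move=> k0; rewrite (kp_nat 1). Qed.

Lemma kp_le k x y : x <= y -> kp k x <= kp k y.
Proof. by move=> xy; rewrite ler_expR ler_wpM2r // ln_nat_ge0. Qed.

Lemma kp_le2 m k x : x <= 0 -> (0 < m)%N -> (m <= k)%N -> kp k x <= kp m x.
Proof.
move=> x0 m0 mk; rewrite ler_expR ler_wnM2l // ler_ln ?natpos ?ler_nat //.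
exact: leq_trans mk.
Qed.

Lemma ln_kp k x : 0 < x -> ln k%:R <= kp k x / x.
Proof.
move=> x0; rewrite ler_pdivlMr // mulrC; apply: le_trans (expR_ge1Dx _).
by rewrite lerDr.
Qed.

Lemma natpowE k z : natpow k z = cexp ((ln k%:R)%:C * z).
Proof. by apply: complexP; rewrite /= ReCM ImCM /= ![ln _ * _]mulrC. Qed.

Lemma nm_natpow k z : nm (natpow k z) = kp k (complex.Re z).
Proof. by rewrite natpowE nm_cexp ReCM mulrC. Qed.

Lemma natpowD k z w : natpow k (z + w) = natpow k z * natpow k w.
Proof. by rewrite !natpowE mulrDr cexpD. Qed.

Lemma natpow_real k x : natpow k x%:C = (kp k x)%:C.
Proof. by apply: complexP; rewrite /= mul0r ?cos0 ?sin0 ?mulr1 ?mulr0. Qed.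

Lemma natpow1 z : natpow 1 z = 1.
Proof. by rewrite natpowE ln1 mul0r cexp0. Qed.

Lemma natpowM m k z : (0 < m)%N -> (0 < k)%N -> natpow (m * k) z = natpow m z * natpow k z.
Proof.
move=> m0 k0; rewrite !natpowE -cexpD natrM lnM ?natpos //.
by rewrite (rmorphD (real_complex R)) mulrDl.
Qed.

Lemma natpowX p j z : (0 < p)%N -> natpow (p ^ j) z = natpow p z ^+ j.
Proof.
move=> p0; elim: j => [|j IH]; first by rewrite expn0 natpow1.
by rewrite expnS natpowM ?expn_gt0 ?p0 // IH exprS.
Qed.

(** The remainder has the factor (ln k)^2 k^d, and ln k <= k^d / d. Altogether the exponent grows by
    3d, which can be afforded inside an open half-plane of absolute convergence. *)
Lemma natpow_qa k z d : 0 < d ->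
  qa (natpow k) z ((ln k%:R)%:C * natpow k z) (4 / d ^+ 2 * kp k (complex.Re z + 3 * d)) d.
Proof.
move=> d0 h hd; have -> : natpow k (z + h) - natpow k z - h * ((ln k%:R)%:C * natpow k z) =
  natpow k z * cexp2 ((ln k%:R)%:C * h).
  by rewrite natpowD [natpow k h]natpowE /cexp2; ring.
rewrite nmM nm_natpow; have l0 := ln_nat_ge0 k.
have nE : nm ((ln k%:R)%:C * h) = ln k%:R * nm h by rewrite nmM nm_real ger0_norm.
apply: (@le_trans _ _ (kp k (complex.Re z) * (4 * (kp k d / d * nm h) ^+ 2 * kp k d))).
  rewrite ler_wpM2l ?kp_ge0 //; apply: (le_trans (nm_cexp2 _)).
  apply: ler_pM; [by rewrite mulr_ge0 ?sqr_ge0|exact: expR_ge0| |].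
    rewrite ler_wpM2l // ler_sqr ?nnegrE ?nm_ge0 ?mulr_ge0 ?invr_ge0 ?kp_ge0 ?nm_ge0 ?(ltW d0) //.
    by rewrite nE ler_wpM2r ?nm_ge0 // ln_kp.
  by rewrite ler_expR nE mulrC ler_wpM2r.
rewrite (_ : complex.Re z + 3 * d = complex.Re z + d + d + d); last by ring.
rewrite !kpD; apply: eq_lexx; rewrite !exprMn exprVn; field; lra.
Qed.

Lemma nm_natpow_diff k z d : 0 < d ->
  nm ((ln k%:R)%:C * natpow k z) <= d^-1 * kp k (complex.Re z + 3 * d).
Proof.
move=> d0; rewrite nmM nm_real ger0_norm ?ln_nat_ge0 // nm_natpow.
apply: (@le_trans _ _ (kp k d / d * kp k (complex.Re z))).
  by rewrite ler_wpM2r ?kp_ge0 // ln_kp.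
rewrite mulrAC mulrC ler_wpM2l ?invr_ge0 ?(ltW d0) // -kpD kp_le //; lra.
Qed.

Lemma qa_neg (f : R[i] -> R[i]) (b s D : R[i]) (A d : R) : 0 < d ->
  qa f (b - s) D A d -> qa (fun s => f (b - s)) s (- D) A d.
Proof.
move=> d0 q h hd; rewrite opprD addrA.
by have := q (- h); rewrite nmN mulNr => /(_ hd); rewrite mulrN opprK.
Qed.

Lemma qa_scale (f : R[i] -> R[i]) (c s D : R[i]) (A d : R) :
  qa f s D A d -> qa (fun s => c * f s) s (c * D) (nm c * A) d.
Proof.
move=> q h hd; rewrite mulrCA -!mulrBr nmM -mulrA ler_wpM2l ?nm_ge0 //.
exact: q.
Qed.

(* For k = 0 the factor [natpow 0 (- s)] is 1, so that series need c 0 = 0. *)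
Definition dt (c : nat -> R) (s : R[i]) k : R[i] := (c k)%:C * natpow k (- s).

Lemma nm_dt c s k : nm (dt c s k) = `|c k| * kp k (- complex.Re s).
Proof. by rewrite nmM nm_real nm_natpow ReN. Qed.

Lemma dt_bdd c s x : bdd (fun k => `|c k| * kp k (- x)) -> x <= complex.Re s ->
  bdd (fun k => nm (dt c s k)).
Proof.
move=> h xs; apply: bdd_le h => k; rewrite nm_dt ler_wpM2l // kp_le // lerN2.
exact: xs.
Qed.

Lemma dirichlet_QA c s x : bdd (fun k => `|c k| * kp k (- x)) -> x < complex.Re s ->
  QA (fun s => csum (dt c s)) s.
Proof.
(* With this d the exponent - Re s + 3d of the error constants is exactly - x. *)
move=> h xs; set d := (complex.Re s - x) / 3.
have d0 : 0 < d by rewrite divr_gt0 // subr_gt0.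
have E : complex.Re (- s) + 3 * d = - x by rewrite ReN /d; field.
have [|||||B] := @qa_series R (fun k s => dt c s k) s
  (fun k => (c k)%:C * - ((ln k%:R)%:C * natpow k (- s)))
  (fun k => `|c k| * (4 / d ^+ 2 * kp k (- x))) d.
- move=> k; rewrite -nm_real; apply: qa_scale.
  have := @natpow_qa k (0 - s) d d0; rewrite sub0r E => q.
  have -> : (fun s => natpow k (- s)) = (fun s : R[i] => natpow k (0 - s)).
    by apply/funext => t; rewrite sub0r.
  by apply: qa_neg => //; rewrite sub0r.
- apply: bdd_le (bddZ (_ : 0 <= 4 / d ^+ 2) h) => [k|]; first by rewrite mulrCA.
  by rewrite divr_ge0 // sqr_ge0.
- apply: bdd_le (bddZ (_ : 0 <= d^-1) h) => [k|]; last by rewrite invr_ge0 ltW.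
  rewrite nmM nm_real nmN mulrCA ler_wpM2l //.
  by have := @nm_natpow_diff k (- s) d d0; rewrite E.
- move=> t td; apply: (dt_bdd h); rewrite ReD.
  have := Re_le_nm t; rewrite ler_norml => /andP[q _].
  have : d <= complex.Re s - x by rewrite /d; lra.
  by move: q td; lra.
- exact: d0.
- by move=> q; apply: qaQA d0 q.
Qed.

Definition one_ (k : nat) : R := (0 < k)%N%:R.

Lemma ln_step k : (0 < k)%N ->
  k.+1%:R^-1 <= ln k.+1%:R - ln k%:R :> R /\ ln k.+1%:R - ln k%:R <= k%:R^-1 :> R.
Proof.
move=> k0; have kp : 0 < k%:R :> R by rewrite ltr0n.
have kp1 : 0 < k.+1%:R :> R by rewrite ltr0n.
have E : k.+1%:R = k%:R + 1 :> R by rewrite -natr1.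
split.
  rewrite -lerN2 opprB -ln_div ?natpos //.
  rewrite (_ : k%:R / k.+1%:R = 1 + - k.+1%:R^-1); last by rewrite E; field; lra.
  by apply: le_ln1Dx; rewrite ltrN2 invf_lt1 // E; lra.
rewrite -ln_div ?natpos // (_ : k.+1%:R / k%:R = 1 + k%:R^-1); last by rewrite E; field; lra.
by apply: le_ln1Dx; rewrite (lt_trans (_ : _ < 0)) ?invr_gt0 //; lra.
Qed.

(** Telescoping, with (x - 1) (k+1)^(-x) <= k^(1-x) - (k+1)^(1-x) from the lower bound in
    [ln_step]. *)
Lemma pseries_bdd x : 1 < x -> bdd (fun k => `|one_ k| * kp k (- x)).
Proof.
move=> x1; exists (1 + (x - 1)^-1) => n.
have f0 k : 0 <= `|one_ k| * kp k (- x) by rewrite mulr_ge0 ?kp_ge0.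
apply: (@le_trans _ _ (ssum (fun k => `|one_ k| * kp k (- x)) n.+2)).
  by apply: ssum_mono => //; rewrite -addn2 leq_addr.
apply: (@le_trans _ _ (1 + (1 - kp n.+1 (1 - x)) / (x - 1))); last first.
  rewrite lerD2l ler_piMl ?invr_ge0 ?subr_ge0 ?(ltW x1) //.
  by rewrite lerBlDr lerDl kp_ge0.
elim: n => [|n IH].
  by rewrite !ssumS ssum0 /one_ !kp1 normr0 normr1; lra.
rewrite ssumS {1}/one_ normr1 mul1r.
have [h _] := @ln_step n.+1 isT; set m := _ - _ in h.
have x0 : 0 < x - 1 by lra.
have : (x - 1) * kp n.+2 (- x) <= kp n.+1 (1 - x) - kp n.+2 (1 - x).
  have -> : kp n.+1 (1 - x) = kp n.+2 (1 - x) * expR ((x - 1) * m).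
    by rewrite /kp -expRD /m; congr expR; ring.
  have := expR_ge1Dx ((x - 1) * m) => q.
  have E : kp n.+2 (1 - x) = n.+2%:R * kp n.+2 (- x) by rewrite kpD kp_id.
  have K := kp_ge0 n.+2 (- x).
  rewrite -[X in _ <= _ - X]mulr1 -mulrBr E.
  apply: (@le_trans _ _ (n.+2%:R * kp n.+2 (- x) * ((x - 1) * n.+2%:R^-1))).
    have : n.+2%:R != 0 :> R by rewrite pnatr_eq0.
    by move: (n.+2%:R : R) => N N0; apply: eq_lexx; field.
  rewrite ler_wpM2l ?mulr_ge0 ?ler0n //.
  have : (x - 1) * n.+2%:R^-1 <= (x - 1) * m by rewrite ler_wpM2l // ltW.
  by move=> q'; apply: (le_trans q'); lra.
rewrite -ler_pdivlMl // => q; apply: (le_trans (lerD IH q)).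
by apply: eq_lexx; field; lra.
Qed.

End Elementary.

(** * The pole of the Riemann zeta function *)

Section ZetaPole.
Variable R : realType.
Implicit Types (x y : R) (z w h : R[i]) (k n : nat).

Definition lam n : R := ln n.+2%:R - ln n.+1%:R.
(** For k = n + 1 and z = 1 - w, the linear term of k^z (exp (z lam) - 1) is z lam k^z = z (1 - rho
    k) k^(-w), and [zu] is the remainder of second order. Since lam and rho are O(1/k), both series
    converge for Re w > 0. *)
Definition rho k : R := if k is n.+1 then 1 - k%:R * lam n else 0.
Definition zu w n : R[i] := natpow n.+1 (1 - w) * cexp2 ((lam n)%:C * (1 - w)).

(* (w - 1) zeta(w), obtained by summing
   (n+1)^z - n^z = n^z (exp (z (ln (n+1) - ln n)) - 1) over n, with z = 1 - w. *)
Definition Zone w : R[i] := 1 + ((w - 1) * csum (dt rho w) + csum (zu w)).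

Lemma lam_ge0 n : 0 <= lam n.
Proof. by have [h _] := @ln_step R n.+1 isT; apply: le_trans h; rewrite invr_ge0. Qed.

Lemma lam_le n : lam n <= n.+1%:R^-1.
Proof. by have [_] := @ln_step R n.+1 isT. Qed.

Lemma lam_le1 n : lam n <= 1.
Proof. by apply: (le_trans (lam_le n)); rewrite invf_le1 // ler1n. Qed.

Lemma lam_sqr n : lam n ^+ 2 <= kp n.+1 (- 2).
Proof.
rewrite kpN (@kp_nat R n.+1 2) // -exprVn ler_sqr ?nnegrE ?lam_ge0 ?invr_ge0 //.
exact: lam_le.
Qed.

Lemma rho_bound k : `|rho k| <= one_ R k * kp k (- 1).
Proof.
case: k => [|n]; first by rewrite normr0 mulr_ge0 ?kp_ge0.
rewrite /rho /one_ mul1r kpN kp_id //; have h2 := lam_le n.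
have [h1 _] := @ln_step R n.+1 isT; rewrite -/(lam n) in h1.
have n0 : 0 < n.+1%:R :> R by rewrite ltr0n.
have E : n.+2%:R = n.+1%:R + 1 :> R by rewrite -natr1.
move: h1 h2; rewrite E; move: n0; move: (n.+1%:R : R) (lam n) => N l N0 h1 h2.
have q1 : N * l <= 1 by rewrite -(mulfV (lt0r_neq0 N0)) ler_pM2l.
rewrite ger0_norm; last by lra.
have q2 : N * (N + 1)^-1 <= N * l by rewrite ler_pM2l.
have q3 : 1 - N * (N + 1)^-1 = (N + 1)^-1 by field; lra.
have q4 : (N + 1)^-1 <= N^-1 by rewrite lef_pV2 ?posrE //; lra.
lra.
Qed.

Lemma rho_bdd x : 0 < x -> bdd (fun k => `|rho k| * kp k (- x)).
Proof.
move=> x0; have : 1 < 1 + x by lra.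
move=> /(@pseries_bdd R); apply: bdd_le => k.
have -> : `|one_ R k| = one_ R k by rewrite ger0_norm ?ler0n.
rewrite opprD kpD mulrA ler_wpM2r ?kp_ge0 //; exact: rho_bound.
Qed.

Lemma bdd_shift (f : nat -> R) : 0 <= f 0%N -> bdd f -> bdd (fun n => f n.+1).
Proof.
move=> f0 [B fB]; exists B => n; apply: le_trans (fB n.+1).
by rewrite /ssum big_nat_recl // lerDr.
Qed.

Lemma pseries_shift x : 1 < x -> bdd (fun n => kp n.+1 (- x)).
Proof.
move=> /(@pseries_bdd R) /bdd_shift; rewrite /one_ normr0 mul0r => /(_ (lexx _)).
by apply: bdd_le => n; rewrite normr1 mul1r.
Qed.

Lemma cexp2_qa z (l M : R) : 0 <= l -> l <= 1 -> nm z <= M ->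
  [/\ qa (fun z => cexp2 (l%:C * z)) z (l%:C * (cexp (l%:C * z) - 1)) (l ^+ 2 * (4 * expR M * expR 1)) 1,
   nm (cexp2 (l%:C * z)) <= l ^+ 2 * (4 * M ^+ 2 * expR M) &
   nm (l%:C * (cexp (l%:C * z) - 1)) <= l ^+ 2 * (M + 4 * M ^+ 2 * expR M)].
Proof.
move=> l0 l1 zM; have z0 := nm_ge0 z.
have lE (y : R[i]) : nm (l%:C * y) = l * nm y by rewrite nmM nm_real ger0_norm.
have lz : l * nm z <= M by apply: le_trans zM; rewrite ler_piMl.
have h2 : nm (cexp2 (l%:C * z)) <= l ^+ 2 * (4 * M ^+ 2 * expR M).
  apply: (le_trans (nm_cexp2 _)); rewrite lE exprMn.
  rewrite [leLHS](_ : _ = l ^+ 2 * (4 * nm z ^+ 2 * expR (l * nm z))); last by ring.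
  rewrite ler_wpM2l ?sqr_ge0 //; apply: ler_pM; rewrite ?expR_ge0 ?ler_expR //.
    by rewrite mulr_ge0 ?sqr_ge0.
  by rewrite ler_wpM2l // ler_sqr ?nnegrE // (le_trans z0).
split => //.
  move=> h h1; have -> : cexp2 (l%:C * (z + h)) - cexp2 (l%:C * z) - h * (l%:C * (cexp (l%:C * z) - 1))
     = cexp (l%:C * z) * cexp2 (l%:C * h).
    by rewrite /cexp2 mulrDr cexpD; ring.
  rewrite nmM nm_cexp; apply: (@le_trans _ _ (expR M * (4 * (l * nm h) ^+ 2 * expR 1))).
    apply: ler_pM; rewrite ?expR_ge0 ?nm_ge0 //.
      rewrite ler_expR; apply: le_trans lz; rewrite -lE.
      exact: le_trans (ler_norm _) (Re_le_nm _).
    apply: (le_trans (nm_cexp2 _)); rewrite lE ler_wpM2l ?mulr_ge0 ?nm_ge0 // ler_expR.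
    by rewrite -[leRHS]mulr1 ler_pM ?nm_ge0.
  by apply: eq_lexx; ring.
rewrite lE expr2 -mulrA ler_wpM2l //.
have -> : cexp (l%:C * z) - 1 = l%:C * z + cexp2 (l%:C * z) by rewrite /cexp2; ring.
apply: (le_trans (nmD _ _)); rewrite mulrDr; apply: lerD; first by rewrite lE ler_wpM2l.
apply: (le_trans h2); rewrite expr2 -[leLHS]mulrA ler_piMl //.
by rewrite !mulr_ge0 ?expR_ge0 // (le_trans z0).
Qed.

(** A product of [natpow], of order k^(1 - Re w), and [cexp2], of order lam^2 <= k^(-2). After a
    loss k^(3d) the exponent - y is still below - 1. Values, derivatives and error constants get one
    common bound, as [qa_series] requires. *)
Lemma zu_qa w : 0 < complex.Re w ->
  exists (d C y : R), [/\ 0 < d, 0 <= C, 1 < y & forall n, exists D,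
     [/\ qa (fun w => zu w n) w D (C * kp n.+1 (- y)) d, nm D <= C * kp n.+1 (- y) &
         forall h, nm h <= d -> nm (zu (w + h) n) <= C * kp n.+1 (- y)]].
Proof.
move=> w0; set d := Num.min 1 (complex.Re w / 6).
have d0 : 0 < d by rewrite lt_min ltr01 divr_gt0.
have d1 : d <= 1 by rewrite ge_min lexx.
have dw : d <= complex.Re w / 6 by rewrite ge_min lexx orbT.
set M := nm (1 - w) + 1.
have M0 : 0 <= M by rewrite addr_ge0 ?nm_ge0.
(* The number [c1] dominates all constants of the factor [natpow], and [c2] those of the factor
   [cexp2]. The 6 below is 1 + 1 + 4, from the three terms of the error constant of a product. *)
set c1 := 1 + d^-1 + 4 / d ^+ 2; set c2 := 4 * expR M * expR 1 + 4 * M ^+ 2 * expR M + M.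
have dV : 0 < d^-1 by rewrite invr_gt0.
have dV2 : 0 < 4 / d ^+ 2 by rewrite divr_gt0 // exprn_gt0.
have c10 : 0 <= c1 by rewrite /c1; lra.
have c20 : 0 <= c2 by rewrite /c2 !addr_ge0 ?mulr_ge0 ?expR_ge0 ?sqr_ge0 ?nm_ge0.
exists d, (6 * (c1 * c2)), (1 + complex.Re w - 3 * d).
split=> //; first by rewrite !mulr_ge0.
  by lra.
move=> n; have l0 := lam_ge0 n; have l1 := lam_le1 n; have l2 := lam_sqr n.
set l := lam n in l0 l1 l2 *.
have zM : nm (1 - w) <= M by rewrite /M lerDl.
have [q2 g0 g1] := cexp2_qa l0 l1 zM.
have q1 := @natpow_qa R n.+1 (1 - w) d d0.
have f1 := @nm_natpow_diff R n.+1 (1 - w) d d0.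
have f0 : nm (natpow n.+1 (1 - w)) <= kp n.+1 (complex.Re (1 - w) + 3 * d).
  by rewrite nm_natpow kp_le //; lra.
have Q1 : 0 <= l ^+ 2 by rewrite sqr_ge0.
have e1 : expR M * expR 1 >= 0 by rewrite mulr_ge0 ?expR_ge0.
have e2 : M ^+ 2 * expR M >= 0 by rewrite mulr_ge0 ?expR_ge0 ?sqr_ge0.
set K := kp n.+1 (complex.Re (1 - w) + 3 * d) in q1 f1 f0.
have K0 : 0 <= K by apply: kp_ge0.
have KE : K * kp n.+1 (- 2) = kp n.+1 (- (1 + complex.Re w - 3 * d)).
  by rewrite /K -kpD; congr (kp _ _); rewrite ReD ReN /=; ring.
have Kl : K * c1 * (l ^+ 2 * c2) <= c1 * c2 * kp n.+1 (- (1 + complex.Re w - 3 * d)).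
  rewrite -KE (_ : K * c1 * _ = c1 * c2 * (K * l ^+ 2)); last by ring.
  by rewrite ler_wpM2l ?mulr_ge0 // ler_wpM2l.
have f0' : nm (natpow n.+1 (1 - w)) <= K * c1.
  apply: (le_trans f0); rewrite ler_peMr // /c1; lra.
have f1' : nm ((ln n.+1%:R)%:C * natpow n.+1 (1 - w)) <= K * c1.
  apply: (le_trans f1); rewrite mulrC ler_wpM2l // /c1; lra.
have A1' : 4 / d ^+ 2 * K <= K * c1 by rewrite mulrC ler_wpM2l // /c1; lra.
have g0' : nm (cexp2 (l%:C * (1 - w))) <= l ^+ 2 * c2.
  by apply: (le_trans g0); rewrite ler_wpM2l // /c2; rewrite -!mulrA; lra.
have g1' : nm (l%:C * (cexp (l%:C * (1 - w)) - 1)) <= l ^+ 2 * c2.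
  by apply: (le_trans g1); rewrite ler_wpM2l // /c2; rewrite -!mulrA; lra.
have A2' : l ^+ 2 * (4 * expR M * expR 1) <= l ^+ 2 * c2.
  by rewrite ler_wpM2l // /c2; rewrite -!mulrA; lra.
have A10 : 0 <= 4 / d ^+ 2 * K by rewrite mulr_ge0 // ltW.
have A20 : 0 <= l ^+ 2 * (4 * expR M * expR 1) by rewrite mulr_ge0 // -mulrA mulr_ge0.
have q := qa_mul (ltW d0) A10 A20 (qa_neg d0 q1) (qa_weak (lexx _) d1 (qa_neg ltr01 q2)).
move: Kl; set F := K * c1; set G := l ^+ 2 * c2; set T := kp _ (- _) => Kl.
have F0 : 0 <= F by rewrite mulr_ge0.
have G0 : 0 <= G by rewrite mulr_ge0.
have FG a b : 0 <= a -> 0 <= b -> a <= F -> b <= G -> a * b <= F * G by move=> *; apply: ler_pM.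
eexists; split; first apply: qa_weak q => //.
- rewrite !nmN; have H1 := FG _ _ (nm_ge0 _) A20 f0' A2'.
  have H2 := FG _ _ A10 (nm_ge0 _) A1' g0'.
  have H3 : (nm ((ln n.+1%:R)%:C * natpow n.+1 (1 - w)) + 4 / d ^+ 2 * K * d) *
    (nm (l%:C * (cexp (l%:C * (1 - w)) - 1)) + l ^+ 2 * (4 * expR M * expR 1) * d) <= (F + F) * (G + G).
    apply: ler_pM; [by rewrite addr_ge0 ?nm_ge0 // (mulr_ge0 A10) // ltW|by rewrite addr_ge0 ?nm_ge0 // (mulr_ge0 A20) // ltW| |]; apply: lerD => //.
      by apply: le_trans A1'; rewrite ler_piMr.
    by apply: le_trans A2'; rewrite ler_piMr.
  rewrite [nm (cexp2 _) * _]mulrC; have := mulr_ge0 F0 G0; lra.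
- have H1 := FG _ _ (nm_ge0 _) (nm_ge0 _) f1' g0'.
  have H2 := FG _ _ (nm_ge0 _) (nm_ge0 _) f0' g1'.
  apply: (le_trans (nmD _ _)); rewrite !nmM !nmN -?nmM [nm (_ * _ * _)]nmM [nm (natpow _ _ * _)]nmM.
  have := mulr_ge0 F0 G0; lra.
- move=> h hd; rewrite /zu nmM nm_natpow.
  have hM : nm (1 - (w + h)) <= M.
    rewrite opprD addrA; apply: (le_trans (nm_subD _ _)).
    by rewrite lerD2l; apply: le_trans d1.
  have [_ g0h _] := cexp2_qa l0 l1 hM.
  have H1 : kp n.+1 (complex.Re (1 - (w + h))) <= F.
    apply: (@le_trans _ _ K); last by rewrite ler_peMr // /c1; lra.
    rewrite kp_le // !ReD !ReN !ReD /=.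
    have := Re_le_nm h; rewrite ler_norml => /andP[]; lra.
  have H2 : nm (cexp2 (l%:C * (1 - (w + h)))) <= G.
    by apply: (le_trans g0h); rewrite ler_wpM2l // /c2; rewrite -!mulrA; lra.
  have := FG _ _ (kp_ge0 _ _) (nm_ge0 _) H1 H2.
  have := mulr_ge0 F0 G0; lra.
Qed.

Lemma zu_QA w : 0 < complex.Re w -> QA (fun w => csum (zu w)) w.
Proof.
move=> w0; have [d [C [y [d0 C0 y1 H]]]] := zu_qa w0.
have [D HD] := choice H.
have by_ := bddZ C0 (pseries_shift y1).
have [|||||B] := @qa_series R (fun n w => zu w n) w D (fun n => C * kp n.+1 (- y)) d.
- by move=> n; have [] := HD n.
- exact: by_.
- by apply: bdd_le by_ => n; have [] := HD n.
- by move=> h hd; apply: bdd_le by_ => n; have [_ _] := HD n; apply.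
- exact: d0.
- exact: qaQA.
Qed.

Lemma zu_bdd w : 0 < complex.Re w -> bdd (fun n => nm (zu w n)).
Proof.
move=> w0; have [d [C [y [d0 C0 y1 H]]]] := zu_qa w0.
apply: bdd_le (bddZ C0 (pseries_shift y1)) => n.
by have [D [_ _]] := H n; move=> /(_ 0); rewrite nm0 addr0; apply; apply: ltW.
Qed.

Lemma eq_QA (f g : R[i] -> R[i]) w : f =1 g -> QA f w -> QA g w.
Proof. by move=> /funext->. Qed.

Lemma Zone_QA w : 0 < complex.Re w -> QA Zone w.
Proof.
move=> w0; rewrite /Zone; apply: QA_add.
  by apply: eq_QA (QA_lin 0 1 w) => s; rewrite mul0r add0r.
apply: QA_add (zu_QA w0); apply: QA_mul.
  by apply: eq_QA (QA_lin 1 (- 1) w) => s; rewrite mul1r.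
have h : 0 < complex.Re w / 2 by rewrite divr_gt0.
apply: (dirichlet_QA (rho_bdd h)); lra.
Qed.

Lemma Zone1 : Zone 1 = 1.
Proof.
rewrite /Zone subrr mul0r add0r (_ : csum _ = 0) ?addr0 //.
have E : zu 1 = fun=> 0.
  apply/funext => n; rewrite /zu subrr mulr0 /cexp2 cexp0 subrr subr0.
  by rewrite mulr0.
apply: ctends_csum; last by exists 0 => n; rewrite /ssum big1 // => i _; rewrite E nm0.
apply: eq_ctends (ctends_cst 0) => n; rewrite /ssum big1 // => i _; by rewrite E.
Qed.

(** The exact form of the telescoping for partial sums; its boundary term [natpow n.+1 (1 - w)]
    tends to 0 when Re w > 1. *)
Lemma zeta_partial w n :
  (w - 1) * ssum (dt (one_ R) w) n.+1 =
  1 - natpow n.+1 (1 - w) + ((w - 1) * ssum (dt rho w) n.+1 + ssum (zu w) n).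
Proof.
elim: n => [|n IH].
  rewrite !ssumS !ssum0 /dt /one_ /rho natpow1 /=.
  by rewrite (_ : 0%:C = 0 :> R[i]) // !(mul0r, addr0, mulr0, subrr).
rewrite [ssum (dt _ _) n.+2]ssumS mulrDr IH [ssum (dt rho w) n.+2]ssumS [ssum (zu w) n.+1]ssumS.
have E2 : natpow n.+2 (1 - w) = natpow n.+1 (1 - w) * cexp ((lam n)%:C * (1 - w)).
  rewrite !natpowE -cexpD -mulrDl -(rmorphD (real_complex R)).
  by rewrite (_ : ln n.+1%:R + lam n = ln n.+2%:R) // /lam; ring.
have E1 : natpow n.+1 (1 - w) = (n.+1%:R)%:C * natpow n.+1 (- w).
  by rewrite natpowD -[1]/((1 : R)%:C) natpow_real kp_id.
have E3 : (rho n.+1)%:C = 1 - (n.+1%:R)%:C * (lam n)%:C.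
  by rewrite /rho; apply: complexP => /=; ring.
have E4 : (one_ R n.+1)%:C = 1 by [].
rewrite {2 4}/dt /zu /cexp2 E2 E1 E3 E4.
move: (ssum _ _) (ssum _ _) ((n.+1%:R)%:C) ((lam n)%:C) (natpow _ _) (cexp _) => S1 S2 N l P Q; ring.
Qed.

Lemma natpow_to0 z : complex.Re z < 0 -> ctends (fun n => natpow n.+1 z) 0.
Proof.
move=> z0; apply: (@ctends_dist _ _ _ (fun n => kp n.+1 (complex.Re z))).
  by move=> n; rewrite subr0 nm_natpow.
have h0 n : 0 <= kp n.+1 (complex.Re z) by apply: kp_ge0.
apply/cvgrPdist_le => e e0.
near=> n; rewrite sub0r normrN ger0_norm // /kp -[leRHS]lnK ?posrE // ler_expR.
set y := complex.Re z in z0 *.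
have y0 : 0 < - y by rewrite oppr_gt0.
have : expR (- ln e / - y) <= n.+1%:R.
  rewrite -natr1 -[leLHS]addr0 lerD //; near: n; exact: nbhs_infty_ger.
rewrite -{1}[n.+1%:R]lnK ?natpos // ler_expR ler_pdivrMr // mulrN lerN2.
by rewrite mulrC.
Unshelve. all: by end_near.
Qed.

Lemma zeta_Zone w : 1 < complex.Re w -> (w - 1) * csum (dt (one_ R) w) = Zone w.
Proof.
move=> w1; have w0 : 0 < complex.Re w by lra.
have b1 : bdd (fun k => nm (dt (one_ R) w k)) by apply: (dt_bdd (pseries_bdd w1)).
have h : 0 < complex.Re w / 2 by rewrite divr_gt0.
have b2 : bdd (fun k => nm (dt rho w k)) by apply: (dt_bdd (rho_bdd h)); lra.
have S (u : nat -> R[i]) z : ctends u z -> ctends (fun n => u n.+1) z.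
  by move=> uz; have := (ctends_shift 1 u z).2 uz; apply: eq_ctends => n; rewrite addn1.
have c1 := ctendsZ (w - 1) (S _ _ (csumP b1)).
have c2 := ctendsZ (w - 1) (S _ _ (csumP b2)).
have c3 : ctends (fun n => natpow n.+1 (1 - w)) 0 by apply: natpow_to0; rewrite ReD ReN /=; lra.
have := ctendsD (ctendsB (ctends_cst 1) c3) (ctendsD c2 (csumP (zu_bdd w0))).
rewrite subr0 => c4; apply: ctends_unique c1 _.
by apply: eq_ctends c4 => n; rewrite zeta_partial.
Qed.

End ZetaPole.

(** * Euler products *)

(* The integers whose prime factors are < P, with exponents < J. *)
Fixpoint Eset (J P : nat) : seq nat :=
  if P is Q.+1 then
    if prime Q then [seq (m * Q ^ j)%N | m <- Eset J Q, j <- iota 0 J] else Eset J Q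
  else [:: 1%N].

Lemma Eset_gt0 J P n : n \in Eset J P -> (0 < n)%N.
Proof.
elim: P n => [|P IH] n /=; first by rewrite inE => /eqP->.
case: ifP => [pP|_]; last exact: IH.
by move=> /allpairsP[[m j] /= [/IH m0 _ ->]]; rewrite muln_gt0 m0 expn_gt0 prime_gt0.
Qed.

Lemma Eset_lt J P n p : n \in Eset J P -> prime p -> (p %| n)%N -> (p < P)%N.
Proof.
elim: P n => [|P IH] n /=.
  by rewrite inE => /eqP-> pp; rewrite dvdn1 => /eqP p1; rewrite p1 in pp.
case: ifP => [pP|_ nE pp pn]; last by apply: ltnW; apply: IH nE pp pn.
move=> /allpairsP[[m j] /= [mE _ ->]] pp; rewrite Euclid_dvdM // => /orP[pm|].
  by apply: ltnW; apply: IH mE pp pm.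
by rewrite Euclid_dvdX // => /andP[]; rewrite dvdn_prime2 // => /eqP->.
Qed.

Lemma Eset_coprime J P n k : n \in Eset J P -> prime P -> coprime n (P ^ k).
Proof.
move=> nE pP; rewrite coprimeXr // coprime_sym prime_coprime //.
by apply/negP => /(Eset_lt nE pP); rewrite ltnn.
Qed.

Lemma Eset_uniq J P : uniq (Eset J P).
Proof.
elim: P => [|P IH] //=; case: ifP => // pP.
apply: allpairs_uniq => //; first exact: iota_uniq.
move=> [m j] [m' j'] /allpairsP[[x y] /= [xE _ [-> ->]]] /allpairsP[[x' y'] /= [xE' _ [-> ->]]] /= E.
have L z k : z \in Eset J P -> logn P (z * P ^ k) = k.
  move=> zE; rewrite logn_Gauss ?pfactorK // coprime_sym.
  by have := Eset_coprime 1 zE pP; rewrite expn1.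
have yy : y = y' by rewrite -(L x y xE) E L.
congr pair => //; move: E; rewrite yy => /eqP; rewrite eqn_pmul2r ?expn_gt0 ?prime_gt0 //.
by move/eqP.
Qed.

Lemma Eset_complete J P n : (0 < n)%N -> (forall p, prime p -> (p %| n)%N -> (p < P)%N) ->
  (forall p, (logn p n < J)%N) -> n \in Eset J P.
Proof.
elim: P n => [|P IH] n n0 np nJ /=.
  rewrite inE; apply/eqP; case: (ltngtP n 1%N) => //; first by case: n n0 {np nJ} => [|[]].
  by move=> n1; have := np _ (pdiv_prime n1) (pdiv_dvd n).
case: ifP => [pP|pP]; last first.
  apply: IH => // p pp pn; have := np p pp pn; rewrite ltnS leq_eqVlt => /orP[/eqP pE|//].
  by rewrite pE pP in pp.
have [m cm nE] := pfactor_coprime pP n0.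
apply/allpairsP; exists (m, logn P n) => /=; split => //; last by rewrite mem_iota add0n nJ.
have m0 : (0 < m)%N by move: n0; rewrite nE muln_gt0 => /andP[].
apply: IH => // [p pp pm|p].
  have := np p pp; rewrite nE dvdn_mulr // => /(_ isT); rewrite ltnS leq_eqVlt => /orP[/eqP pE|//].
  by move: cm; rewrite -pE prime_coprime // pm.
apply: leq_ltn_trans (nJ p); apply: dvdn_leq_log => //.
by rewrite [X in (_ %| X)%N]nE dvdn_mulr.
Qed.

Lemma Eset_sum (T : comPzRingType) (f : nat -> T) J P : f 1%N = 1 ->
  (forall m k, (0 < m)%N -> (0 < k)%N -> coprime m k -> f (m * k)%N = f m * f k) ->
  \sum_(n <- Eset J P) f n = \prod_(0 <= p < P | prime p) \sum_(0 <= j < J) f (p ^ j)%N.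
Proof.
move=> f1 fM; elim: P => [|P IH]; first by rewrite big_seq1 big_geq.
rewrite [RHS]big_mkcond big_nat_recr //= -big_mkcond /=; case: ifP => pP; last by rewrite mulr1.
rewrite big_allpairs_dep /= -IH mulr_suml; apply: eq_big_seq => m mE.
rewrite mulr_sumr /index_iota subn0; apply: eq_bigr => j _.
by rewrite fM ?(Eset_gt0 mE) ?expn_gt0 ?prime_gt0 // (Eset_coprime _ mE).
Qed.

Lemma Eset_filter J P N : (N <= P)%N -> (N <= J)%N ->
  perm_eq [seq n <- Eset J P | (n < N)%N] (index_iota 1 N).
Proof.
move=> NP NJ; apply: uniq_perm; rewrite ?filter_uniq ?Eset_uniq ?iota_uniq // => n.
rewrite mem_filter mem_index_iota andbC; case: (ltnP n N) => nN; rewrite ?andbF // !andbT.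
apply/idP/idP; first exact: Eset_gt0.
move=> n0; apply: Eset_complete => // [p pp pn|p].
  by apply: leq_trans NP; apply: leq_ltn_trans nN; apply: dvdn_leq.
apply: leq_trans NJ; apply: leq_ltn_trans nN; apply: ltnW.
by apply: leq_trans (ltn_logl p n0) _.
Qed.

Section Euler.
Variable R : realType.
Implicit Types (f : nat -> R[i]) (F : nat -> R).

Lemma ssum1 (T : nmodType) (f : nat -> T) N : f 0%N = 0 -> ssum f N = \sum_(1 <= i < N) f i.
Proof.
case: N => [|N] f0; first by rewrite ssum0 big_geq.
by rewrite /ssum big_ltn // f0 add0r.
Qed.

Lemma uniq_sum_le F (s : seq nat) N M : (forall n, 0 <= F n) -> uniq s -> (N <= M)%N ->
  (forall n, n \in s -> (N <= n < M)%N) -> \sum_(n <- s) F n <= ssum F M - ssum F N.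
Proof.
move=> F0 us NM sNM; rewrite /ssum (big_cat_nat _ NM) //= addrAC subrr add0r.
have <- : \sum_(n <- [seq n <- index_iota N M | n \in s]) F n = \sum_(n <- s) F n.
  apply: perm_big; apply: uniq_perm; rewrite ?filter_uniq ?iota_uniq // => n.
  by rewrite mem_filter mem_index_iota; case: (boolP (n \in s)) => // /sNM ->.
by rewrite big_filter big_mkcond; apply: ler_sum => n _; case: ifP.
Qed.

Definition multf (T : pzRingType) (f : nat -> T) :=
  [/\ f 0%N = 0, f 1%N = 1 &
   forall m k, (0 < m)%N -> (0 < k)%N -> coprime m k -> f (m * k)%N = f m * f k].

(** The sum over n < N is at most the product of the local sums over p < N, hence at most the
    exponential of the sum of the [B p], which converges by comparison with p^(-th). *)
Lemma sum_bdd F (B : nat -> R) (P0 : nat) (C th : R) : (forall n, 0 <= F n) -> multf F ->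
  0 <= C -> 1 < th -> (forall p, 0 <= B p) ->
  (forall p J, prime p -> \sum_(0 <= j < J) F (p ^ j)%N <= 1 + B p) ->
  (forall p, prime p -> (P0 <= p)%N -> B p <= C * kp p (- th)) -> bdd F.
Proof.
move=> F0 [Fz F1 FM] C0 th1 B0 BF BC; have [Z HZ] := pseries_bdd th1.
exists (expR (ssum B P0 + C * Z)) => N.
apply: (@le_trans _ _ (\sum_(n <- Eset N N) F n)).
  rewrite ssum1 // -(perm_big _ (Eset_filter (leqnn N) (leqnn N))) /= big_filter big_mkcond.
  by apply: ler_sum => n _; case: ifP.
rewrite Eset_sum //; apply: (@le_trans _ _ (\prod_(0 <= p < N | prime p) expR (B p))).
  apply: ler_prod => p pp; rewrite sumr_ge0 //=.
  exact: le_trans (BF p N pp) (expR_ge1Dx _).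
rewrite -expR_sum ler_expR.
apply: (@le_trans _ _ (ssum (fun p => (if (p < P0)%N then B p else 0) + C * (`|one_ R p| * kp p (- th))) N)).
  rewrite /ssum big_mkcond; apply: ler_sum => p _.
  have q0 : 0 <= C * (`|one_ R p| * kp p (- th)) by rewrite !mulr_ge0 ?kp_ge0.
  case: ifP => pp; last by rewrite addr_ge0 //; case: ifP.
  case: ltnP => pP; first by rewrite lerDl.
  by rewrite add0r /one_ prime_gt0 // normr1 mul1r BC.
rewrite /ssum big_split /= -mulr_sumr; apply: lerD; last by rewrite ler_wpM2l // HZ.
rewrite -big_mkcond -big_filter; have := @uniq_sum_le B [seq p <- index_iota 0 N | (p < P0)%N] 0 P0 B0.
rewrite ssum0 subr0; apply; rewrite ?filter_uniq ?iota_uniq // => p.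
by rewrite mem_filter => /andP[].
Qed.

Lemma ctends_prod (r : seq nat) (P : pred nat) (u : nat -> nat -> R[i]) z :
  (forall p, P p -> ctends (u p) (z p)) ->
  ctends (fun n => \prod_(p <- r | P p) u p n) (\prod_(p <- r | P p) z p).
Proof.
move=> uz; elim: r => [|p r IH].
  by rewrite big_nil; apply: eq_ctends (ctends_cst 1) => n; rewrite big_nil.
rewrite big_cons; case: ifP => Pp.
  by apply: eq_ctends (ctendsM (uz p Pp) IH) => n; rewrite big_cons Pp.
by apply: eq_ctends IH => n; rewrite big_cons Pp.
Qed.

(** The product over p < P and the partial sum over n < P differ by terms with n >= P only, so by at
    most a tail of an absolutely convergent series. *)
Lemma euler_product f (loc : nat -> R[i]) : multf f -> bdd (fun n => nm (f n)) ->
  (forall p, prime p -> ctends (ssum (fun j => f (p ^ j)%N)) (loc p)) ->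
  ctends (fun P => \prod_(0 <= p < P | prime p) loc p) (csum f).
Proof.
move=> [f0 f1 fM] fb fl; set F := fun n => nm (f n).
have F0 n : 0 <= F n by apply: nm_ge0.
have cF := bdd_cvg F0 fb; set r := fun n => limn (ssum F) - ssum F n.
have tail n m : ssum F m - ssum F n <= r n.
  rewrite lerD2r; apply: (nondecreasing_cvgn_le (fun i j ij => ssum_mono F0 ij) cF).
have r0 : r @ \oo --> 0.
  by rewrite -(subrr (limn (ssum F))); apply: cvgB => //; apply: cvg_cst.
apply: (@ctends_dist _ _ _ (fun n => r n + r n)); last by rewrite -(addr0 0); apply: cvgD.
move=> P; rewrite -(subrKA (ssum f P)); apply: (le_trans (nmD _ _)); apply: lerD.
  have h := @ctends_prod (index_iota 0 P) prime _ _ fl.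
  have {}h := (ctends_shift P _ _).2 h.
  (* The exponents run below J + P: bounds of at least P guarantee that every n < P occurs in the
     expanded product. *)
  apply: ctends_le (ctendsB h (ctends_cst (ssum f P))) _ => J; set K := (J + P)%N.
  rewrite -Eset_sum // ssum1 // -(perm_big _ (Eset_filter (leqnn P) (leq_addl J P))) /=.
  rewrite big_filter (bigID (fun n => (n < P)%N)) /= addrAC subrr add0r.
  apply: (le_trans (nm_sum _ _ _)).
  rewrite -big_filter; set s := [seq _ <- _ | _].
  have [M sM] : exists M, forall n, n \in s -> (n < M)%N.
    exists (\max_(n <- s) n).+1 => n ns; rewrite ltnS.
    exact: (@leq_bigmax_seq _ s predT id n).
  apply: (le_trans (@uniq_sum_le F s P (maxn P M) F0 _ _ _)) (tail _ _).
  - by rewrite filter_uniq // Eset_uniq.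
  - exact: leq_maxl.
  - move=> n ns; apply/andP; split; last by rewrite leq_max (sM n ns) orbT.
    by move: ns; rewrite mem_filter -leqNgt => /andP[].
have h := csumP fb; have {}h := (ctends_shift P _ _).2 h.
apply: ctends_le (ctendsB (ctends_cst (ssum f P)) h) _ => J.
rewrite nmB; apply: le_trans (tail P (J + P)%N).
rewrite /ssum (big_cat_nat _ (leq_addl J P)) //= [\sum_(0 <= i < J + P) F i](big_cat_nat _ (leq_addl J P)) //=.
have sb (T : zmodType) (x y : T) : x + y - x = y by rewrite addrAC subrr add0r.
by rewrite !sb; apply: nm_sum.
Qed.

Lemma multf_dt (c : nat -> R) s : multf c -> multf (dt c s).
Proof.
move=> [c0 c1 cM]; split; rewrite /dt ?c0 ?c1 ?natpow1 ?mulr1 //.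
  exact: mul0r.
move=> m k m0 k0 mk; rewrite cM // natpowM // (rmorphM (real_complex R)).
by rewrite mulrACA.
Qed.

Lemma multf_one : multf (one_ R).
Proof. by split => // m k m0 k0 _; rewrite /one_ muln_gt0 m0 k0 mulr1. Qed.

Lemma multf_abs (c : nat -> R) x : multf c -> multf (fun k => `|c k| * kp k (- x)).
Proof.
move=> [c0 c1 cM]; split; rewrite ?c0 ?c1 ?normr0 ?normr1 ?mul0r ?kp1 ?mulr1 //.
by move=> m k m0 k0 mk; rewrite cM // kpM // normrM mulrACA.
Qed.

(** The multiplicative function with values [h q j] at q^j; [h q 0] is meant to be 1. *)
Definition mext (h : nat -> nat -> R) (n : nat) : R :=
  if n == 0%N then 0 else \prod_(q <- primes n) h q (logn q n).

Lemma multf_mext h : multf (mext h).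
Proof.
split => //; first by rewrite /mext /= big_nil.
move=> m k m0 k0 mk; rewrite /mext muln_eq0 !gtn_eqF //=.
have -> : \prod_(q <- primes (m * k)) h q (logn q (m * k)) =
          \prod_(q <- primes m ++ primes k) h q (logn q (m * k)).
  apply: perm_big; apply: uniq_perm; rewrite ?primes_uniq //.
    by rewrite cat_uniq !primes_uniq /= andbT coprime_has_primes // in mk *.
  by move=> q; rewrite mem_cat primesM.
rewrite big_cat /=; congr (_ * _); apply: eq_big_seq => q; rewrite mem_primes => /and3P[pq _ qd].
  rewrite lognM // [logn q k](_ : _ = 0%N) ?addn0 //; apply: logn_coprime.
  by apply: coprime_dvdl qd mk.
rewrite lognM // [logn q m](_ : _ = 0%N) //; apply: logn_coprime.
by apply: coprime_dvdl qd _; rewrite coprime_sym.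
Qed.

Lemma mext_pow h p j : prime p -> h p 0%N = 1 -> mext h (p ^ j) = h p j.
Proof.
move=> pp h0; rewrite /mext expn_eq0 (gtn_eqF (prime_gt0 pp)) /=.
case: j => [|j]; first by rewrite expn0 big_nil h0.
by rewrite (primesX p (ltn0Sn j)) (primes_prime pp) big_seq1 (pfactorK _ pp).
Qed.

End Euler.

(** * Factorization of the Dirichlet series *)

Section Local.
Variable R : realType.
Implicit Types (b : nat -> R) (X : R[i]).

(* The coefficients of (1 - c X^l) sum_j b_j X^j. *)
Definition tw (l : nat) (c : R) b j := b j - (if (l <= j)%N then c * b (j - l)%N else 0).

Lemma tw_series l c b X A :
  ctends (ssum (fun j => (b j)%:C * X ^+ j)) A ->
  ctends (ssum (fun j => (tw l c b j)%:C * X ^+ j)) (A * (1 - c%:C * X ^+ l)).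
Proof.
move=> h; apply/(ctends_shift l).
have h' := (ctends_shift l _ _).2 h.
have := ctendsB h' (ctendsZ (c%:C * X ^+ l) h).
rewrite [_ * A]mulrC -{1}(mulr1 A) -mulrBr; apply: eq_ctends => n.
have -> : ssum (fun j => (tw l c b j)%:C * X ^+ j) (n + l) =
   ssum (fun j => (b j)%:C * X ^+ j) (n + l) -
   ssum (fun j => (if (l <= j)%N then c * b (j - l)%N else 0)%:C * X ^+ j) (n + l).
  rewrite /ssum -sumrB; apply: eq_bigr => j _.
  by rewrite /tw (rmorphB (real_complex R)) mulrBl.
congr (_ - _); rewrite /ssum [RHS](big_cat_nat _ (leq_addl n l)) //=.
rewrite [X in _ = X + _](_ : _ = 0) ?add0r; last first.
  rewrite big_nat_cond big1 // => j; rewrite andbT => /andP[_ jl].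
  by rewrite leqNgt jl /= (_ : 0%:C = 0 :> R[i]) // mul0r.
rewrite -[X in index_iota X (n + l)](add0n l) big_addn addnK mulr_sumr; apply: eq_bigr => j _.
rewrite leq_addl addnK exprD (rmorphM (real_complex R)) /=; ring.
Qed.

Lemma tw_bound l c b (B : nat -> R) : 0 <= c -> (forall j, `|b j| <= B j) ->
  (forall j, (l <= j)%N -> c * B (j - l)%N <= B j) -> forall j, `|tw l c b j| <= 2 * B j.
Proof.
move=> c0 bB cB j; have B0 : 0 <= B j by apply: le_trans (bB j).
apply: (le_trans (ler_normB _ _)); rewrite mulr_natl mulr2n; apply: lerD => //.
case: ifP => lj; last by rewrite normr0.
rewrite normrM ger0_norm //; apply: le_trans (cB j lj).
by rewrite ler_wpM2l.
Qed.

Lemma tw2_bound l c b (B : nat -> R) : 0 <= c -> (forall j, `|b j| <= B j) ->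
  (forall j, (l <= j)%N -> c * B (j - l)%N <= B j) ->
  forall j, `|tw l c (tw l c b) j| <= 4 * B j.
Proof.
move=> c0 bB cB j; rewrite (_ : 4 * B j = 2 * (2 * B j)); last by ring.
apply: (@tw_bound l c _ (fun j => 2 * B j)) => // [k|k lk]; first exact: tw_bound.
by rewrite mulrCA ler_wpM2l // cB.
Qed.

Lemma geo_bdd (r : R) : 0 <= r -> r < 1 -> bdd (fun j => r ^+ j).
Proof.
move=> r0 r1; exists (1 - r)^-1 => n; have h : 0 < 1 - r by rewrite subr_gt0.
rewrite -[leRHS]mul1r ler_pdivlMr //.
have -> : ssum (fun j => r ^+ j) n * (1 - r) = 1 - r ^+ n.
  elim: n => [|n IH]; first by rewrite ssum0 mul0r expr0 subrr.
  by rewrite ssumS mulrDl IH exprS; ring.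
by rewrite lerBlDr lerDl exprn_ge0.
Qed.

(** Half of the decay absorbs the polynomial, because exp x >= x^(N+1) / (N+1)! for x >= 0; the
    other half is a geometric series. *)
Lemma poly_geo (t : R) N c : 0 < t -> bdd (fun j => (j + c)%:R ^+ N * expR (- t) ^+ j).
Proof.
move=> t0; have t2 : 0 < t / 2 by rewrite divr_gt0.
set K := N.+1`!%:R / (t / 2) ^+ N.+1 * expR (t / 2 * (c + 1)%:R).
have K0 : 0 <= K by rewrite mulr_ge0 ?expR_ge0 // divr_ge0 ?ler0n // exprn_ge0 // ltW.
have : bdd (fun j => expR (- (t / 2)) ^+ j).
  by apply: geo_bdd; rewrite ?expR_ge0 // expR_lt1 oppr_lt0.
move=> /(bddZ K0); apply: bdd_le => j.
have h : (j + c)%:R ^+ N <= (j + c + 1)%:R ^+ N.+1 :> R.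
  rewrite exprSr -[leLHS]mulr1; apply: ler_pM; rewrite ?exprn_ge0 ?ler0n ?ler1n ?addn1 //.
  by apply: lerXn2r; rewrite ?nnegrE ?ler0n // ler_nat.
apply: (@le_trans _ _ ((j + c + 1)%:R ^+ N.+1 * expR (- t) ^+ j)).
  by rewrite ler_wpM2r // exprn_ge0 // expR_ge0.
have := @expR_ge1Dxn R (t / 2 * (j + c + 1)%:R) N.
rewrite mulr_ge0 ?ler0n ?(ltW t2) // => /(_ isT) q.
have q2 : (t / 2 * (j + c + 1)%:R) ^+ N.+1 / N.+1`!%:R <= expR (t / 2 * (j + c + 1)%:R).
  by apply: le_trans q; rewrite lerDr.
have f0 : 0 < N.+1`!%:R :> R by rewrite ltr0n fact_gt0.
have q3 : (j + c + 1)%:R ^+ N.+1 <= N.+1`!%:R / (t / 2) ^+ N.+1 * expR (t / 2 * (j + c + 1)%:R).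
  move: q2; rewrite ler_pdivrMr // exprMn mulrC -ler_pdivlMr ?exprn_gt0 // => q2.
  by apply: (le_trans q2); rewrite -mulrA mulrC.
apply: (@le_trans _ _ (N.+1`!%:R / (t / 2) ^+ N.+1 * expR (t / 2 * (j + c + 1)%:R) * expR (- t) ^+ j)).
  by rewrite ler_wpM2r // exprn_ge0 // expR_ge0.
rewrite /K -!mulrA ler_wpM2l ?ler0n // ler_wpM2l ?invr_ge0 ?exprn_ge0 ?(ltW t2) //.
rewrite -!expRM_natl -!expRD ler_expR; by apply: eq_lexx; rewrite !natrD; field.
Qed.

Lemma real_csum (u : nat -> R[i]) (v : nat -> R) z : (forall n, u n = (v n)%:C) ->
  (forall n, 0 <= v n) -> v 0%N = 1 -> ctends (ssum u) z -> exists2 r, 1 <= r & z = r%:C.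
Proof.
move=> uv v0 v1 [hR hI]; exists (complex.Re z); last first.
  apply: complexP => //=; apply: (cvg_unique _ hI) => //.
  rewrite (_ : (fun n => _) = cst 0); first exact: cvg_cst.
  by apply/funext => n; rewrite /ssum Im_sum big1 // => i _; rewrite uv.
rewrite -(cvg_lim _ hR) //; apply: limr_ge; first by apply/cvg_ex; eexists; exact: hR.
exists 1%N => //= n n1; rewrite /ssum Re_sum (eq_bigr v) => [|i _]; last by rewrite uv.
apply: (@le_trans _ _ (ssum v 1)); first by rewrite ssumS ssum0 add0r v1.
exact: ssum_mono.
Qed.

Lemma multiples_sum (v : nat -> R) l J : (0 < l)%N -> (forall j, 0 <= v j) ->
  (forall j, ~~ (l %| j)%N -> v j = 0) -> ssum v J <= ssum (fun m => v (l * m)%N) J.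
Proof.
move=> l0 v0 vl; rewrite /ssum (bigID (fun j => (l %| j)%N)) /= addrC big1 ?add0r; last first.
  by move=> j; apply: vl.
rewrite -big_filter; set s := [seq _ <- _ | _].
have -> : \sum_(j <- s) v j = \sum_(m <- [seq (j %/ l)%N | j <- s]) v (l * m)%N.
  rewrite big_map; apply: eq_big_seq => j; rewrite mem_filter => /andP[lj _].
  by rewrite mulnC divnK.
have := @uniq_sum_le R (fun m => v (l * m)%N) [seq (j %/ l)%N | j <- s] 0 J.
rewrite ssum0 subr0; apply=> //.
  rewrite map_inj_in_uniq ?filter_uniq ?iota_uniq // => i j.
  rewrite !mem_filter => /andP[li _] /andP[lj _] E.
  by rewrite -(divnK li) E divnK.
move=> m /mapP[j]; rewrite mem_filter mem_index_iota => /andP[_ /andP[_ jJ]] ->.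
by apply: leq_ltn_trans jJ; apply: leq_div.
Qed.

(** The classical bound for a product of factors 1 - d by 1 minus the sum of the d; once that sum
    exceeds 1, it only says that the product is nonnegative. *)
Lemma prod_ge (r : seq nat) (P : pred nat) (x d : nat -> R) :
  (forall p, P p -> [/\ 0 <= x p, 0 <= d p & 1 - d p <= x p]) ->
  0 <= \prod_(p <- r | P p) x p /\
  1 - \sum_(p <- r | P p) d p <= \prod_(p <- r | P p) x p.
Proof.
move=> H; split; first by apply: prodr_ge0 => p /H[].
elim: r => [|p r IH]; first by rewrite !big_nil subr0.
rewrite !big_cons; case: ifP => // /H[x0 d0 xd].
have Q0 : 0 <= \prod_(j <- r | P j) x j by apply: prodr_ge0 => j /H[].
have D0 : 0 <= \sum_(j <- r | P j) d j by apply: sumr_ge0 => j /H[].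
move: IH Q0 D0; set Q := \prod_(_ <- _ | _) _; set D := \sum_(_ <- _ | _) _ => IH Q0 D0.
have h3 := mulr_ge0 d0 D0; have h4 := mulr_ge0 x0 Q0.
have [D1|D1] := leP D 1; last by lra.
have h1 : x p * (1 - D) <= x p * Q by rewrite ler_wpM2l.
have h2 : (1 - d p) * (1 - D) <= x p * (1 - D) by rewrite ler_wpM2r // subr_ge0.
by lra.
Qed.

End Local.

(** * Comparison with the square of the Riemann zeta function *)

Section Master.
Variable R : realType.
Variables (l0 e N P0 : nat) (a : nat -> R) (C1 : R).
Let l := l0.+1.
Hypothesis a_ge0 : forall k, 0 <= a k.
Hypothesis a_mul : multf a.
Hypothesis a_supp : forall p, prime p -> (P0 <= p)%N -> forall k, a (p ^ k)%N != 0 -> (l %| k)%N.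
Hypothesis a_good : forall p, prime p -> (P0 <= p)%N ->
  forall m, a (p ^ (l * m))%N <= m.+1%:R ^+ l * p%:R ^+ (e * m).
Hypothesis a_first : forall p, prime p -> (P0 <= p)%N ->
  `|a (p ^ l)%N - 2 * p%:R ^+ e| <= C1 * p%:R ^+ e / p%:R.
Hypothesis C1_ge0 : 0 <= C1.
Hypothesis a_bad : forall p, prime p -> exists (C : R) (c : nat), 0 <= C /\
  forall k, a (p ^ k)%N <= C * (k + c).+1%:R ^+ N * p%:R ^+ ((k + c) %/ l * e).

(** The coefficients of the local series times (1 - p^e X^l)^2, which at X = p^(-s) is the inverse
    of the local factor of zeta(l s - e)^2. *)
Definition hloc p : nat -> R := tw l (p%:R ^+ e) (tw l (p%:R ^+ e) (fun j => a (p ^ j)%N)).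
Definition hh := mext hloc.

Lemma a1 : a 1%N = 1. Proof. by case: a_mul. Qed.

Lemma hloc0 p : hloc p 0 = 1.
Proof. by rewrite /hloc /tw /l leqn0 /= !subr0 expn0 a1. Qed.

Lemma hhX p j : prime p -> hh (p ^ j) = hloc p j.
Proof. by move=> pp; apply: mext_pow => //; apply: hloc0. Qed.

(* At Re s = xth th the modulus of p^(e - l s) is p^(- th). *)
Definition xth (th : R) : R := (e%:R + th) / l%:R.

Lemma l_neq0 : l%:R != 0 :> R. Proof. by rewrite pnatr_eq0. Qed.
Lemma l_gt0 : 0 < l%:R :> R. Proof. by rewrite ltr0n. Qed.

Lemma kp_xth p th : (0 < p)%N -> kp p (- xth th) ^+ l = (p%:R ^+ e)^-1 * kp p (- th).
Proof.
move=> p0; rewrite -kpMn -kp_nat // -kpN -kpD; congr kp.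
by rewrite /xth mulNr divfK ?l_neq0 // opprD.
Qed.

(** At a single prime, bad ones included, the series converges for all th > 0, as the coefficients
    grow like a polynomial in j times p^(e j / l). The second clause lets the bound survive the
    passage from [a] to [hloc]. *)
Lemma local_bound p : prime p -> exists b : nat -> R,
  [/\ forall j, `|a (p ^ j)%N| <= b j, forall j, (l <= j)%N -> p%:R ^+ e * b (j - l)%N <= b j &
   forall th, 0 < th -> bdd (fun j => b j * kp p (- xth th) ^+ j)].
Proof.
move=> pp; have [C [c [C0 aC]]] := a_bad pp; have p0 := prime_gt0 pp.
have pR : 1 <= p%:R :> R by rewrite ler1n.
exists (fun k => C * (k + c).+1%:R ^+ N * p%:R ^+ ((k + c) %/ l * e)); split.
- by move=> j; rewrite ger0_norm.
- move=> j lj; rewrite mulrCA -exprD -mulSn.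
  have -> : ((j + c) %/ l)%N = ((j - l + c) %/ l).+1.
    by rewrite -{1}(subnK lj) addnAC divnDr // divnn addn1.
  rewrite ler_wpM2r ?exprn_ge0 ?ler0n // ler_wpM2l //.
  by apply: lerXn2r; rewrite ?nnegrE ?ler0n // ler_nat; lia.
- move=> th th0; set t := th / l%:R * ln p%:R.
  have t0 : 0 < t by rewrite mulr_gt0 ?divr_gt0 ?l_gt0 // ln_gt0 // ltr1n prime_gt1.
  have K0 : 0 <= C * kp p (c%:R * e%:R / l%:R) by rewrite mulr_ge0 ?kp_ge0.
  apply: bdd_le (bddZ K0 (poly_geo N c.+1 t0)) => j.
  rewrite addnS -!mulrA ler_wpM2l // [leRHS]mulrCA ler_wpM2l ?exprn_ge0 ?ler0n //.
  have -> : expR (- t) = kp p (- (th / l%:R)) by rewrite /kp mulNr.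
  rewrite -kp_nat // -!kpMn -!kpD kp_le //.
  have d : ((j + c) %/ l * e)%:R <= (j + c)%:R * e%:R / l%:R :> R.
    by rewrite ler_pdivlMr ?l_gt0 // -!natrM ler_nat mulnAC leq_mul2r leq_trunc_div orbT.
  rewrite natrD in d; apply: (le_trans (lerD d (lexx _))).
  by apply: eq_lexx; rewrite /xth; field; apply: l_neq0.
Qed.

Lemma hloc_supp p j : prime p -> (P0 <= p)%N -> ~~ (l %| j)%N -> hloc p j = 0.
Proof.
move=> pp Pp; have H (b : nat -> R) c : (forall j, ~~ (l %| j)%N -> b j = 0) ->
  forall j, ~~ (l %| j)%N -> tw l c b j = 0.
  move=> b0 k lk; rewrite /tw b0 // sub0r; case: ifP => [le|]; last by rewrite oppr0.
  by rewrite b0 ?mulr0 ?oppr0 // dvdn_subl.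
apply: (H _ _ (H _ _ _)) => k lk; apply/eqP; apply: contraNT lk; exact: a_supp.
Qed.

Lemma hloc_good p m : prime p -> (P0 <= p)%N ->
  `|hloc p (l * m)| <= 4 * (m.+1%:R ^+ l * p%:R ^+ (e * m)).
Proof.
move=> pp Pp; have p1 : 1 <= p%:R :> R by rewrite ler1n prime_gt0.
pose B j : R := if (l %| j)%N then (j %/ l).+1%:R ^+ l * p%:R ^+ (e * (j %/ l)) else 0.
have := @tw2_bound R l (p%:R ^+ e) (fun j => a (p ^ j)%N) B _ _ _ (l * m)%N.
rewrite /B dvdn_mulr // mulKn //; apply; first by rewrite exprn_ge0 ?ler0n.
  move=> j; rewrite ger0_norm //; case: ifP => lj.
    by rewrite -{1}(divnK lj) mulnC; apply: a_good.
  by have [->//|/(a_supp pp Pp)] := eqVneq (a (p ^ j)%N) 0; rewrite lj.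
move=> j lj; rewrite dvdn_subl //; case: ifP => lj'; last by rewrite mulr0.
have -> : ((j - l) %/ l)%N = (j %/ l).-1 by rewrite -{2}(subnK lj) divnDr // divnn addn1.
have : (0 < j %/ l)%N by rewrite divn_gt0.
case: (j %/ l)%N => // k _ /=; rewrite mulrCA -exprD -mulnS ler_wpM2r ?exprn_ge0 ?ler0n //.
by apply: lerXn2r; rewrite ?nnegrE ?ler0n // ler_nat.
Qed.

(** The factor squared removes 2 p^e; by [a_first] there remains O(p^(e-1)) at good primes. *)
Lemma hloc_first p : hloc p l = a (p ^ l)%N - 2 * p%:R ^+ e.
Proof. by rewrite /hloc /tw leqnn subnn /= expn0 a1; ring. Qed.

Lemma kp_expln p (th : R) : kp p (- th) = expR (- (th * ln p%:R)).
Proof. by rewrite /kp mulNr. Qed.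

(** The prime 2 is the worst case, so the bound is uniform in p. *)
Lemma good_tail (th : R) c : 0 < th -> exists2 K : R, 0 <= K & forall p J, prime p ->
  ssum (fun m => (m + c)%:R ^+ l * kp p (- th) ^+ m) J <= K.
Proof.
move=> th0; have t0 : 0 < th * ln 2%:R by rewrite mulr_gt0 // ln_gt0 // ltr1n.
have [K HK] := @poly_geo R _ l c t0; exists K; first by have := HK 0%N; rewrite ssum0.
move=> p J pp; apply: le_trans (HK J); apply: ssum_le => m.
rewrite -kp_expln ler_wpM2l ?exprn_ge0 ?ler0n //; apply: lerXn2r; rewrite ?nnegrE ?kp_ge0 //.
by apply: kp_le2; rewrite ?oppr_le0 ?(ltW th0) // prime_gt1.
Qed.

Lemma good_a th : 0 < th -> exists2 C : R, 0 <= C & forall p J, prime p -> (P0 <= p)%N ->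
  \sum_(0 <= j < J) `|a (p ^ j)%N| * kp (p ^ j) (- xth th) <= 1 + C * kp p (- th).
Proof.
move=> th0; have [K K0 HK] := good_tail 2 th0; exists K => // p J pp Pp.
have p0 := prime_gt0 pp; set v := fun j => `|a (p ^ j)%N| * kp (p ^ j) (- xth th).
have v0 j : 0 <= v j by rewrite mulr_ge0 ?kp_ge0.
apply: (@le_trans _ _ (ssum (fun m => v (l * m)%N) J)).
  apply: (@multiples_sum R v) => // j lj; rewrite /v.
  by have [->|/(a_supp pp Pp)] := eqVneq (a (p ^ j)%N) 0; rewrite ?normr0 ?mul0r // (negPf lj).
apply: (@le_trans _ _ (ssum (fun m => v (l * m)%N) J.+1)).
  by apply: ssum_mono => // j; apply: v0.
rewrite /ssum big_nat_recl // muln0 {1}/v expn0 a1 kp1 normr1 mulr1 lerD2l.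
apply: (@le_trans _ _ (ssum (fun m => (m + 2)%:R ^+ l * kp p (- th) ^+ m * kp p (- th)) J)).
  apply: ler_sum => m _; rewrite /v ger0_norm // kpX // exprM kp_xth // exprMn.
  apply: (@le_trans _ _ (m.+2%:R ^+ l * p%:R ^+ (e * m.+1) * ((p%:R ^+ e)^-1 ^+ m.+1 * kp p (- th) ^+ m.+1))).
    rewrite ler_wpM2r ?a_good // mulr_ge0 ?exprn_ge0 ?invr_ge0 ?kp_ge0 ?exprn_ge0 //.
  apply: eq_lexx; rewrite exprM exprVn addn2 [kp p (- th) ^+ m.+1]exprSr.
  have : p%:R ^+ e ^+ m.+1 != 0 :> R by rewrite !expf_neq0 // pnatr_eq0 -lt0n.
  by move: (_ ^+ m.+1) (kp _ _) (_ ^+ l) => x y z x0; field.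
rewrite /ssum -mulr_suml ler_wpM2r ?kp_ge0 //; exact: HK.
Qed.

(** The coefficient at X^l contributes at most C1 p^(-1-th) <= C1 p^(-2 th), and all later terms
    contain the factor p^(-2 th). For th > 1/2 this is summable over p. *)
Lemma good_h th : 2^-1 < th -> th <= 1 -> exists2 C : R, 0 <= C & forall p J, prime p -> (P0 <= p)%N ->
  \sum_(0 <= j < J) `|hloc p j| * kp (p ^ j) (- xth th) <= 1 + C * kp p (- (2 * th)).
Proof.
move=> th2 th1; have th0 : 0 < th by apply: lt_trans th2; rewrite invr_gt0.
have [K K0 HK] := good_tail 3 th0; exists (C1 + 4 * K); first by rewrite addr_ge0 // mulr_ge0.
move=> p J pp Pp.
have p0 := prime_gt0 pp; set v := fun j => `|hloc p j| * kp (p ^ j) (- xth th).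
have v0 j : 0 <= v j by rewrite mulr_ge0 ?kp_ge0.
apply: (@le_trans _ _ (ssum (fun m => v (l * m)%N) J)).
  apply: (@multiples_sum R v) => // j lj; rewrite /v.
  by rewrite hloc_supp ?normr0 ?mul0r.
apply: (@le_trans _ _ (ssum (fun m => v (l * m)%N) J.+2)).
  by apply: ssum_mono => [j|]; [apply: v0 | rewrite -addn2 leq_addr].
have pe0 : 0 < p%:R ^+ e :> R by rewrite exprn_gt0 // ltr0n.
rewrite /ssum big_nat_recl // muln0 {1}/v expn0 hloc0 kp1 normr1 mulr1 lerD2l.
rewrite big_nat_recl // mulrDl; apply: lerD.
  rewrite muln1 /v hloc_first kpX // kp_xth //.
  apply: (@le_trans _ _ (C1 * p%:R ^+ e / p%:R * ((p%:R ^+ e)^-1 * kp p (- th)))).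
    by rewrite ler_wpM2r ?a_first // mulr_ge0 ?kp_ge0 // invr_ge0 ltW.
  rewrite (_ : C1 * _ / _ * _ = C1 * (kp p (- 1) * kp p (- th))); last first.
    rewrite (kpN p 1) kp_id //; have : p%:R != 0 :> R by rewrite pnatr_eq0 -lt0n.
    move: (lt0r_neq0 pe0); move: (p%:R ^+ e) => x x1; move: (p%:R) => y y0.
    by field; rewrite ?x1 ?y0.
  by rewrite ler_wpM2l // -kpD kp_le //; lra.
apply: (@le_trans _ _ (ssum (fun m => 4 * ((m + 3)%:R ^+ l * kp p (- th) ^+ m) * kp p (- (2 * th))) J)).
  apply: ler_sum => m _; rewrite /v kpX // exprM kp_xth // exprMn.
  apply: (@le_trans _ _ (4 * (m.+3%:R ^+ l * p%:R ^+ (e * m.+2)) * ((p%:R ^+ e)^-1 ^+ m.+2 * kp p (- th) ^+ m.+2))).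
    rewrite ler_wpM2r ?hloc_good // mulr_ge0 ?exprn_ge0 ?invr_ge0 ?kp_ge0 ?exprn_ge0 //.
  apply: eq_lexx; rewrite exprM exprVn addn3 (_ : - (2 * th) = - th * 2%:R); last by ring.
  rewrite kpMn [kp p (- th) ^+ m.+2](_ : _ = kp p (- th) ^+ m * kp p (- th) ^+ 2); last by rewrite -exprD addn2.
  have : p%:R ^+ e ^+ m.+2 != 0 :> R by rewrite !expf_neq0 // pnatr_eq0 -lt0n.
  by move: (_ ^+ m.+2) (kp _ _) (kp _ _ ^+ m) (_ ^+ l) => x z y t x0; field.
rewrite /ssum -mulr_suml ler_wpM2r ?kp_ge0 // -mulr_sumr ler_wpM2l //; exact: HK.
Qed.

(** For the primes below [P0] some bound of each local sum is enough, as they only contribute a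
    finite factor. *)
Lemma sum_bdd2 (F : nat -> R) (C th : R) : (forall n, 0 <= F n) -> multf F ->
  0 <= C -> 1 < th -> (forall p, prime p -> bdd (fun j => F (p ^ j)%N)) ->
  (forall p J, prime p -> (P0 <= p)%N -> \sum_(0 <= j < J) F (p ^ j)%N <= 1 + C * kp p (- th)) ->
  bdd F.
Proof.
move=> F0 FM C0 th1 Fb Fg.
have [b Hb] : exists b : nat -> R, forall p J, prime p -> \sum_(0 <= j < J) F (p ^ j)%N <= b p.
  have : forall p, exists B : R, prime p -> forall J, \sum_(0 <= j < J) F (p ^ j)%N <= B.
    move=> p; case: (boolP (prime p)) => pp; last by exists 0.
    by have [B HB] := Fb p pp; exists B.
  by move=> /choice[b Hb]; exists b => p J pp; apply: Hb.
apply: (@sum_bdd R F (fun p => if (P0 <= p)%N then C * kp p (- th) else `|b p|) P0 C th) => //.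
- by move=> p; case: ifP; rewrite ?mulr_ge0 ?kp_ge0.
- move=> p J pp; case: ifP => Pp; first exact: Fg.
  apply: (le_trans (Hb p J pp)); apply: (le_trans (ler_norm _)); by rewrite lerDr.
- by move=> p pp ->.
Qed.

Lemma a_bdd th : 1 < th -> bdd (fun k => `|a k| * kp k (- xth th)).
Proof.
move=> th1; have th0 : 0 < th by lra.
have [C C0 HC] := good_a th0.
apply: (@sum_bdd2 _ C th) => //; first by move=> n; rewrite mulr_ge0 ?kp_ge0.
  exact: multf_abs.
move=> p pp; have [b [ab _ /(_ _ th0)]] := local_bound pp; apply: bdd_le => j.
by rewrite kpX ?prime_gt0 // ler_wpM2r // exprn_ge0 ?kp_ge0.
Qed.

Lemma hloc_bdd p th : prime p -> 0 < th -> bdd (fun j => `|hloc p j| * kp (p ^ j) (- xth th)).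
Proof.
move=> pp th0; have [b [ab bb /(_ _ th0)/(bddZ (ler0n R 4))]] := local_bound pp.
apply: bdd_le => j; rewrite kpX ?prime_gt0 // mulrA ler_wpM2r ?exprn_ge0 ?kp_ge0 //.
by apply: tw2_bound => //; rewrite exprn_ge0.
Qed.

Lemma hh_bdd : bdd (fun k => `|hh k| * kp k (- xth (3 / 4))).
Proof.
have [||C C0 HC] := @good_h (3 / 4); [lra|lra|].
apply: (@sum_bdd2 _ C (2 * (3 / 4))) => //; first by move=> n; rewrite mulr_ge0 ?kp_ge0.
- by apply: multf_abs; apply: multf_mext.
- by lra.
- move=> p pp; have := @hloc_bdd p (3 / 4) pp.
  have -> : (fun j => `|hh (p ^ j)| * kp (p ^ j) (- xth (3 / 4))) = fun j => `|hloc p j| * kp (p ^ j) (- xth (3 / 4)).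
    by apply/funext => j; rewrite hhX.
  by apply; lra.
- move=> p J pp Pp; under eq_bigr do rewrite hhX //.
  exact: HC.
Qed.

Definition locA s p : R[i] := csum (fun j => (a (p ^ j)%N)%:C * natpow p (- s) ^+ j).
Definition locH s p : R[i] :=
  locA s p * (1 - (p%:R ^+ e)%:C * natpow p (- s) ^+ l) * (1 - (p%:R ^+ e)%:C * natpow p (- s) ^+ l).

Lemma xth_gt th s : xth 0 < complex.Re s -> th = complex.Re s * l%:R - e%:R ->
  0 < th /\ xth th = complex.Re s.
Proof.
move=> hs ->; split; last by rewrite /xth addrC subrK mulfK ?l_neq0.
by move: hs; rewrite /xth ltr_pdivrMr ?l_gt0 // addr0 subr_gt0.
Qed.

Lemma locA_bdd p s : prime p -> xth 0 < complex.Re s ->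
  bdd (fun j => nm ((a (p ^ j)%N)%:C * natpow p (- s) ^+ j)).
Proof.
move=> pp /xth_gt /(_ erefl)[th0 E]; have [b [ab _ /(_ _ th0)]] := local_bound pp.
apply: bdd_le => j; rewrite nmM nm_real nmX nm_natpow ReN E.
by rewrite ler_wpM2r // exprn_ge0 ?kp_ge0.
Qed.

Lemma locA_tends p s : prime p -> xth 0 < complex.Re s ->
  ctends (ssum (fun j => (a (p ^ j)%N)%:C * natpow p (- s) ^+ j)) (locA s p).
Proof. by move=> pp hs; apply: csumP; apply: locA_bdd. Qed.

Lemma locH_tends p s : prime p -> xth 0 < complex.Re s ->
  ctends (ssum (fun j => (hloc p j)%:C * natpow p (- s) ^+ j)) (locH s p).
Proof. by move=> pp hs; apply: tw_series; apply: tw_series; apply: locA_tends. Qed.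

Lemma dtX (c : nat -> R) s p j : prime p -> dt c s (p ^ j) = (c (p ^ j)%N)%:C * natpow p (- s) ^+ j.
Proof. by move=> pp; rewrite /dt natpowX ?prime_gt0. Qed.

Lemma dt_hhX s p j : prime p -> dt hh s (p ^ j) = (hloc p j)%:C * natpow p (- s) ^+ j.
Proof. by move=> pp; rewrite dtX // hhX. Qed.

Lemma dt_oneX s p j : prime p -> dt (one_ R) s (p ^ j) = natpow p (- s) ^+ j.
Proof. by move=> pp; rewrite dtX // /one_ expn_gt0 prime_gt0 // mul1r. Qed.

Lemma geo_tends (Y : R[i]) : nm Y < 1 -> ctends (ssum (fun j => Y ^+ j)) (1 - Y)^-1.
Proof.
move=> Y1; have Y0 : 1 - Y != 0.
  by apply: contraTneq Y1 => /eqP; rewrite subr_eq0 => /eqP <-; rewrite nm1 ltxx.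
have h : ctends (fun n => Y ^+ n) 0.
  apply: (@ctends_dist _ _ _ (fun n => nm Y ^+ n)); first by move=> n; rewrite subr0 nmX.
  by apply: cvg_expr; rewrite ger0_norm ?nm_ge0.
have := ctendsZ (1 - Y)^-1 (ctendsB (ctends_cst 1) h); rewrite subr0 mulr1.
apply: eq_ctends => n; apply: (mulfI Y0); rewrite mulVKf //.
elim: n => [|n IH]; first by rewrite ssum0 mulr0 expr0 subrr.
by rewrite ssumS mulrDr -IH exprS; ring.
Qed.

Definition waff (s : R[i]) : R[i] := (l%:R)%:C * s + (- e%:R)%:C.

Lemma natpow_waff p s : (0 < p)%N -> natpow p (- waff s) = (p%:R ^+ e)%:C * natpow p (- s) ^+ l.
Proof.
move=> p0; rewrite /waff opprD natpowD mulrC; congr (_ * _).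
  by rewrite -(rmorphN (real_complex R)) /= opprK natpow_real kp_nat.
rewrite -mulrN; elim: l => [|k IH].
  by rewrite (_ : 0%:R%:C = 0 :> R[i]) // mul0r -[0]/((0 : R)%:C) natpow_real kp0.
by rewrite -natr1 (rmorphD (real_complex R)) mulrDl natpowD IH mul1r -exprSr.
Qed.

(** Both sides are limits of products over p < P, and these agree factor by factor. *)
Lemma main_identity s : xth 1 < complex.Re s ->
  csum (dt a s) = csum (dt (one_ R) (waff s)) ^+ 2 * csum (dt hh s) /\
  bdd (fun k => nm (dt a s k)) .
Proof.
move=> hs; have hs0 : xth 0 < complex.Re s.
  by apply: le_lt_trans hs; rewrite /xth ler_pM2r ?invr_gt0 ?l_gt0 // lerD2l.
have hsq : xth (3 / 4) <= complex.Re s.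
  apply: le_trans (ltW hs); rewrite /xth ler_pM2r ?invr_gt0 ?l_gt0 // lerD2l; lra.
have [th0 E] := xth_gt hs0 erefl; set th := _ - _ in th0 E.
have th1 : 1 < th.
  by move: hs; rewrite -E /xth ltr_pM2r ?invr_gt0 ?l_gt0 // ltrD2l.
have ba : bdd (fun k => nm (dt a s k)) by apply: (dt_bdd (a_bdd th1)); rewrite E.
split => //.
have bh : bdd (fun k => nm (dt hh s k)) by apply: (dt_bdd hh_bdd).
have Rw : complex.Re (waff s) = th by rewrite /waff ReD ReCM /= mulrC.
have bz : bdd (fun k => nm (dt (one_ R) (waff s) k)).
  by apply: (dt_bdd (pseries_bdd th1)); rewrite Rw.
have tA := euler_product (loc := locA s) (multf_dt s a_mul) ba.
have tH := euler_product (loc := locH s) (multf_dt s (multf_mext hloc)) bh.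
have tZ := euler_product (loc := fun p => (1 - natpow p (- waff s))^-1) (multf_dt (waff s) (multf_one R)) bz.
have {}tA := tA (fun p pp => eq_ctends (fun n => eq_bigr _ (fun j _ => esym (dtX a s j pp))) (locA_tends pp hs0)).
have {}tH := tH (fun p pp => eq_ctends (fun n => eq_bigr _ (fun j _ => esym (dt_hhX s j pp))) (locH_tends pp hs0)).
have Y1 p : prime p -> nm (natpow p (- waff s)) < 1.
  by move=> pp; rewrite nm_natpow ReN Rw /kp expR_lt1 mulNr oppr_lt0 mulr_gt0 // ln_gt0 // ltr1n prime_gt1.
have {}tZ := tZ (fun p pp => eq_ctends (fun n => eq_bigr _ (fun j _ => esym (dt_oneX (waff s) j pp))) (geo_tends (Y1 p pp))).
apply: ctends_unique tA _; rewrite expr2.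
apply: eq_ctends (ctendsM (ctendsM tZ tZ) tH) => P.
rewrite -!big_split /=; apply: eq_bigr => p pp.
rewrite /locH natpow_waff ?prime_gt0 //.
have := Y1 p pp; rewrite natpow_waff ?prime_gt0 //; set Y := _ * _ => {}Y1.
have Y0 : 1 - Y != 0.
  by apply: contraTneq Y1 => /eqP; rewrite subr_eq0 => /eqP <-; rewrite nm1 ltxx.
by field.
Qed.

Lemma xth_lt th th' : th < th' -> xth th < xth th'.
Proof. by move=> h; rewrite /xth ltr_pM2r ?invr_gt0 ?l_gt0 // ltrD2l. Qed.

(** At this real point the local factor is a series with nonnegative terms and first term 1, times
    (1 - 1/p)^2; so it is positive at every prime. The lower bound at good primes comes from
    [good_h], with th = 3/4 as majorant of th = 1. *)
Lemma locH_real : exists2 C : R, 0 <= C & exists r : nat -> R, forall p, prime p ->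
  [/\ locH (xth 1)%:C p = (r p)%:C, 0 < r p &
      (P0 <= p)%N -> 1 - C * (`|one_ R p| * kp p (- (3 / 2))) <= r p].
Proof.
have [||C C0 HC] := @good_h (3 / 4); [lra|lra|].
exists C => //; set s : R[i] := (xth 1)%:C.
suff : forall p, exists r : R, prime p -> [/\ locH s p = r%:C, 0 < r &
      (P0 <= p)%N -> 1 - C * (`|one_ R p| * kp p (- (3 / 2))) <= r].
  by move=> /choice[r Hr]; exists r.
move=> p; case: (boolP (prime p)) => pp; last by exists 0.
have p0 := prime_gt0 pp; have hs0 : xth 0 < complex.Re s by apply: xth_lt.
have Xr : natpow p (- s) = (kp p (- xth 1))%:C.
  by rewrite /s -(rmorphN (real_complex R)) natpow_real.
have [r r1 rE] : exists2 r, 1 <= r & locA s p = r%:C.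
  apply: (real_csum (v := fun j => a (p ^ j)%N * kp p (- xth 1) ^+ j)) (locA_tends pp hs0).
  - by move=> n; rewrite Xr -(rmorphXn (real_complex R)) -(rmorphM (real_complex R)).
  - by move=> n; rewrite mulr_ge0 // exprn_ge0 // kp_ge0.
  - by rewrite expn0 a1 mulr1.
have pR : 1 < p%:R :> R by rewrite ltr1n prime_gt1.
have E : locH s p = (r * (1 - p%:R^-1) ^+ 2)%:C.
  rewrite /locH rE Xr -(rmorphXn (real_complex R)) kp_xth // -(rmorphM (real_complex R)).
  rewrite mulrA divff ?mul1r; last by rewrite expf_neq0 // pnatr_eq0 -lt0n.
  by rewrite kpN kp_id //; apply: complexP => /=; ring.
have i1 : p%:R^-1 < 1 :> R by rewrite invf_lt1 //; lra.
exists (r * (1 - p%:R^-1) ^+ 2); split => //.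
  by rewrite mulr_gt0 ?exprn_gt0 ?subr_gt0 //; lra.
move=> Pp; set d := C * _.
have h1 : ctends (fun J => ssum (fun j => (hloc p j)%:C * natpow p (- s) ^+ j) (J + 1) - 1) (locH s p - 1).
  by apply: ctendsB (ctends_cst 1); apply/ctends_shift; apply: locH_tends.
have : nm (locH s p - 1) <= d.
  apply: (ctends_le h1) => J; rewrite addn1 /ssum big_nat_recl // hloc0 expr0 mulr1.
  rewrite addrAC subrr add0r; apply: (le_trans (nm_sum _ _ _)).
  have := HC p J.+1 pp Pp; rewrite big_nat_recl // hloc0 expn0 kp1 normr1 mulr1 lerD2l.
  rewrite (_ : 2 * (3 / 4) = 3 / 2 :> R); last by field.
  rewrite /d /one_ p0 normr1 mul1r; apply: le_trans; apply: ler_sum => j _.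
  rewrite nmM nm_real ler_wpM2l // Xr nmX nm_real ger0_norm ?kp_ge0 // kpX //.
  apply: lerXn2r; rewrite ?nnegrE ?kp_ge0 // kp_le // lerN2 ltW // xth_lt //; lra.
have -> : locH s p - 1 = (r * (1 - p%:R^-1) ^+ 2 - 1)%:C by rewrite E; apply: complexP => /=; ring.
rewrite nm_real ler_norml => /andP[]; lra.
Qed.

(** Finitely many positive factors, followed by a product that stays above 1/2 since the deviations
    from 1 sum to at most 1/2. *)
Lemma hh_pos : exists2 A : R, 0 < A & csum (dt hh (xth 1)%:C) = A%:C.
Proof.
have [C C0 [r Hr]] := locH_real; set s : R[i] := (xth 1)%:C.
have hs0 : xth 0 < complex.Re s by apply: xth_lt.
have bh : bdd (fun k => nm (dt hh s k)).
  by apply: (dt_bdd hh_bdd); apply/ltW/xth_lt; lra.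
have tH := euler_product (loc := locH s) (multf_dt s (multf_mext hloc)) bh.
have {}tH := tH (fun p pp => eq_ctends (fun n => eq_bigr _ (fun j _ => esym (dt_hhX s j pp))) (locH_tends pp hs0)).
pose f p : R := C * (`|one_ R p| * kp p (- (3 / 2))).
have f0 p : 0 <= f p by rewrite !mulr_ge0 ?kp_ge0.
have bf : bdd f by apply: bddZ => //; apply: pseries_bdd; lra.
have [|N1 HN] := bdd_tail f0 bf (_ : 0 < 1 / 2); first by lra.
pose P1 := maxn N1 P0; pose c0 := \prod_(0 <= p < P1 | prime p) r p.
have c00 : 0 < c0 by apply: prodr_gt0 => p /Hr[].
have rE P : \prod_(0 <= p < P | prime p) locH s p = (\prod_(0 <= p < P | prime p) r p)%:C.
  rewrite (rmorph_prod (real_complex R)); apply: eq_bigr => p /Hr[-> //].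
have lb P : (P1 <= P)%N -> c0 / 2 <= \prod_(0 <= p < P | prime p) r p.
  move=> PP; rewrite (big_cat_nat _ PP) //= ler_wpM2l ?(ltW c00) //.
  have [|_ h] := @prod_ge R (index_iota P1 P) (fun p => (P1 <= p)%N && prime p) r f.
    move=> p /andP[P1p pp]; have [_ r0 rf] := Hr p pp; split => //; first exact: ltW.
    by apply: rf; apply: leq_trans P1p; apply: leq_maxr.
  have E (F : nat -> R) op x : \big[op/x]_(P1 <= p < P | (P1 <= p)%N && prime p) F p =
     \big[op/x]_(P1 <= p < P | prime p) F p.
    rewrite big_seq_cond [RHS]big_seq_cond; apply: eq_bigl => p.
    by rewrite mem_index_iota; case: (P1 <= p)%N.
  rewrite !E in h; apply: le_trans h.
  have : \sum_(P1 <= p < P | prime p) f p <= ssum f P - ssum f P1.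
    rewrite /ssum [\sum_(0 <= i < P) _](big_cat_nat _ PP) //= addrAC subrr add0r big_mkcond.
    by apply: ler_sum => p _; case: ifP.
  have := HN P1 P (leq_maxl _ _) PP; lra.
have [hR hI] := tH; set z := csum _ in hR hI *.
exists (complex.Re z); last first.
  apply: complexP => //=; apply: (cvg_unique _ hI) => //.
  rewrite (_ : (fun n => _) = cst 0); first exact: cvg_cst.
  by apply/funext => n; rewrite rE.
apply: (@lt_le_trans _ _ (c0 / 2)); first by rewrite divr_gt0.
rewrite -(cvg_lim _ hR) //; apply: limr_ge; first by apply/cvg_ex; eexists; exact: hR.
by exists P1 => //= n n1; rewrite rE lb.
Qed.

Theorem master : exists g : R[i] -> R[i],
  [/\ forall s, xth (3 / 4) < complex.Re s -> QA g s,
      exists2 A : R, 0 < A & g (xth 1)%:C = A%:C &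
      forall s, xth 1 < complex.Re s -> bdd (fun k => nm (dt a s k)) /\
        csum (dt a s) = g s / (s - (xth 1)%:C) ^+ 2].
Proof.
have lC : (l%:R)%:C != 0 :> R[i].
  by apply/eqP => /(congr1 (@complex.Re R)) /= /eqP; rewrite (negPf l_neq0).
(* The factor l^(-2) appears because [waff s] - 1 is l times s - (e + 1)/l. *)
exists (fun s => ((l%:R)%:C ^- 2 * (Zone (waff s) * Zone (waff s))) * csum (dt hh s)); split.
- move=> s hs; apply: QA_mul; last exact: (dirichlet_QA hh_bdd).
  apply: QA_mul; first by apply: eq_QA (QA_lin 0 _ s) => t; rewrite mul0r add0r.
  have Zs : QA (fun s => Zone (waff s)) s.
    apply: QA_affine => //; apply: Zone_QA; rewrite ReD ReCM /= mulrC.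
    move: hs; rewrite /xth ltr_pdivrMr ?l_gt0 //; lra.
  exact: QA_mul.
- have [A A0 AE] := hh_pos; exists (l%:R ^- 2 * A).
    by rewrite mulr_gt0 // invr_gt0 exprn_gt0 // l_gt0.
  have -> : waff (xth 1)%:C = 1.
    apply: complexP; rewrite /waff ?ReD ?ImD ?ReCM ?ImCM /=; last by ring.
    by rewrite /xth mulrC divfK ?l_neq0 //; ring.
  rewrite Zone1 !mulr1 AE (rmorphM (real_complex R)); congr (_ * _).
  by rewrite (fmorphV (real_complex R)) (rmorphXn (real_complex R)).
- move=> s hs; have [E b] := main_identity hs; split => //; rewrite E.
  have w1 : 1 < complex.Re (waff s).
    rewrite ReD ReCM /= mulrC; move: hs; rewrite /xth ltr_pdivrMr ?l_gt0 //; lra.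
  rewrite -(zeta_Zone w1).
  have -> : waff s - 1 = (l%:R)%:C * (s - (xth 1)%:C).
    apply: complexP; rewrite /waff ?(ReD, ReN, ReCM, ImD, ImN, ImCM) /=; last by ring.
    by rewrite mulrDr mulrN /xth [_ * (_ / _)]mulrC divfK ?l_neq0 //; ring.
  have s0 : s - (xth 1)%:C != 0.
    apply: contraTneq hs => /eqP; rewrite subr_eq0 => /eqP ->.
    by rewrite /= ltxx.
  by move: (s - _) s0 ((l%:R)%:C) lC => d d0 L L0; field; rewrite ?d0 ?L0.
Qed.

End Master.

(** * Poles *)

Section Poles.
Variable R : realType.
Implicit Types (f g : R[i] -> R[i]) (z w h : R[i]).

Lemma QA_inv (c w : R[i]) : w != c -> QA (fun s => (s - c)^-1) w.
Proof.
move=> wc; have n0 : 0 < nm (w - c) by rewrite nm_gt0 // subr_eq0.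
have n2 : 0 < nm (w - c) / 2 by rewrite divr_gt0.
apply: (@qaQA _ _ _ (- (w - c) ^- 2) ((nm (w - c) / 2)^-1 * nm (w - c) ^- 2) _ n2) => h hd.
have n1 : nm (w - c) / 2 <= nm (w + h - c).
  rewrite (_ : w + h - c = (w - c) + h); last by ring.
  have := nmD (w - c + h) (- h); rewrite nmN addrK; lra.
have w0 : w - c != 0 by rewrite subr_eq0.
have wh0 : w + h - c != 0.
  by apply: contraTneq n1 => ->; rewrite nm0 -ltNge.
have -> : (w + h - c)^-1 - (w - c)^-1 - h * - (w - c) ^- 2 =
   h ^+ 2 * ((w + h - c)^-1 * (w - c) ^- 2) by field; rewrite w0 wh0.
rewrite nmM nmX mulrC ler_wpM2r ?exprn_ge0 ?nm_ge0 // nmM !nmV nmX.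
rewrite ler_wpM2r ?invr_ge0 ?exprn_ge0 ?nm_ge0 // lef_pV2 ?posrE //.
exact: lt_le_trans n1.
Qed.

Lemma QA_near f z (s : R) : s < complex.Re z ->
  (forall w, s < complex.Re w -> derivable f w 1) -> holomorphic_at f z.
Proof.
move=> sz fd; apply/nearC; exists (complex.Re z - s); first by rewrite subr_gt0.
move=> w wz; apply: fd; have := Re_le_nm (w - z).
rewrite ReD ReN ler_norml => /andP[h1 _]; lra.
Qed.

Lemma derivable_lip f w : derivable f w 1 ->
  exists M d : R, [/\ 0 <= M, 0 < d & forall h, h != 0 -> nm h < d -> nm (f (w + h) - f w) <= M * nm h].
Proof.
move=> /cvg_ex[D /cvgrPdist_le /(_ 1 ltr01) /nearC'[d d0 H]].
exists (nm D + 1), d; split => //; first by rewrite addr_ge0 ?nm_ge0.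
move=> h h0 hd; have := H h h0; rewrite subr0 => /(_ hd).
have -> : D - h^-1 *: ((f \o shift w) (h *: 1) - f w) = D - h^-1 * (f (w + h) - f w).
  by rewrite /= -[h *: 1]/(h * 1) mulr1 [h + w]addrC.
rewrite nmE -[1]/((1 : R)%:C) lecR => q.
have : nm (h^-1 * (f (w + h) - f w)) <= nm D + 1.
  rewrite -[X in nm X](subKr D); apply: (le_trans (nm_subD _ _)).
  by rewrite lerD2l.
by rewrite nmM nmV ler_pdivrMl ?nm_gt0 // mulrC.
Qed.

(** Near z the function [f] is bounded, so g(w) = f(w) (w - z)^m tends to 0, against g(z) != 0. The
    contradiction is drawn at a single point z + t. *)
Lemma QA_not_pole f z : QA f z -> ~ is_pole f z.
Proof.
move=> /QA_derivable /derivable_lip[M [d [M0 d0 fM]]] [m [m0 [g [/nearC[d1 d10 gd] gz /nearC'[d2 d20 E]]]]].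
have [|M' [d' [M'0 d'0 gM]]] := derivable_lip (gd z _); first by rewrite subrr nm0.
have g0 := nm_gt0 gz; set B := nm (f z) + M * d.
have B0 : 0 <= B by rewrite addr_ge0 ?nm_ge0 // mulr_ge0 // ltW.
have c0 : 0 < B + M' + 1 by lra.
(* The last bound gives t (B + M' + 1) < |g(z)|, while the estimates below give |g(z)| <= B t + M'
   t. *)
pose t : R := Num.min (Num.min (Num.min d 1) (Num.min d2 d')) (nm (g z) / (B + M' + 1)) / 2.
have t2 : 0 < t * 2 by rewrite /t divfK // !lt_min d0 d20 d'0 ltr01 divr_gt0.
have t0 : 0 < t by lra.
have : t < t * 2 by lra.
rewrite [X in _ < X]divfK // !lt_min => /andP[/andP[/andP[td t1] /andP[td2 td']] tg].
have ht : nm (t%:C) = t by rewrite nm_real gtr0_norm.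
have tC : (t%:C : R[i]) != 0.
  by apply: contraTneq t0 => tz; rewrite -ht tz nm0 ltxx.
have q1 := fM _ tC; rewrite ht in q1; have {}q1 := q1 td.
have q2 := gM _ tC; rewrite ht in q2; have {}q2 := q2 td'.
have := E (z + t%:C); rewrite addrAC subrr add0r ht => /(_ _ td2) E1.
have {}E1 : f (z + t%:C) * t%:C ^+ m = g (z + t%:C).
  rewrite E1 ?divfK ?expf_neq0 //; apply: contraNneq tC => zt.
  by rewrite -(addKr z t%:C) zt addNr.
have n1 : nm (f (z + t%:C)) <= B.
  rewrite -[X in nm X](subrK (f z)); apply: (le_trans (nmD _ _)).
  rewrite addrC lerD2l; apply: (le_trans q1); rewrite ler_wpM2l // ltW //.
have n2 : nm (g (z + t%:C)) <= B * t.
  rewrite -E1 nmM nmX ht; apply: ler_pM; rewrite ?nm_ge0 ?exprn_ge0 ?(ltW t0) //.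
  by rewrite -[leRHS]expr1; apply: ler_wiXn2l; rewrite ?(ltW t0) ?(ltW t1).
have n3 : nm (g z) <= B * t + M' * t.
  rewrite -[X in nm X](subKr (g (z + t%:C))); apply: (le_trans (nm_subD _ _)).
  exact: lerD.
move: tg; rewrite ltr_pdivlMr //; have : t * (B + M' + 1) = B * t + M' * t + t by ring.
lra.
Qed.

Lemma nm_cvg_series (u : nat -> R[i]) : bdd (fun k => nm (u k)) -> cvgn (series (fun k => `|u k|)).
Proof.
move=> ub; have cu := bdd_cvg (fun k => nm_ge0 (u k)) ub.
set L := limn (ssum (fun k => nm (u k))).
have E n : series (fun k => `|u k|) n = (ssum (fun k => nm (u k)) n)%:C.
  rewrite /series /ssum /= (rmorph_sum (real_complex R)); apply: eq_bigr => k _.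
  exact: nmE.
apply/cvg_ex; exists L%:C; apply/cvgrPdist_le => -[e b].
rewrite ltcE /= => /andP[/eqP b0 e0]; rewrite {}b0.
have /cvgrPdist_le /(_ e e0) := cu; apply: filterS => n h.
rewrite E -(rmorphB (real_complex R)) nmE nm_real -[Complex e 0]/(e%:C) lecR.
exact: h.
Qed.

(** The error function is g / A - 1; it is O(s - sn) because [g] is derivable at sn with value A. *)
Lemma double_pole (g : R[i] -> R[i]) (sigma sn A : R) : sigma < sn -> 0 < A ->
  g sn%:C = A%:C -> (forall s, sigma < complex.Re s -> QA g s) ->
  let zeta := fun s => g s / (s - sn%:C) ^+ 2 in
  [/\ meromorphic_on [set s : R[i] | sigma < complex.Re s] zeta,
      pole_of_order zeta sn%:C 2,
      forall z : R[i], sigma < complex.Re z -> is_pole zeta z -> z <> sn%:C ->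
            complex.Re z < sn &
      exists A : R, 0 < A /\ exists E : R[i] -> R[i],
              E =O_ (sn%:C^') (fun s => s - sn%:C) /\
              \forall s \near sn%:C^', zeta s = A%:C * (s - sn%:C) ^- 2 * (1 + E s)].
Proof.
move=> ssn A0 gA gQ zeta.
have AC : A%:C != 0 :> R[i].
  by apply: contraTneq A0 => /(congr1 (@complex.Re R)) /= ->; rewrite ltxx.
have zQ z : sigma < complex.Re z -> z != sn%:C -> QA zeta z.
  move=> zs zn; rewrite /zeta; apply: (@QA_mul R g (fun s => ((s - sn%:C) ^+ 2)^-1)); first exact: gQ.
  have := QA_mul (QA_inv zn) (QA_inv zn).
  have -> // : (fun s => (s - sn%:C)^-1 * (s - sn%:C)^-1) = (fun s : R[i] => ((s - sn%:C) ^+ 2)^-1).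
  by apply/funext => s; rewrite expr2 invfM.
have pole2 : pole_of_order zeta sn%:C 2.
  split=> //; exists g; split; rewrite ?gA //.
    by apply: (@QA_near _ _ sigma) => // w ws; apply: QA_derivable; apply: gQ.
  by apply/nearC'; exists 1.
split=> //.
- move=> z /= zs; have [->|zn] := eqVneq z sn%:C; first by right; exists 2%N.
  left; apply/nearC; exists (Num.min (complex.Re z - sigma) (nm (z - sn%:C))).
    by rewrite lt_min subr_gt0 zs nm_gt0 // subr_eq0.
  move=> w; rewrite lt_min => /andP[w1 w2]; apply: QA_derivable; apply: zQ.
    have := Re_le_nm (w - z); rewrite ReD ReN ler_norml => /andP[h1 _]; lra.
  by apply: contraTneq w2 => ->; rewrite nmB ltxx.
- by move=> z zs zp zn; case: (QA_not_pole (zQ z zs _) zp); apply/eqP.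
- exists A; split=> //; exists (fun s => g s / A%:C - 1); split; last first.
    by apply/nearC'; exists 1 => // w wz _; rewrite /zeta; field; rewrite AC subr_eq0 wz.
  have [M [d [M0 d0 H]]] := derivable_lip (QA_derivable (gQ sn%:C ssn)).
  apply/eqO_exP; exists ((M / A + 1)%:C).
    by rewrite ltcR ltr_wpDl // divr_ge0 // ltW.
  apply/nearC'; exists d => // w wz wd.
  rewrite !nmE -(rmorphM (real_complex R)) lecR.
  have -> : g w / A%:C - 1 = (g w - g sn%:C) / A%:C by rewrite gA; field.
  rewrite nmM nmV nm_real (gtr0_norm A0).
  have := H (w - sn%:C); rewrite subr_eq0 [sn%:C + _]addrC subrK => /(_ wz wd) q.
  rewrite mulrDl mul1r; apply: (@le_trans _ _ (M / A * nm (w - sn%:C))); last by rewrite lerDl nm_ge0.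
  by rewrite mulrAC ler_wpM2r // invr_ge0 ltW.
Qed.

End Poles.

(** * The Euler product of the polynomials W *)

Section WFactor.
Variable R : realType.
Variable l0 : nat.
Let l := l0.+1.
Let e := ((l * l.-1) %/ 2)%N.
Implicit Types (p : nat) (K I : {set 'I_l}).

Definition qq p : R[i] := (p%:R : R[i])^-1.

Lemma natC n : (n%:R : R[i]) = (n%:R : R)%:C.
Proof. by rewrite (rmorph_nat (real_complex R)). Qed.

Lemma qqE p : qq p = (p%:R^-1 : R)%:C.
Proof. by rewrite /qq natC (fmorphV (real_complex R)). Qed.

Lemma nm_qX p j : prime p -> (0 < j)%N -> 2^-1 <= nm (qq p ^+ j - 1) /\ nm (qq p ^+ j - 1) <= 1.
Proof.
move=> pp j0; have p2 : 2 <= p%:R :> R by rewrite ler_nat prime_gt1.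
have -> : qq p ^+ j - 1 = ((p%:R^-1) ^+ j - 1 : R)%:C.
  by rewrite qqE (rmorphB (real_complex R)) (rmorphXn (real_complex R)).
have i0 : 0 <= p%:R^-1 :> R by rewrite invr_ge0.
have i1 : p%:R^-1 <= 2^-1 :> R by rewrite lef_pV2 ?posrE //; lra.
have i2 : (p%:R^-1 : R) ^+ j <= p%:R^-1.
  by rewrite -[leRHS]expr1; apply: ler_wiXn2l => //; lra.
have i3 : 0 <= (p%:R^-1 : R) ^+ j by rewrite exprn_ge0.
rewrite nm_real ler0_norm; lra.
Qed.

(** Each factor 1 - p^(-j) lies between 1/2 and 1, so phi stays away from 0 uniformly in p. *)
Lemma phi_bounds p d : prime p -> 2^-1 ^+ d <= nm (phi d (qq p)) /\ nm (phi d (qq p)) <= 1.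
Proof.
move=> pp; elim: d => [|d [h1 h2]]; first by rewrite /phi big_geq // nm1.
rewrite /phi big_nat_recr //= -/(phi d (qq p)) nmM.
have [q1 q2] := @nm_qX p d.+1 pp isT.
split; first by rewrite exprSr ler_pM // ?exprn_ge0 // invr_ge0.
by rewrite -[leRHS]mulr1 ler_pM ?nm_ge0.
Qed.

Lemma phi_neq0 p d : prime p -> phi d (qq p) != 0.
Proof.
move=> /(phi_bounds d)[h _]; apply: contraTneq h => ->.
by rewrite nm0 -ltNge exprn_gt0 // invr_gt0.
Qed.

Lemma prod_phi_ge p (s : seq nat) B : prime p -> all (fun d => (d <= B)%N) s ->
  2^-1 ^+ (B * size s) <= nm (\prod_(d <- s) phi d (qq p)).
Proof.
move=> pp; elim: s => [|d s IH]; first by rewrite big_nil muln0 nm1.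
move=> /andP[dB /IH h]; rewrite big_cons nmM mulnS exprD.
have [h1 _] := phi_bounds d pp.
apply: ler_pM; rewrite ?exprn_ge0 ?invr_ge0 //; apply: le_trans h1.
by apply: ler_wiXn2l => //; lra.
Qed.

Lemma pairmap_le (s : seq nat) a B : all (fun b => (b <= B)%N) s ->
  all (fun d => (d <= B)%N) (pairmap (fun a b => (b - a)%N) a s).
Proof.
elim: s a => [|b s IH] a //= /andP[bB sB]; rewrite IH // andbT.
by apply: leq_trans bB; apply: leq_subr.
Qed.

Lemma phi_set_bound p I : prime p -> nm (phi_set I (qq p)) <= 2 ^+ (l * l.+1).
Proof.
move=> pp; rewrite /phi_set nmM nmV; set P := \prod_(d <- _) _.
have : 2^-1 ^+ (l * l.+1) <= nm P.
  apply: le_trans (@prod_phi_ge _ _ l pp _); last first.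
    apply: pairmap_le; rewrite all_rcons leqnn /=; apply/allP => x /mapP[i _ ->].
    exact: ltnW.
  rewrite size_pairmap size_rcons size_map -cardE.
  apply: ler_wiXn2l; rewrite ?invr_ge0 //; first by lra.
  by rewrite leq_mul2l ltnS (leq_trans (max_card _)) ?card_ord ?orbT.
have x0 : 0 < (2^-1 : R) ^+ (l * l.+1) by rewrite exprn_gt0 // invr_gt0.
move=> hP; rewrite -[leRHS]mul1r; apply: ler_pM; rewrite ?nm_ge0 ?invr_ge0 ?nm_ge0 //.
  by have [] := phi_bounds l pp.
rewrite -[leRHS]invrK -exprVn lef_pV2 ?posrE //; exact: lt_le_trans hP.
Qed.

Definition wB : R := \sum_(I : {set 'I_l}) 2 ^+ (l * l.+1).

Lemma wB_ge0 : 0 <= wB. Proof. by rewrite /wB sumr_ge0 // => I _; rewrite exprn_ge0. Qed.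

Lemma w_bound p K : prime p -> nm (w_coef K (qq p)) <= wB.
Proof.
move=> pp; rewrite /w_coef; apply: (le_trans (nm_sum _ _ _)).
rewrite /wB big_mkcond; apply: ler_sum => I _; case: ifP => _; last by rewrite exprn_ge0.
by rewrite nmM nmX nmN nm1 expr1n mul1r phi_set_bound.
Qed.

Lemma phi_set0 p : prime p -> phi_set (finset.set0 : {set 'I_l}) (qq p) = 1.
Proof.
move=> pp; rewrite /phi_set enum_set0 /= big_seq1 subn0.
by rewrite divff // phi_neq0.
Qed.

Lemma w_empty p : prime p -> w_coef (finset.set0 : {set 'I_l}) (qq p) = 1.
Proof.
move=> pp; rewrite /w_coef (big_pred1 finset.set0) => [|I]; last by rewrite /= finset.subset0.
by rewrite finset.setDv cards0 expr0 mul1r phi_set0.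
Qed.

(** With q = 1/p the coefficient is phi_l / (phi_1 phi_(l-1)) - 1 = (q^l - q) / (q - 1), which
    contains the factor q. *)
Lemma w_one p (i : 'I_l) : prime p -> (i : nat) = 1%N ->
  nm (w_coef [set i]%SET (qq p)) <= 2 * kp p (- 1).
Proof.
move=> pp i1; have p0 := prime_gt0 pp.
have -> : w_coef [set i]%SET (qq p) = phi_set [set i]%SET (qq p) - 1.
  rewrite /w_coef (bigD1 [set i]%SET) //= finset.setDv cards0 expr0 mul1r; congr (_ + _).
  rewrite (big_pred1 finset.set0) => [|I]; last first.
    rewrite /= finset.subset1; have [->|_] := eqVneq I [set i]%SET.
      by rewrite andbF; apply/esym/negbTE; rewrite -card_gt0 cards1.
    by rewrite andbT.
  by rewrite finset.setD0 cards1 expr1 phi_set0 // mulr1.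
have ll : (1 < l)%N by rewrite -i1.
have -> : phi_set [set i]%SET (qq p) - 1 = (qq p ^+ l - qq p) / (qq p - 1).
  rewrite /phi_set enum_set1 /= i1 !big_cons big_nil mulr1 subn0.
  have [q1 _] := @nm_qX p 1 pp isT; rewrite expr1 in q1.
  have q0 : qq p - 1 != 0 by apply: contraTneq q1 => ->; rewrite nm0 -ltNge invr_gt0.
  have -> : phi l (qq p) = phi l0 (qq p) * (qq p ^+ l - 1) by rewrite /phi big_nat_recr.
  have -> : phi 1 (qq p) = qq p - 1 by rewrite /phi big_nat1.
  rewrite /l subn1 /=; move: (phi l0 _) (phi_neq0 l0 pp) (qq p ^+ l0.+1) => x x0 y.
  by field; rewrite ?q0 ?x0.
have [q1 _] := @nm_qX p 1 pp isT; rewrite expr1 in q1.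
have -> : qq p ^+ l - qq p = (qq p ^+ l0 - 1) * qq p by rewrite mulrBl mul1r -exprSr.
rewrite !nmM nmV.
have [_ q2] := @nm_qX p l0 pp ll.
have qn : nm (qq p) = kp p (- 1) by rewrite qqE nm_real ger0_norm ?invr_ge0 // kpN kp_id.
rewrite ler_pdivrMr; last by apply: lt_le_trans q1; rewrite invr_gt0.
rewrite qn; have k0 := @kp_ge0 R p (- 1).
have : nm (qq p ^+ l0 - 1) * kp p (- 1) <= 1 * kp p (- 1) by rewrite ler_wpM2r.
have : 2 * kp p (- 1) * 2^-1 <= 2 * kp p (- 1) * nm (qq p - 1) by rewrite ler_wpM2l // mulr_ge0.
lra.
Qed.

(** Let t be the sum of i(i-1)/2 over K. The powers of p contribute the exponent - t - (3/4) #K.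
    This is at most - 3/2 if #K >= 2, and at most - 7/4 if K = {i} with i >= 2, since then t >= 1;
    for K = {1} it is - 3/4, and [w_one] adds - 1. *)
Lemma term_bound p K (T : R[i]) : prime p -> nm T <= kp p (- (e%:R + 3 / 4)) ->
  K \subset [set i : 'I_l | (0 < i)%N] -> K != finset.set0 ->
  nm (w_coef K (qq p) * (p%:R : R[i]) ^+ a_exp K * T ^+ #|K|) <= (wB + 2) * kp p (- (3 / 2)).
Proof.
move=> pp hT K1 K0; have p0 := prime_gt0 pp.
have i_le (i : 'I_l) : ((i * i.-1) %/ 2 <= e)%N.
  by apply: leq_div2r; apply: leq_mul; [apply: ltnW | case: (i : nat) (ltn_ord i) => // k; rewrite /l ltnS => /ltnW].
have aE : (a_exp K + \sum_(i in K) ((i * i.-1) %/ 2) = e * #|K|)%N.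
  rewrite /a_exp -big_split /= (eq_bigr (fun=> e)) => [|i _]; last by rewrite subnK.
  by rewrite sum_nat_const mulnC.
set t := (\sum_(i in K) _)%N in aE.
have aR : (a_exp K)%:R = e%:R * #|K|%:R - t%:R :> R by rewrite -natrM -aE natrD addrK.
have kT : nm ((p%:R : R[i]) ^+ a_exp K * T ^+ #|K|) <= kp p (- (t%:R + 3 / 4 * #|K|%:R)).
  rewrite nmM !nmX natC nm_real ger0_norm ?ler0n //.
  apply: (@le_trans _ _ (kp p (a_exp K)%:R * kp p (- (e%:R + 3 / 4)) ^+ #|K|)).
    rewrite kp_nat // ler_wpM2l ?exprn_ge0 ?ler0n //.
    by apply: lerXn2r; rewrite ?nnegrE ?nm_ge0 ?kp_ge0.
  by rewrite -kpMn -kpD aR; apply: eq_lexx; congr kp; ring.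
rewrite -mulrA nmM; have w0 := wB_ge0; have c0 : (0 < #|K|)%N by rewrite card_gt0.
have fin (x : R) : - (t%:R + 3 / 4 * #|K|%:R) <= x -> x <= - (3 / 2) ->
   nm (w_coef K (qq p)) * nm ((p%:R : R[i]) ^+ a_exp K * T ^+ #|K|) <= (wB + 2) * kp p (- (3 / 2)).
  move=> x1 x2; apply: ler_pM; rewrite ?nm_ge0 //.
    by apply: le_trans (w_bound K pp) _; rewrite lerDl.
  by apply: le_trans kT _; apply: kp_le; apply: le_trans x2.
have [K2|] := leqP 2 #|K|.
  apply: (fin (- (t%:R + 3 / 4 * #|K|%:R))) => //; rewrite lerN2.
  have : 2 <= #|K|%:R :> R by rewrite ler_nat.
  have := ler0n R t; lra.
rewrite ltnS => K1'; have /cards1P[i Ki] : #|K| == 1%N by rewrite eqn_leq K1' c0.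
have tE : t = ((i * i.-1) %/ 2)%N by rewrite /t Ki big_set1.
have i0 : (0 < i)%N by have /fintype.subsetP /(_ i) := K1; rewrite Ki finset.set11 inE /=; apply.
have [i1|i2] := eqVneq (i : nat) 1%N.
  apply: (@le_trans _ _ (2 * kp p (- 1) * kp p (- (3 / 4)))).
    apply: ler_pM; rewrite ?nm_ge0 //; first by rewrite Ki w_one.
    apply: le_trans kT _; apply: kp_le; rewrite lerN2 Ki cards1; have := ler0n R t; lra.
  rewrite -mulrA -kpD; apply: ler_pM; rewrite ?kp_ge0 //; first by rewrite lerDr.
  by apply: kp_le; lra.
apply: (fin (- (t%:R + 3 / 4 * #|K|%:R))) => //; rewrite lerN2 Ki cards1.
have : 1 <= t%:R :> R.
  rewrite ler1n tE divn_gt0 //; case: (i : nat) i0 i2 => [|[|k]] // _ _.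
  by lia.
lra.
Qed.

Lemma W_bound : exists2 C : R, 0 <= C & forall p (T : R[i]), prime p -> nm T <= kp p (- (e%:R + 3 / 4)) ->
  nm (W_plus l p%:R T - 1) <= C * kp p (- (3 / 2)).
Proof.
exists (\sum_(K : {set 'I_l}) (wB + 2)).
  by rewrite sumr_ge0 // => K _; rewrite addr_ge0 // wB_ge0.
move=> p T pp hT; have s0 : finset.set0 \subset [set i : 'I_l | (0 < i)%N].
  by apply/fintype.subsetP => i; rewrite finset.in_set0.
rewrite /W_plus (bigD1 finset.set0) //= -/(qq p) w_empty // cards0.
rewrite (_ : a_exp finset.set0 = 0%N); last by rewrite /a_exp big_set0.
rewrite !expr0 !mulr1 addrAC subrr add0r; apply: (le_trans (nm_sum _ _ _)).
rewrite mulr_suml big_mkcond; apply: ler_sum => K _; case: ifP => [/andP[K1 K0]|_].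
  exact: term_bound.
by rewrite mulr_ge0 ?kp_ge0 // addr_ge0 // wB_ge0.
Qed.

Lemma euler_abs (S : seq nat) (s : R[i]) : (e%:R + 3 / 4) / l%:R < complex.Re s ->
  abs_cvg_prod (euler_factor l.*2 S s).
Proof.
move=> hs; apply: nm_cvg_series; have [C C0 HC] := W_bound.
have b : bdd (fun k => C * (`|one_ R k| * kp k (- (3 / 2)))).
  by apply: bddZ => //; apply: pseries_bdd; lra.
apply: bdd_le b => p; rewrite /euler_factor doubleK; case: ifP => [/andP[pp _]|_]; last first.
  by rewrite subrr nm0 !mulr_ge0 ?kp_ge0.
rewrite /one_ prime_gt0 // normr1 mul1r; apply: HC => //.
rewrite nm_natpow kp_le // ReN lerN2.
have -> : l.*2%:R * s / 2 = (l%:R)%:C * s :> R[i].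
  by rewrite -muln2 natrM natC; field.
by rewrite ReCM [_ * complex.Re s]mulrC; move: hs; rewrite ltr_pdivrMr ?ltr0n // => /ltW.
Qed.

End WFactor.

(** * The zeta function of a lattice *)

Lemma uniq_sub_sum (R : realType) (T : eqType) (s1 s2 : seq T) (F : T -> R) :
  uniq s1 -> uniq s2 -> {subset s1 <= s2} -> (forall x, 0 <= F x) ->
  \sum_(x <- s1) F x <= \sum_(x <- s2) F x.
Proof.
move=> u1 u2 s12 F0.
have <- : \sum_(x <- [seq x <- s2 | x \in s1]) F x = \sum_(x <- s1) F x.
  apply: perm_big; apply: uniq_perm; rewrite ?filter_uniq // => x.
  by rewrite mem_filter; case: (boolP (x \in s1)) => // /s12 ->.
by rewrite big_filter big_mkcond; apply: ler_sum => x _; case: ifP.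
Qed.

Lemma csum_tail (R : realType) (u : nat -> R[i]) K (d : R) : bdd (fun k => nm (u k)) ->
  (forall m, (K <= m)%N -> ssum (fun k => nm (u k)) m - ssum (fun k => nm (u k)) K <= d) ->
  nm (csum u - ssum u K) <= d.
Proof.
move=> ub H; have h := (ctends_shift K _ _).2 (csumP ub).
apply: ctends_le (ctendsB h (ctends_cst (ssum u K))) _ => J.
apply: le_trans (H (J + K)%N (leq_addl _ _)).
rewrite /ssum (big_cat_nat _ (leq_addl J K)) //= [\sum_(0 <= i < J + K) nm (u i)](big_cat_nat _ (leq_addl J K)) //=.
have sb (T : zmodType) (x y : T) : x + y - x = y by rewrite addrAC subrr add0r.
by rewrite !sb; apply: nm_sum.
Qed.

Section ZetaSum.
Variables (R : realType) (V : vectType rat) (beta : V -> V -> rat).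
Hypothesis bD : forall u v w, beta (u + v) w = beta u w + beta v w.
Hypothesis bZ : forall a u w, beta (a *: u) w = a * beta u w.
Hypothesis bC : forall u v, beta u v = beta v u.
Hypothesis bnd : forall u, (forall v, beta u v = 0) -> u = 0.
Hypothesis V0 : exists v : V, v != 0.
Variables (n : nat) (e : n.+1.-tuple V) (L : set V).
Hypothesis free_e : free e.
Hypothesis LE : L = [set v | inIntSpan e v].
Hypothesis Lmax : maximal_lattice beta L.

Local Notation GG := (G bD bZ bC bnd V0 e Lmax).
(** The value 0 at k = 0 is imposed because [natpow 0] is 1 and would add a spurious term. *)
Definition acoef k : R := if k == 0%N then 0 else (acount GG k)%:R.

Definition level k : seq (set V) := [seq emb e @` S0 | S0 <- fset_set (Amax GG k)].

Lemma levelP k M : (0 < k)%N ->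
  M \in level k <-> [/\ maximal_lattice beta M, M `<=` L & lattice_index L M = k].
Proof.
move=> k0; split.
  move=> /mapP[S0 + ->]; rewrite in_fset_set ?inE; last exact: Amax_finite.
  move=> [[B [-> kE]] mS]; have B0 : \det B != 0 by rewrite -absz_gt0 kE.
  split; [exact: maxL_maximal mS | exact: emb_sub | by rewrite index_emb].
move=> [Mm ML ik]; have [B B0 [ME mB]] := maximal_sub bD bZ bC bnd V0 free_e LE Lmax Mm ML.
apply/mapP; exists (rspan B) => //; rewrite in_fset_set ?inE; last exact: Amax_finite.
split; last exact: mB.
by exists B; split=> //; rewrite -ik ME index_emb.
Qed.

Fixpoint upto K : seq (set V) := if K is K'.+1 then upto K' ++ level K else [::].

Lemma uptoP K M :
  M \in upto K <-> [/\ maximal_lattice beta M, M `<=` L & (0 < lattice_index L M <= K)%N].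
Proof.
elim: K => [|K IH]; first by split=> // -[_ _]; case: lattice_index.
rewrite [upto _]/= mem_cat; split.
  move=> /orP[/IH[h1 h2 /andP[h3 h4]]|/(levelP _ (ltn0Sn K))[h1 h2 ->]]; split; rewrite ?leqnn //.
  by rewrite h3 leqW.
move=> [h1 h2 /andP[h3]]; rewrite leq_eqVlt => /orP[/eqP h4|h4]; apply/orP; [right|left].
  exact/levelP.
by apply/IH; split; rewrite // h3.
Qed.

Lemma level_uniq k : uniq (level k).
Proof.
rewrite map_inj_in_uniq ?fset_uniq // => S1 S2 _ _ E; apply/seteqP.
split=> x Sx.
  have : (emb e @` S2) (emb e x) by rewrite -E; exists x.
  by move=> [y Sy /(emb_inj free_e) <-].
have : (emb e @` S1) (emb e x) by rewrite E; exists x.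
by move=> [y Sy /(emb_inj free_e) <-].
Qed.

Lemma upto_uniq K : uniq (upto K).
Proof.
elim: K => [|K IH] //; rewrite [upto _]/= cat_uniq IH level_uniq andbT /=.
apply/hasPn => M /(levelP _ (ltn0Sn K))[_ _ iK]; apply/negP => /uptoP[_ _].
by rewrite iK ltnn.
Qed.

Lemma size_level k : size (level k) = acount GG k.
Proof. by rewrite size_map. Qed.

(** Used with [F] the identity for the sum itself, and with [F] the modulus for the tails. *)
Lemma upto_sum (T : zmodType) (s : R[i]) K (F : R[i] -> T) (c : nat -> T) : c 0%N = 0 ->
  (forall k, (0 < k)%N -> c k = F (natpow k (- s)) *+ acount GG k) ->
  \sum_(M <- upto K) F (zeta_term beta L s M) = ssum c K.+1.
Proof.
move=> c0 cE; elim: K => [|K IH]; first by rewrite big_nil ssumS ssum0 c0 addr0.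
rewrite ssumS -IH big_cat /=; congr (_ + _).
rewrite (eq_big_seq (fun=> F (natpow K.+1 (- s)))) => [|M /(levelP _ (ltn0Sn K))[h1 h2 h3]].
  by rewrite cE // big_const_seq count_predT size_level iter_addr_0.
by rewrite /zeta_term h3 asboolT.
Qed.

(** The base set consists of the maximal sublattices of index at most K. A finite set containing it
    adds only lattices with term 0 or of larger index, so this excess and the tail of the series are
    each at most d / 2. *)
Lemma zeta_sum_csum (s : R[i]) : bdd (fun k => nm (dt acoef s k)) -> zeta_sum beta L s (csum (dt acoef s)).
Proof.
move=> ub; set x := zeta_term beta L s.
have E1 K : \sum_(M <- upto K) x M = ssum (dt acoef s) K.+1.
  apply: (upto_sum K (F := id)); rewrite /dt /acoef /=; first exact: mul0r.
  by move=> k k0; rewrite gtn_eqF // (rmorph_nat (real_complex R)) mulr_natl.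
have E2 K : \sum_(M <- upto K) nm (x M) = ssum (fun k => nm (dt acoef s k)) K.+1.
  apply: (upto_sum K (F := @nm R)); rewrite ?nm_dt /acoef /= ?normr0 ?mul0r //.
  by move=> k k0; rewrite nm_dt gtn_eqF // normr_nat mulr_natl nm_natpow ReN.
have FF := @summability.totally_filter (set V).
apply/cvgrPdist_le => -[d b]; rewrite ltcE /= => /andP[/eqP b0 d0]; rewrite {}b0.
have d2 : 0 < d / 2 by rewrite divr_gt0.
have [K HK] := bdd_tail (fun k => nm_ge0 (dt acoef s k)) ub d2.
exists [fset M in upto K]%fset => // B /= AB.
rewrite nmE -[Complex d 0]/(d%:C) lecR /summability.partial_sum.
rewrite -(big_seq_fsetE _ _ predT x) /=.
have uB : uniq (enum_fset B) by apply: fset_uniq.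
rewrite (bigID (fun M => M \in upto K)) /=.
have -> : \sum_(M <- B | M \in upto K) x M = ssum (dt acoef s) K.+1.
  rewrite -E1 -big_filter; apply: perm_big; apply: uniq_perm; rewrite ?filter_uniq ?upto_uniq // => M.
  rewrite mem_filter; case: (boolP (M \in upto K)) => //= MK.
  by apply: (fsubsetP AB); rewrite inE.
rewrite opprD addrA (_ : d = d / 2 + d / 2); last by field.
apply: (le_trans (nm_subD _ _)); apply: lerD.
  by apply: csum_tail => // m Km; apply: HK => //; apply: leqW.
apply: (le_trans (nm_sum _ _ _)).
(* All lattices of [B] with a nonzero term have index at most K'. *)
pose K' := maxn K (\max_(M <- enum_fset B) lattice_index L M).
rewrite -big_filter.
have nz M : nm (x M) != 0 -> maximal_lattice beta M /\ M `<=` L.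
  rewrite /x /zeta_term; case: asboolP => // _; by rewrite nm0 eqxx.
rewrite (bigID (fun M => nm (x M) != 0)) /= addrC big1 ?add0r; last by move=> M /negbNE /eqP.
rewrite -big_filter.
apply: (@le_trans _ _ (\sum_(M <- [seq M <- upto K' | M \notin upto K]) nm (x M))).
  apply: uniq_sub_sum; rewrite ?filter_uniq ?upto_uniq //; last by move=> M; apply: nm_ge0.
  move=> M; rewrite !mem_filter => /and3P[xM MK MB]; rewrite MK /=; apply/uptoP.
  have [h1 h2] := nz M xM; split=> //.
  have [B0 dB0 [ME _]] := maximal_sub bD bZ bC bnd V0 free_e LE Lmax h1 h2.
  rewrite {1}ME index_emb // absz_gt0 dB0 /= /K' leq_max; apply/orP; right.
  exact: (@leq_bigmax_seq _ _ predT (lattice_index L) M).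
have -> : \sum_(M <- [seq M <- upto K' | M \notin upto K]) nm (x M) =
  \sum_(M <- upto K') nm (x M) - \sum_(M <- upto K) nm (x M).
  rewrite [X in X - _](bigID (fun M => M \in upto K)) /= big_filter addrC -[X in X - _](addrC).
  have -> : \sum_(M <- upto K' | M \in upto K) nm (x M) = \sum_(M <- upto K) nm (x M).
    rewrite -big_filter; apply: perm_big; apply: uniq_perm; rewrite ?filter_uniq ?upto_uniq // => M.
    rewrite mem_filter; case: (boolP (M \in upto K)) => //= /uptoP[h1 h2 /andP[h3 h4]].
    by apply/uptoP; split=> //; rewrite h3 (leq_trans h4) // leq_maxl.
  by rewrite addrAC subrr add0r.
by rewrite !E2; apply: HK; [apply: leqW | rewrite ltnS leq_maxl].
Qed.

End ZetaSum.

Lemma rat_sqr_int (q : rat) (k : int) : q ^+ 2 = k%:~R -> exists s : int, k = s ^+ 2.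
Proof.
move=> qk; have E : numq q ^+ 2 = k * denq q ^+ 2.
  apply: (@intr_inj rat); rewrite [RHS]rmorphM /= -qk ![(_ ^+ 2)%:~R]rmorphXn /= numqE exprMn.
  by [].
have : (`|denq q| %| 1)%N.
  have : (`|denq q| %| `|numq q| ^ 2)%N.
    by rewrite -abszX E abszM abszX dvdn_mull // dvdn_exp.
  by rewrite -(@Gauss_dvdr _ (`|numq q| ^ 2) 1) ?muln1 // coprimeXr // coprime_sym coprime_num_den.
rewrite dvdn1 => /eqP d1; exists (numq q); rewrite E.
have -> : denq q = 1 by have := denq_gt0 q; lia.
by rewrite expr1n mulr1.
Qed.

Lemma prod_pow_bounds (p l : nat) : (0 < p)%N ->
  [/\ (\prod_(i < l) p ^ i.+1 <= \prod_(i < l) (1 + p ^ i.+1))%N,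
      (\prod_(i < l) (1 + p ^ i.+1) <= 2 ^ l * \prod_(i < l) p ^ i.+1)%N &
      (p * \prod_(i < l) (1 + p ^ i.+1) <= (p + 2 ^ l) * \prod_(i < l) p ^ i.+1)%N].
Proof.
move=> p0; elim: l => [|l [h1 h2 h3]]; first by rewrite !big_ord0; split; lia.
rewrite !big_ord_recr /=; move: h1 h2 h3.
set P := (\prod_(i < l) (1 + _))%N; set Q := (\prod_(i < l) p ^ _)%N => h1 h2 h3.
have px : (p <= p ^ l.+1)%N by rewrite -{1}(expn1 p) leq_pexp2l.
rewrite [(2 ^ l.+1)%N]expnS; move: (p ^ l.+1)%N px (2 ^ l)%N h2 h3 => x px t h2 h3.
split; first by apply: leq_mul => //; lia.
  rewrite (_ : 2 * t * (Q * x) = t * Q * (2 * x))%N; last by ring.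
  by apply: leq_mul => //; lia.
have h4 : (p * P * x <= (p + t) * Q * x)%N by rewrite leq_mul2r h3 orbT.
have h5 : (p * P <= x * (t * Q))%N by apply: leq_mul.
have -> : (p * (P * (1 + x)) = p * P * x + p * P)%N by ring.
have -> : ((p + 2 * t) * (Q * x) = (p + t) * Q * x + x * (t * Q))%N by ring.
exact: leq_add.
Qed.

Lemma prod_pow (p l m : nat) : (\prod_(i < l) p ^ (i * m) = p ^ ('C(l, 2) * m))%N.
Proof. by rewrite -expn_sum -big_distrl /= -bin2_sum big_mkord. Qed.

(** The factor with i = 0 is 1 + 1 = 2. It makes the leading term 2 p^e, and thereby the pole
    double. *)
Lemma count_first (R : realType) (p l : nat) : (0 < p)%N ->
  `|(\prod_(i < l.+1) (1 + p ^ i))%N%:R - 2 * p%:R ^+ 'C(l.+1, 2)| <=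
   (2 * 2 ^ l)%:R * p%:R ^+ 'C(l.+1, 2) / p%:R :> R.
Proof.
move=> p0; have [h1 _ h3] := prod_pow_bounds l p0.
have QE : (\prod_(i < l) p ^ i.+1 = p ^ 'C(l.+1, 2))%N.
  have := prod_pow p l.+1 1; rewrite muln1 big_ord_recl mul0n expn0 mul1n => <-.
  by apply: eq_bigr => i _; rewrite muln1.
rewrite QE in h1 h3; rewrite big_ord_recl expn0 addn1 -natrX.
move: (\prod_(i < l) _)%N (p ^ _)%N h1 h3 => P Q h1 h3.
have pR : 0 < p%:R :> R by rewrite ltr0n.
rewrite natrM -mulrBr normrM normr_nat ger0_norm; last by rewrite subr_ge0 ler_nat.
rewrite ler_pdivlMr // -natrB // -!natrM ler_nat; lia.
Qed.

Lemma count_level (p l m : nat) : (0 < p)%N ->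
  (\prod_(i < l) (1 + m * p ^ (i * m)) <= m.+1 ^ l * p ^ ('C(l, 2) * m))%N.
Proof.
move=> p0; have -> : (m.+1 ^ l = \prod_(i < l) m.+1)%N by rewrite prod_nat_const card_ord.
rewrite -prod_pow -big_split /=.
apply: leq_prod => i _; have : (0 < p ^ (i * m))%N by rewrite expn_gt0 p0.
by move: (p ^ _)%N => x x0; rewrite mulSn leq_add2r.
Qed.

Theorem theorem3p10 (R : realType) (n : nat) (V : vectType rat)
    (beta : {symmetric V}) (L : set V) (D : rat) (S : seq nat)
    (n_gt0 : (0 < n)%N) (n_even : ~~ odd n) (dimV : \dim {:V} = n)
    (beta_nondeg : nondegenerate beta)
    (L_max : maximal_lattice beta L)
    (D_discr : is_discriminant beta L D)
    (D_square : exists q : rat, (-1) ^+ n./2 * D = q ^+ 2)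
    (S_prime : all prime S)
    (S_div : forall p : nat, prime p ->
       (p %| numq D)%Z || (p %| denq D)%Z -> p \in S) :
  let sn : R := sigma_ R n in
  exists sigma : R, [/\ 0 < sigma, sigma < sn,
    forall s : R[i], sigma < complex.Re s -> abs_cvg_prod (euler_factor n S s) &
    exists zeta : R[i] -> R[i],
      [/\ forall s : R[i], sn < complex.Re s -> zeta_sum beta L s (zeta s),
          meromorphic_on [set s : R[i] | sigma < complex.Re s] zeta,
          pole_of_order zeta sn%:C 2,
          forall z : R[i], sigma < complex.Re z -> is_pole zeta z -> z <> sn%:C ->
            complex.Re z < sn &
          exists A : R, 0 < A /\
            exists E : R[i] -> R[i],
              E =O_ (sn%:C^') (fun s => s - sn%:C) /\
              \forall s \near sn%:C^',
                zeta s = A%:C * (s - sn%:C) ^- 2 * (1 + E s)]].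
Proof.
have [l nE] : exists l, n = l.+1.*2.
  have := odd_double_half n; rewrite (negPf n_even) add0n => nE.
  by move: n_gt0; rewrite -nE; case: (n./2) => // l _; exists l.
move: dimV D_square; rewrite nE => dimV D_square sn; rewrite doubleK in D_square.
have bD u v w : beta (u + v) w = beta u w + beta v w by rewrite linearDl.
have bZ a u w : beta (a *: u) w = a * beta u w by rewrite linearZl_LR.
have bC u v : beta u v = beta v u by rewrite hermC expr0 mul1r.
have bnd u : (forall v, beta u v = 0) -> u = 0.
  move=> H; apply/eqP; rewrite -memv0 -(eqP beta_nondeg).
  by apply/mem_orthovP => v _; apply: H.
have V0 : exists v : V, v != 0.
  have : vpick {:V} != 0 by rewrite vpick0 -dimv_eq0 dimV.
  by exists (vpick {:V}).
have [m [e [[fe LE] DE]]] := D_discr.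
(* The basis given with the discriminant spans V, because it spans the generators of the lattice; so
   its length is the dimension. *)
have mE : m = l.+1.*2.
  have de : \dim <<e>>%VS = m by move: fe; rewrite /free size_tuple => /eqP.
  apply/eqP; rewrite -dimV eqn_leq -{1}de dimvS ?subvf //=.
  have [k [g [LE' <-]]] := L_max.1; rewrite -de; apply: dimvS; apply/span_subvP => v vg.
  have : L v.
    have [i ik <-] := nthP 0 vg; rewrite size_tuple in ik.
    by rewrite LE'; exact: (span_gen g (Ordinal ik)).
  rewrite LE => -[a ->]; apply: rpred_sum => i _; rewrite mulz_scale memvZ // memv_span //.
  by rewrite mem_nth // size_tuple.
subst m; pose nn := (l.*2).+1.
have eG := @G_even V beta bD bZ bC bnd V0 nn e L LE L_max.
have G0 := @G_det0 V beta bD bZ bC bnd V0 nn e L fe LE L_max.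
have mT := @maxT V beta bD bZ bC bnd V0 nn e L fe LE L_max.
have n1 := @norm1 V beta bD bZ bC bnd V0 nn e L LE L_max.
have Dm := @G_det V beta bD bZ bC bnd V0 nn e L LE L_max D DE.
set GG := G bD bZ bC bnd V0 e L_max in eG G0 mT n1 Dm.
(* D is det G times an even power of the norm, so the signed determinant of G is a square in Q,
   hence in Z. *)
have sq : exists s, (-1) ^+ l.+1 * \det GG = s ^+ 2.
  have [q qE] := D_square; set mm := mu _ _ _ _ _ _ in Dm.
  have m0 : mm != 0 by apply: mu_neq0.
  apply: (@rat_sqr_int (q / mm ^+ l.+1)).
  rewrite expr_div_n -qE Dm rmorphM rmorphXn rmorphN1 /=.
  have -> : mm ^+ nn.+1 = (mm ^+ l.+1) ^+ 2 by rewrite -exprM muln2.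
  have := expf_neq0 l.+1 m0; move: (mm ^+ l.+1) => c c0; by field.
pose a := acoef R bD bZ bC bnd V0 e L_max.
(* Primes from P0 on are odd and do not divide det G. *)
pose P0 := (3 + `|\det GG|)%N.
have aE k : (0 < k)%N -> a k = (acount GG k)%:R by move=> k0; rewrite /a /acoef gtn_eqF.
have aX p k : prime p -> a (p ^ k)%N = (acount GG (p ^ k))%:R.
  by move=> pp; rewrite aE // expn_gt0 prime_gt0.
have good p : prime p -> (P0 <= p)%N -> odd p /\ ~~ (p%:Z %| \det GG)%Z.
  move=> pp Pp; split; first by case: (even_prime pp) => // p2; move: Pp; rewrite p2 /P0; lia.
  by rewrite dvdzE /= gtnNdvd ?absz_gt0 //; move: Pp; rewrite /P0; lia.
have [|||||||g [gQ [A A0 gA] gE]] :=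
  @master R l 'C(l.+1, 2) (2 * l.+1).+1 P0 a (2 * 2 ^ l)%:R.
- by move=> k; rewrite /a /acoef; case: ifP.
- split; first by [].
    by rewrite aE // acount1.
  by move=> i j i0 j0 ij; rewrite !aE ?muln_gt0 ?i0 // acount_mul // natrM.
- move=> p pp Pp k; rewrite aX // pnatr_eq0 -lt0n; have [op pG] := good p pp Pp.
  by have [h _ _] := @acount_good l GG eG mT n1 p pp op pG sq; apply: h.
- move=> p pp Pp m; have [op pG] := good p pp Pp.
  have [_ h _] := @acount_good l GG eG mT n1 p pp op pG sq.
  rewrite aX // -!natrX -natrM ler_nat; apply: (leq_trans (h m)).
  by apply: count_level; apply: prime_gt0.
- move=> p pp Pp; have [op pG] := good p pp Pp.
  have [_ _ h] := @acount_good l GG eG mT n1 p pp op pG sq.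
  by rewrite aX // h; apply: count_first; apply: prime_gt0.
- exact: ler0n.
- move=> p pp; have [C [c h]] := @acount_bad l GG eG G0 n1 p pp.
  exists C%:R, c; split; first exact: ler0n.
  by move=> k; rewrite aX // -!natrX -!natrM ler_nat.
have e2 : (l.+1 * l)%:R = 2 * 'C(l.+1, 2)%:R :> R.
  by have := mul_bin_diag l.+1 1; rewrite bin1 /= => ->; rewrite natrM.
(* Here n = 2(l+1) and e = C(l+1, 2), so sigma_n is (e + 1)/(l + 1). *)
have snE : sn = @xth R l 'C(l.+1, 2) 1.
  rewrite /sn /sigma_ /xth -muln2 !natrM; move: e2; rewrite natrM.
  have : l.+1%:R != 0 :> R by rewrite pnatr_eq0.
  rewrite -natr1; move: (l%:R : R) ('C(_, _)%:R : R) => x y x0 e2.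
  have -> : y = (x + 1) * x / 2 by rewrite e2; field.
  by field.
have s1 : @xth R l 'C(l.+1, 2) (3 / 4) < sn by rewrite snE; apply: xth_lt; lra.
exists (@xth R l 'C(l.+1, 2) (3 / 4)); split => //.
- by rewrite /xth divr_gt0 ?ltr0n // ltr_wpDl ?ler0n //; lra.
- move=> s hs; apply: euler_abs; move: hs; rewrite /xth bin2 /= divn2.
  by [].
rewrite -snE in gA gE.
have [h1 h2 h3 h4] := double_pole s1 A0 gA gQ.
exists (fun s => g s / (s - sn%:C) ^+ 2); split => // s hs.
have [b <-] := gE s hs.
exact: (@zeta_sum_csum R V beta bD bZ bC bnd V0 nn e L fe LE L_max s b).
Qed.
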